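(* Consider the heteroscedastic data model and the PCA estimates described in the context. Suppose that the sample-to-dimension ratio $n/d \to c > 0$ and the noise variance proportions $n_\ell/n \to p_\ell$ for $\ell \in \{1,\dots,L\}$ as $n,d \to \infty$. Define $$A(x) = 1-c \sum_{\ell=1}^L \frac{p_\ell \sigma_\ell^4}{(x-\sigma_\ell^2)^2}, \qquad B_i(x) = 1-c\,\theta_i^2 \sum_{\ell=1}^L \frac{p_\ell}{x-\sigma_\ell^2},$$ and let $\alpha$ and $\beta_i$ be, respectively, the largest real roots of $A(x)$ and $B_i(x)$. Then for each $i\in\{1,\dots,k\}$ the $i$th PCA amplitude $\hat\theta_i$ is such that $$\hat\theta_i^2 \xrightarrow{a.s.} \frac{1}{c}\max(\alpha,\beta_i)\left\{1+c\sum_{\ell=1}^L\frac{p_\ell\sigma_\ell^2}{\max(\alpha,\beta_i)-\sigma_\ell^2}\right\}.$$ Furthermore, if $A(\beta_i)>0$, then the $i$th principal component $\hat u_i$ is such that $$\left|\langle \hat u_i,\operatorname{Span}\{u_j:\theta_j=\theta_i\}\rangle\right|^2 \xrightarrow{a.s.} \frac{A(\beta_i)}{\beta_i B_i'(\beta_i)}, \qquad \left|\langle \hat u_i,\operatorname{Span}\{u_j:\theta_j\neq\theta_i\}\rangle\right|^2 \xrightarrow{a.s.} 0,$$ the normalized score vector $\hat z^{(i)}/\sqrt n$ is such that $$\left|\left\langle \frac{\hat z^{(i)}}{\sqrt n},\operatorname{Span}\{z^{(j)}:\theta_j=\theta_i\}\right\rangle\right|^2 \xrightarrow{a.s.} \frac{A(\beta_i)}{c\{\beta_i+(1-c)\theta_i^2\}B_i'(\beta_i)},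 \qquad \left|\left\langle \frac{\hat z^{(i)}}{\sqrt n},\operatorname{Span}\{z^{(j)}:\theta_j\neq\theta_i\}\right\rangle\right|^2 \xrightarrow{a.s.} 0,$$ and $$\sum_{j:\theta_j=\theta_i}\langle \hat u_i,u_j\rangle\left\langle \frac{\hat z^{(i)}}{\sqrt n},\frac{z^{(j)}}{\|z^{(j)}\|}\right\rangle^* \xrightarrow{a.s.} \frac{A(\beta_i)}{\sqrt{c\,\beta_i\{\beta_i+(1-c)\theta_i^2\}}\,B_i'(\beta_i)}.$$
   Context: **Model.** Fix integers $k,L\ge 1$, amplitudes $\theta_1\ge\cdots\ge\theta_k>0$, and noise standard deviations $\sigma_1,\dots,\sigma_L>0$; these do not depend on $n,d$. For each $n$ (with $d=d(n)$), there are $n$ sample vectors in $\mathbb{C}^d$ $$y_i = U\Theta z_i+\eta_i\varepsilon_i = \sum_{j=1}^k \theta_j u_j (z^{(j)}_i)^* + \eta_i\varepsilon_i, \qquad i=1,\dots,n.$$ Deterministic quantities: $U=(u_1,\dots,u_k)\in\mathbb{C}^{d\times k}$ has orthonormal columns; $\Theta=\operatorname{diag}(\theta_1,\dots,\theta_k)$; each $\eta_i\in\{\sigma_1,\dots,\sigma_L\}$; $n_\ell$ is the number of samples with noise standard deviation $\sigma_\ell$, and $n_1+\cdots+n_L=n$. The limiting proportions satisfy $p_\ell>0$ and $p_1+\cdots+p_L=1$. Random and mutually independent quantities: - $z_i\in\mathbb{C}^k$ are iid coefficient vectors with iid entries $z_{ij}$ with $\mathrm{E}(z_{ij})=0$,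 $\mathrm{E}|z_{ij}|^2=1$, whose distribution satisfies a log-Sobolev inequality (a probability measure $\mu$ on a Euclidean space satisfies it if, for some constant $C<\infty$, $\int f^2\log\frac{f^2}{\int f^2\,d\mu}\,d\mu\le 2C\int \|\nabla f\|^2\,d\mu$ for all differentiable $f\in L^2(\mu)$). - $\varepsilon_i\in\mathbb{C}^d$ are iid noise vectors with iid entries, $\mathrm{E}(\varepsilon_{ij})=0$, $\mathrm{E}|\varepsilon_{ij}|^2=1$, $\mathrm{E}|\varepsilon_{ij}|^4<\infty$, and are unitarily invariant: left multiplication of $\varepsilon_i$ by any unitary matrix (any orthogonal matrix, for real-valued data) does not change the joint distribution of its entries. The entry distributions do not depend on $n,d$. The component coefficient vectors $z^{(1)},\dots,z^{(k)}\in\mathbb{C}^n$ are defined by $z^{(j)}_i=(z_{ij})^*$, the complex conjugate of the $j$th entry of $z_i$. **PCA.** The principal components $\hat u_1,\dots,\hat u_k\in\mathbb{C}^d$ (orthonormal) and squared PCA amplitudes $\hat\theta_1^2\ge\cdots\ge\hat\theta_k^2$ (with $\hat\theta_i\ge 0$) are the first $k$ eigenvectors and eigenvalues (those with largest eigenvalues) of the sample covariance matrix $(y_1y_1^{\mathsf H}+\cdots+y_ny_n^{\mathsf H})/n$. The score vectors are $\hat z^{(i)}=(1/\hat\theta_i)\{\hat u_i^{\mathsf H}(y_1,\dots,y_n)\}^{\mathsf H}\in\mathbb{C}^n$; thus $\hat u_i,\hat\theta_i,\hat z^{(i)}/\sqrt n$ are the leading left singular vectors, singular values and right singular vectors of $(y_1,\dots,y_n)/\sqrt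 n$. **Notation.** $^{\mathsf H}$ is conjugate transpose, $^*$ is complex conjugate, $\langle a,b\rangle=a^{\mathsf H}b$. For a vector $v$ and subspace $S$, $|\langle v,S\rangle|^2$ denotes the squared Euclidean norm of the orthogonal projection of $v$ onto $S$ (zero if $S=\{0\}$). $\xrightarrow{a.s.}$ denotes almost sure convergence as $n,d\to\infty$. $B_i'$ is the derivative of $B_i$. *)

(* Defs.v *)
(* MathComp-Analysis over an arbitrary R : realType; the complex numbers are
   R[i] from mathcomp-real-closed. *)
From HB Require Import structures.
From mathcomp Require Import all_boot all_order all_algebra.
From mathcomp Require Import sesquilinear spectral complex.
From mathcomp Require Import all_classical all_reals all_analysis.

Set Implicit Arguments.
Unset Strict Implicit.
Unset Printing Implicit Defensive.

Import Order.TTheory GRing.Theory Num.Theory.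
Import numFieldNormedType.Exports.

Local Open Scope classical_set_scope.
Local Open Scope ring_scope.
Local Open Scope sesquilinear_scope.

(* R[i] carries no measurable structure, so a complex random variable is a
   random variable with values in R * R, read through this identification. *)
Definition cplx (R : realType) (x : R * R) : R[i] := (x.1 +i* x.2)%C.

Definition uncplx (R : realType) (x : R[i]) : R * R :=
  (complex.Re x, complex.Im x).

(* <a, b> = a^H b, conjugate-linear in the first argument *)
Definition vdot (R : realType) (m : nat) (a b : 'cV[R[i]]_m) : R[i] :=
  (a ^t* *m b) 0 0.

Definition vnorm (R : realType) (m : nat) (a : 'cV[R[i]]_m) : R :=
  Num.sqrt (complex.Re (vdot a a)).

(* |<v, Span {w_j : j in J}>|^2, where w_j is the j-th column of W.  Subspaces
   and proj_ortho are about row vectors in the library, hence the transposes. *)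
Definition sqproj (R : realType) (m k : nat) (v : 'cV[R[i]]_m)
    (W : 'M[R[i]]_(m, k)) (J : pred 'I_k) : R :=
  vnorm (v^T *m proj_ortho (\sum_(j | J j) <<(col j W)^T>>)%MS)^T ^+ 2.

Definition mutually_independent (dT dE : measure_display)
    (T : measurableType dT) (E : measurableType dE) (R : realType)
    (P : probability T R) (I : finType) (X : I -> {RV P >-> E}) : Prop :=
  forall (J : {set I}) (B : I -> set E), (forall j, measurable (B j)) ->
    P (\bigcap_(j in [set` J]) (X j @^-1` B j)) =
    (\prod_(j in J) P (X j @^-1` B j))%E.

Definition has_law (dT dE : measure_display)
    (T : measurableType dT) (E : measurableType dE) (R : realType)
    (P : probability T R) (X : {RV P >-> E}) (mu : probability E R) : Prop :=
  forall B : set E, measurable B -> distribution P X B = mu B.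

(* Log-Sobolev inequality on the Euclidean plane R^2 = C.  If f vanishes
   mu-a.e. the conventions x / 0 = 0 and ln 0 = 0 make the left side 0. *)
Definition log_sobolev (R : realType) (mu : probability (R * R)%type R)
    : Prop :=
  exists C : R, forall f : R * R -> R,
    (forall x, differentiable f x) ->
    mu.-integrable setT (fun x => (f x ^+ 2)%:E) ->
    let m := fine (\int[mu]_x (f x ^+ 2)%:E)%E in
    (\int[mu]_x (f x ^+ 2 * ln (f x ^+ 2 / m))%:E <=
     (2 * C)%:E *
       \int[mu]_x (('D_((1, 0) : R * R) f x) ^+ 2 +
                   ('D_((0, 1) : R * R) f x) ^+ 2)%:E)%E.

(* E(X) = 0 and E|X|^2 = 1 for a complex variable X with law mu *)
Definition standardized (R : realType) (mu : probability (R * R)%type R)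
    : Prop :=
  [/\ (\int[mu]_x (x.1)%:E = 0)%E,
      (\int[mu]_x (x.2)%:E = 0)%E &
      (\int[mu]_x (Normc.normc (cplx x) ^+ 2)%:E = 1)%E].

Definition finite_fourth_moment (R : realType)
    (mu : probability (R * R)%type R) : Prop :=
  (\int[mu]_x (Normc.normc (cplx x) ^+ 4)%:E < +oo)%E.

Definition real_law (R : realType) (mu : probability (R * R)%type R) : Prop :=
  {ae mu, forall x, x.2 = 0}.

Definition cvec (R : realType) (dT : measure_display) (T : measurableType dT)
    (P : probability T R) (m : nat) (e : 'I_m -> {RV P >-> (R * R)%type})
    (w : T) : 'cV[R[i]]_m :=
  \col_a cplx (e a w).

(* the random vectors e and Q e have the same joint law *)
Definition law_invariant (R : realType) (dT : measure_display)
    (T : measurableType dT) (P : probability T R) (m : nat)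
    (e : 'I_m -> {RV P >-> (R * R)%type}) (Q : 'M[R[i]]_m) : Prop :=
  forall B : set (m.-tuple (R * R)%type), measurable B ->
    P [set w | B [tuple uncplx ((Q *m cvec e w) a 0) | a < m]] =
    P [set w | B [tuple e a w | a < m]].

(* y_1, ..., y_n as the columns of a matrix, with y_i = U Theta z_i + eta_i eps_i *)
Definition data_mx (R : realType) (d k n : nat) (U : 'M[R[i]]_(d, k))
    (theta : 'I_k -> R) (eta : 'I_n -> R)
    (z : 'I_n -> 'cV[R[i]]_k) (eps : 'I_n -> 'cV[R[i]]_d) : 'M[R[i]]_(d, n) :=
  \matrix_(a, i) (U *m diag_mx (\row_j (theta j)%:C%C) *m z i
                  + (eta i)%:C%C *: eps i) a 0.

Definition sample_cov (R : realType) (d n : nat) (Y : 'M[R[i]]_(d, n))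
    : 'M[R[i]]_d :=
  n%:R^-1 *: \sum_(i < n) col i Y *m (col i Y) ^t*.

(* The columns of Uhat and the squares of that are the first k eigenvectors and
   eigenvalues in some orthonormal eigendecomposition of S, eigenvalues being
   listed with multiplicity in nonincreasing order. *)
Definition is_pca (R : realType) (d k : nat) (S : 'M[R[i]]_d)
    (Uhat : 'M[R[i]]_(d, k)) (that : 'I_k -> R) : Prop :=
  (k <= d)%N /\
  exists (V : 'M[R[i]]_d) (lambda : 'I_d -> R),
    [/\ V ^t* *m V = 1%:M,
        S = V *m diag_mx (\row_a (lambda a)%:C%C) *m V ^t*,
        (forall a b : 'I_d, (a <= b)%N -> lambda b <= lambda a),
        (forall (i : 'I_k) (a : 'I_d), i = a :> nat ->
           col i Uhat = col a V /\ that i ^+ 2 = lambda a) &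
        (forall i : 'I_k, 0 <= that i)].

Definition score (R : realType) (d n : nat) (Y : 'M[R[i]]_(d, n))
    (u : 'cV[R[i]]_d) (t : R) : 'cV[R[i]]_n :=
  (t^-1)%:C%C *: (u ^t* *m Y) ^t*.

(* the vectors z^(j), z^(j)_i = conjugate of z_ij, as columns *)
Definition coef_mx (R : realType) (n k : nat) (z : 'I_n -> 'cV[R[i]]_k)
    : 'M[R[i]]_(n, k) :=
  \matrix_(i, j) Num.conj (z i j 0).

Definition fun_A (R : realType) (L : nat) (c : R) (p sigma : 'I_L -> R)
    (x : R) : R :=
  1 - c * \sum_(l < L) p l * sigma l ^+ 4 / (x - sigma l ^+ 2) ^+ 2.

(* B_i is fun_B c p sigma (theta i) *)
Definition fun_B (R : realType) (L : nat) (c : R) (p sigma : 'I_L -> R)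
    (t x : R) : R :=
  1 - c * t ^+ 2 * \sum_(l < L) p l / (x - sigma l ^+ 2).

(* Division by zero being total, the poles sigma_l^2 have to be excluded
   explicitly from the domain in which roots are sought. *)
Definition largest_root (R : realType) (L : nat) (sigma : 'I_L -> R)
    (f : R -> R) (r : R) : Prop :=
  let dom := [set x : R | forall l, x != sigma l ^+ 2] in
  [/\ dom r, f r = 0 & forall s, dom s -> f s = 0 -> s <= r].

(* Main.v *)
(** Rotational invariance of iid noise entries and the log-Sobolev inequality for the coefficients
both give moments of all orders.  For [phi x = x (1 + c sum_l p_l sigma_l^2 / (x - sigma_l^2)) / c],
which increases exactly where [A > 0], the resolvent of the noise covariance is followed one column
at a time along a deterministic path of spectral parameters ending at [phi x]: each parameter step
compensates the rank-one update, up to fluctuations whose 18th moments are summable.  Hence no noise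
eigenvalue exceeds the path and the resolvent at [phi x] tends to [x^-1] as a quadratic form.  With
these limits the spikes are a finite-rank perturbation: eigenvalues outside the bulk are read off
from quadratic forms, eigenvectors from difference quotients in [x] of resolvent forms. *)
Require Import Defs.
From HB Require Import structures.
From mathcomp Require Import all_boot all_order all_algebra.
From mathcomp Require Import sesquilinear spectral complex.
From mathcomp Require Import all_classical all_reals all_analysis.
From mathcomp Require Import measurable_realfun.
From mathcomp Require Import ring lra zify.
Set Implicit Arguments.
Unset Strict Implicit.
Unset Printing Implicit Defensive.
Import Order.TTheory GRing.Theory Num.Theory.
Import numFieldNormedType.Exports.
Local Open Scope classical_set_scope.
Local Open Scope ring_scope.
Local Open Scope sesquilinear_scope.

(** Why two passes and why the exponent 18. Nothing bounds the resolvent near the path a priori: in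
    the first pass the only control is a bound on the normalised trace of its cube, so its norm may
    be of order n^(1/3). The squared Frobenius norm of its fourth power, with weight n^-4, is then
    of order n^(-4/3); a sum of n martingale increments has 18th moment of order n^-3, and the O(n)
    quantities to control leave n^-2. So the squared moduli of the entries need 18 moments
    ([m = 8]). The normalised trace of the squared resolvent obeys a Riccati recursion. The inverse
    of its solution falls from x^2/c to x^2/c - sum_l p_l (w_l sigma_l^2)^2 with w_l = 1/(1 -
    sigma_l^2/x), which equals (x^2/c) A(x): this is where [A > 0] enters. In the second pass, a
    path started at some x1 < x separates the spectrum from the path started at x. Resolvents are
    then bounded in norm, and forms are followed from both sides at speeds 1 + eps and 1 - eps.
    Limits are taken almost surely at rational x only, and reach the edge and the roots by density
    and monotonicity. *)

Notation cRe := complex.Re.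
Notation cIm := complex.Im.
Notation letr y := (@le_trans _ _ y) (only parsing).
Notation mfunT := (measurable_fun setT).
Ltac nneg := rewrite ?nnegrE ?posrE; do 20? first [ by [] | by apply: ltW
 | exact: sqr_ge0 | exact: sqrtr_ge0 | apply: mulr_ge0 | apply: addr_ge0 | apply: exprn_ge0
 | rewrite invr_ge0 | apply: mulr_gt0 | apply: exprn_gt0 | rewrite invr_gt0 | apply: addr_gt0
 | apply: sumr_ge0 => ? _ | rewrite subr_ge0 | rewrite subr_gt0 | rewrite ler0n | rewrite ltr0n
 | by apply: le_trans ler01 _ | by apply: lt_le_trans ltr01 _ ].
Ltac meas := do 8? first [ by [] | apply/measurable_EFinP | apply: measurable_funX
 | apply: measurable_funD | apply: measurable_funB | apply: measurable_funM ].

(** * Independence of the sigma-algebras of disjoint families of variables *)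

Section Cylinders.
Context d (T : measurableType d) dE (E : measurableType dE) (R : realType).
Variables (P : probability T R) (I : finType) (X : I -> {RV P >-> E}).
(** These rectangles form a pi-system, so identities of finite measures that hold on them extend to
    the sigma-algebra of the variables indexed by [J]. *)
Definition cylinder (J : {set I}) : set (set T) :=
 [set A | exists2 B : I -> set E, (forall j, measurable (B j)) & A = \bigcap_(j in [set` J]) (X j @^-1` B j)].
Lemma cylinder_meas (J : {set I}) : cylinder J `<=` measurable.
move=> _ [B mB ->]; apply: fin_bigcap_measurable => // j _.
by rewrite -[X in measurable X]setTI; apply: measurable_funP.
Qed.
Lemma cylinder_setI (J : {set I}) : setI_closed (cylinder J).
move=> _ _ [B mB ->] [C mC ->]; exists (fun j => B j `&` C j).
by move=> j; apply: measurableI.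
by rewrite -bigcapI; apply: eq_bigcapr => j _.
Qed.
Lemma cylinder_preimage (J : {set I}) j (B : set E) : j \in J -> measurable B -> cylinder J (X j @^-1` B).
move=> jJ mB; exists (fun i => if i == j then B else setT).
by move=> i; case: ifP.
rewrite eqEsubset; split => [w Bw i _|w /(_ j jJ)]; last by rewrite eqxx.
by case: eqP => [->|].
Qed.
Lemma cylinder_setT (J : {set I}) : cylinder J setT.
exists (fun=> setT) => //.
by rewrite eqEsubset; split.
Qed.
Lemma cylinder_sub (J K : {set I}) : J \subset K -> cylinder J `<=` cylinder K.
move=> /fintype.subsetP JK _ [B mB ->].
exists (fun j => if j \in J then B j else setT).
by move=> i; case: ifP.
rewrite eqEsubset; split => [w Bw i _|w Bw i iJ].
by case: ifPn => // iJ; apply: Bw.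
by have := Bw i (JK _ iJ); rewrite /= ifT.
Qed.
Hypothesis indX : mutually_independent X.
Lemma cylinder_indep0 (J K : {set I}) (A B : set T) : {in J, forall j, j \notin K} ->
 cylinder J A -> cylinder K B -> P (A `&` B) = (P A * P B)%E.
move=> JK [a ma ->] [b mb ->].
have KJ j : j \in K -> j \notin J by move=> jK; apply: (contraL (JK j)).
pose cc j := if j \in J then a j else b j.
have -> : \bigcap_(j in [set` J]) (X j @^-1` a j) `&` \bigcap_(j in [set` K]) (X j @^-1` b j) =
 \bigcap_(j in [set` J :|: K]) (X j @^-1` cc j).
rewrite eqEsubset; split => [w [aw bw] j /=|w cw].
rewrite inE => /orP[jJ|jK]; rewrite /cc.
by rewrite jJ; apply: aw.
by rewrite (negbTE (KJ _ jK)); apply: bw.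
split=> j /= jJ.
by have := cw j; rewrite /= /cc inE jJ; apply.
by have := cw j; rewrite /= /cc inE jJ orbT (negbTE (KJ _ jJ)); apply.
rewrite !indX //; last by move=> j; rewrite /cc; case: ifP.
rewrite (eq_bigl [predU J & K]); last by move=> j; rewrite !inE.
rewrite bigU /=; last first.
by rewrite fintype.disjoint_subset; apply/fintype.subsetP.
congr (_ * _)%E; apply: eq_bigr => j jJ; rewrite /cc.
by rewrite jJ.
by rewrite (negbTE (KJ _ jJ)).
Qed.
(** With one set [F] frozen, P(A [&] F) and P(F) P(A) are two finite measures of [A] agreeing on a
    pi-system, hence everywhere. This is applied twice, first to free [A] and then to free [B]. *)
Lemma cylinder_indep (J K : {set I}) (A B : set T) : {in J, forall j, j \notin K} ->
 <<s cylinder J >> A -> <<s cylinder K >> B -> P (A `&` B) = (P A * P B)%E.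
have gen (J' : {set I}) (F : set T) : measurable F ->
 (forall A, cylinder J' A -> P (A `&` F) = (P A * P F)%E) ->
 forall A, <<s cylinder J' >> A -> P (A `&` F) = (P A * P F)%E.
move=> mF h A' sA.
have PF : P F \is a fin_num by apply: fin_num_measure.
pose r := NngNum (fine_ge0 (measure_ge0 P F)).
have rE : (r%:num)%:E = P F by rewrite /= fineK.
have e : mrestr P mF A' = mscale r P A'.
apply: (@g_sigma_algebra_measure_unique _ R T (cylinder J')
 (@cylinder_meas J') (fun=> setT) (fun=> cylinder_setT J')
 _ (mrestr P mF) (mscale r P) (@cylinder_setI J') _ _ A' sA).
 - by rewrite bigcup_const //; exists 0%N.
 - move=> C cC; transitivity (P C * P F)%E; first exact: h.
by rewrite muleC -rE.
 - move=> _; apply: (@le_lt_trans _ _ 1%E); last by rewrite ltry.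
by apply: probability_le1; rewrite setTI.
by rewrite muleC -rE.
have msig J' F : <<s cylinder J' >> F -> measurable F.
exact: (smallest_sub (@sigma_algebra_measurable _ T) (@cylinder_meas J')).
move=> JK sA sB.
apply: (gen J) => // [|C cC]; first exact: msig sB.
rewrite setIC muleC.
apply: (gen K) => // [|D cD]; first exact: cylinder_meas cC.
by rewrite setIC muleC; apply: (cylinder_indep0 JK).
Qed.
End Cylinders.

(** * Integration over two independent sigma-algebras *)

Section Decoupling.
Context d (T : measurableType d) (R : realType) (P : probability T R).
Variables (G H : set (set T)) (mG : G `<=` measurable) (mH : H `<=` measurable)
 (GH : forall A B, <<s G >> A -> <<s H >> B -> P (A `&` B) = (P A * P B)%E).
Notation TG := (g_sigma_algebraType G).
Notation TH := (g_sigma_algebraType H).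
(** The identity, read as a random variable with values in [T] equipped with a coarser
    sigma-algebra. Independence of [G] and [H] then says that the law of w |-> (w, w) is a product
    measure, and conditioning becomes Fubini's theorem. *)
Let iG : T -> TG := id.
Let iH : T -> TH := id.
Let diag : T -> (TG * TH)%type := fun w => (w, w).
Let miG : mfunT iG.
move=> _ A mA; rewrite setTI.
exact: (smallest_sub (@sigma_algebra_measurable _ T) mG).
Qed.
Let miH : mfunT iH.
move=> _ A mA; rewrite setTI.
exact: (smallest_sub (@sigma_algebra_measurable _ T) mH).
Qed.
Let mdiag : mfunT diag.
by apply: measurable_fun_pair; [exact: miG|exact: miH]. Qed.
HB.instance Definition _ := isMeasurableFun.Build _ _ _ _ iG miG.
HB.instance Definition _ := isMeasurableFun.Build _ _ _ _ iH miH.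
HB.instance Definition _ := isMeasurableFun.Build _ _ _ _ diag mdiag.
Let joint_integral (f : TG * TH -> \bar R) : mfunT f -> (forall z, (0 <= f z)%E) ->
 (\int[P]_w f (w, w) = \int[distribution P iG]_w fubini_F (distribution P iH) f w)%E.
move=> mf f0; have -> : (\int[P]_w f (w, w) = \int[distribution P diag]_z f z)%E.
by rewrite ge0_integral_distribution.
rewrite (@eq_measure_integral _ _ _ _ (distribution P iG \x distribution P iH)%E); last first.
by move=> A mA _; apply/esym; apply: product_measure_unique => //.
rewrite fubini_tonelli1 //.
Qed.
Lemma ge0_decoupling (f : TG * TH -> \bar R) : mfunT f -> (forall z, (0 <= f z)%E) ->
 (\int[P]_w f (w, w) = \int[P]_w \int[P]_v f (w, v))%E.
move=> mf f0.
have f1 : mfunT (fun w : TG => \int[distribution P iH]_v f (w, v))%E.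
exact: measurable_fun_fubini_tonelli_F.
rewrite joint_integral // ge0_integral_distribution //; last first.
by move=> w; apply: integral_ge0.
apply: eq_integral => w _ /=; rewrite /fubini_F ge0_integral_distribution //.
exact: measurableT_comp.
Qed.
(** Turns a bound valid for every frozen value of the [G]-measurable data into an unconditional one;
    it serves for matrices depending on earlier columns. *)
Lemma ge0_decoupling_le (f : TG * TH -> \bar R) (c : \bar R) : mfunT f -> (forall z, (0 <= f z)%E) ->
 (forall w, \int[P]_v f (w, v) <= c)%E -> (\int[P]_w f (w, w) <= c)%E.
move=> mf f0 fc.
rewrite joint_integral //.
have c0 : (0 <= c)%E by apply: le_trans (fc point); apply: integral_ge0.
apply: (letr (\int[distribution P iG]_w (cst c w))%E); last first.
by rewrite integral_cst // [X in (_ * X)%E]probability_setT mule1.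
apply: ge0_le_integral => //.
- by move=> w _; apply: integral_ge0.
- exact: measurable_fun_fubini_tonelli_F.
- move=> w _; rewrite /fubini_F ge0_integral_distribution //; first exact: fc.
exact: measurableT_comp.
Qed.
Lemma ge0_expectation_mul (f : TG -> \bar R) (h : TH -> \bar R) : mfunT f -> mfunT h ->
 (forall w, 0 <= f w)%E -> (forall w, 0 <= h w)%E ->
 (\int[P]_w (f w * h w) = \int[P]_w f w * \int[P]_w h w)%E.
move=> mf mh f0 h0.
have mfT : measurable_fun (setT : set T) f by apply: (measurableT_comp mf miG).
have mhT : measurable_fun (setT : set T) h by apply: (measurableT_comp mh miH).
rewrite (ge0_decoupling (f := fun z => f z.1 * h z.2)%E); last 2 first.
- by apply: emeasurable_funM; apply: measurableT_comp.
- by move=> z; apply: mule_ge0.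
under eq_integral do rewrite /= ge0_integralZl //.
by rewrite ge0_integralZr //; apply: integral_ge0.
Qed.
(** The martingale property: zero conditional mean is expressed by freezing the [G]-measurable
    argument. *)
Lemma decoupling_eq0 (F : TG * TH -> R) : mfunT F -> P.-integrable setT (fun w => (F (w, w))%:E) ->
 (forall w, P.-integrable setT (fun v => (F (w, v))%:E)) -> (forall w, \int[P]_v (F (w, v))%:E = 0)%E ->
 (\int[P]_w (F (w, w))%:E = 0)%E.
move=> mF iF0 iF1 F0.
have mEF : mfunT (EFin \o F) by meas.
have E A : measurable A -> distribution P diag A = (distribution P iG \x distribution P iH)%E A.
by move=> mA; apply/esym; apply: product_measure_unique.
have iF : (distribution P iG \x distribution P iH)%E.-integrable setT (EFin \o F).
apply/integrableP; split => //.
rewrite (@eq_measure_integral _ _ _ _ (distribution P diag)).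
rewrite ge0_integral_distribution //; last exact: measurableT_comp.
by case/integrableP: iF0.
by move=> A mA _; apply/esym; exact: E.
have -> : (\int[P]_w (F (w, w))%:E = \int[distribution P diag]_z (F z)%:E)%E.
by rewrite integral_distribution.
rewrite (@eq_measure_integral _ _ _ _
 (distribution P iG \x distribution P iH)%E); last by move=> A mA _; exact: E.
rewrite -(integral12_prod_meas1 iF).
apply: integral0_eq => w _; rewrite /fubini_F integral_distribution //.
- exact: F0.
- exact: measurableT_comp.
- exact: iF1.
Qed.
Lemma expectation_mul_eq0 (f : TG -> R) (h : TH -> R) : P.-integrable setT (EFin \o f : T -> _) ->
 P.-integrable setT (EFin \o h : T -> _) -> mfunT f -> mfunT h -> (\int[P]_w (h w)%:E = 0)%E ->
 P.-integrable setT (fun w : T => (f w * h w)%:E) /\ (\int[P]_w (f w * h w)%:E = 0)%E.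
move=> if_ ih mf mh h0.
have mfT : measurable_fun (setT : set T) f by apply: (measurableT_comp mf miG).
have mhT : measurable_fun (setT : set T) h by apply: (measurableT_comp mh miH).
have ifh : P.-integrable setT (fun w : T => (f w * h w)%:E).
apply/integrableP; split.
by apply/measurable_EFinP; apply: measurable_funM.
under eq_integral do rewrite EFinM abseM.
rewrite (@ge0_expectation_mul (fun w => `|f w|%:E)%E (fun w => `|h w|%:E)%E) //.
 - apply: lte_mul_pinfty; first exact: integral_ge0.
by case/integrableP : (integrable_abse if_) => _;
rewrite ge0_fin_numE ?integral_ge0//; case/integrableP: if_.
by case/integrableP: ih.
 - by apply/measurable_EFinP/measurableT_comp.
 - by apply/measurable_EFinP/measurableT_comp.
split => //.
apply: (@decoupling_eq0 (fun z => f z.1 * h z.2)) => //.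
by apply: measurable_funM; apply: measurableT_comp.
by move=> w /=; under eq_fun do rewrite EFinM; exact: integrableZl.
move=> w /=; under eq_integral do rewrite EFinM.
by rewrite integralZl // h0 mule0.
Qed.
End Decoupling.

(** * Inequalities between even powers *)

Section PowerInequalities.
Context {R : realType}.
Implicit Types s t x y a b c : R.
Lemma exprD_ge0 m s : 0 <= s ^+ m.*2.
by rewrite -muln2 exprM sqr_ge0. Qed.
Lemma exprD_norm m s : `|s| ^+ m.*2 = s ^+ m.*2.
by rewrite -normrX ger0_norm // exprD_ge0. Qed.
Lemma norm_exprM_le m i s t : (i <= m.*2)%N -> `|s ^+ (m.*2 - i) * t ^+ i| <= s ^+ m.*2 + t ^+ m.*2.
move=> im; rewrite normrM !normrX.
have [st|/ltW st] := leP `|s| `|t|.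
apply: (letr (`|t| ^+ (m.*2 - i) * `|t| ^+ i)).
by apply: ler_wpM2r; rewrite ?exprn_ge0 // lerXn2r ?nnegrE.
by rewrite -exprD subnK // exprD_norm lerDr exprD_ge0.
apply: (letr (`|s| ^+ (m.*2 - i) * `|s| ^+ i)).
by apply: ler_wpM2l; rewrite ?exprn_ge0 // lerXn2r ?nnegrE.
by rewrite -exprD subnK // exprD_norm lerDl exprD_ge0.
Qed.
Definition taylorK (m : nat) : R := (\sum_(i < m.*2.+1) 'C(m.*2.+2, i.+2))%:R.
Lemma taylorK_ge1 m : 1 <= taylorK m.
by rewrite ler1n big_ord_recr /= binn addn1.
Qed.
Lemma exprD_taylor2 m s t : (s + t) ^+ m.*2.+2 <= s ^+ m.*2.+2 + m.*2.+2%:R * (s ^+ m.*2.+1 * t) +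
 taylorK m * (s ^+ m.*2 * t ^+ 2 + t ^+ m.*2.+2).
rewrite exprDn 2!big_ord_recl /= subn0 expr0 mulr1 bin0 mulr1n addrA.
rewrite /bump /= subn1 /= expr1 bin1 -[_ *+ m.*2.+2]mulr_natl lerD2l.
rewrite /taylorK natr_sum mulr_suml; apply: ler_sum => i _.
rewrite add1n -[_ *+ 'C(_, _)]mulr_natl; apply: ler_wpM2l => //.
rewrite !add1n !subSS.
have -> : t ^+ i.+2 = t ^+ i * t ^+ 2 by rewrite -exprD addn2.
have -> : t ^+ m.*2.+2 = t ^+ m.*2 * t ^+ 2 by rewrite -exprD addn2.
rewrite mulrA -mulrDl; apply: ler_wpM2r; first by nneg.
apply: (le_trans (ler_norm _)); apply: norm_exprM_le.
by rewrite -ltnS.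
Qed.
Lemma young_even m l s t : 0 < l -> s ^+ m.*2 * t ^+ 2 <= l * s ^+ m.*2.+2 + l^-1 ^+ m * t ^+ m.*2.+2.
move=> l0.
have e x : x ^+ m.*2.+2 = x ^+ m.*2 * x ^+ 2 by rewrite -exprD addn2.
have [ts|/ltW st] := leP (t ^+ 2) (l * s ^+ 2).
apply: (letr (l * s ^+ m.*2.+2)).
by rewrite (e s) [l * _]mulrCA; apply: ler_wpM2l => //; exact: exprD_ge0.
rewrite lerDl; apply: mulr_ge0; last exact: (exprD_ge0 m.+1).
by nneg.
apply: (letr (l^-1 ^+ m * t ^+ m.*2.+2)).
rewrite (e t) [l^-1 ^+ m * _]mulrA; apply: ler_wpM2r; first by nneg.
rewrite -!muln2 !(mulnC m) !(exprM _ 2) -exprMn lerXn2r // ?nnegrE.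
 - by nneg.
 - by nneg.
 - by rewrite ler_pdivlMl.
by rewrite lerDr; apply: mulr_ge0; [exact: ltW|exact: (exprD_ge0 m.+1)].
Qed.
Lemma exprS_superadd m a c : 0 <= a -> 0 <= c -> a ^+ m.+1 + c / 2 * (a ^+ m + c ^+ m) <= (a + c) ^+ m.+1.
move=> a0 c0.
have a1 : a ^+ m <= (a + c) ^+ m by rewrite lerXn2r ?nnegrE ?addr_ge0 ?lerDl.
have c1 : c ^+ m <= (a + c) ^+ m by rewrite lerXn2r ?nnegrE ?addr_ge0 ?lerDr.
rewrite exprS [leRHS]exprS mulrDl; apply: lerD; first exact: ler_wpM2l.
rewrite -mulrA; apply: ler_wpM2l => //.
by rewrite ler_pdivrMl // mulr2n mulrDl !mul1r lerD.
Qed.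
Lemma young_optimize m K a b x : 1 <= K -> 0 <= a -> 0 <= b -> (forall l, 0 < l ->
 x <= (1 + K * l) * a ^+ m.+1 + K * (l^-1 ^+ m + 1) * b ^+ m.+1) -> x <= (a + 4 * K * b) ^+ m.+1.
move=> K1 a0 b0 h; have K0 : 0 < K by nneg.
have [b0'|b0'] := eqVneq b 0.
rewrite b0' mulr0 addr0; apply/ler_addgt0Pr => e e0.
have ap : 0 < a ^+ m.+1 + 1 by rewrite ltr_wpDl ?exprn_ge0.
(* For [b = 0] the optimal [l] would be 0; this small positive [l] costs at most [e]. *)
have /h := divr_gt0 e0 (mulr_gt0 K0 ap); move=> /le_trans; apply.
rewrite b0' expr0n /= mulr0 addr0 mulrDl mul1r lerD2l.
rewrite invfM !mulrA [K * e]mulrC mulfK ?gt_eqF // -mulrA.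
by rewrite ger_pMr // ler_pdivrMl // mulr1 lerDl.
have {b0'} b0' : 0 < b by rewrite lt_neqAle eq_sym b0' b0.
have Kb0 : 0 <= 4 * K * b by nneg.
have bK : b <= 4 * K * b by rewrite ler_peMl // mulr_ege1 ?ler1n.
apply: le_trans (exprS_superadd m a0 Kb0).
have -> : 4 * K * b / 2 = 2 * K * b by field.
have bm : b ^+ m <= (4 * K * b) ^+ m by rewrite lerXn2r ?nnegrE.
have bm0 : 0 <= b ^+ m by nneg.
have am0 : 0 <= a ^+ m by nneg.
have Kb : 0 <= K * b by nneg.
have [az|az] := eqVneq a 0.
apply: (le_trans (h 1 ltr01)).
rewrite [a ^+ m.+1]exprS az mul0r mulr0 !add0r invr1 expr1n exprS.
rewrite az in am0 *.
have := ler_wpM2l Kb (lerD am0 bm).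
by rewrite add0r; lra.
have {az} a0' : 0 < a by rewrite lt_neqAle eq_sym az a0.
(* At l = b / a both terms depending on [l] become multiples of b a^m. *)
apply: (le_trans (h _ (divr_gt0 b0' a0'))).
have e1 : (b / a)^-1 ^+ m * b ^+ m.+1 = b * a ^+ m.
by rewrite invf_div expr_div_n exprS mulrCA mulfVK // expf_neq0 // gt_eqF.
have e2 : b / a * a ^+ m.+1 = b * a ^+ m.
by rewrite exprS mulrA mulfVK // gt_eqF.
have -> : (1 + K * (b / a)) * a ^+ m.+1 + K * ((b / a)^-1 ^+ m + 1) * b ^+ m.+1
 = a ^+ m.+1 + K * (b / a * a ^+ m.+1) + K * ((b / a)^-1 ^+ m * b ^+ m.+1) + K * b ^+ m.+1 by ring.
rewrite e1 e2 [b ^+ m.+1]exprS.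
have := ler_wpM2l Kb bm; have := mulr_ge0 Kb am0; have := mulr_ge0 Kb bm0.
set u := b ^+ m; set v := a ^+ m; set z := (4 * K * b) ^+ m; lra.
Qed.
End PowerInequalities.

(** * Moments of a martingale, one increment at a time *)

Section MomentStep.
Context d (T : measurableType d) (R : realType) (P : probability T R).
Variable m : nat.
Let integrableX (S : T -> R) (a : R) : mfunT S -> (\int[P]_w (S w ^+ m.*2.+2)%:E <= a%:E)%E ->
 P.-integrable setT (fun w => (S w ^+ m.*2.+2)%:E).
move=> mS h; apply/integrableP; split.
by apply/measurable_EFinP; apply: measurable_funX.
rewrite (eq_integral (fun w => (S w ^+ m.*2.+2)%:E)); last first.
by move=> w _; rewrite gee0_abs // lee_fin (exprD_ge0 m.+1).
exact: (le_lt_trans h (ltry _)).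
Qed.
Lemma integrableXM (S D : T -> R) (a b : R) : mfunT S -> mfunT D ->
 (\int[P]_w (S w ^+ m.*2.+2)%:E <= a%:E)%E -> (\int[P]_w (D w ^+ m.*2.+2)%:E <= b%:E)%E ->
 P.-integrable setT (fun w => (S w ^+ m.*2.+1 * D w)%:E).
move=> mS mD hS hD.
have iS := integrableX mS hS; have iD := integrableX mD hD.
apply: (le_integrable measurableT _ _ (integrableD measurableT iS iD)).
by apply/measurable_EFinP; apply: measurable_funM => //; exact: measurable_funX.
move=> w _; rewrite -EFinD !abse_EFin lee_fin.
rewrite [leRHS]ger0_norm; last first.
by rewrite addr_ge0 // (exprD_ge0 m.+1).
have := @norm_exprM_le _ m.+1 1 (S w) (D w) isT.
by [].
Qed.
(** A Burkholder-type step. The term linear in [D] integrates to 0, the mixed term is split by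
    Young's inequality with a free parameter, and [young_optimize] removes the parameter. Bounds
    then add like variances. *)
Lemma moment_step (S D : T -> R) (a b : R) : 0 <= a -> 0 <= b -> mfunT S -> mfunT D ->
 (\int[P]_w (S w ^+ m.*2.+2)%:E <= (a ^+ m.+1)%:E)%E -> (\int[P]_w (D w ^+ m.*2.+2)%:E <= (b ^+ m.+1)%:E)%E ->
 (\int[P]_w (S w ^+ m.*2.+1 * D w)%:E = 0)%E -> (\int[P]_w ((S w + D w) ^+ m.*2.+2)%:E <=
 ((a + 4 * taylorK m * b) ^+ m.+1)%:E)%E.
move=> a0 b0 mS mD hS hD h0.
have iS := integrableX mS hS; have iD := integrableX mD hD.
have iSD := integrableXM mS mD hS hD.
set K := taylorK m; have K1 : 1 <= K := taylorK_ge1 m.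
have K0 : 0 <= K by [].
have fS : (\int[P]_w (S w ^+ m.*2.+2)%:E)%E \is a fin_num.
exact: integrable_fin_num.
have fD : (\int[P]_w (D w ^+ m.*2.+2)%:E)%E \is a fin_num.
exact: integrable_fin_num.
have bnd l : 0 < l -> (\int[P]_w ((S w + D w) ^+ m.*2.+2)%:E <=
 ((1 + K * l) * a ^+ m.+1 + K * (l^-1 ^+ m + 1) * b ^+ m.+1)%:E)%E.
move=> l0.
pose F w := ((1 + K * l)%:E * (S w ^+ m.*2.+2)%:E + m.*2.+2%:R%:E * (S w ^+ m.*2.+1 * D w)%:E +
 (K * (l^-1 ^+ m + 1))%:E * (D w ^+ m.*2.+2)%:E)%E.
have iF1 := integrableZl measurableT (1 + K * l) iS.
have iF2 := integrableZl measurableT m.*2.+2%:R iSD.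
have iF3 := integrableZl measurableT (K * (l^-1 ^+ m + 1)) iD.
have iF12 := integrableD measurableT iF1 iF2.
have iF := integrableD measurableT iF12 iF3.
have le w : (S w + D w) ^+ m.*2.+2 <= (1 + K * l) * S w ^+ m.*2.+2 + m.*2.+2%:R * (S w ^+ m.*2.+1 * D w) +
 (K * (l^-1 ^+ m + 1)) * D w ^+ m.*2.+2.
apply: (le_trans (exprD_taylor2 m (S w) (D w))).
have := ler_wpM2l K0 (young_even m (S w) (D w) l0); rewrite -/K.
set u := S w ^+ m.*2.+2; set v := D w ^+ m.*2.+2.
rewrite !mulrDr; set z := S w ^+ m.*2 * _; lra.
apply: (letr (\int[P]_w F w)%E).
apply: ge0_le_integral => //.
 - by move=> w _; rewrite lee_fin (exprD_ge0 m.+1).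
 - apply/measurable_EFinP; apply: measurable_funX; exact: measurable_funD.
 - by case/integrableP : iF.
 - by move=> w _; rewrite /F -!EFinM -!EFinD lee_fin.
rewrite /F integralD // integralD // !integralZl // h0 mule0 adde0.
have u0 : 0 <= 1 + K * l by nneg.
have v0 : 0 <= K * (l^-1 ^+ m + 1).
by nneg.
move: (1 + K * l) (K * (l^-1 ^+ m + 1)) u0 v0 => u v u0 v0.
by rewrite EFinD !EFinM; apply: leeD; apply: lee_wpmul2l.
have fSD : (\int[P]_w ((S w + D w) ^+ m.*2.+2)%:E)%E \is a fin_num.
rewrite ge0_fin_numE; first exact: (le_lt_trans (bnd 1 ltr01) (ltry _)).
by apply: integral_ge0 => w _; rewrite lee_fin (exprD_ge0 m.+1).
rewrite -(fineK fSD) lee_fin; apply: young_optimize => // l l0.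
by rewrite -lee_fin fineK //; exact: bnd.
Qed.
End MomentStep.

(** * Moments of linear and quadratic forms in independent entries *)

Section LinearForms.
Context d (T : measurableType d) (R : realType) (P : probability T R).
Variables (I : finType) (X : I -> {RV P >-> (R * R)%type}) (indX : mutually_independent X) (m : nat) (B : R)
 (X1_0 : forall i, (\int[P]_w ((X i w).1)%:E = 0)%E) (X2_0 : forall i, (\int[P]_w ((X i w).2)%:E = 0)%E)
 (XB : forall i, (\int[P]_w (((X i w).1 ^+ 2 + (X i w).2 ^+ 2) ^+ m.*2.+2)%:E <= B%:E)%E).
(** The entries are revealed one by one in the order of a list; [past J] generates what is known
    once those in [J] have been seen. *)
Definition past (J : seq I) : set (set T) := cylinder X [set x in J].
Lemma past_meas J : past J `<=` measurable.
exact: cylinder_meas. Qed.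
Lemma past_indep J s A C : s \notin J ->
 <<s past J >> A -> <<s past [:: s] >> C -> P (A `&` C) = (P A * P C)%E.
move=> sJ; apply: cylinder_indep => // j; rewrite !inE => jJ.
by apply: contra sJ => /eqP <-.
Qed.
Lemma past_fst (J : seq I) s : s \in J -> mfunT (fun w : g_sigma_algebraType (past J) => (X s w).1).
move=> sJ; apply: (measurableT_comp measurable_fst) => _ A mA; rewrite setTI.
by apply: sub_sigma_algebra; apply: cylinder_preimage; rewrite ?inE.
Qed.
Lemma past_snd (J : seq I) s : s \in J -> mfunT (fun w : g_sigma_algebraType (past J) => (X s w).2).
move=> sJ; apply: (measurableT_comp measurable_snd) => _ A mA; rewrite setTI.
by apply: sub_sigma_algebra; apply: cylinder_preimage; rewrite ?inE.
Qed.
Lemma past_mfunT (J : seq I) (f : T -> R) : mfunT (f : g_sigma_algebraType (past J) -> R) -> mfunT f.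
move=> mf _ A mA; have := mf measurableT A mA.
exact: (smallest_sub (@sigma_algebra_measurable _ T) (@past_meas J)).
Qed.
Definition linform (a b : I -> R) (J : seq I) (w : T) : R :=
 \sum_(t <- J) (a t * (X t w).1 - b t * (X t w).2).
Lemma past_linform a b (J K : seq I) : {subset J <= K} ->
 mfunT (linform a b J : g_sigma_algebraType (past K) -> R).
move=> JK; rewrite /linform (_ : (fun w => _) = (fun w => \sum_(t <- J)
 (if t \in J then a t * (X t w).1 - b t * (X t w).2 else 0))); last first.
by apply/funext => w; rewrite big_seq [RHS]big_seq; apply: eq_bigr => i ->.
apply: measurable_sum => t /=.
case: (boolP (t \in J)) => tJ; last exact: measurable_cst.
by apply: measurable_funB; apply: measurable_funM => //; [apply: past_fst|apply: past_snd]; exact: JK.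
Qed.
End LinearForms.
Notation pastT X J := (g_sigma_algebraType (past X J)).

Section ExprFacts.
Context {R : realType}.
Implicit Types x y z : R.
Lemma exprS_le1D m x : 0 <= x -> x ^+ m.+1 <= 1 + x ^+ m.*2.+2.
move=> x0; have := @norm_exprM_le R m.+1 m.+1 x 1.
rewrite !expr1n mulr1 [_ + 1]addrC -addnn addnK addnn doubleS.
by rewrite ger0_norm ?exprn_ge0 //; apply; rewrite -doubleS -addnn leq_addr.
Qed.
Lemma exprD3_even m x y z : (x + y + z) ^+ m.*2.+2 <= 3 ^+ m.*2.+2 *
 (x ^+ m.*2.+2 + y ^+ m.*2.+2 + z ^+ m.*2.+2).
rewrite -doubleS -exprD_norm -(exprD_norm _ x) -(exprD_norm _ y) -(exprD_norm _ z).
set n := m.+1.*2.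
set M := Num.max `|x| (Num.max `|y| `|z|).
have [hx hy hz] : [/\ `|x| <= M, `|y| <= M & `|z| <= M] by rewrite !le_max !lexx !orbT.
have M0 : 0 <= M by apply: le_trans hx.
have h (u : R) : 0 <= `|u| ^+ n by [].
apply: (letr ((3 * M) ^+ n)).
rewrite lerXn2r ?nnegrE ?mulr_ge0 //.
apply: le_trans (ler_normD _ _) _.
rewrite [3 * M](_ : _ = M + M + M); last by ring.
by rewrite lerD // (le_trans (ler_normD _ _)) // lerD.
rewrite exprMn; apply: ler_wpM2l; first by [].
have [x0 y0 z0] := And3 (h x) (h y) (h z).
by move: x0 y0 z0; rewrite /M /Num.max; case: ifP => _; first case: ifP => _; lra.
Qed.
Lemma expr_superadd m x y : 0 <= x -> 0 <= y -> x ^+ m.+1 + y ^+ m.+1 <= (x + y) ^+ m.+1.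
move=> x0 y0; have xy0 : 0 <= x + y by nneg.
rewrite !exprS mulrDl; apply: lerD; apply: ler_wpM2l => //; by rewrite lerXn2r ?nnegrE // (lerDl, lerDr).
Qed.
Lemma expr_ge1_mul m x y : 1 <= x -> 0 <= y -> x * y ^+ m.+1 <= (x * y) ^+ m.+1.
move=> x1 y0; rewrite exprMn; apply: ler_wpM2r; first by nneg.
by rewrite ler_eXnr.
Qed.
Lemma expr_sub1_le m x : 0 <= x -> (x - 1) ^+ m.*2.+2 <= 2 ^+ m.*2.+2 * (1 + x ^+ m.*2.+2).
move=> x0; rewrite -doubleS -exprD_norm; set n := _.*2.
have xn : 0 <= x ^+ n by exact: exprn_ge0.
apply: (letr (1 + x ^+ n)); last by rewrite ler_peMl ?addr_ge0 // exprn_ege1 // ler1n.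
have [x1|/ltW x1] := lerP x 1.
by apply: (letr 1); rewrite ?lerDl // exprn_ile1 //; lra.
by apply: (letr (x ^+ n)); rewrite ?lerDr // lerXn2r ?nnegrE //; lra.
Qed.
End ExprFacts.

Section IntegrableExpr.
Context d (T : measurableType d) (R : realType) (P : probability T R).
Lemma integrableXn m k (S : T -> R) (a : R) : (k <= m.*2.+2)%N ->
 mfunT S -> (\int[P]_w (S w ^+ m.*2.+2)%:E <= a%:E)%E -> P.-integrable setT (fun w => (S w ^+ k)%:E).
move=> km mS h.
have i1 : P.-integrable setT (cst 1%:E : T -> \bar R).
exact: finite_measure_integrable_cst.
have iS : P.-integrable setT (fun w => (S w ^+ m.*2.+2)%:E).
apply/integrableP; split.
by apply/measurable_EFinP; apply: measurable_funX.
rewrite (eq_integral (fun w => (S w ^+ m.*2.+2)%:E)); last first.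
by move=> w _; rewrite gee0_abs // lee_fin (exprD_ge0 m.+1).
exact: (le_lt_trans h (ltry _)).
apply: (le_integrable measurableT _ _ (integrableD measurableT iS i1)).
by apply/measurable_EFinP; exact: measurable_funX.
move=> w _; rewrite -EFinD !abse_EFin lee_fin.
rewrite [leRHS]ger0_norm; last by rewrite addr_ge0 // (exprD_ge0 m.+1).
have := @norm_exprM_le _ m.+1 (m.+1.*2 - k) (S w) 1 (leq_subr _ _).
by rewrite !expr1n mulr1 subKn.
Qed.
End IntegrableExpr.
Lemma measurable_quad_sum d (D : measurableType d) (R : realType) (I : eqType) (J : seq I)
 (a b : I -> I -> D -> R) (x y : I -> D -> R) : (forall s t, mfunT (a s t)) -> (forall s t, mfunT (b s t)) ->
 {in J, forall s, mfunT (x s)} -> {in J, forall s, mfunT (y s)} -> mfunT (fun z => \sum_(s <- J) \sum_(t <- J)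
 (a s t z * (x s z * x t z + y s z * y t z) + b s t z * (y s z * x t z - x s z * y t z))).
move=> ma mb mx my.
rewrite (_ : (fun z => _) = (fun z => \sum_(s <- J) \sum_(t <- J) (if (s \in J) && (t \in J) then
 a s t z * (x s z * x t z + y s z * y t z) + b s t z * (y s z * x t z - x s z * y t z) else 0))); last first.
apply/funext => w; rewrite big_seq [RHS]big_seq; apply: eq_bigr => s sJ.
by rewrite big_seq [RHS]big_seq; apply: eq_bigr => t tJ; rewrite sJ tJ.
apply: measurable_sum => s /=; apply: measurable_sum => t /=.
case: (boolP (_ && _)) => [/andP[sJ tJ]|_]; last exact: measurable_cst.
have [f1 f2 g1 g2] := And4 (mx _ sJ) (my _ sJ) (mx _ tJ) (my _ tJ).
by apply: measurable_funD; apply: measurable_funM => //;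
 [apply: measurable_funD|apply: measurable_funB]; apply: measurable_funM.
Qed.
(** The entries may have different laws: coefficients and noise entries will be put into one array,
    with a common moment bound [B]. *)
Record std_array d (T : measurableType d) (R : realType) (P : probability T R) (I : finType)
 (X : I -> {RV P >-> (R * R)%type}) (m : nat) (B : R) : Prop := StdArray { sa_indep : mutually_independent X;
 sa_bound : 1 <= B; sa_mean1 : forall i, (\int[P]_w ((X i w).1)%:E = 0)%E;
 sa_mean2 : forall i, (\int[P]_w ((X i w).2)%:E = 0)%E;
 sa_var : forall i, (\int[P]_w ((X i w).1 ^+ 2 + (X i w).2 ^+ 2)%:E = 1)%E; sa_moment : forall i,
 (\int[P]_w (((X i w).1 ^+ 2 + (X i w).2 ^+ 2) ^+ m.*2.+2)%:E <= B%:E)%E }.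

Section Forms.
Context d (T : measurableType d) (R : realType) (P : probability T R).
Variables (I : finType) (X : I -> {RV P >-> (R * R)%type}) (m : nat) (B : R) (stdX : std_array X m B).
Let indX := sa_indep stdX.
Let B1 := sa_bound stdX.
Let X1_0 := sa_mean1 stdX.
Let X2_0 := sa_mean2 stdX.
Let Xsq := sa_var stdX.
Let XB := sa_moment stdX.
Let n := m.*2.+2.
Let B2 : 1 <= 2 * B. by have := B1; lra. Qed.
Let B20 : 0 <= 2 * B. exact: le_trans B2. Qed.
Let rho i w := (X i w).1 ^+ 2 + (X i w).2 ^+ 2.
Let rho0 i w : 0 <= rho i w.
by nneg. Qed.
Let mX1 i : mfunT (fun w : T => (X i w).1).
exact: (measurableT_comp measurable_fst). Qed.
Let mX2 i : mfunT (fun w : T => (X i w).2).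
exact: (measurableT_comp measurable_snd). Qed.
Let mrho i : mfunT (rho i).
by apply: measurable_funD; apply: measurable_funX. Qed.
Let rho_bound i : (\int[P]_w (1 + rho i w ^+ n)%:E <= (2 * B)%:E)%E.
under eq_integral do rewrite EFinD.
rewrite ge0_integralD //=.
- have -> : (\int[P]__ 1 = 1)%E by rewrite integral_cst // mul1e; exact: probability_setT.
have -> : 2 * B = B + B by ring.
by rewrite EFinD; apply: leeD; [rewrite lee_fin|exact: XB].
- by move=> w _; rewrite lee_fin exprn_ge0.
- by apply/measurable_EFinP; apply: measurable_funX.
Qed.
Let le_rho (f : T -> R) (c : R) i : 0 <= c -> mfunT f -> (forall w, 0 <= f w) ->
 (forall w, f w <= c * (1 + rho i w ^+ n)) -> (\int[P]_w (f w)%:E <= (c * (2 * B))%:E)%E.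
move=> c0 mf f0 h.
have m1 : mfunT (fun w => (1 + rho i w ^+ n)%:E).
by apply/measurable_EFinP; apply: measurable_funD => //; apply: measurable_funX.
apply: (letr (\int[P]_w (c%:E * (1 + rho i w ^+ n)%:E))%E).
apply: ge0_le_integral => //.
 - by move=> w _; rewrite lee_fin.
 - exact/measurable_EFinP.
 - exact: emeasurable_funM.
 - by move=> w _; rewrite -EFinM lee_fin.
rewrite ge0_integralZl //; last by move=> w _; rewrite lee_fin addr_ge0 // exprn_ge0.
by rewrite EFinM; apply: lee_wpmul2l; [rewrite lee_fin|by []].
Qed.
Let sqr_le_rho (f : T -> R) i : mfunT f -> (forall w, f w ^+ 2 <= rho i w) ->
 (\int[P]_w (f w ^+ n)%:E <= (2 * B)%:E)%E.
move=> mf fr; rewrite -[2 * B]mul1r; apply: (le_rho (i := i)) => //.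
- exact: measurable_funX.
- by move=> w; rewrite (exprD_ge0 m.+1).
- move=> w; rewrite mul1r; apply: le_trans (exprS_le1D _ (rho0 i w)).
by rewrite /n -doubleS -muln2 mulnC exprM lerXn2r ?nnegrE ?sqr_ge0.
Qed.
Let X1n i : (\int[P]_w ((X i w).1 ^+ n)%:E <= (2 * B)%:E)%E.
by apply: (sqr_le_rho (i := i)) => // w; rewrite lerDl sqr_ge0. Qed.
Let X2n i : (\int[P]_w ((X i w).2 ^+ n)%:E <= (2 * B)%:E)%E.
by apply: (sqr_le_rho (i := i)) => // w; rewrite lerDr sqr_ge0. Qed.
Let iX1 i : P.-integrable setT (fun w => ((X i w).1)%:E).
exact: (integrableXn (k := 1) isT (mX1 i) (X1n i)). Qed.
Let iX2 i : P.-integrable setT (fun w => ((X i w).2)%:E).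
exact: (integrableXn (k := 1) isT (mX2 i) (X2n i)). Qed.
Let irho i : P.-integrable setT (fun w => (rho i w)%:E).
exact: (integrableXn (k := 1) isT (mrho i) (XB i)). Qed.
Let rho_mean1 s : P.-integrable setT (EFin \o (fun w => rho s w - 1)) /\ (\int[P]_w (rho s w - 1)%:E = 0)%E.
have i1 : P.-integrable setT (cst 1%:E : T -> \bar R).
exact: finite_measure_integrable_cst.
split; first exact: (integrableB measurableT (irho s) i1).
under eq_integral do rewrite EFinB.
rewrite integralB //= Xsq.
have -> : (\int[P]__ 1 = 1)%E by rewrite integral_cst // mul1e; exact: probability_setT.
by rewrite subee.
Qed.
Let past_mul0 (J : seq I) s (f h : T -> R) : s \notin J ->
 P.-integrable setT (EFin \o f) -> P.-integrable setT (EFin \o h) -> mfunT (f : pastT X J -> R) ->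
 mfunT (h : pastT X [:: s] -> R) -> (\int[P]_w (h w)%:E = 0)%E ->
 P.-integrable setT (fun w : T => (f w * h w)%:E) /\ (\int[P]_w (f w * h w)%:E = 0)%E.
move=> sJ; apply: expectation_mul_eq0; [exact: past_meas..|].
by move=> A C; apply: past_indep.
Qed.
Definition linK : R := 4 * taylorK m * (2 * B).
Let K := @taylorK R m.
Let K1 : 1 <= K. exact: taylorK_ge1. Qed.
Lemma linK_ge1 : 1 <= linK.
by rewrite /linK -/K !mulr_ege1 // ler1n. Qed.
Let L0 : 0 <= linK. exact: le_trans linK_ge1. Qed.
Let L20 : 0 <= 2 * linK. by nneg. Qed.
Let T40 : 0 <= 4 * taylorK m :> R.
by nneg. Qed.
Let S60 : 0 <= 6 ^+ n :> R. by []. Qed.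
Let S6B : 0 <= 6 ^+ n * (2 * B). by nneg. Qed.
Let S6L : 0 <= 6 ^+ n * (2 * B) * (2 * linK). by nneg. Qed.
(** The newly revealed entry is centred and independent of the past, so [moment_step] adds its
    squared coefficient to the bound. *)
Lemma linform_moment a b (J : seq I) : uniq J -> (\int[P]_w (linform X a b J w ^+ n)%:E <=
 ((linK * \sum_(t <- J) (a t ^+ 2 + b t ^+ 2)) ^+ m.+1)%:E)%E.
elim: J => [_|s J IH /= /andP[sJ uJ]].
under eq_integral do rewrite /linform big_nil expr0n /=.
by rewrite integral0 big_nil mulr0 expr0n.
have mS : mfunT (linform X a b J : pastT X J -> R).
exact: past_linform.
have mST : mfunT (linform X a b J).
exact: (past_mfunT mS).
have mD : mfunT (fun w => a s * (X s w).1 - b s * (X s w).2).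
by apply: measurable_funB; apply: measurable_funM.
have q0 : 0 <= a s ^+ 2 + b s ^+ 2 by nneg.
have hD : (\int[P]_w ((a s * (X s w).1 - b s * (X s w).2) ^+ n)%:E <=
 ((2 * B * (a s ^+ 2 + b s ^+ 2)) ^+ m.+1)%:E)%E.
apply: (letr ((a s ^+ 2 + b s ^+ 2) ^+ m.+1 * (2 * B))%:E).
apply: (le_rho (i := s)); rewrite ?exprn_ge0 //.
 - exact: measurable_funX.
 - by move=> w; rewrite (exprD_ge0 m.+1).
 - move=> w; apply: (letr ((a s ^+ 2 + b s ^+ 2) ^+ m.+1 * rho s w ^+ m.+1)).
rewrite -exprMn /n -doubleS -muln2 mulnC exprM.
rewrite lerXn2r ?nnegrE ?sqr_ge0 ?mulr_ge0 //.
(* Cauchy-Schwarz in the plane: the squares of a x - b y and a y + b x add up to (a^2 + b^2) (x^2 +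
   y^2). *)
rewrite /rho; have := sqr_ge0 (a s * (X s w).2 + b s * (X s w).1); nra.
by apply: ler_wpM2l; rewrite ?exprn_ge0 //; exact: exprS_le1D.
by rewrite lee_fin mulrC; apply: expr_ge1_mul.
have h0 : (\int[P]_w (linform X a b J w ^+ m.*2.+1 * (a s * (X s w).1 - b s * (X s w).2))%:E = 0)%E.
have iS : P.-integrable setT (EFin \o (fun w => linform X a b J w ^+ m.*2.+1)).
exact: (integrableXn (leqnSn _) mST (IH uJ)).
have mSn : mfunT ((fun w => linform X a b J w ^+ m.*2.+1) : pastT X J -> R) by apply: measurable_funX.
have [i1 e1] := past_mul0 sJ iS (iX1 s) mSn (past_fst (mem_head s [::])) (X1_0 s).
have [i2 e2] := past_mul0 sJ iS (iX2 s) mSn (past_snd (mem_head s [::])) (X2_0 s).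
rewrite (eq_integral (fun w => (a s)%:E * (linform X a b J w ^+ m.*2.+1 * (X s w).1)%:E
 + (- b s)%:E * (linform X a b J w ^+ m.*2.+1 * (X s w).2)%:E)%E); last first.
by move=> w _; rewrite -!EFinM -EFinD; congr (_%:E); ring.
rewrite integralD ?integralZl //; [|exact: integrableZl..].
by rewrite e1 e2 !mule0 adde0.
rewrite (eq_integral (fun w => ((linform X a b J w +
 (a s * (X s w).1 - b s * (X s w).2)) ^+ n)%:E)); last first.
by move=> w _; rewrite /linform big_cons addrC.
have S0 : 0 <= linK * \sum_(t <- J) (a t ^+ 2 + b t ^+ 2).
rewrite mulr_ge0 ?(le_trans ler01 linK_ge1) // sumr_ge0 // => i _.
by nneg.
have b0 : 0 <= 2 * B * (a s ^+ 2 + b s ^+ 2) by nneg.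
apply: (le_trans (moment_step S0 b0 mST mD (IH uJ) hD h0)).
rewrite lee_fin le_eqVlt; apply/orP; left; apply/eqP; congr (_ ^+ _).
by rewrite big_cons /linK; ring.
Qed.

(* The value of [sum_(s,t in J) conj (X_s) M_st X_t - sum_(s in J) M_ss] for a
 Hermitian matrix [M = a + i b], in terms of real and imaginary parts. *)
Definition quadform (a b : I -> I -> R) (J : seq I) (w : T) : R := \sum_(s <- J) \sum_(t <- J)
 (a s t * ((X s w).1 * (X t w).1 + (X s w).2 * (X t w).2) +
 b s t * ((X s w).2 * (X t w).1 - (X s w).1 * (X t w).2))
 - \sum_(s <- J) a s s.
Definition quadK : R := 4 * taylorK m * (6 ^+ n * (2 * B) * (2 * linK)).
Lemma quadK_ge0 : 0 <= quadK. by nneg. Qed.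
Lemma past_quadform a b (J K' : seq I) : {subset J <= K'} -> mfunT (quadform a b J : pastT X K' -> R).
move=> JK; apply: measurable_funB; last exact: measurable_cst.
apply: (@measurable_quad_sum _ (pastT X K') R I J (fun s t _ => a s t) (fun s t _ => b s t)
 (fun s w => (X s w).1) (fun s w => (X s w).2)) => *; [exact: measurable_cst..| |].
by move=> s /JK; exact: past_fst.
by move=> s /JK; exact: past_snd.
Qed.
(** The increment of the form seen as a martingale: a centred diagonal term, plus each coordinate of
    the new entry times a linear form in the past. *)
Let quad_step a b s J w : (forall s t, a s t = a t s) -> (forall s t, b s t = - b t s) -> s \notin J ->
 quadform a b (s :: J) w = quadform a b J w +
 (a s s * (rho s w - 1) + 2 * ((X s w).1 * linform X (a s) (b s) J w) +
 2 * ((X s w).2 * linform X (b s) (fun t => - a s t) J w)).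
move=> sa sb sJ; have bss : b s s = 0 by have := sb s s; lra.
pose c s t := a s t * ((X s w).1 * (X t w).1 + (X s w).2 * (X t w).2) +
 b s t * ((X s w).2 * (X t w).1 - (X s w).1 * (X t w).2).
have E K' : quadform a b K' w = \sum_(s <- K') \sum_(t <- K') c s t - \sum_(s <- K') a s s by [].
have cC i j : c i j = c j i by rewrite /c (sa i j) (sb i j); ring.
have e2 : (X s w).1 * linform X (a s) (b s) J w +
 (X s w).2 * linform X (b s) (fun t => - a s t) J w = \sum_(j <- J) c s j.
rewrite /linform !mulr_sumr -big_split.
by apply: eq_bigr => j _; rewrite /c /=; ring.
rewrite !E !big_cons; under [X in _ + X - _]eq_bigr do rewrite big_cons cC.
rewrite [X in _ + X - _]big_split /=.
have -> : c s s = a s s * rho s w by rewrite /c bss /rho; ring.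
move: e2; set S1 := linform X (a s) _ J w; set S2 := linform X (b s) _ J w.
move: (\sum_(j <- J) c s j) => Sc e2; rewrite -e2.
by move: (X s w).1 (X s w).2 => x1 x2; ring.
Qed.
(** The coefficients of the two linear forms in [quad_step] are the entries of one matrix row, so
    [linform_moment] and independence bound the increment by the squared norm of that row. Summed
    over steps, the rows give the squared Frobenius norm. *)
Lemma quadform_moment a b (J : seq I) : uniq J ->
 (forall s t, a s t = a t s) -> (forall s t, b s t = - b t s) -> (\int[P]_w (quadform a b J w ^+ n)%:E <=
 ((quadK * \sum_(s <- J) \sum_(t <- J) (a s t ^+ 2 + b s t ^+ 2)) ^+ m.+1)%:E)%E.
move=> uJ sa sb; elim: J uJ => [_|s J IH /= /andP[sJ uJ]].
under eq_integral do rewrite /quadform !big_nil subrr expr0n /=.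
by rewrite integral0 big_nil mulr0 expr0n.
have mS : mfunT (quadform a b J : pastT X J -> R).
exact: past_quadform.
have mST : mfunT (quadform a b J) := past_mfunT mS.
pose f1 := linform X (a s) (b s) J; pose f2 := linform X (b s) (fun t => - a s t) J.
have mf1 : mfunT (f1 : pastT X J -> R).
exact: past_linform.
have mf2 : mfunT (f2 : pastT X J -> R).
exact: past_linform.
have mf1T : mfunT f1 := past_mfunT mf1.
have mf2T : mfunT f2 := past_mfunT mf2.
pose D w := a s s * (rho s w - 1) + 2 * ((X s w).1 * f1 w) + 2 * ((X s w).2 * f2 w).
have mD1 : mfunT (fun w => a s s * (rho s w - 1)).
by apply: measurable_funM => //; apply: measurable_funB.
have mD2 : mfunT (fun w => 2 * ((X s w).1 * f1 w)).
by apply: measurable_funM => //; apply: measurable_funM.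
have mD3 : mfunT (fun w => 2 * ((X s w).2 * f2 w)).
by apply: measurable_funM => //; apply: measurable_funM.
have mD : mfunT D.
by apply: measurable_funD => //; apply: measurable_funD.
pose r := \sum_(t <- J) (a s t ^+ 2 + b s t ^+ 2).
have r0 : 0 <= r by nneg.
have hf1 : (\int[P]_w (f1 w ^+ n)%:E <= ((linK * r) ^+ m.+1)%:E)%E.
exact: linform_moment.
have hf2 : (\int[P]_w (f2 w ^+ n)%:E <= ((linK * r) ^+ m.+1)%:E)%E.
rewrite (_ : r = \sum_(t <- J) (b s t ^+ 2 + (- a s t) ^+ 2)).
exact: linform_moment.
by apply: eq_bigr => t _; rewrite sqrrN addrC.
have Lr0 : 0 <= linK * r by nneg.
have prod_bound (x f : T -> R) : mfunT (x : pastT X [:: s] -> R) -> mfunT (f : pastT X J -> R) ->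
 (\int[P]_w (x w ^+ n)%:E <= (2 * B)%:E)%E -> (\int[P]_w (f w ^+ n)%:E <= ((linK * r) ^+ m.+1)%:E)%E ->
 (\int[P]_w ((2 * (x w * f w)) ^+ n)%:E <= (2 ^+ n * (2 * B) * (linK * r) ^+ m.+1)%:E)%E.
move=> mx mf hx hf.
rewrite (eq_integral (fun w => (2 ^+ n)%:E * ((f w ^+ n)%:E * (x w ^+ n)%:E))%E); last first.
by move=> w _; rewrite -!EFinM; congr (_%:E); rewrite !exprMn [f w ^+ n * _]mulrC.
have mfT := past_mfunT mf; have mxT := past_mfunT mx.
have ge0n (u : R) : (0 <= (u ^+ n)%:E)%E by rewrite lee_fin (exprD_ge0 m.+1).
rewrite ge0_integralZl //; last 2 first.
 - by apply: emeasurable_funM; apply/measurable_EFinP; apply: measurable_funX.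
 - by move=> w _; apply: mule_ge0.
rewrite (@ge0_expectation_mul _ _ _ _ (past X J) (past X [:: s]) _ _ _
 (fun w => (f w ^+ n)%:E) (fun w => (x w ^+ n)%:E)) //; last 5 first.
 - exact: past_meas.
 - exact: past_meas.
 - by move=> A C; apply: past_indep.
 - by apply/measurable_EFinP; apply: measurable_funX.
 - by apply/measurable_EFinP; apply: measurable_funX.
rewrite -[X in (_ <= X%:E)%E]mulrA (EFinM (2 ^+ n)); apply: lee_wpmul2l; first by [].
by rewrite mulrC (EFinM _ (2 * B)); apply: lee_pmul => //; exact: integral_ge0.
have hD1 : (\int[P]_w ((a s s * (rho s w - 1)) ^+ n)%:E <= (2 ^+ n * (2 * B) * (a s s ^+ 2) ^+ m.+1)%:E)%E.
rewrite mulrAC; apply: (le_rho (i := s)).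
 - by nneg.
 - exact: measurable_funX.
 - by move=> w; rewrite (exprD_ge0 m.+1).
 - move=> w; rewrite exprMn -exprM [(2 * m.+1)%N]mulnC muln2 doubleS -/n.
rewrite [leRHS](_ : _ = a s s ^+ n * (2 ^+ n * (1 + rho s w ^+ n))); last first.
by move: (2 ^+ n) (a s s ^+ n) (rho s w ^+ n) => x y z; ring.
apply: ler_wpM2l.
exact: (exprD_ge0 m.+1).
exact: expr_sub1_le (rho0 s w).
have ms1 : mfunT (fun w : pastT X [:: s] => (X s w).1).
exact: (past_fst (mem_head s [::])).
have ms2 : mfunT (fun w : pastT X [:: s] => (X s w).2).
exact: (past_snd (mem_head s [::])).
have hD2 := prod_bound _ _ ms1 mf1 (X1n s) hf1.
have hD3 := prod_bound _ _ ms2 mf2 (X2n s) hf2.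
pose u := a s s ^+ 2.
have u0 : 0 <= u := sqr_ge0 _.
have Q0 : 0 <= 6 ^+ n * (2 * B) * (2 * linK) * (u + r).
by nneg.
(* The factor 6^n is 3^n, from splitting the increment into three terms, times the 2^n present in
   the bound of each term. *)
have hD : (\int[P]_w (D w ^+ n)%:E <= ((6 ^+ n * (2 * B) * (2 * linK) * (u + r)) ^+ m.+1)%:E)%E.
have ge0n (x : R) : (0 <= (x ^+ n)%:E)%E by rewrite lee_fin (exprD_ge0 m.+1).
have mn (x : T -> R) : mfunT x -> mfunT (fun w => (x w ^+ n)%:E).
by move=> mx; apply/measurable_EFinP; apply: measurable_funX.
apply: (letr (\int[P]_w ((3 ^+ n)%:E * ((((a s s * (rho s w - 1)) ^+ n)%:E +
 ((2 * ((X s w).1 * f1 w)) ^+ n)%:E) + ((2 * ((X s w).2 * f2 w)) ^+ n)%:E)))%E).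
apply: ge0_le_integral => //.
 - exact: mn.
 - apply: emeasurable_funM => //.
by apply: emeasurable_funD; [apply: emeasurable_funD|]; exact: mn.
 - by move=> w _; rewrite -!EFinD -EFinM lee_fin; exact: exprD3_even.
have m3 : (0 <= (3 ^+ n)%:E :> \bar R)%E by [].
rewrite ge0_integralZl //; last 2 first.
 - by apply: emeasurable_funD; [apply: emeasurable_funD|]; exact: mn.
 - by move=> w _; rewrite !adde_ge0.
rewrite ge0_integralD //; [|by move=> w _; rewrite adde_ge0|
by apply: emeasurable_funD; exact: mn|exact: mn].
rewrite ge0_integralD //; [|exact: mn..].
apply: (letr ((3 ^+ n)%:E * ((2 ^+ n * (2 * B) * u ^+ m.+1)%:E + (2 ^+ n * (2 * B) * (linK * r) ^+ m.+1)%:E +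
 (2 ^+ n * (2 * B) * (linK * r) ^+ m.+1)%:E))%E).
by apply: lee_wpmul2l => //; apply: leeD => //; apply: leeD.
rewrite -!EFinD -EFinM lee_fin -!mulrDr mulrA.
have -> : 3 ^+ n * (2 ^+ n * (2 * B)) = 6 ^+ n * (2 * B).
by rewrite mulrA -exprMn; congr (_ ^+ _ * _); ring.
rewrite -[6 ^+ n * _ * _ * _]mulrA.
apply: (letr (6 ^+ n * (2 * B) * (2 * linK * (u + r)) ^+ m.+1)).
apply: ler_wpM2l; first exact: S6B.
have L1 := linK_ge1.
have e1 : u ^+ m.+1 + (linK * r) ^+ m.+1 <= (u + linK * r) ^+ m.+1.
exact: expr_superadd.
have e2 : (u + linK * r) ^+ m.+1 + (linK * r) ^+ m.+1 <= (u + linK * r + linK * r) ^+ m.+1.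
by apply: expr_superadd => //; rewrite addr_ge0.
apply: (letr ((u + linK * r + linK * r) ^+ m.+1)); first lra.
have u2 : u <= 2 * linK * u by rewrite ler_peMl // mulr_ege1 ?ler1n.
have e3 : u + linK * r + linK * r <= 2 * linK * (u + r).
by rewrite [leRHS]mulrDr; move: u2; lra.
have p0 : 0 <= u + linK * r + linK * r by nneg.
by rewrite lerXn2r ?nnegrE // (le_trans p0).
apply: expr_ge1_mul; last first.
by nneg.
by rewrite mulr_ege1 // exprn_ege1 // ler1n.
(* Each of the three parts of the increment is a function of the past times a centred function of
   the new entry. *)
have h0 : (\int[P]_w (quadform a b J w ^+ m.*2.+1 * D w)%:E = 0)%E.
have iS : P.-integrable setT (EFin \o (fun w => quadform a b J w ^+ m.*2.+1)).
exact: (integrableXn (leqnSn _) mST (IH uJ)).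
have mSn : mfunT ((fun w => quadform a b J w ^+ m.*2.+1) : pastT X J -> R) by apply: measurable_funX.
have iSf1 := integrableXM mST mf1T (IH uJ) hf1.
have iSf2 := integrableXM mST mf2T (IH uJ) hf2.
have mSf1 : mfunT ((fun w => quadform a b J w ^+ m.*2.+1 * f1 w) : pastT X J -> R) by apply: measurable_funM.
have mSf2 : mfunT ((fun w => quadform a b J w ^+ m.*2.+1 * f2 w) : pastT X J -> R) by apply: measurable_funM.
have mr1 : mfunT ((fun w => rho s w - 1) : pastT X [:: s] -> R).
by apply: measurable_funB => //; apply: measurable_funD; apply: measurable_funX.
have [ir1 er1] := rho_mean1 s.
have [j1 e1] := past_mul0 sJ iS ir1 mSn mr1 er1.
have [j2 e2] := past_mul0 sJ iSf1 (iX1 s) mSf1 ms1 (X1_0 s).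
have [j3 e3] := past_mul0 sJ iSf2 (iX2 s) mSf2 ms2 (X2_0 s).
rewrite (eq_integral (fun w => ((a s s)%:E * (quadform a b J w ^+ m.*2.+1 * (rho s w - 1))%:E
 + 2%:E * (quadform a b J w ^+ m.*2.+1 * f1 w * (X s w).1)%:E) +
 2%:E * (quadform a b J w ^+ m.*2.+1 * f2 w * (X s w).2)%:E)%E); last first.
by move=> w _; rewrite -!EFinM -!EFinD; congr (_%:E); rewrite /D; ring.
have k1 := integrableZl measurableT (a s s) j1.
have k2 := integrableZl measurableT 2 j2.
have k3 := integrableZl measurableT 2 j3.
rewrite integralD //; last exact: integrableD.
rewrite integralD // !integralZl //.
by rewrite e1 e2 e3 !mule0 !adde0.
rewrite (eq_integral (fun w => ((quadform a b J w + D w) ^+ n)%:E)); last first.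
by move=> w _; rewrite quad_step.
have S0 : 0 <= quadK * \sum_(s <- J) \sum_(t <- J) (a s t ^+ 2 + b s t ^+ 2).
rewrite mulr_ge0 //.
by nneg.
rewrite sumr_ge0 // => i _; rewrite sumr_ge0 // => j _.
by nneg.
apply: (le_trans (moment_step S0 Q0 mST mD (IH uJ) hD h0)).
have -> : quadK * \sum_(s <- J) \sum_(t <- J) (a s t ^+ 2 + b s t ^+ 2) +
 4 * taylorK m * (6 ^+ n * (2 * B) * (2 * linK) * (u + r)) =
 quadK * (\sum_(s <- J) \sum_(t <- J) (a s t ^+ 2 + b s t ^+ 2) + (u + r)).
by rewrite /quadK; ring.
have QK0 : 0 <= quadK.
by nneg.
have sum0 (f : I -> R) : 0 <= \sum_(i <- J) (f i ^+ 2 + b i s ^+ 2).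
by nneg.
have SS0 : 0 <= \sum_(s <- J) \sum_(t <- J) (a s t ^+ 2 + b s t ^+ 2).
rewrite sumr_ge0 // => i _; rewrite sumr_ge0 // => j _.
by nneg.
have le : \sum_(s <- J) \sum_(t <- J) (a s t ^+ 2 + b s t ^+ 2) + (u + r) <=
 \sum_(x <- s :: J) \sum_(t <- s :: J) (a x t ^+ 2 + b x t ^+ 2).
have -> : \sum_(x <- s :: J) \sum_(t <- s :: J) (a x t ^+ 2 + b x t ^+ 2) =
 a s s ^+ 2 + b s s ^+ 2 + r + (\sum_(i <- J) (a i s ^+ 2 + b i s ^+ 2) +
 \sum_(x <- J) \sum_(t <- J) (a x t ^+ 2 + b x t ^+ 2)).
by rewrite !big_cons -big_split /=; congr (_ + _); apply: eq_bigr => i _; rewrite big_cons.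
move: (sum0 (fun i => a i s)) (sqr_ge0 (b s s)); rewrite -/u.
move: (\sum_(i <- J) (a i s ^+ 2 + b i s ^+ 2))
 (\sum_(x <- J) \sum_(t <- J) (a x t ^+ 2 + b x t ^+ 2)) => x y; lra.
rewrite lee_fin lerXn2r ?nnegrE //.
- by nneg.
- by nneg.
- exact: ler_wpM2l.
Qed.
Lemma quadform_mean a b (J : seq I) : uniq J ->
 (forall s t, a s t = a t s) -> (forall s t, b s t = - b t s) ->
 P.-integrable setT (fun w => (quadform a b J w)%:E) /\ (\int[P]_w (quadform a b J w)%:E = 0)%E.
move=> uJ sa sb; elim: J uJ => [_|s J IH /= /andP[sJ uJ]].
rewrite (_ : (fun w => _) = cst 0%E); last first.
by apply/funext => w; rewrite /quadform !big_nil subrr.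
by split; [exact: integrable0|exact: integral0].
have [iJ eJ] := IH uJ.
have [ir1 er1] := rho_mean1 s.
have lin a' b' : P.-integrable setT (EFin \o linform X a' b' J) /\ mfunT (linform X a' b' J : pastT X J -> R).
have ml : mfunT (linform X a' b' J : pastT X J -> R).
exact: past_linform.
split=> //.
exact: (integrableXn (k := 1) isT (past_mfunT ml) (linform_moment a' b' uJ)).
have [l1 ml1] := lin (a s) (b s); have [l2 ml2] := lin (b s) (fun t => - a s t).
have [j2 e2] := past_mul0 sJ l1 (iX1 s) ml1 (past_fst (mem_head s [::])) (X1_0 s).
have [j3 e3] := past_mul0 sJ l2 (iX2 s) ml2 (past_snd (mem_head s [::])) (X2_0 s).
have k1 := integrableZl measurableT (a s s) ir1.
have k2 := integrableZl measurableT 2 j2.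
have k3 := integrableZl measurableT 2 j3.
have k12 := integrableD measurableT k1 k2.
have k := integrableD measurableT k12 k3.
have kk := integrableD measurableT iJ k.
have E w : (quadform a b (s :: J) w)%:E = ((quadform a b J w)%:E +
 ((a s s)%:E * (rho s w - 1)%:E + 2%:E * (linform X (a s) (b s) J w * (X s w).1)%:E +
 2%:E * (linform X (b s) (fun t => - a s t) J w * (X s w).2)%:E))%E.
rewrite quad_step // -!EFinM -!EFinD; congr (_%:E).
by rewrite [(X s w).1 * _]mulrC [(X s w).2 * _]mulrC.
split; first by rewrite (funext E); exact: kk.
rewrite (eq_integral _ _ (fun w _ => E w)).
rewrite integralD // eJ add0e integralD // integralD // !integralZl //.
by rewrite er1 e2 e3 !mule0 !adde0.
Qed.
End Forms.

(** * Quadratic forms whose coefficients depend on the past *)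

Section AdaptedForms.
Context d (T : measurableType d) (R : realType) (P : probability T R).
Variables (I : finType) (X : I -> {RV P >-> (R * R)%type}) (m : nat) (B : R) (stdX : std_array X m B).
Let indX := sa_indep stdX.
Let n := m.*2.+2.
Let K := quadK m B.
Let indep (J K' : seq I) A C : {in J, forall s, s \notin K'} ->
 <<s past X K' >> A -> <<s past X J >> C -> P (A `&` C) = (P A * P C)%E.
move=> JK; apply: cylinder_indep => // j; rewrite !inE => jK.
by apply/negP => /JK; rewrite jK.
Qed.
Lemma meas_quadform2 (J K' : seq I) (a b : T -> I -> I -> R) : (forall s t, mfunT
 ((fun w => a w s t) : pastT X K' -> R)) -> (forall s t, mfunT ((fun w => b w s t) : pastT X K' -> R)) ->
 mfunT (fun z : pastT X K' * pastT X J => quadform X (a z.1) (b z.1) J z.2).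
move=> ma mb; rewrite /quadform; apply: measurable_funB; last first.
by apply: measurable_sum => s /=; apply: (measurableT_comp (ma s s) measurable_fst).
apply: (@measurable_quad_sum _ (pastT X K' * pastT X J)%type R I J (fun s t z => a z.1 s t)
 (fun s t z => b z.1 s t) (fun s z => (X s z.2).1) (fun s z => (X s z.2).2)) => s.
- by move=> t; exact: (measurableT_comp (ma s t) measurable_fst).
- by move=> t; exact: (measurableT_comp (mb s t) measurable_fst).
- by move=> sJ; exact: (measurableT_comp (past_fst sJ) measurable_snd).
- by move=> sJ; exact: (measurableT_comp (past_snd sJ) measurable_snd).
Qed.

Section OneBlock.
Variables (J K' : seq I) (a b : T -> I -> I -> R) (tau : R) (uJ : uniq J) (JK : {in J, forall s, s \notin K'})
 (ma : forall s t, mfunT ((fun w => a w s t) : pastT X K' -> R)) (mb : forall s t, mfunT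
 ((fun w => b w s t) : pastT X K' -> R)) (sa : forall w s t, a w s t = a w t s)
 (sb : forall w s t, b w s t = - b w t s) (hab : forall w,
 \sum_(s <- J) \sum_(t <- J) (a w s t ^+ 2 + b w s t ^+ 2) <= tau).
Definition adform w := quadform X (a w) (b w) J w.
Lemma measurable_adform (L : seq I) : {subset J <= L} -> {subset K' <= L} -> mfunT (adform : pastT X L -> R).
move=> JL KL.
have sub (M : seq I) : {subset M <= L} -> mfunT (id : pastT X L -> pastT X M).
move=> ML _ A mA; rewrite setTI; move: A mA.
apply: smallest_sub; first exact: smallest_sigma_algebra.
apply: subset_trans; last exact: sub_sigma_algebra.
by apply: (@cylinder_sub _ _ _ _ _ P _ X); apply/fintype.subsetP => s; rewrite !inE; exact: ML.
have h := meas_quadform2 (J := J) ma mb.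
exact: (measurableT_comp h (measurable_fun_pair (sub _ KL) (sub _ JL))).
Qed.
Lemma meas_adformT : mfunT adform.
apply: (@past_mfunT _ _ _ _ _ X (J ++ K')).
by apply: measurable_adform => s sJ; rewrite mem_cat sJ ?orbT.
Qed.
(** For frozen coefficients this is [quadform_moment]. The bound [tau] on their squares holds for
    every outcome, so it survives integration over the past. *)
Lemma adform_moment : (\int[P]_w (adform w ^+ n)%:E <= ((K * tau) ^+ m.+1)%:E)%E.
have h := meas_quadform2 (J := J) ma mb.
have K0 : 0 <= K := quadK_ge0 stdX.
have sum0 w : 0 <= \sum_(s <- J) \sum_(t <- J) (a w s t ^+ 2 + b w s t ^+ 2).
by nneg.
apply: (@ge0_decoupling_le _ _ _ P (past X K') (past X J) (@past_meas _ _ _ _ _ X K')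
 (@past_meas _ _ _ _ _ X J) _ (fun z => (quadform X (a z.1) (b z.1) J z.2 ^+ n)%:E)).
- by move=> A C; apply: indep.
- by apply/measurable_EFinP; apply: measurable_funX.
- by move=> z; rewrite lee_fin (exprD_ge0 m.+1).
move=> w /=.
apply: le_trans (quadform_moment stdX uJ (sa w) (sb w)) _.
rewrite lee_fin lerXn2r ?nnegrE; [|exact: mulr_ge0|exact: mulr_ge0 (le_trans (sum0 w) (hab w))|].
by [].
exact: ler_wpM2l.
Qed.
Lemma adform_mul_eq0 (S : T -> R) (A : R) : mfunT (S : pastT X K' -> R) ->
 (\int[P]_w (S w ^+ n)%:E <= A%:E)%E -> (\int[P]_w (S w ^+ m.*2.+1 * adform w)%:E = 0)%E.
move=> mS hS.
have h := meas_quadform2 (J := J) ma mb.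
apply: (@decoupling_eq0 _ _ _ P (past X K') (past X J) (@past_meas _ _ _ _ _ X K')
 (@past_meas _ _ _ _ _ X J) _ (fun z => S z.1 ^+ m.*2.+1 * quadform X (a z.1) (b z.1) J z.2)).
- by move=> A' C; apply: indep.
- apply: measurable_funM => //; apply: measurable_funX.
exact: (measurableT_comp mS measurable_fst).
- apply: (integrableXM (past_mfunT mS) meas_adformT hS).
exact: adform_moment.
- move=> w; have [i e] := quadform_mean stdX uJ (sa w) (sb w).
exact: (integrableZl measurableT (S w ^+ m.*2.+1) i).
- move=> w /=; under eq_integral do rewrite EFinM.
have [i e] := quadform_mean stdX uJ (sa w) (sb w).
by rewrite integralZl // e mule0.
Qed.
End OneBlock.

Section AdaptedSums.
Variables (J K' : nat -> seq I) (a b : nat -> T -> I -> I -> R) (tau : R) (uJ : forall i, uniq (J i))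
 (JK : forall i, {in J i, forall s, s \notin K' i}) (JS : forall i, {subset J i <= K' i.+1})
 (KS : forall i, {subset K' i <= K' i.+1}) (ma : forall i s t, mfunT
 ((fun w => a i w s t) : pastT X (K' i) -> R)) (mb : forall i s t, mfunT
 ((fun w => b i w s t) : pastT X (K' i) -> R)) (sa : forall i w s t, a i w s t = a i w t s)
 (sb : forall i w s t, b i w s t = - b i w t s) (hab : forall i w,
 \sum_(s <- J i) \sum_(t <- J i) (a i w s t ^+ 2 + b i w s t ^+ 2) <= tau).
(** A martingale: at step [i] the block of entries [J i] is revealed, while the coefficients depend
    only on the entries in [K' i], which contains the earlier blocks. *)
Definition adsum N w := \sum_(i < N) adform (J i) (a i) (b i) w.
Lemma measurable_adsum N : mfunT (adsum N : pastT X (K' N) -> R).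
rewrite /adsum; apply: measurable_sum => i /=.
have KK j : {subset K' j <= K' (j + (N - j))%N}.
 elim: (N - j)%N => [|l IH] s sK; first by rewrite addn0.
by rewrite addnS; apply: KS; apply: IH.
apply: measurable_adform => // s sJ.
by have := KK i.+1; rewrite subnKC //; apply; exact: JS.
by have := KK i; rewrite subnKC //; [apply|exact: ltnW].
Qed.
Lemma adsum_moment N : (\int[P]_w (adsum N w ^+ n)%:E <= ((N%:R * (4 * taylorK m * (K * tau))) ^+ m.+1)%:E)%E.
have tau0 : 0 <= tau.
apply: le_trans (hab 0%N point); rewrite sumr_ge0 // => s _.
by rewrite sumr_ge0 // => t _; rewrite addr_ge0 // sqr_ge0.
have Kt0 : 0 <= K * tau by rewrite mulr_ge0 // (quadK_ge0 stdX).
have c0 : 0 <= 4 * taylorK m * (K * tau).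
by rewrite mulr_ge0 // mulr_ge0 // (le_trans ler01) // taylorK_ge1.
elim: N => [|N IH].
rewrite (eq_integral (cst 0%E)) ?integral0 ?lee_fin ?mul0r ?expr0n //.
by move=> w _; rewrite /adsum big_ord0 expr0n.
have hD := adform_moment (@uJ N) (@JK N) (@ma N) (@mb N) (@sa N) (@sb N) (@hab N).
have h0 := adform_mul_eq0 (@uJ N) (@JK N) (@ma N) (@mb N) (@sa N) (@sb N) (@hab N) (@measurable_adsum N) IH.
rewrite (eq_integral (fun w => ((adsum N w + adform (J N) (a N) (b N) w) ^+ n)%:E)); last first.
by move=> w _; rewrite /adsum big_ord_recr.
have mD := @meas_adformT (J N) _ _ _ (@ma N) (@mb N).
have S0 : 0 <= N%:R * (4 * taylorK m * (K * tau)) by rewrite mulr_ge0.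
have := moment_step S0 Kt0 (past_mfunT (@measurable_adsum N)) mD IH hD h0.
set c := 4 * taylorK m * (K * tau).
have -> : N.+1%:R * c = N%:R * c + c by rewrite -natr1 mulrDl mul1r.
by [].
Qed.
End AdaptedSums.
End AdaptedForms.

(** * From summable integrals to almost sure convergence *)

Section AlmostSureConvergence.
Context d (T : measurableType d) (R : realType) (P : probability T R).
Lemma nneseries_invsq_le (C : R) (u : (\bar R)^nat) : 0 <= C -> (forall n, (0 <= u n)%E) ->
 (forall n, (u n <= (C / n.+1%:R ^+ 2)%:E)%E) -> (\sum_(0 <= n <oo) u n <= (2 * C)%:E)%E.
move=> C0 u0 uC.
apply: lime_le; first exact: is_cvg_nneseries.
apply: nearW => N.
(* A telescoping majorant of the inverse squares. *)
have h k : C / k.+1%:R ^+ 2 <= 2 * C * (k.+1%:R^-1 - k.+2%:R^-1).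
have -> : k.+1%:R^-1 - k.+2%:R^-1 = (k.+1%:R * k.+2%:R)^-1 :> R.
have e : k.+2%:R = k.+1%:R + 1 :> R by rewrite -natr1.
rewrite e; have : 0 < k.+1%:R :> R by [].
by move: (k.+1%:R) => x x0; field; rewrite !gt_eqF // addr_gt0.
rewrite [2 * C]mulrC -mulrA; apply: ler_wpM2l => //.
rewrite expr2 !invfM mulrCA; apply: ler_wpM2l; first by [].
rewrite -ler_pdivrMr ?invr_gt0 // invrK.
by rewrite ler_pdivrMl // -natrM ler_nat; lia.
apply: (letr (\sum_(0 <= k < N) (2 * C * (k.+1%:R^-1 - k.+2%:R^-1))%:E)%E).
by apply: lee_sum => k _; apply: (le_trans (uC k)); rewrite lee_fin.
rewrite sumEFin lee_fin -mulr_sumr.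
have -> : \sum_(0 <= k < N) (k.+1%:R^-1 - k.+2%:R^-1) = 1 - N.+1%:R^-1 :> R.
 elim: N => [|N IH]; first by rewrite big_geq // invr1 subrr.
by rewrite big_nat_recr //= IH addrA subrK.
by rewrite ler_piMr ?mulr_ge0 // gerBl invr_ge0.
Qed.
(** The series of the [V n], taken beyond the rank where the bounds start, has a finite integral. It
    is thus finite almost everywhere, its tails tend to 0, and each term is at most the tail that
    starts with it. *)
Lemma ae_cvg0_integrals (C : R) (V : nat -> T -> R) : (forall n, mfunT (V n)) -> (forall n w, 0 <= V n w) ->
 (\forall n \near \oo, (\int[P]_w (V n w)%:E <= (C / n%:R ^+ 2)%:E)%E) ->
 {ae P, forall w, V n w @[n \oo] --> (0 : R)}.
move=> mV V0 [N _ hN].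
pose Z k w : \bar R := (V (k + N.+1)%N w)%:E.
have mZ k : mfunT (Z k) by meas.
have Z0 k w : (0 <= Z k w)%E by rewrite lee_fin.
have C0 : 0 <= `|C| by [].
have hZ : (\sum_(0 <= k <oo) (\int[P]_w Z k w) <= (2 * `|C|)%:E)%E.
apply: nneseries_invsq_le => // [k|k]; first exact: integral_ge0.
have kN : (N <= k + N.+1)%N by lia.
apply: (le_trans (hN _ kN)); rewrite lee_fin.
apply: (letr (`|C| / (k + N.+1)%:R ^+ 2)).
by apply: ler_wpM2r; [rewrite invr_ge0 sqr_ge0|exact: ler_norm].
apply: ler_wpM2l => //; rewrite lef_pV2 ?posrE ?exprn_gt0 ?ltr0n //; last lia.
by rewrite lerXn2r ?nnegrE // ler_nat; lia.
have iZ : P.-integrable setT (fun w => \sum_(0 <= k <oo) Z k w)%E.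
apply/integrableP; split; first exact: ge0_emeasurable_sum.
under eq_integral do rewrite gee0_abs ?nneseries_ge0 //.
by rewrite integral_nneseries // (le_lt_trans hZ) ?ltry.
apply: filterS (integrable_ae measurableT iZ) => w /(_ Logic.I) fw.
have {}fw : (\sum_(0 <= k <oo) Z k w < +oo)%E by rewrite ltey_eq fw.
have := nneseries_tail_cvg fw (fun k _ => Z0 k w).
move=> /fine_cvgP[hf /cvgrPdist_lt ht].
rewrite -(cvg_shiftn N.+1); apply/cvgrPdist_lt => e e0.
near=> k.
rewrite sub0r normrN ger0_norm; last exact: V0.
have : `|0 - fine (\sum_(k <= i <oo) Z i w)%E| < e by near: k; exact: ht.
rewrite sub0r normrN; apply: le_lt_trans.
have tw : (\sum_(k <= i <oo) Z i w)%E \is a fin_num by near: k; exact: hf.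
rewrite ger0_norm; last by apply: fine_ge0; exact: nneseries_ge0.
rewrite -lee_fin fineK //.
apply: le_trans (@nneseries_lim_ge _ _ xpredT k k.+1 _); last by [].
by rewrite big_nat1.
Unshelve. all: end_near. Qed.
End AlmostSureConvergence.
(** Writing the inverse as x times a real power of x^2 treats both signs at once, and 0 as well
    because 0^-1 = 0. *)
Lemma measurable_inv (R : realType) : mfunT (fun x : R => x^-1).
rewrite (_ : (fun x : R => x^-1) = (fun x => x * ((x ^+ 2) `^ (-1)))); last first.
apply/funext => x; rewrite powR_inv1 ?sqr_ge0 //.
have [->|x0] := eqVneq x 0; first by rewrite invr0 mul0r.
by rewrite expr2 invfM mulrA mulfV // mul1r.
apply: measurable_funM => //.
apply: (measurableT_comp (measurable_powR _ )).
by meas.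
Qed.
Lemma measurable_funV d (T : measurableType d) (R : realType) (f : T -> R) :
 mfunT f -> mfunT (fun w => (f w)^-1).
by move=> mf; apply: (measurableT_comp (@measurable_inv R)). Qed.

(** * The log-Sobolev inequality gives moments of all orders *)

Section LogSobolevMoments.
Context (R : realType).
Implicit Types (x : R * R) (e s t c : R).
Let rho x := x.1 ^+ 2 + x.2 ^+ 2.
(** A smooth truncation of s^(a+1), bounded by 1/e and increasing to it as [e] decreases to 0. The
    log-Sobolev inequality applies to square-integrable functions only, and integrability of the
    power is what is sought. *)
Definition satur (a : nat) e s : R := s ^+ a.+1 / (1 + e * s ^+ a.+1).
Let sat_den a e s : 0 < e -> 0 <= s -> 0 < 1 + e * s ^+ a.+1.
by move=> e0 s0; rewrite ltr_wpDr // mulr_ge0 ?exprn_ge0 // ltW.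
Qed.
Lemma is_derive_satur a e c t : 0 < e -> 0 <= c -> is_derive t 1 (fun t => satur a e (t ^+ 2 + c))
 (a.+1%:R * (t ^+ 2 + c) ^+ a / (1 + e * (t ^+ 2 + c) ^+ a.+1) ^+ 2 * (2 * t)).
move=> e0 c0; set s := t ^+ 2 + c.
have s0 : 0 <= s by nneg.
have den := sat_den a e0 s0.
have dq : is_derive t 1 (fun t : R => t ^+ 2 + c) (2 * t).
have h := @is_deriveD _ _ _ _ _ _ _ _ _
 (@is_deriveM _ _ _ _ _ _ _ _ (@is_derive_id R _ t 1) (@is_derive_id R _ t 1)) (@is_derive_cst R _ _ c t 1).
by apply: (is_derive_eq h); rewrite /GRing.scale /=; ring.
have du : is_derive t 1 (fun t : R => (t ^+ 2 + c) ^+ a.+1) (a.+1%:R * s ^+ a * (2 * t)).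
 elim: a {den} => [|k IH].
by apply: (is_derive_eq dq); rewrite expr0 !mul1r.
have h := is_deriveM dq IH.
apply: (is_derive_eq h); rewrite /GRing.scale /= -/s.
by rewrite [s ^+ k.+1]exprS -[k.+2%:R]natr1; ring.
have dd : is_derive t 1 (fun t : R => 1 + e * (t ^+ 2 + c) ^+ a.+1) (e * (a.+1%:R * s ^+ a * (2 * t))).
pose one : R := 1.
have h := @is_deriveD _ _ _ _ _ _ _ _ _ (@is_derive_cst R _ _ one t 1)
 (@is_deriveM _ _ _ _ _ _ _ _ (@is_derive_cst R _ _ e t 1) du).
by apply: (is_derive_eq h); rewrite /GRing.scale /=; ring.
have dv := @is_deriveV R (fun t : R => 1 + e * (t ^+ 2 + c) ^+ a.+1) t _ 1 (lt0r_neq0 den) dd.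
have := is_deriveM du dv.
rewrite /satur => h; apply: (is_derive_eq h).
rewrite /GRing.scale /= -/s.
have dn : 1 + e * s ^+ a.+1 != 0 by rewrite gt_eqF.
rewrite [s ^+ a.+1]exprS in dn *.
by move: (s ^+ a) dn => z dn; field.
Qed.
Lemma derive_satur_sq a e x : 0 < e -> ('D_((1, 0) : R * R) (fun x => satur a e (rho x)) x) ^+ 2 +
 ('D_((0, 1) : R * R) (fun x => satur a e (rho x)) x) ^+ 2 =
 4 * rho x * (a.+1%:R * rho x ^+ a / (1 + e * rho x ^+ a.+1) ^+ 2) ^+ 2.
move=> e0.
have -> : 'D_((1, 0) : R * R) (fun x => satur a e (rho x)) x =
 'D_1 (fun t : R => satur a e (t ^+ 2 + x.2 ^+ 2)) x.1.
apply: (congr1 (fun F : R -> R => lim (F @ 0^'))); apply/funext => h.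
by rewrite /rho /shift /= scaler0 add0r.
have -> : 'D_((0, 1) : R * R) (fun x => satur a e (rho x)) x =
 'D_1 (fun t : R => satur a e (t ^+ 2 + x.1 ^+ 2)) x.2.
apply: (congr1 (fun F : R -> R => lim (F @ 0^'))); apply/funext => h.
rewrite /rho /shift /= scaler0 add0r.
by rewrite ![x.1 ^+ 2 + _]addrC.
rewrite !(@derive_val _ _ _ _ _ _ _ (is_derive_satur _ _ e0 (sqr_ge0 _))).
rewrite [x.2 ^+ 2 + _]addrC -/(rho x).
move: (a.+1%:R * _ / _) => z; rewrite /rho; ring.
Qed.
Lemma differentiable_satur a e x : 0 < e -> differentiable (fun x => satur a e (rho x)) x.
move=> e0.
have d1 : differentiable (fun y : R * R => y.1) x.
by apply: linear_differentiable => y; exact: cvg_fst.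
have d2 : differentiable (fun y : R * R => y.2) x.
by apply: linear_differentiable => y; exact: cvg_snd.
have dr : differentiable rho x.
by apply: differentiableD; apply: (@differentiableX _ _ _ 1).
have dra k : differentiable (fun y => rho y ^+ k) x.
 elim: k => [|k IH]; first exact: differentiable_cst.
rewrite (_ : (fun y => _) = (fun y => rho y * rho y ^+ k)).
exact: differentiableM.
by apply/funext => y; rewrite exprS.
have rho0 : 0 <= rho x by nneg.
apply: (@differentiableM _ _ _ _ _ (dra a.+1)).
apply: (@differentiableV _ _ (fun y => 1 + e * rho y ^+ a.+1)).
have dc (c : R) : differentiable (fun y : R * R => c) x.
by [].
exact: (differentiableD (dc 1) (differentiableM (dc e) (dra a.+1))).
by rewrite gt_eqF // sat_den.
Qed.
(** The left side is 2 h - 2 sqrt h, so this is ln (1/y) <= 1/y - 1 at y = sqrt h. The part h - 1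
    integrates to 0 for a density [h], and the square measures how far [h] is from 1. *)
Lemma entropy_ge (h : R) : 0 <= h -> h - 1 + (1 - Num.sqrt h) ^+ 2 <= h * ln h.
rewrite le_eqVlt => /orP[/eqP <-|h0].
by rewrite sqrtr0 mul0r; lra.
have y0 : 0 < Num.sqrt h by rewrite sqrtr_gt0.
have hE : h = Num.sqrt h ^+ 2 by rewrite sqr_sqrtr // ltW.
move: (Num.sqrt h) y0 hE => y y0 ->.
rewrite lnXn // -mulr_natl.
have : ln y^-1 <= y^-1 - 1.
have := @le_ln1Dx R (y^-1 - 1); rewrite [1 + _]addrC subrK; apply.
by rewrite ltrBrDr addNr invr_gt0.
rewrite lnV ?posrE // => l.
have : - (2 * y ^+ 2 * ln y) <= 2 * y ^+ 2 * (y^-1 - 1).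
by rewrite -mulrN; apply: ler_wpM2l => //; rewrite mulr_ge0 // sqr_ge0.
have -> : 2 * y ^+ 2 * (y^-1 - 1) = 2 * y - 2 * y ^+ 2 by field; rewrite gt_eqF.
have -> : y ^+ 2 * (2 * ln y) = 2 * y ^+ 2 * ln y by ring.
move: (2 * y ^+ 2 * ln y) => z; rewrite !expr2; lra.
Qed.
Lemma expr_young a k s : 0 < k -> 0 <= s -> s ^+ a.*2.+1 <= k * s ^+ a.*2.+2 + k^-1 ^+ a.*2.+1.
move=> k0 s0; have [ks|/ltW ks] := lerP s k^-1.
apply: (letr (k^-1 ^+ a.*2.+1)).
by rewrite lerXn2r ?nnegrE ?invr_ge0 // ltW.
by rewrite lerDr mulr_ge0 ?exprn_ge0 // ltW.
apply: (letr (k * s ^+ a.*2.+2)).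
rewrite [s ^+ a.*2.+2]exprS mulrA ler_peMl ?exprn_ge0 //.
by rewrite -ler_pdivrMl // mulr1.
by rewrite lerDl exprn_ge0 // invr_ge0 ltW.
Qed.
Let rho0 x : 0 <= rho x. by nneg. Qed.
Let mrho : mfunT rho.
by apply: measurable_funD; apply: measurable_funX; [exact: measurable_fst | exact: measurable_snd].
Qed.
Lemma meas_satur a e : mfunT (fun x => satur a e (rho x)).
apply: measurable_funM; first exact: measurable_funX.
apply: measurable_funV; apply: measurable_funD => //.
by apply: measurable_funM => //; exact: measurable_funX.
Qed.
Let satur_ge0 a e x : 0 < e -> 0 <= satur a e (rho x).
by move=> e0; rewrite divr_ge0 ?exprn_ge0 // ltW // sat_den. Qed.
Let satur_le a e x : 0 < e -> satur a e (rho x) <= rho x ^+ a.+1.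
move=> e0; rewrite ler_pdivrMr ?sat_den //.
rewrite -[leLHS]mulr1; apply: ler_wpM2l; first by nneg.
by rewrite lerDl mulr_ge0 ?exprn_ge0 // ltW.
Qed.
Let satur_le_inv a e x : 0 < e -> satur a e (rho x) <= e^-1.
move=> e0; rewrite ler_pdivrMr ?sat_den // mulrDr mulr1 mulKf ?gt_eqF //.
by rewrite lerDr invr_ge0 ltW.
Qed.
Let satur_anti a e1 e2 x : 0 < e1 -> e1 <= e2 -> satur a e2 (rho x) <= satur a e1 (rho x).
move=> e10 e12; apply: ler_wpM2l; first by nneg.
rewrite lef_pV2 ?posrE ?sat_den //; last exact: lt_le_trans e12.
by rewrite lerD2l ler_wpM2r ?exprn_ge0.
Qed.
Context (mu : probability (R * R)%type R) (a : nat).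
Hypotheses (lsi : log_sobolev mu) (mu_sq : (\int[mu]_x (rho x)%:E = 1)%E).
Let f e x := satur a e (rho x).
Let integrable_bd (g : R * R -> R) (K : R) : mfunT g ->
 (forall x, `|g x| <= K) -> mu.-integrable setT (EFin \o g).
move=> mg gK; apply: (@le_integrable _ _ _ _ _ _ _ (cst K%:E)) => //.
- exact/measurable_EFinP.
- by move=> x _ /=; rewrite lee_fin; exact: le_trans (gK x) (ler_norm _).
- apply/integrableP; split => //.
by rewrite /= integral_cst //= -ge0_fin_numE ?mule_ge0 // fin_numM // fin_num_measure.
Qed.
Let integral_cst1 (r : R) : (\int[mu]_x cst r%:E x = r%:E)%E.
by rewrite integral_cst // -[RHS]mule1; congr (_ * _)%E; exact: probability_setT.
Qed.
Let integrable_f2 e : 0 < e -> mu.-integrable setT (fun x => (f e x ^+ 2)%:E).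
move=> e0; apply: (@integrable_bd _ (e^-1 ^+ 2)).
by apply: measurable_funX; exact: meas_satur.
move=> x; rewrite ger0_norm ?sqr_ge0 //.
by rewrite lerXn2r ?nnegrE ?satur_ge0 ?invr_ge0 ?satur_le_inv // ltW.
Qed.
Let integrable_rho : mu.-integrable setT (fun x => (rho x)%:E).
apply/integrableP; split; first exact/measurable_EFinP.
under eq_integral do rewrite /= ger0_norm //.
by rewrite mu_sq ltry.
Qed.

(* On [rho <= 4], a set of mass at least 3/4, the density h is at most 1/16
 as soon as M is large, which keeps the entropy away from 0. *)
Let entropy_pointwise (M y s : R) : 0 < M -> 0 <= s ->
 0 <= y -> y <= s ^+ a.+1 -> 16 * (4 ^+ a.+1) ^+ 2 <= M ->
 y ^+ 2 - M + M * (9 / 16 * (1 - s / 4)) <= y ^+ 2 * ln (y ^+ 2 / M).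
move=> M0 s0 y0 ys ML.
have h0 : 0 <= y ^+ 2 / M by nneg.
have e := entropy_ge h0.
have e' : M * (y ^+ 2 / M - 1 + (1 - Num.sqrt (y ^+ 2 / M)) ^+ 2) <=
 M * (y ^+ 2 / M * ln (y ^+ 2 / M)) by rewrite ler_pM2l.
have M' : M != 0 by rewrite gt_eqF.
have E : M * (y ^+ 2 / M * ln (y ^+ 2 / M)) = y ^+ 2 * ln (y ^+ 2 / M).
by move: (ln _) => l; field.
rewrite E in e'; apply: le_trans e'.
set u := (1 - Num.sqrt _) ^+ 2.
have -> : M * (y ^+ 2 / M - 1 + u) = y ^+ 2 - M + M * u by field.
rewrite lerD2l ler_pM2l // /u.
have [s4|s4] := lerP s 4; last first.
apply: le_trans (sqr_ge0 _); apply: mulr_ge0_le0 => //; lra.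
have sq : Num.sqrt (y ^+ 2 / M) <= 1 / 4.
have -> : (1 / 4 : R) = Num.sqrt ((1 / 4) ^+ 2) by rewrite sqrtr_sqr ger0_norm.
rewrite ler_wsqrtr // ler_pdivrMr //.
have : y ^+ 2 <= (4 ^+ a.+1) ^+ 2.
rewrite lerXn2r ?nnegrE ?exprn_ge0 //.
by apply: (le_trans ys); rewrite lerXn2r ?nnegrE.
move: ML; move: ((4 ^+ a.+1) ^+ 2) => z; move: (y ^+ 2) => y2; lra.
have sq0 := sqrtr_ge0 (y ^+ 2 / M).
move: (Num.sqrt _) sq sq0 => q; nra.
Qed.
(** The squared gradient has degree one less in rho than the squared power, so Young's inequality
    makes it a small multiple of f^2 plus a constant. The truncation only helps, its denominator
    being at least 1. *)
Let gradient_le (k e : R) x : 0 < k -> 0 < e ->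
 ('D_((1, 0) : R * R) (f e) x) ^+ 2 + ('D_((0, 1) : R * R) (f e) x) ^+ 2 <=
 4 * a.+1%:R ^+ 2 * (k * f e x ^+ 2 + k^-1 ^+ a.*2.+1).
move=> k0 e0; rewrite derive_satur_sq //.
have den := @sat_den a e (rho x) e0 (rho0 x).
have yo := expr_young a k0 (rho0 x).
rewrite /f /satur; set D := 1 + _ in den *.
have -> : 4 * rho x * (a.+1%:R * rho x ^+ a / D ^+ 2) ^+ 2 = 4 * a.+1%:R ^+ 2 * (rho x ^+ a.*2.+1 / D ^+ 4).
rewrite [rho x ^+ a.*2.+1]exprS -muln2 exprM; move: (rho x ^+ a) => z; field.
by rewrite gt_eqF.
apply: ler_wpM2l; first by [].
have D1 : 1 <= D by rewrite /D lerDl mulr_ge0 ?exprn_ge0 // ltW.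
have i4 : 0 <= D ^- 4 by nneg.
apply: (le_trans (ler_wpM2r i4 yo)).
have kk : 0 <= k^-1 ^+ a.*2.+1 by nneg.
rewrite [X in X <= _]mulrDl; apply: lerD; last first.
by rewrite ler_pdivrMr ?exprn_gt0 // ler_peMr // exprn_ege1.
rewrite -mulrA; apply: ler_wpM2l; first exact: ltW.
rewrite expr_div_n -exprM muln2 doubleS.
apply: ler_wpM2l; first by rewrite exprn_ge0.
by rewrite lef_pV2 ?posrE ?exprn_gt0 // ler_weXn2l.
Qed.
(** If M, the integral of f^2, is large, its entropy is at least 27 M / 64, whereas the gradient
    side is at most M / 8 + K1. Hence M <= 4 K1, uniformly in [e]. *)
Let truncated_moment : exists B : R, forall e, 0 < e -> (\int[mu]_x (f e x ^+ 2)%:E <= B%:E)%E.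
have [C hC] := lsi.
pose C' := Num.max C 0; have C'0 : 0 <= C' by rewrite le_max lexx orbT.
pose G := 2 * C' * (4 * a.+1%:R ^+ 2).
have G0 : 0 <= G by nneg.
(* The Young parameter for which the gradient side costs at most M / 8. *)
pose k := (8 * (G + 1))^-1.
have k0 : 0 < k by rewrite invr_gt0 mulr_gt0 // ltr_wpDl.
pose K1 := G * k^-1 ^+ a.*2.+1.
have K10 : 0 <= K1 by nneg.
have Gk : G * k <= 1 / 8.
rewrite /k ler_pdivrMr; last by rewrite mulr_gt0 // ltr_wpDl.
 lra.
(* Below the first term there is nothing to prove and above it [entropy_pointwise] applies. The
   comparison there gives M <= (64/19) K1, rounded up to 4 K1. *)
exists (16 * (4 ^+ a.+1) ^+ 2 + 4 * K1) => e e0.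
have i2 := integrable_f2 e0.
have fi := integrable_fin_num measurableT i2.
set I2 := (\int[mu]_x _)%E in fi *.
have I20 : (0 <= I2)%E by apply: integral_ge0 => x _; rewrite lee_fin sqr_ge0.
rewrite -(fineK fi) lee_fin.
have [ML|/ltW ML] := lerP (fine I2) (16 * (4 ^+ a.+1) ^+ 2).
by apply: (le_trans ML); rewrite lerDl mulr_ge0.
have M0 : 0 < fine I2.
by apply: lt_le_trans ML; rewrite mulr_gt0 // !exprn_gt0.
have H := hC (f e) (fun x => differentiable_satur a x e0) i2.
rewrite /= -/I2 in H.
set M := fine I2 in H M0 ML *.
have mf : mfunT (f e) by exact: meas_satur.
have iR : mu.-integrable setT (fun x => (4 * a.+1%:R ^+ 2 * (k * f e x ^+ 2 + k^-1 ^+ a.*2.+1))%:E).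
apply: (@integrable_bd _ (4 * a.+1%:R ^+ 2 * (k * e^-1 ^+ 2 + k^-1 ^+ a.*2.+1))).
apply: measurable_funM => //; apply: measurable_funD => //.
by apply: measurable_funM => //; exact: measurable_funX.
have kk : 0 <= k^-1 ^+ a.*2.+1 by nneg.
move=> x; rewrite ger0_norm; last first.
apply: mulr_ge0; first by [].
by nneg.
apply: ler_wpM2l; first by [].
rewrite lerD2r; apply: ler_wpM2l; first exact: ltW.
by rewrite lerXn2r ?nnegrE ?satur_ge0 ?invr_ge0 ?satur_le_inv // ltW.
have E0 x : 0 <= ('D_((1, 0) : R * R) (f e) x) ^+ 2 + ('D_((0, 1) : R * R) (f e) x) ^+ 2.
by rewrite addr_ge0 // sqr_ge0.
have up : ((2 * C)%:E * \int[mu]_x (('D_((1, 0) : R * R) (f e) x) ^+ 2 +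
 ('D_((0, 1) : R * R) (f e) x) ^+ 2)%:E <= (M / 8 + K1)%:E)%E.
apply: (letr ((2 * C')%:E * \int[mu]_x (4 * a.+1%:R ^+ 2 * (k * f e x ^+ 2 + k^-1 ^+ a.*2.+1))%:E)%E).
apply: (letr ((2 * C')%:E * \int[mu]_x (('D_((1, 0) : R * R) (f e) x) ^+ 2 +
 ('D_((0, 1) : R * R) (f e) x) ^+ 2)%:E)%E).
apply: lee_wpmul2r; first by apply: integral_ge0 => x _; rewrite lee_fin.
by rewrite lee_fin ler_pM2l // le_max lexx.
apply: lee_wpmul2l; first by nneg.
apply: ge0_le_integral => //.
 - by move=> x _; rewrite lee_fin.
 - apply/measurable_EFinP.
rewrite (_ : (fun x => _) = (fun x => 4 * rho x * (a.+1%:R * rho x ^+ a / (1 + e * rho x ^+ a.+1) ^+ 2) ^+ 2)); last first.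
by apply/funext => x; rewrite derive_satur_sq.
apply: measurable_funM; first exact: measurable_funM.
apply: measurable_funX; apply: measurable_funM.
by apply: measurable_funM => //; exact: measurable_funX.
apply: measurable_funV; apply: measurable_funX; apply: measurable_funD => //.
by apply: measurable_funM => //; exact: measurable_funX.
 - by case/integrableP: iR.
 - by move=> x _; rewrite lee_fin; exact: gradient_le.
rewrite (_ : (\int[mu]_x _)%E = (4 * a.+1%:R ^+ 2 * (k * M + k^-1 ^+ a.*2.+1))%:E); last first.
under eq_integral do rewrite EFinM EFinD EFinM.
have i3 : mu.-integrable setT (fun x => k%:E * (f e x ^+ 2)%:E)%E.
exact: (integrableZl measurableT k i2).
have i4 : mu.-integrable setT (cst (k^-1 ^+ a.*2.+1)%:E).
by apply: (@integrable_bd (cst (k^-1 ^+ a.*2.+1)) `|k^-1 ^+ a.*2.+1|).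
rewrite integralZl //; last exact: integrableD.
rewrite integralD //.
under eq_integral do rewrite EFinM.
by rewrite integralZl // integral_cst1 // -/I2 -(fineK fi) -/M.
rewrite -EFinM lee_fin /K1 /G.
move: Gk; rewrite /G; move: (4 * _) => u; move: (k^-1 ^+ _) => v.
have M0' := ltW M0.
by move=> /(ler_wpM2r M0'); move: (fine I2 : R) => M1; rewrite /=; lra.
(* Here 27/64 is 9/16 times the integral 3/4 of 1 - rho/4. *)
have lo : ((M * (27 / 64))%:E <= \int[mu]_x (f e x ^+ 2 * ln (f e x ^+ 2 / M))%:E)%E.
have i1 : mu.-integrable setT (cst 1%:E : R * R -> \bar R).
by apply: (@integrable_bd (cst 1) `|1|).
have i5 : mu.-integrable setT (fun x => (M * (9 / 16 * (1 - rho x / 4)) - M)%:E).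
have -> : (fun x => (M * (9 / 16 * (1 - rho x / 4)) - M)%:E) =
 (fun x => (- (M * 7 / 16))%:E * cst 1%:E x + (- (M * 9 / 64))%:E * (rho x)%:E)%E.
by apply/funext => x; rewrite -!EFinM -EFinD; congr (_%:E); lra.
by apply: integrableD => //; apply: integrableZl.
have -> : (M * (27 / 64))%:E = (\int[mu]_x (f e x ^+ 2 - M + M * (9 / 16 * (1 - rho x / 4)))%:E)%E.
transitivity (\int[mu]_x ((f e x ^+ 2)%:E + ((- (M * 7 / 16))%:E * cst 1%:E x + (- (M * 9 / 64))%:E * (rho x)%:E))%E)%E.
rewrite integralD //; last by apply: integrableD => //; apply: integrableZl.
rewrite integralD //; [|exact: integrableZl|exact: integrableZl].
rewrite !integralZl // integral_cst1 // mu_sq -/I2 -(fineK fi) -/M.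
by rewrite !mule1 -!EFinD; congr (_%:E); lra.
by apply: eq_integral => x _ /=; rewrite -!EFinM -!EFinD; congr (_%:E); lra.
apply: le_integral => //.
 - have -> : (fun x => (f e x ^+ 2 - M + M * (9 / 16 * (1 - rho x / 4)))%:E) =
 ((fun x => (f e x ^+ 2)%:E) \+ (fun x => (M * (9 / 16 * (1 - rho x / 4)) - M)%:E))%E.
by apply/funext => x /=; rewrite -EFinD; congr (_%:E); lra.
exact: integrableD.
 - pose K := M * ((e^-1 ^+ 2 / M) ^+ 2 + 1).
apply: (@integrable_bd _ K).
apply: measurable_funM; first exact: measurable_funX.
apply: (measurableT_comp (@measurable_ln R)).
by apply: measurable_funM => //; exact: measurable_funX.
move=> x.
have fb : f e x ^+ 2 <= e^-1 ^+ 2.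
by rewrite lerXn2r ?nnegrE ?satur_ge0 ?invr_ge0 ?satur_le_inv // ltW.
have f20 := sqr_ge0 (f e x).
move: (f e x ^+ 2) fb f20 => y yb y0.
have h0 : 0 <= y / M by nneg.
have hb : y / M <= e^-1 ^+ 2 / M by rewrite ler_wpM2r // invr_ge0 ltW.
have -> : y * ln (y / M) = M * (y / M * ln (y / M)).
by move: (ln _) => l; field; rewrite gt_eqF.
rewrite normrM gtr0_norm // ler_pM2l //.
have : (y / M) ^+ 2 <= (e^-1 ^+ 2 / M) ^+ 2 by rewrite lerXn2r ?nnegrE // (le_trans h0).
have := entropy_ge h0.
move: (_ ^+ 2) (sqr_ge0 (1 - Num.sqrt (y / M))) => q q0 lo up2.
have : y / M * ln (y / M) <= (y / M) ^+ 2.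
rewrite expr2; apply: ler_wpM2l => //; move: h0; rewrite le_eqVlt.
case/orP=> [/eqP <-|h0']; first by rewrite ln0.
have := @le_ln1Dx R (y / M - 1); rewrite [1 + _]addrC subrK => l1.
by apply: (le_trans (l1 _)); lra.
rewrite ler_norml; move: (y / M * ln (y / M)) lo up2 => l.
have := sqr_ge0 (y / M).
move: (y / M) h0 ((y / M) ^+ 2) ((e^-1 ^+ 2 / M) ^+ 2) => h hge0 h2 h3; lra.
 - by move=> x _; rewrite lee_fin; apply: entropy_pointwise => //; [exact: satur_ge0|exact: satur_le].
have := le_trans lo (le_trans H up).
rewrite lee_fin; have := sqr_ge0 (4 ^+ a.+1 : R).
move: (4 ^+ a.+1) => z; move: (z ^+ 2) => z2; lra.
Qed.

(** Monotone convergence along the truncations with e = 1/(n+1), whose integrals share one bound. *)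
Theorem log_sobolev_moment : exists B : R, (\int[mu]_x (rho x ^+ a.*2.+2)%:E <= B%:E)%E.
have [B hB] := truncated_moment; exists B.
pose g (n : nat) x := (f n.+1%:R^-1 x ^+ 2)%:E.
have gE x : rho x ^+ a.*2.+2 = (rho x ^+ a.+1) ^+ 2.
by rewrite -exprM muln2 doubleS.
have e0 n : 0 < (n.+1%:R^-1 : R) by [].
have mg n : mfunT (g n).
by apply/measurable_EFinP; apply: measurable_funX; exact: meas_satur.
have g0 n x : (0 <= g n x)%E by nneg.
have ndg x : nondecreasing_seq (g ^~ x).
move=> i j ij; rewrite lee_fin lerXn2r ?nnegrE ?satur_ge0 //.
by apply: satur_anti => //; rewrite lef_pV2 ?posrE // ler_nat.
have cg x : g ^~ x @ \oo --> (rho x ^+ a.*2.+2)%:E.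
rewrite /g gE; apply: cvg_EFin; first by near=> n.
have ce : (n.+1%:R^-1 : R) @[n \oo] --> (0 : R) by exact: cvg_harmonic.
have : (rho x ^+ a.+1 / (1 + n.+1%:R^-1 * rho x ^+ a.+1)) ^+ 2 @[n \oo] -->
 (rho x ^+ a.+1 / (1 + 0 * rho x ^+ a.+1)) ^+ 2.
have c1 : (rho x ^+ a.+1 / (1 + n.+1%:R^-1 * rho x ^+ a.+1)) @[n \oo] -->
 (rho x ^+ a.+1 / (1 + 0 * rho x ^+ a.+1)).
apply: cvgMr; apply: cvgV; first by rewrite mul0r addr0.
by apply: cvgD; [exact: cvg_cst|apply: cvgMl].
exact: (cvgM c1 c1).
by rewrite mul0r addr0 divr1.
have cv := cvg_monotone_convergence measurableT mg (fun n x _ => g0 n x) (fun x _ => ndg x) : (\int[mu]_x g n x)%E @[n \oo] --> (\int[mu]_x limn (g^~ x))%E.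
have -> : (\int[mu]_x (rho x ^+ a.*2.+2)%:E)%E = (\int[mu]_x limn (g^~ x))%E.
by apply: eq_integral => x _; apply/esym/cvg_lim.
rewrite -(cvg_lim _ cv) //; apply: lime_le; first by apply/cvg_ex; eexists; exact: cv.
by near=> n; exact: hB.
Unshelve. all: end_near.
Qed.
End LogSobolevMoments.
Lemma real_complexE (R : realType) (x : R) : (x%:C)%C \is Num.real.
by rewrite realE -[0]/(0%:C)%C !lecR -realE num_real. Qed.

(** * Rotational invariance gives moments of all orders *)

Section Reflection.
Context (R : realType) (m : nat) (i0 i1 : 'I_m).
Hypothesis i01 : i0 != i1.
Notation C := R[i].
Let s : R := (Num.sqrt 2)^-1.
Let r : C := (s%:C)%C.
(** The Householder vector: [e_i0] minus its image r (e_i0 + e_i1). Its squared norm is 2 (1 - r),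
    whence the factor (1 - r)^-1 in the reflection. *)
Let u : 'rV[C]_m := (1 - r) *: 'e_i0 - r *: 'e_i1.

(* Householder reflection acting on the coordinates i0, i1 as
 (x, y) |-> ((x + y) / sqrt 2, (x - y) / sqrt 2). *)
Definition reflm : 'M[C]_m := 1%:M - (1 - r)^-1 *: (u^T *m u).
Let s0 : 0 < s. by nneg. Qed.
Let s2 : s ^+ 2 = 2^-1. by rewrite exprVn sqr_sqrtr. Qed.
Let s1 : s < 1.
by have := s0; have := s2; rewrite expr2 => h h'; nra. Qed.
Let r2 : r ^+ 2 = 2^-1.
by rewrite /r -rmorphXn /= s2 rmorphV ?unitfE //= rmorph_nat. Qed.
Let r2' : r * r * 2 = 1. by rewrite -expr2 r2 mulVf. Qed.
Let r1 : 1 - r != 0.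
rewrite -[1]/((1 : R)%:C)%C -rmorphB /= -[0]/((0 : R)%:C)%C.
by rewrite (inj_eq (@complexI _)) subr_eq0 gt_eqF.
Qed.
Let uu : u *m u^T = (2 * (1 - r))%:M.
have ut : u^T = (1 - r) *: ('e_i0)^T - r *: ('e_i1)^T by rewrite /u linearB /= !linearZ.
rewrite ut {1}/u mulmxBl !mulmxBr.
rewrite -!scalemxAl -!scalemxAr !trmx_delta !mul_delta_mx_cond !eqxx.
rewrite (negbTE i01) eq_sym (negbTE i01) !mulr0n !scaler0 !subr0 sub0r opprK !mulr1n.
have -> : delta_mx 0 0 = 1%:M :> 'M[C]_1.
by apply/matrixP => a b; rewrite !mxE !ord1 !eqxx.
rewrite !scalerA -scalerDl scalemx1; congr (_%:M).
have -> : (1 - r) * (1 - r) + r * r = 1 - 2 * r + r * r * 2 by ring.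
by rewrite r2'; ring.
Qed.
Lemma reflm_real : reflm \is a realmx.
apply/mxOverP => a b; rewrite !mxE big_ord1 !mxE.
have rr : r \is Num.real by exact: real_complexE.
have d1 (c : 'I_m) j : (((0 : 'I_1) == 0) && (c == j))%:R \is @Num.real C.
by [].
by rewrite !(rpredB, rpredM, rpredV, rpred1, realn).
Qed.
Lemma reflm_unitary : reflm \is unitarymx.
apply/unitarymxP.
have -> : reflm ^t* = reflm.
have RR := mxOverP reflm_real.
have ST : reflm^T = reflm.
by rewrite /reflm linearB /= linearZ /= trmx1 trmx_mul trmxK.
apply/matrixP => a b; rewrite mxE -[in RHS]ST; apply/CrealP.
by rewrite ST RR.
rewrite /reflm; have := uu; move: (u) => v vv.
rewrite mulmxBl !mulmxBr !mulmx1 !mul1mx.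
rewrite -scalemxAl -scalemxAr mulmxA -[v^T *m v *m _]mulmxA vv.
rewrite mul_mx_scalar -scalemxAl !scalerA.
have -> : (1 - r)^-1 * ((1 - r)^-1 * (2 * (1 - r))) = 2 * (1 - r)^-1 by field.
have -> : 2 / (1 - r) = (1 - r)^-1 + (1 - r)^-1 by move: (1 - r)^-1 => z; ring.
by rewrite scalerDl; set A := _ *: _; rewrite opprB addrK subrK.
Qed.
Let ue (v : 'cV[C]_m) : (u *m v) 0 0 = (1 - r) * v i0 0 - r * v i1 0.
by rewrite /u mulmxBl -!scalemxAl -!rowE !mxE. Qed.
Let reflE (v : 'cV[C]_m) a : (reflm *m v) a 0 = v a 0 - (1 - r)^-1 * u 0 a * ((1 - r) * v i0 0 - r * v i1 0).
rewrite /reflm mulmxBl mul1mx -scalemxAl -mulmxA.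
rewrite [in LHS]mxE; congr (_ + _); rewrite [in LHS]mxE; congr (- _).
by rewrite [in LHS]mxE [in LHS]mxE big_ord1 ue [u^T _ _]mxE mulrA.
Qed.
Lemma reflm_mul0 (v : 'cV[C]_m) : (reflm *m v) i0 0 = r * (v i0 0 + v i1 0).
rewrite reflE /u !mxE !eqxx (negbTE i01) /=; field.
exact: r1.
Qed.
Lemma reflm_mul1 (v : 'cV[C]_m) : (reflm *m v) i1 0 = r * (v i0 0 - v i1 0).
rewrite reflE /u !mxE !eqxx [i1 == _]eq_sym (negbTE i01) /=.
apply: (mulfI r1).
have -> : (1 - r) * (v i1 0 - (1 - r)^-1 * ((1 - r) * 0%:R - r * 1%:R) * ((1 - r) * v i0 0 - r * v i1 0)) =
 (1 - r) * v i1 0 + r * ((1 - r) * v i0 0 - r * v i1 0).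
by move: (v i1 0) (v i0 0) => y x; field; exact: r1.
have -> : (1 - r) * v i1 0 + r * ((1 - r) * v i0 0 - r * v i1 0) =
 (1 - r) * (r * (v i0 0 - v i1 0)) + (1 - r * r * 2) * v i1 0 by ring.
by rewrite r2' subrr mul0r addr0.
Qed.

(* |x + y|^2 |x - y|^2 = |x^2 - y^2|^2 *)
Lemma reflm_norm_prod (v : 'cV[C]_m) (x y : R * R) : v i0 0 = cplx x -> v i1 0 = cplx y -> forall U V : R * R,
 uncplx ((reflm *m v) i0 0) = U -> uncplx ((reflm *m v) i1 0) = V ->
 ((x.1 ^+ 2 + x.2 ^+ 2) - (y.1 ^+ 2 + y.2 ^+ 2)) ^+ 2 <= 4 * ((U.1 ^+ 2 + U.2 ^+ 2) * (V.1 ^+ 2 + V.2 ^+ 2)).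
move=> v0 v1 U V hU hV.
have UE : U = (s * (x.1 + y.1), s * (x.2 + y.2)).
rewrite -hU reflm_mul0 v0 v1 /uncplx /cplx /r /=; congr (_, _); ring.
have VE : V = (s * (x.1 - y.1), s * (x.2 - y.2)).
rewrite -hV reflm_mul1 v0 v1 /uncplx /cplx /r /=; congr (_, _); ring.
rewrite UE VE /= !exprMn s2.
move: x.1 x.2 y.1 y.2 => a b c e.
have -> : 4 * ((2^-1 * (a + c) ^+ 2 + 2^-1 * (b + e) ^+ 2) * (2^-1 * (a - c) ^+ 2 + 2^-1 * (b - e) ^+ 2)) =
 ((a ^+ 2 + b ^+ 2) - (c ^+ 2 + e ^+ 2)) ^+ 2 + 4 * (a * e - b * c) ^+ 2.
by field.
by rewrite lerDl mulr_ge0 // sqr_ge0.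
Qed.
End Reflection.
Lemma exprD_le2 (R : realType) (k : nat) (x y : R) : 0 <= x -> 0 <= y ->
 (x + y) ^+ k <= 2 ^+ k * (x ^+ k + y ^+ k).
move=> x0 y0; wlog xy : x y x0 y0 / x <= y => [H|].
have [xy|/ltW yx] := lerP x y; first exact: H.
by rewrite addrC [x ^+ k + _]addrC; exact: H.
apply: (letr ((2 * y) ^+ k)).
by rewrite lerXn2r ?nnegrE ?addr_ge0 ?mulr_ge0 //; lra.
by rewrite exprMn ler_wpM2l ?exprn_ge0 // lerDr exprn_ge0.
Qed.

Section MomentDoubling.
Context d (T : measurableType d) (R : realType) (P : probability T R)
 (m : nat) (e : 'I_m -> {RV P >-> (R * R)%type}) (mu : probability (R * R)%type R) (i0 i1 : 'I_m).
Hypotheses (i01 : i0 != i1) (ind : mutually_independent e) (law : forall a, has_law (e a) mu)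
 (inv : law_invariant e (reflm R i0 i1)).
Let rho (x : R * R) := x.1 ^+ 2 + x.2 ^+ 2.
Hypothesis mu_sq : (\int[mu]_x (rho x)%:E = 1)%E.
Let rho0 x : 0 <= rho x. by nneg. Qed.
Let mrho : mfunT rho.
by apply: measurable_funD; apply: measurable_funX; [exact: measurable_fst | exact: measurable_snd].
Qed.
Lemma has_law_int a (f : R * R -> \bar R) : mfunT f ->
 (forall x, (0 <= f x)%E) -> (\int[P]_w f (e a w) = \int[mu]_x f x)%E.
move=> mf f0; rewrite -(@ge0_integral_distribution _ _ _ _ _ P (e a) f) //.
by apply: eq_measure_integral => A mA _; exact: law.
Qed.
Let pastE a (f : R * R -> R) : mfunT f -> mfunT (fun w : pastT e [:: a] => (f (e a w))%:E).
move=> mf; apply/measurable_EFinP; apply: (measurableT_comp mf) => _ A mA.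
rewrite setTI.
by apply: sub_sigma_algebra; apply: cylinder_preimage; rewrite ?inE.
Qed.
Let pair_integral (f g : R * R -> R) : mfunT f -> mfunT g -> (forall x, 0 <= f x) -> (forall x, 0 <= g x) ->
 (\int[P]_w (f (e i0 w) * g (e i1 w))%:E = \int[mu]_x (f x)%:E * \int[mu]_x (g x)%:E)%E.
move=> mf mg f0 g0; under eq_integral do rewrite EFinM.
have IN A C : <<s past e [:: i0] >> A -> <<s past e [:: i1] >> C -> P (A `&` C) = (P A * P C)%E.
by apply: past_indep => //; rewrite inE eq_sym.
rewrite (ge0_expectation_mul (@past_meas _ _ _ _ _ _ _) (@past_meas _ _ _ _ _ _ _) IN
 (f := fun w => (f (e i0 w))%:E) (h := fun w => (g (e i1 w))%:E)) //.
- by congr (_ * _)%E; [apply: (has_law_int i0 (f := fun x => (f x)%:E))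
 |apply: (has_law_int i1 (f := fun x => (g x)%:E))] => //;
 try exact/measurable_EFinP; move=> x; rewrite lee_fin.
- exact: pastE.
- exact: pastE.
- by move=> w; rewrite lee_fin.
- by move=> w; rewrite lee_fin.
Qed.
Let UV (w : T) := rho (uncplx ((reflm R i0 i1 *m cvec e w) i0 0)) *
 rho (uncplx ((reflm R i0 i1 *m cvec e w) i1 0)).
Let EE (w : T) := rho (e i0 w) * rho (e i1 w).
Let mEE : mfunT EE.
by apply: measurable_funM; apply: (measurableT_comp mrho); exact: measurable_funP.
Qed.
Let UVE w : UV w = rho ((Num.sqrt 2)^-1 * ((e i0 w).1 + (e i1 w).1), (Num.sqrt 2)^-1 * ((e i0 w).2 + (e i1 w).2)) *
 rho ((Num.sqrt 2)^-1 * ((e i0 w).1 - (e i1 w).1), (Num.sqrt 2)^-1 * ((e i0 w).2 - (e i1 w).2)).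
by rewrite /UV reflm_mul0 // reflm_mul1 // !mxE /uncplx /cplx /rho /=; congr (_ * _); congr (_ ^+ 2 + _ ^+ 2); ring.
Qed.
Let mUV : mfunT UV.
rewrite (funext UVE) /rho /=.
have m1 a : mfunT (fun w => (e a w).1).
by apply: (measurableT_comp measurable_fst); exact: measurable_funP.
have m2 a : mfunT (fun w => (e a w).2).
by apply: (measurableT_comp measurable_snd); exact: measurable_funP.
have ms (c : R) (f h : T -> R) : mfunT f -> mfunT h -> mfunT (fun w => (c * (f w + h w)) ^+ 2).
move=> mf mh; apply: measurable_funX; apply: measurable_funM => //.
exact: measurable_funD.
have mn (f : T -> R) : mfunT f -> mfunT (fun w => - f w).
by move=> mf; apply: (measurableT_comp (@oppr_measurable R setT)).
by apply: measurable_funM; apply: measurable_funD; apply: ms => //; apply: mn.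
Qed.
HB.instance Definition _ := isMeasurableFun.Build _ _ _ _ UV mUV.
HB.instance Definition _ := isMeasurableFun.Build _ _ _ _ EE mEE.
(** [UV] and [EE] are the same function of the rotated and of the original vector, whose joint laws
    coincide. *)
Let UV_law (f : R -> \bar R) : mfunT f -> (forall x, (0 <= f x)%E) ->
 (\int[P]_w f (UV w) = \int[P]_w f (EE w))%E.
move=> mf f0.
rewrite -(@ge0_integral_distribution _ _ _ _ _ P UV f) //.
rewrite -(@ge0_integral_distribution _ _ _ _ _ P EE f) //.
apply: eq_measure_integral => A mA _; rewrite /distribution /pushforward.
pose G (t : m.-tuple (R * R)) := rho (tnth t i0) * rho (tnth t i1).
have mG : mfunT G.
by apply: measurable_funM; apply: (measurableT_comp mrho); exact: measurable_tnth.
have mGA : measurable (G @^-1` A) by rewrite -[X in measurable X]setTI; exact: mG.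
have := inv mGA; rewrite /G /preimage /=.
have -> : [set w | A (rho (tnth [tuple uncplx ((reflm R i0 i1 *m cvec e w) a 0) | a < m] i0) *
 rho (tnth [tuple uncplx ((reflm R i0 i1 *m cvec e w) a 0) | a < m] i1))] = [set w | A (UV w)].
by apply/seteqP; split => w /=; rewrite !tnth_mktuple.
have -> // : [set w | A (rho (tnth [tuple e a w | a < m] i0) *
 rho (tnth [tuple e a w | a < m] i1))] = [set w | A (EE w)].
by apply/seteqP; split => w /=; rewrite !tnth_mktuple.
Qed.
(** A weight carried by {rho < 2} with integral at least 1/2, since rho has mean 1. It pins the
    second entry down, so that the difference of the two squared moduli controls the first. *)
Let g (x : R * R) := Num.max 0 (1 - rho x / 2).
Let g0 x : 0 <= g x. by rewrite le_max lexx. Qed.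
Let g1 x : g x <= 1.
by rewrite ge_max ler01 /= gerBl divr_ge0. Qed.
Let mg : mfunT g.
apply: measurable_maxr => //; apply: measurable_funB => //.
exact: measurable_funM.
Qed.
Let g_half : ((2^-1)%:E <= \int[mu]_x (g x)%:E)%E.
have c1 (r : R) : (\int[mu]_x cst r%:E x = r%:E)%E.
by rewrite integral_cst // -[RHS]mule1; congr (_ * _)%E; exact: probability_setT.
have ic : mu.-integrable setT (cst 1%:E : R * R -> \bar R).
apply/integrableP; split => //; under eq_integral do rewrite /= normr1.
by rewrite (c1 1) ltry.
have ir : mu.-integrable setT (fun x => (rho x)%:E).
apply/integrableP; split; first exact/measurable_EFinP.
under eq_integral do rewrite /= ger0_norm //.
by rewrite mu_sq ltry.
have -> : ((2^-1)%:E = \int[mu]_x (1 - rho x / 2)%:E)%E.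
transitivity (\int[mu]_x (cst 1%:E x + (- 2^-1)%:E * (rho x)%:E))%E.
rewrite integralD //; last exact: integrableZl.
by rewrite integralZl // c1 mu_sq mule1 -EFinD; congr (_%:E); lra.
by apply: eq_integral => x _; rewrite /= -EFinM -EFinD; congr (_%:E); lra.
apply: le_integral => //.
- have -> : (fun x => (1 - rho x / 2)%:E) = (fun x => cst 1%:E x + (- 2^-1)%:E * (rho x)%:E)%E.
by apply/funext => x; rewrite /= -EFinM -EFinD; congr (_%:E); lra.
by apply: integrableD => //; exact: integrableZl.
- apply: (@le_integrable _ _ _ _ _ _ _ (cst 1%:E)) => //.
exact/measurable_EFinP.
by move=> x _ /=; rewrite normr1 ger0_norm // lee_fin.
- by move=> x _; rewrite lee_fin /g le_max lexx orbT.
Qed.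

(** By [reflm_norm_prod], the squared difference of two squared moduli is at most 4 [UV]. By
    invariance [UV] has the law of a product of two independent copies of rho, whose q-th moment is
    the square of that of rho. So q moments control 2 q moments of the difference. *)
Theorem moment_doubling q : (\int[mu]_x (rho x ^+ q)%:E < +oo)%E -> (\int[mu]_x (rho x ^+ q.*2)%:E < +oo)%E.
move=> fin.
have mq k : mfunT (fun x => rho x ^+ k) by exact: measurable_funX.
have q0 k x : 0 <= rho x ^+ k by nneg.
have fm : (\int[P]_w (EE w ^+ q)%:E < +oo)%E.
rewrite /EE; under eq_integral do rewrite exprMn.
rewrite (pair_integral (mq q) (mq q)) //.
have i0' : (0 <= \int[mu]_x (rho x ^+ q)%:E)%E.
by apply: integral_ge0 => x _; rewrite lee_fin.
by apply: lte_mul_pinfty => //; rewrite ge0_fin_numE.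
have mUVq : mfunT (fun w => UV w ^+ q) by exact: measurable_funX.
have fu : (\int[P]_w (UV w ^+ q)%:E < +oo)%E.
have ab (S : T -> R) : (forall w, 0 <= S w) -> (\int[P]_w (S w ^+ q)%:E = \int[P]_w (`|S w| ^+ q)%:E)%E.
by move=> S0; apply: eq_integral => w _; rewrite ger0_norm.
rewrite ab; last by move=> w; rewrite mulr_ge0.
rewrite (@UV_law (fun y => (`|y| ^+ q)%:E)).
 - by rewrite -ab // => w; rewrite mulr_ge0.
 - by apply/measurable_EFinP; apply: measurable_funX; exact: normr_measurable.
 - by [].
have K0 : 0 <= (2 ^+ q.*2 : R) by [].
(* Where the weight is nonzero, rho of the first entry is at most the absolute difference plus 2. *)
have pw w : rho (e i0 w) ^+ q.*2 * g (e i1 w) <= 2 ^+ q.*2 * (4 ^+ q * UV w ^+ q + 2 ^+ q.*2).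
have UV0 : 0 <= UV w by nneg.
have b0 : 0 <= 4 ^+ q * UV w ^+ q + 2 ^+ q.*2.
by nneg.
have [r2|r2] := lerP 2 (rho (e i1 w)).
by rewrite [g _]max_l ?mulr0 ?mulr_ge0 // subr_le0 ler_pdivlMr // mul1r.
apply: (letr (rho (e i0 w) ^+ q.*2)).
by rewrite -[leRHS]mulr1 ler_wpM2l.
have v0 : cvec e w i0 0 = cplx (e i0 w) by rewrite mxE.
have v1 : cvec e w i1 0 = cplx (e i1 w) by rewrite mxE.
have := reflm_norm_prod i01 v0 v1 erefl erefl; rewrite -!/(rho _) -/(UV w) => N.
apply: (letr ((`|rho (e i0 w) - rho (e i1 w)| + 2) ^+ q.*2)).
apply: lerXn2r; [exact: rho0|by nneg|].
have := ler_norm (rho (e i0 w) - rho (e i1 w)).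
by move: r2; move: (rho _) (rho _) `|_| => x y z; lra.
apply: (le_trans (exprD_le2 _ _ _)) => //.
rewrite ler_wpM2l // lerD2r exprD_norm -mul2n exprM -exprMn.
by rewrite lerXn2r ?nnegrE ?sqr_ge0 ?mulr_ge0.
have big : (\int[P]_w (rho (e i0 w) ^+ q.*2 * g (e i1 w))%:E < +oo)%E.
apply: (@le_lt_trans _ _ (\int[P]_w (2 ^+ q.*2 * (4 ^+ q * UV w ^+ q + 2 ^+ q.*2))%:E)%E).
apply: ge0_le_integral => //.
 - by move=> w _; rewrite lee_fin mulr_ge0.
 - apply/measurable_EFinP; apply: measurable_funM.
by apply: (measurableT_comp (mq q.*2)); exact: measurable_funP.
by apply: (measurableT_comp mg); exact: measurable_funP.
 - apply/measurable_EFinP; apply: measurable_funM => //.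
by apply: measurable_funD => //; exact: measurable_funM.
 - by move=> w _; rewrite lee_fin.
have UV0 w : 0 <= UV w ^+ q by nneg.
have iU : P.-integrable setT (fun w => (UV w ^+ q)%:E).
apply/integrableP; split; first exact/measurable_EFinP.
by under eq_integral do rewrite /= ger0_norm ?UV0 //.
have ic : P.-integrable setT (cst (2 ^+ q.*2)%:E).
exact: finite_measure_integrable_cst.
have : P.-integrable setT (fun w => (2 ^+ q.*2)%:E *
 ((4 ^+ q)%:E * (UV w ^+ q)%:E + cst (2 ^+ q.*2)%:E w))%E.
by apply: integrableZl => //; apply: integrableD => //; apply: integrableZl.
case/integrableP=> _.
rewrite (eq_integral (fun w => (2 ^+ q.*2 * (4 ^+ q * UV w ^+ q + 2 ^+ q.*2))%:E)) //.
move=> w _; rewrite /= ger0_norm //.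
apply: mulr_ge0 => //; apply: addr_ge0 => //; apply: mulr_ge0 => //; by [].
rewrite (pair_integral (mq q.*2) mg) // in big.
rewrite ltNge leye_eq; apply/negP => /eqP oo; move: big.
rewrite oo gt0_mulye ?ltxx //.
by apply: lt_le_trans g_half; rewrite lte_fin.
Qed.
End MomentDoubling.

(** * Complex numbers, adjoints and Hermitian forms *)

Section ComplexParts.
Context (R : realType).
Implicit Types (x y : R[i]) (r : R).
Lemma Re_add x y : cRe (x + y) = cRe x + cRe y.
by case: x y => [a b] [c e]. Qed.
Lemma Im_add x y : cIm (x + y) = cIm x + cIm y.
by case: x y => [a b] [c e]. Qed.
Lemma Re_opp x : cRe (- x) = - cRe x. by case: x. Qed.
Lemma Im_opp x : cIm (- x) = - cIm x. by case: x. Qed.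
Lemma Re_sub x y : cRe (x - y) = cRe x - cRe y.
by rewrite Re_add Re_opp. Qed.
Lemma Re_mul x y : cRe (x * y) = cRe x * cRe y - cIm x * cIm y.
by case: x y => [a b] [c e]. Qed.
Lemma Im_mul x y : cIm (x * y) = cRe x * cIm y + cIm x * cRe y.
by case: x y => [a b] [c e]. Qed.
Lemma cRe_conj x : cRe (Num.conj x) = cRe x. by case: x. Qed.
Lemma cIm_conj x : cIm (Num.conj x) = - cIm x. by case: x. Qed.
Lemma Re_mulCl r x : cRe (r%:C%C * x) = r * cRe x.
by rewrite Re_mul /= mul0r subr0. Qed.
Lemma Re_sum (I : Type) (s : seq I) (Q : pred I) (F : I -> R[i]) :
 cRe (\sum_(i <- s | Q i) F i) = \sum_(i <- s | Q i) cRe (F i).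
elim: s => [|a s IH]; first by rewrite !big_nil.
by rewrite !big_cons; case: ifP => _; rewrite ?Re_add IH.
Qed.
Lemma Im_sum (I : Type) (s : seq I) (Q : pred I) (F : I -> R[i]) :
 cIm (\sum_(i <- s | Q i) F i) = \sum_(i <- s | Q i) cIm (F i).
elim: s => [|a s IH]; first by rewrite !big_nil.
by rewrite !big_cons; case: ifP => _; rewrite ?Im_add IH.
Qed.
Lemma conjR r : Num.conj (r%:C%C) = (r%:C)%C.
by apply/eqP; rewrite eq_complex cRe_conj cIm_conj /= oppr0 !eqxx. Qed.
Lemma complex_ext x y : cRe x = cRe y -> cIm x = cIm y -> x = y.
by case: x y => [a b] [c e] /= -> ->. Qed.
Definition nsq x : R := cRe x ^+ 2 + cIm x ^+ 2.
Lemma nsq_ge0 x : 0 <= nsq x. by rewrite addr_ge0 // sqr_ge0. Qed.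
Lemma nsqE x : Num.conj x * x = (nsq x)%:C%C.
by apply: complex_ext; rewrite ?Re_mul ?Im_mul cRe_conj cIm_conj /= /nsq; ring. Qed.
Lemma nsq_eq0 x : (nsq x == 0) = (x == 0).
by rewrite /nsq paddr_eq0 ?sqr_ge0 // !sqrf_eq0 eq_complex. Qed.
Lemma nsqJ x : nsq (Num.conj x) = nsq x.
by rewrite /nsq cRe_conj cIm_conj sqrrN. Qed.
Lemma nsqM x y : nsq (x * y) = nsq x * nsq y.
by rewrite /nsq Re_mul Im_mul; ring. Qed.
Lemma nsqR r : nsq r%:C%C = r ^+ 2.
by rewrite /nsq /= expr0n addr0. Qed.
Lemma nsq0 : nsq 0 = 0. by rewrite /nsq /= expr0n addr0. Qed.
Lemma nsqN x : nsq (- x) = nsq x.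
by rewrite /nsq Re_opp Im_opp !sqrrN. Qed.
Lemma realCK x : cIm x = 0 -> x = (cRe x)%:C%C.
by move=> h; apply: complex_ext; rewrite //= h. Qed.
End ComplexParts.
HB.lock Definition vsq (R : realType) n (v : 'cV[R[i]]_n) : R := \sum_a nsq (v a 0).
HB.lock Definition rq (R : realType) n (A : 'M[R[i]]_n) (v : 'cV[R[i]]_n) : R := cRe (vdot v (A *m v)).

Section Adjoint.
Context (R : realType).
Notation C := R[i].
Lemma adjmxM (m n p : nat) (A : 'M[C]_(m, n)) (B : 'M[C]_(n, p)) : (A *m B) ^t* = B ^t* *m A ^t*.
by rewrite trmx_mul map_mxM. Qed.
Lemma adjmxD (m n : nat) (A B : 'M[C]_(m, n)) : (A + B) ^t* = A ^t* + B ^t*.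
by rewrite linearD map_mxD. Qed.
Lemma adjmxN (m n : nat) (A : 'M[C]_(m, n)) : (- A) ^t* = - A ^t*.
by rewrite linearN map_mxN. Qed.
Lemma adjmxB (m n : nat) (A B : 'M[C]_(m, n)) : (A - B) ^t* = A ^t* - B ^t*.
by rewrite adjmxD adjmxN. Qed.
Lemma adjmxZ (m n : nat) a (A : 'M[C]_(m, n)) : (a *: A) ^t* = Num.conj a *: A ^t*.
by rewrite linearZ /= map_mxZ. Qed.
Lemma adjmx_scalar n (a : C) : (a%:M : 'M[C]_n) ^t* = (Num.conj a)%:M.
by rewrite tr_scalar_mx map_scalar_mx. Qed.
Lemma adjmxK (m n : nat) (A : 'M[C]_(m, n)) : A ^t* ^t* = A.
exact: trmxCK. Qed.
Lemma adjmx0 (m n : nat) : (0 : 'M[C]_(m, n)) ^t* = 0.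
by rewrite trmx0 map_mx0. Qed.
Definition herm n (A : 'M[C]_n) := A ^t* = A.
Lemma herm_scalar n (r : R) : herm (r%:C%C%:M : 'M[C]_n).
by rewrite /herm adjmx_scalar conjR. Qed.
Lemma hermD n (A B : 'M[C]_n) : herm A -> herm B -> herm (A + B).
by move=> a b; rewrite /herm adjmxD a b. Qed.
Lemma hermB n (A B : 'M[C]_n) : herm A -> herm B -> herm (A - B).
by move=> a b; rewrite /herm adjmxB a b. Qed.
Lemma herm_gram m n (X : 'M[C]_(m, n)) : herm (X *m X ^t*).
by rewrite /herm adjmxM adjmxK. Qed.
Lemma vdotE n (u v : 'cV[C]_n) :
 vdot u v = \sum_a Num.conj (u a 0) * v a 0.
by rewrite /vdot mxE; apply: eq_bigr => a _; rewrite !mxE. Qed.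
Lemma vdotC n (u v : 'cV[C]_n) : vdot v u = Num.conj (vdot u v).
by rewrite !vdotE rmorph_sum; apply: eq_bigr => a _; rewrite rmorphM /= conjCK mulrC.
Qed.
Lemma vdotDr n (u v w : 'cV[C]_n) : vdot u (v + w) = vdot u v + vdot u w.
by rewrite /vdot mulmxDr mxE. Qed.
Lemma vdotZr n a (u v : 'cV[C]_n) : vdot u (a *: v) = a * vdot u v.
by rewrite /vdot -scalemxAr mxE. Qed.
Lemma vdotDl n (u v w : 'cV[C]_n) : vdot (v + w) u = vdot v u + vdot w u.
by rewrite /vdot adjmxD mulmxDl mxE. Qed.
Lemma vdotZl n a (u v : 'cV[C]_n) : vdot (a *: v) u = Num.conj a * vdot v u.
by rewrite /vdot adjmxZ -scalemxAl mxE. Qed.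
Lemma vdotNr n (u v : 'cV[C]_n) : vdot u (- v) = - vdot u v.
by rewrite -scaleN1r vdotZr mulN1r. Qed.
Lemma vdotNl n (u v : 'cV[C]_n) : vdot (- v) u = - vdot v u.
by rewrite -scaleN1r vdotZl rmorphN1 mulN1r. Qed.
Lemma vdotBr n (u v w : 'cV[C]_n) : vdot u (v - w) = vdot u v - vdot u w.
by rewrite vdotDr vdotNr. Qed.
Lemma vdotBl n (u v w : 'cV[C]_n) : vdot (v - w) u = vdot v u - vdot w u.
by rewrite vdotDl vdotNl. Qed.
Lemma vdot0r n (u : 'cV[C]_n) : vdot u 0 = 0.
by rewrite /vdot mulmx0 mxE. Qed.
Lemma vdotMr m n (A : 'M[C]_(m, n)) u v :
 vdot u (A *m v) = vdot (A ^t* *m u) v.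
by rewrite /vdot adjmxM adjmxK mulmxA. Qed.
Lemma vdotMl m n (A : 'M[C]_(m, n)) u v :
 vdot (A *m v) u = vdot v (A ^t* *m u).
by rewrite /vdot adjmxM mulmxA. Qed.
Lemma vsq_def n (v : 'cV[C]_n) : vsq v = \sum_a nsq (v a 0).
by rewrite vsq.unlock. Qed.
Lemma vsq_ge0 n (v : 'cV[C]_n) : 0 <= vsq v.
by rewrite vsq_def; apply: sumr_ge0 => a _; exact: nsq_ge0. Qed.
Lemma vdotvv n (v : 'cV[C]_n) : vdot v v = (vsq v)%:C%C.
by rewrite vsq_def vdotE rmorph_sum; apply: eq_bigr => a _; rewrite nsqE. Qed.
Lemma vsq_eq0 n (v : 'cV[C]_n) : (vsq v == 0) = (v == 0).
rewrite vsq_def; apply/eqP/eqP => [/eqP|->]; last by apply: big1 => a _; rewrite mxE /nsq /= expr0n addr0.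
rewrite psumr_eq0; last by move=> a _; exact: nsq_ge0.
move=> /allP h; apply/matrixP => a b; rewrite ord1 mxE.
by apply/eqP; rewrite -nsq_eq0; apply: h; rewrite mem_index_enum.
Qed.
Lemma vsq_gt0 n (v : 'cV[C]_n) : v != 0 -> 0 < vsq v.
by move=> v0; rewrite lt_neqAle vsq_ge0 andbT eq_sym vsq_eq0. Qed.
Lemma vsqZ n a (v : 'cV[C]_n) : vsq (a *: v) = nsq a * vsq v.
by rewrite !vsq_def mulr_sumr; apply: eq_bigr => b _; rewrite mxE nsqM. Qed.
Lemma vsq_isom m n (V : 'M[C]_(m, n)) (v : 'cV[C]_n) : V ^t* *m V = 1%:M ->
 vsq (V *m v) = vsq v.
move=> VV; apply/complexI; rewrite -!vdotvv vdotMr mulmxA VV mul1mx.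
by [].
Qed.
Lemma vsq1 n (u v : 'cV[C]_n) : vsq (u ^t* *m v) = nsq (vdot u v).
by rewrite vsq_def big_ord1. Qed.
Lemma rq_def n (A : 'M[C]_n) v : rq A v = cRe (vdot v (A *m v)).
by rewrite rq.unlock. Qed.
Lemma rqE n (A : 'M[C]_n) v : herm A -> vdot v (A *m v) = (rq A v)%:C%C.
move=> hA; rewrite rq_def; apply: realCK.
have : vdot v (A *m v) = Num.conj (vdot v (A *m v)).
by rewrite -vdotC vdotMl hA.
move=> /(congr1 (@cIm R)); rewrite cIm_conj => h; lra.
Qed.
Lemma rqD n (A B : 'M[C]_n) v : rq (A + B) v = rq A v + rq B v.
by rewrite !rq_def mulmxDl vdotDr Re_add. Qed.
Lemma rqN n (A : 'M[C]_n) v : rq (- A) v = - rq A v.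
by rewrite !rq_def mulNmx vdotNr Re_opp. Qed.
Lemma rqB n (A B : 'M[C]_n) v : rq (A - B) v = rq A v - rq B v.
by rewrite rqD rqN. Qed.
Lemma rqZ n (r : R) (A : 'M[C]_n) v : rq (r%:C%C *: A) v = r * rq A v.
by rewrite !rq_def -scalemxAl vdotZr Re_mulCl. Qed.
Lemma rq_scalar n (r : R) v : rq (r%:C%C%:M : 'M[C]_n) v = r * vsq v.
by rewrite !rq_def mul_scalar_mx vdotZr vdotvv Re_mulCl. Qed.
Lemma rq_gram m n (X : 'M[C]_(m, n)) v : rq (X *m X ^t*) v = vsq (X ^t* *m v).
by rewrite !rq_def -mulmxA vdotMr vdotvv. Qed.
End Adjoint.

(** * Algebra of rank-one updates *)

Section MatrixRing.
Context (F : comNzRingType).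
Lemma sandwich_mul n (W W' D D' : 'M[F]_n) : W *m W' = 1%:M ->
 (W' *m D *m W) *m (W' *m D' *m W) = W' *m (D *m D') *m W.
by move=> e; rewrite !mulmxA -[W' *m D *m W *m W']mulmxA e mulmx1.
Qed.
Lemma sandwich_add n (W W' D D' : 'M[F]_n) :
 (W' *m D *m W) + (W' *m D' *m W) = W' *m (D + D') *m W.
by rewrite mulmxDr mulmxDl. Qed.
Lemma tr_sqD n (M E : 'M[F]_n) : \tr ((M + E) *m (M + E)) =
 \tr (M *m M) + 2 * \tr (M *m E) + \tr (E *m E).
rewrite mulmxDl !mulmxDr !mxtraceD [\tr (E *m M)]mxtrace_mulC.
by move: (\tr _) (\tr _) (\tr _) => a b c; ring.
Qed.
Lemma tr_cubeD n (M E : 'M[F]_n) :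
 \tr ((M + E) *m ((M + E) *m (M + E))) =
 \tr (M *m (M *m M)) + 3 * \tr (M *m M *m E) + 3 * \tr (M *m (E *m E)) +
 \tr (E *m (E *m E)).
rewrite !mulmxDl !mulmxDr !mxtraceD !mulmxA.
have -> : \tr (M *m E *m M) = \tr (M *m M *m E) by rewrite mxtrace_mulC mulmxA.
have -> : \tr (E *m M *m M) = \tr (M *m M *m E) by rewrite -mulmxA mxtrace_mulC.
have -> : \tr (E *m M *m E) = \tr (M *m E *m E) by rewrite -mulmxA mxtrace_mulC.
have -> : \tr (E *m E *m M) = \tr (M *m E *m E) by rewrite mxtrace_mulC mulmxA.
by move: (\tr _) (\tr _) (\tr _) (\tr _) => a b c d; ring.
Qed.
Lemma sherman_morrison n (B M : 'M[F]_n) (x : 'cV[F]_n) (y : 'rV[F]_n) (q k : F) :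
 B *m M = 1%:M -> y *m (M *m x) = q%:M -> k * (1 - q) = 1 ->
 (B - x *m y) *m (M + k *: ((M *m x) *m (y *m M))) = 1%:M.
move=> BM yMx kq.
rewrite mulmxBl !mulmxDr BM -!scalemxAr [B *m _]mulmxA [B *m _]mulmxA BM mul1mx.
have -> : x *m y *m (M *m x *m (y *m M)) = q *: (x *m (y *m M)).
have -> : x *m y *m (M *m x *m (y *m M)) =
 x *m (y *m (M *m x)) *m (y *m M) by rewrite !mulmxA.
by rewrite yMx mul_mx_scalar -!scalemxAl.
rewrite -mulmxA; set W := x *m (y *m M).
rewrite scalerA -addrA -[RHS]addr0; congr (_ + _).
rewrite -{2}[W]scale1r -scalerDl -scalerBl.
have -> : k - (1 + k * q) = k * (1 - q) - 1 by ring.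
by rewrite kq subrr scale0r.
Qed.
Lemma tr_rank1 n (M : 'M[F]_n) k (u : 'cV[F]_n) (v : 'rV[F]_n) :
 \tr (M *m (k *: (u *m v))) = k * (v *m (M *m u)) 0 0.
rewrite -scalemxAr mxtraceZ (mulmxA M u v) (mxtrace_mulC (M *m u) v).
by rewrite /mxtrace big_ord1.
Qed.
Lemma rank1_sq n k a (u : 'cV[F]_n) (v : 'rV[F]_n) : v *m u = a%:M ->
 (k *: (u *m v)) *m (k *: (u *m v)) = (k * a) *: (k *: (u *m v)).
move=> vu; rewrite -scalemxAl -scalemxAr.
have -> : u *m v *m (u *m v) = u *m (v *m u) *m v by rewrite !mulmxA.
rewrite vu mul_mx_scalar -!scalemxAl !scalerA; congr (_ *: _).
by rewrite mulrAC.
Qed.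
End MatrixRing.
HB.lock Definition eigbasis (R : realType) n (A : 'M[R[i]]_n) : 'M[R[i]]_n :=
 spectralmx A.
HB.lock Definition eig (R : realType) n (A : 'M[R[i]]_n) (a : 'I_n) : R :=
 cRe (spectral_diag A 0 a).

(* g(A) for a Hermitian matrix A *)
HB.lock Definition fcal (R : realType) n (A : 'M[R[i]]_n) (g : R -> R) :
 'M[R[i]]_n :=
 (eigbasis A) ^t* *m diag_mx (\row_a (g (eig A a))%:C%C) *m eigbasis A.

(* squared modulus of the a-th coordinate of v in the eigenbasis of A *)
HB.lock Definition wt (R : realType) n (A : 'M[R[i]]_n) (v : 'cV[R[i]]_n) a : R :=
 nsq ((eigbasis A *m v) a 0).
(** The cofactor formula for (z - A)^-1: its entries are rational functions of those of [A], which
    yields measurability of random resolvents at once. *)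
HB.lock Definition res (R : realType) n z (A : 'M[R[i]]_n) : 'M[R[i]]_n :=
 (\det (z%:C%C%:M - A))^-1 *: \adj (z%:C%C%:M - A).
HB.lock Definition rpow (R : realType) n z (A : 'M[R[i]]_n) (r : nat) :
 'M[R[i]]_n :=
 iter r (mulmx (res z A)) 1%:M.

(* Re tr (z - A)^-r *)
HB.lock Definition rtr (R : realType) n z (A : 'M[R[i]]_n) (r : nat) : R :=
 cRe (\tr (rpow z A r)).

(** * Functions of a Hermitian matrix and its resolvent *)

Section SpectralCalculus.
Context (R : realType) (n : nat).
Notation C := R[i].
Implicit Types (A : 'M[C]_n) (g f : R -> R) (z : R).
Notation V := eigbasis.
Let VV A : V A *m (V A) ^t* = 1%:M.
by rewrite eigbasis.unlock; exact/unitarymxP/spectral_unitarymx. Qed.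
Let VV' A : (V A) ^t* *m V A = 1%:M.
by apply: mulmx1C; exact: VV. Qed.
Lemma fcalM A f g : fcal A f *m fcal A g = fcal A (fun t => f t * g t).
rewrite fcal.unlock (sandwich_mul _ _ (VV A)) mulmx_diag.
apply: (congr1 (fun D => (V A) ^t* *m diag_mx D *m V A)); apply/rowP => a.
by rewrite !mxE rmorphM.
Qed.
Lemma fcalD A f g : fcal A f + fcal A g = fcal A (fun t => f t + g t).
rewrite fcal.unlock sandwich_add -linearD.
apply: (congr1 (fun D => (V A) ^t* *m diag_mx D *m V A)); apply/rowP => a.
by rewrite !mxE rmorphD.
Qed.
Lemma fcalZ A (r : R) g : r%:C%C *: fcal A g = fcal A (fun t => r * g t).
rewrite fcal.unlock [in LHS]scalemxAl scalemxAr; apply: (congr1 (fun D => (V A) ^t* *m D *m V A)).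
rewrite -linearZ; congr (diag_mx _).
by apply/rowP => a; rewrite !mxE rmorphM.
Qed.
Lemma fcal_cst A (r : R) : fcal A (fun=> r) = r%:C%C%:M.
rewrite fcal.unlock (_ : diag_mx _ = r%:C%C%:M).
by rewrite mul_mx_scalar -scalemxAl VV' scalemx1.
by rewrite -diag_const_mx; congr diag_mx; apply/rowP => a; rewrite !mxE.
Qed.
Lemma eq_fcal A f g : (forall a, f (eig A a) = g (eig A a)) ->
 fcal A f = fcal A g.
move=> fg; rewrite fcal.unlock; apply: (congr1 (fun D => (V A) ^t* *m D *m V A)); congr (diag_mx _).
by apply/rowP => a; rewrite !mxE fg.
Qed.
Lemma fcal_herm A g : herm (fcal A g).
rewrite /herm fcal.unlock !adjmxM adjmxK !mulmxA; apply: (congr1 (fun D => (V A) ^t* *m D *m V A)).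
rewrite tr_diag_mx map_diag_mx; congr (diag_mx _); apply/rowP => a; rewrite !mxE.
exact: conjR.
Qed.
Lemma fcal_id A : herm A -> fcal A id = A.
move=> hA.
have hs : A \is hermsymmx.
by apply/is_hermitianmxP; rewrite expr0 scale1r -[LHS]hA.
have -> : fcal A id = invmx (V A) *m diag_mx (spectral_diag A) *m V A.
rewrite fcal.unlock (_ : invmx (V A) = (V A) ^t*); last first.
have u : V A \in unitmx by rewrite eigbasis.unlock; exact: spectral_unit.
by rewrite -[LHS]mulmx1 -(VV A) mulmxA mulVmx ?mul1mx.
apply: (congr1 (fun D => (V A) ^t* *m D *m V A)).
congr (diag_mx _); apply/rowP => a; rewrite !mxE eig.unlock.
have /mxOverP /(_ 0 a) := hermitian_spectral_diag_real hs.
by move=> /RRe_real ->.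
by rewrite eigbasis.unlock -(orthomx_spectralP (hermitian_normalmx hs)).
Qed.
Lemma fcal_tr A g : \tr (fcal A g) = (\sum_a g (eig A a))%:C%C.
rewrite fcal.unlock mxtrace_mulC mulmxA VV mul1mx mxtrace_diag rmorph_sum.
by apply: eq_bigr => a _; rewrite mxE.
Qed.
Lemma wt_def A v a : wt A v a = nsq ((V A *m v) a 0).
by rewrite wt.unlock. Qed.
Lemma wt_ge0 A v a : 0 <= wt A v a.
by rewrite wt_def nsq_ge0. Qed.
Lemma wt_sum A v : \sum_a wt A v a = vsq v.
rewrite -[RHS](vsq_isom v (VV' A)) vsq_def.
by apply: eq_bigr => a _; rewrite wt_def. Qed.
Lemma rq_fcal A g v : rq (fcal A g) v = \sum_a g (eig A a) * wt A v a.
rewrite !rq_def fcal.unlock -!mulmxA vdotMr adjmxK vdotE Re_sum.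
apply: eq_bigr => a _; rewrite mul_diag_mx !mxE mulrCA nsqE.
by rewrite Re_mulCl wt_def mxE.
Qed.
Lemma vsq_fcal A g v : vsq (fcal A g *m v) = \sum_a g (eig A a) ^+ 2 * wt A v a.
have h := fcal_herm A (fun t => g t * g t).
apply/complexI; rewrite -vdotvv vdotMl fcal_herm mulmxA fcalM rqE //.
by rewrite rq_fcal.
Qed.
Definition below A z := forall a, eig A a < z.
Lemma belowW A z z' : z <= z' -> below A z -> below A z'.
by move=> zz b a; exact: lt_le_trans (b a) zz. Qed.
Lemma rq_eig A v : herm A -> rq A v = \sum_a eig A a * wt A v a.
by move=> hA; rewrite -{1}[A]fcal_id // rq_fcal. Qed.
Lemma belowP A z : herm A ->
 (below A z <-> forall v, v != 0 -> rq A v < z * vsq v).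
move=> hA; split => [b v v0|h a].
rewrite rq_eig // -(wt_sum A) mulr_sumr -subr_gt0 -sumrB.
have h a : 0 <= z * wt A v a - eig A a * wt A v a.
by rewrite -mulrBl mulr_ge0 ?wt_ge0 // subr_ge0 ltW.
rewrite lt_neqAle sumr_ge0 // andbT eq_sym psumr_eq0 //.
apply/negP => /allP e.
have /eqP : vsq v != 0 by rewrite vsq_eq0.
apply; rewrite -(wt_sum A); apply: big1 => a _.
have := e a (mem_index_enum a); rewrite /= -mulrBl mulf_eq0.
by rewrite subr_eq0 gt_eqF //= => /eqP.
pose v := (V A) ^t* *m (delta_mx a 0 : 'cV[C]_n).
have w b : wt A v b = (b == a)%:R.
rewrite wt_def /v mulmxA VV mul1mx mxE andbT.
by case: eqP => _; rewrite /nsq /= !(expr0n, expr1n) addr0.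
have s (g : R -> R) : \sum_b g (eig A b) * wt A v b = g (eig A a).
rewrite (bigD1 a) //= w eqxx mulr1 big1 ?addr0 // => b ba.
by rewrite w (negbTE ba) mulr0.
have v1 : vsq v = 1.
by rewrite -(wt_sum A) -[RHS](s (fun=> 1)); apply: eq_bigr => b _; rewrite mul1r.
have v0 : v != 0 by rewrite -vsq_eq0 v1 oner_eq0.
by have := h v v0; rewrite rq_eig // (s id) v1 mulr1.
Qed.
Lemma shift_fcal z A : herm A -> z%:C%C%:M - A = fcal A (fun t => z - t).
move=> hA; rewrite -fcalD fcal_cst; congr (_ + _).
rewrite (eq_fcal (g := fun t => -1 * t)) => [|a]; last by rewrite mulN1r.
by rewrite -fcalZ rmorphN1 scaleN1r (fcal_id hA).
Qed.
Lemma res_mul z A : herm A -> below A z ->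
 res z A *m (z%:C%C%:M - A) = 1%:M /\ (z%:C%C%:M - A) *m res z A = 1%:M.
move=> hA b; suff u : z%:C%C%:M - A \in unitmx.
have -> : res z A = invmx (z%:C%C%:M - A) by rewrite /invmx u res.unlock.
by rewrite mulVmx // mulmxV.
have /mulmx1_unit [] // : (z%:C%C%:M - A) *m fcal A (fun t => (z - t)^-1) = 1%:M.
rewrite shift_fcal // fcalM (eq_fcal (g := fun=> 1)) ?fcal_cst // => a.
by rewrite mulfV // gt_eqF // subr_gt0.
Qed.
Lemma res_uniq z A B : herm A -> below A z ->
 (z%:C%C%:M - A) *m B = 1%:M -> res z A = B.
move=> hA b e; have [r1 r2] := res_mul hA b.
by rewrite -[LHS]mulmx1 -e mulmxA r1 mul1mx.
Qed.
Lemma res_fcal z A : herm A -> below A z ->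
 res z A = fcal A (fun t => (z - t)^-1).
move=> hA b; apply: res_uniq => //.
rewrite shift_fcal // fcalM (eq_fcal (g := fun=> 1)) ?fcal_cst // => a.
by rewrite mulfV // gt_eqF // subr_gt0.
Qed.
Lemma res_herm z A : herm A -> below A z -> herm (res z A).
by move=> hA b; rewrite res_fcal //; exact: fcal_herm. Qed.
Lemma rpow0 z A : rpow z A 0 = 1%:M.
by rewrite rpow.unlock. Qed.
Lemma rpowS z A r : rpow z A r.+1 = res z A *m rpow z A r.
by rewrite rpow.unlock iterS. Qed.
Lemma rpow1 z A : rpow z A 1 = res z A.
by rewrite rpowS rpow0 mulmx1. Qed.
Lemma rpow_fcal z A r : herm A -> below A z ->
 rpow z A r = fcal A (fun t => (z - t)^-1 ^+ r).
move=> hA b; elim: r => [|r IH]; first by rewrite rpow0 fcal_cst.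
rewrite rpowS IH (res_fcal hA b) (fcalM A (fun t => (z - t)^-1)).
by apply: eq_fcal => a; rewrite exprS.
Qed.
Lemma rpow_comm z A r : herm A -> below A z ->
 res z A *m rpow z A r *m res z A = rpow z A r.+2.
move=> hA b; rewrite (rpow_fcal r.+2 hA b) (rpow_fcal r hA b) (res_fcal hA b).
rewrite (fcalM A (fun t => (z - t)^-1)).
rewrite (fcalM A (fun t => (z - t)^-1 * (z - t)^-1 ^+ r)).
by apply: eq_fcal => a; rewrite !exprS mulrAC mulrA.
Qed.
Lemma rtr_def z A r : rtr z A r = cRe (\tr (rpow z A r)).
by rewrite rtr.unlock. Qed.
Lemma rtrE z A r : herm A -> below A z ->
 rtr z A r = \sum_a (z - eig A a)^-1 ^+ r.
by move=> hA b; rewrite rtr_def rpow_fcal // fcal_tr. Qed.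
Lemma rq_rpow z A r v : herm A -> below A z ->
 rq (rpow z A r) v = \sum_a (z - eig A a)^-1 ^+ r * wt A v a.
by move=> hA b; rewrite rpow_fcal // rq_fcal. Qed.
End SpectralCalculus.
HB.lock Definition frob2 (R : realType) m n (M : 'M[R[i]]_(m, n)) : R :=
 \sum_i \sum_j nsq (M i j).

(** * Frobenius norms *)

Section Frobenius.
Context (R : realType).
Notation C := R[i].
Lemma frob2E m n (M : 'M[C]_(m, n)) :
 frob2 M = \sum_i \sum_j nsq (M i j).
by rewrite frob2.unlock. Qed.
Lemma frob2_ge0 m n (M : 'M[C]_(m, n)) : 0 <= frob2 M.
by rewrite frob2E; apply: sumr_ge0 => i _; apply: sumr_ge0 => j _; exact: nsq_ge0.
Qed.
Lemma frob2_col m n (M : 'M[C]_(m, n)) : frob2 M = \sum_j vsq (col j M).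
rewrite frob2E exchange_big; apply: eq_bigr => j _.
by rewrite vsq_def; apply: eq_bigr => i _; rewrite mxE.
Qed.
Lemma frob2_adj m n (M : 'M[C]_(m, n)) : frob2 (M ^t*) = frob2 M.
rewrite !frob2E exchange_big; apply: eq_bigr => j _.
by apply: eq_bigr => i _; rewrite !mxE nsqJ.
Qed.
Lemma frob2Z m n a (M : 'M[C]_(m, n)) : frob2 (a *: M) = nsq a * frob2 M.
rewrite !frob2E mulr_sumr; apply: eq_bigr => i _; rewrite mulr_sumr.
by apply: eq_bigr => j _; rewrite mxE nsqM.
Qed.
Lemma frob2_tr m n (M : 'M[C]_(m, n)) : frob2 M = cRe (\tr (M *m M ^t*)).
rewrite !frob2E /mxtrace Re_sum; apply: eq_bigr => i _.
rewrite mxE Re_sum; apply: eq_bigr => j _.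
by rewrite !mxE mulrC nsqE.
Qed.
Lemma frob2_rank1 n (v : 'cV[C]_n) : frob2 (v *m v ^t*) = vsq v ^+ 2.
rewrite !frob2E expr2 vsq_def mulr_suml; apply: eq_bigr => i _.
rewrite mulr_sumr; apply: eq_bigr => j _.
by rewrite !mxE big_ord1 !mxE nsqM nsqJ.
Qed.
Lemma frob2_scalar n (r : R) : frob2 (r%:C%C%:M : 'M[C]_n) = n%:R * r ^+ 2.
have h i : \sum_(j < n) nsq ((r%:C%C%:M : 'M[C]_n) i j) = r ^+ 2.
rewrite (bigD1 i) //= mxE eqxx nsqR big1 ?addr0 // => j ji.
by rewrite mxE eq_sym (negbTE ji) /nsq /= !expr0n addr0.
rewrite !frob2E (eq_bigr (fun=> r ^+ 2)) => [|i _]; last exact: h.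
by rewrite sumr_const card_ord mulr_natl.
Qed.
Lemma frob2_fcal n (A : 'M[C]_n) g : frob2 (fcal A g) = \sum_a g (eig A a) ^+ 2.
by rewrite frob2_tr fcal_herm fcalM fcal_tr. Qed.
Lemma frob2_fcal_mul n m (A : 'M[C]_n) (M : 'M[C]_(n, m)) g (K : R) :
 (forall a, g (eig A a) ^+ 2 <= K) -> frob2 (fcal A g *m M) <= K * frob2 M.
move=> gK; rewrite !frob2_col mulr_sumr; apply: ler_sum => j _.
rewrite -(wt_sum A (col j M)) mulr_sumr (_ : col j _ = fcal A g *m col j M).
rewrite vsq_fcal; apply: ler_sum => a _; apply: ler_wpM2r => //; exact: wt_ge0.
by rewrite !colE mulmxA.
Qed.
End Frobenius.

(** * Rank-one updates: traces, positivity and resolvents *)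

Section RankOneTraces.
Context (R : realType) (n : nat).
Notation C := R[i].
Variables (Q : 'M[C]_n) (w : 'cV[C]_n) (k s2 s3 s4 : R)
 (ww : vdot w w = (s2%:C)%C) (wQw : vdot w (Q *m w) = (s3%:C)%C)
 (wQQw : vdot w (Q *m Q *m w) = (s4%:C)%C).
Let E : 'M[C]_n := k%:C%C *: (w *m w ^t*).
Let wwM : w ^t* *m w = ((s2%:C)%C)%:M.
by apply/matrixP => i j; rewrite !ord1 [RHS]mxE eqxx mulr1n -ww. Qed.
Let EE : E *m E = ((k * s2)%:C)%C *: E.
by rewrite rmorphM; exact: rank1_sq wwM. Qed.
Let trE (M : 'M[C]_n) : \tr (M *m E) = k%:C%C * vdot w (M *m w).
exact: tr_rank1. Qed.
Let trE1 : \tr E = ((k * s2)%:C)%C.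
by have := trE 1%:M; rewrite !mul1mx ww => ->; rewrite rmorphM. Qed.
Let trEE : \tr (E *m E) = ((k * s2 * (k * s2))%:C)%C.
by rewrite EE mxtraceZ trE1 [in RHS]rmorphM. Qed.
Let trQE : \tr (Q *m E) = ((k * s3)%:C)%C.
by rewrite trE wQw [in RHS]rmorphM. Qed.
Let trQQE : \tr (Q *m Q *m E) = ((k * s4)%:C)%C.
by rewrite trE wQQw [in RHS]rmorphM. Qed.
Let trQEE : \tr (Q *m (E *m E)) = ((k * s2 * (k * s3))%:C)%C.
by rewrite EE -scalemxAr mxtraceZ trQE [in RHS]rmorphM. Qed.
Let trEEE : \tr (E *m (E *m E)) = ((k * s2 * (k * s2 * (k * s2)))%:C)%C.
by rewrite EE -scalemxAr mxtraceZ trEE [in RHS]rmorphM. Qed.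
Lemma rank1_trace1 : cRe (\tr (Q + E)) = cRe (\tr Q) + k * s2.
by rewrite mxtraceD trE1 Re_add. Qed.
Let RnM m (r : R) : cRe (m%:R * (r%:C)%C) = m%:R * r.
have -> : m%:R = ((m%:R : R)%:C)%C :> C by rewrite rmorph_nat.
by rewrite Re_mul /= mul0r subr0. Qed.
Lemma rank1_trace2 : cRe (\tr ((Q + E) *m (Q + E))) =
 cRe (\tr (Q *m Q)) + (2 * k * s3 + k ^+ 2 * s2 ^+ 2).
by rewrite tr_sqD trEE trQE !Re_add RnM /=; ring. Qed.
Lemma rank1_trace3 : cRe (\tr ((Q + E) *m ((Q + E) *m (Q + E)))) =
 cRe (\tr (Q *m (Q *m Q))) +
 (3 * k * s4 + 3 * k ^+ 2 * s3 * s2 + k ^+ 3 * s2 ^+ 3).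
by rewrite tr_cubeD trEEE trQEE trQQE !Re_add !RnM /=; ring. Qed.
End RankOneTraces.

Section RankOneForms.
Context (R : realType) (n : nat).
Notation C := R[i].
Variables (B Q : 'M[C]_n) (x : 'cV[C]_n) (q : R)
 (hB : herm B) (BQ : B *m Q = 1%:M)
 (qE : vdot x (Q *m x) = (q%:C)%C).
Lemma rank1_form_sq (v : 'cV[C]_n) (t : C) : t = vdot x v ->
 rq B (v - t *: (Q *m x)) = rq B v - nsq t * (2 - q).
move=> tE; have BQx : B *m (Q *m x) = x by rewrite mulmxA BQ mul1mx.
rewrite !rq_def mulmxBr -scalemxAr BQx vdotBr !vdotBl vdotZr !vdotZl vdotZr.
rewrite [vdot v x]vdotC -tE [vdot (Q *m x) (B *m v)]vdotMr hB BQx -tE.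
have -> : vdot (Q *m x) x = (q%:C)%C by rewrite vdotC qE conjR.
have -> : t * Num.conj t = ((nsq t)%:C)%C by rewrite mulrC nsqE.
have -> : Num.conj t * (t * (q%:C)%C) = ((nsq t * q)%:C)%C.
by rewrite mulrA nsqE rmorphM.
by rewrite nsqE !Re_sub /=; ring.
Qed.
Lemma rank1_form_res : rq B (Q *m x) = q.
by rewrite rq_def mulmxA BQ mul1mx vdotC cRe_conj qE. Qed.
End RankOneForms.

Section RankOneUpdate.
Context (R : realType) (n : nat).
Notation C := R[i].
Variables (A : 'M[C]_n) (z : R) (x : 'cV[C]_n)
 (hA : herm A)
 (bA : below A z).
Notation A1 := (A + x *m x ^t*).
Notation q := (rq (res z A) x).
Notation k := ((1 - rq (res z A) x)^-1).
Notation s r := (rq (rpow z A r) x).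
Let hQ : herm (res z A). exact: res_herm. Qed.
Let qE : vdot x (res z A *m x) = (q%:C)%C. exact: rqE. Qed.
Let hB : herm ((z%:C)%C%:M - A).
by apply: hermB => //; exact: herm_scalar. Qed.
Let r2 := (res_mul hA bA).2.
Lemma rank1_herm : herm A1. by apply: hermD => //; exact: herm_gram. Qed.
Let rqA1 v : rq A1 v = z * vsq v - rq ((z%:C)%C%:M - A) v + nsq (vdot x v).
by rewrite rqD rqB rq_scalar rq_gram vsq1 subKr.
Qed.
(** Evaluating the positive form B = z - A at v - t Q x with t = <x, v> gives B(v) >= (2 - q) |t|^2.
    This exceeds |t|^2 when t is nonzero and q < 1, so z - A1 = B - x x^H stays positive
    definite. *)
Lemma rank1_below : q < 1 -> below A1 z.
move=> q1; apply/(belowP z rank1_herm) => v v0.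
have bB u : u != 0 -> 0 < rq ((z%:C)%C%:M - A) u.
by move=> u0; rewrite rqB rq_scalar subr_gt0; exact: ((belowP z hA).1 bA).
have bB0 u : 0 <= rq ((z%:C)%C%:M - A) u.
have [->|u0] := eqVneq u 0; last exact: ltW (bB _ u0).
by rewrite rq_def vdotC vdot0r cRe_conj.
rewrite rqA1.
have := bB0 (v - vdot x v *: (res z A *m x)).
rewrite (rank1_form_sq hB r2 qE erefl).
have := bB v v0.
have [t0|t0] := eqVneq (vdot x v) 0.
by rewrite t0 nsq0; move: (rq _ v) (z * _) => a b; lra.
have : 0 < nsq (vdot x v) by rewrite lt_neqAle nsq_ge0 andbT eq_sym nsq_eq0.
move: (rq _ v) (nsq _) (z * _) (q) q1 => a b c q1 q11; nra.
Qed.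
(** Tested at Q x, the positive form z - A1 takes the value q - q^2, and q >= 0. *)
Lemma rank1_lt1 : below A1 z -> q < 1.
move=> b1; have [x0|x0] := eqVneq x 0.
by rewrite rq_def x0 mulmx0 vdot0r.
have Qx0 : res z A *m x != 0.
by apply: contra x0 => /eqP e; rewrite -[x]mul1mx -r2 -mulmxA e mulmx0.
have := (belowP z rank1_herm).1 b1 _ Qx0.
rewrite rqA1 (rank1_form_res r2 qE) qE nsqR.
have : 0 <= q.
rewrite (res_fcal hA bA) rq_fcal; apply: sumr_ge0 => a _.
by rewrite mulr_ge0 ?wt_ge0 // invr_ge0 subr_ge0 ltW.
by move: (z * _) (q) => u q'; nra.
Qed.
Hypothesis q1 : q < 1.
Let k1 : 1 - q != 0. by rewrite gt_eqF // subr_gt0. Qed.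
Lemma rank1_res : res z A1 =
 res z A + k%:C%C *: ((res z A *m x) *m (res z A *m x) ^t*).
apply: res_uniq; [exact: rank1_herm|exact: rank1_below|].
have -> : (res z A *m x) ^t* = x ^t* *m res z A by rewrite adjmxM hQ.
have -> : z%:C%C%:M - A1 = (z%:C%C%:M - A) - x *m x ^t* by rewrite opprD addrA.
apply: (sherman_morrison r2 (q := (q%:C)%C)).
by apply/matrixP => i j; rewrite !ord1 [RHS]mxE eqxx mulr1n -qE.
have -> : 1 - (q%:C)%C = ((1 - q)%:C)%C :> C by rewrite rmorphB rmorph1.
by rewrite -rmorphM /= mulVf.
Qed.
Lemma vdot_rpow r : vdot (res z A *m x) (rpow z A r *m (res z A *m x)) =
 ((s r.+2)%:C)%C.
rewrite vdotMl hQ !mulmxA (rpow_comm r hA bA); apply: rqE.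
by rewrite (rpow_fcal r.+2 hA bA); exact: fcal_herm.
Qed.
Let ww : vdot (res z A *m x) (res z A *m x) = ((s 2)%:C)%C.
by rewrite -(vdot_rpow 0) [rpow _ _ 0]rpow0 mul1mx. Qed.
Let wQw : vdot (res z A *m x) (res z A *m (res z A *m x)) = ((s 3)%:C)%C.
by rewrite -(vdot_rpow 1) rpow1. Qed.
Let rpow2 (B : 'M[C]_n) : rpow z B 2 = res z B *m res z B.
by rewrite rpowS rpow1. Qed.
Let wQQw : vdot (res z A *m x) (res z A *m res z A *m (res z A *m x)) =
 ((s 4)%:C)%C.
by rewrite -(vdot_rpow 2) rpow2. Qed.
Lemma rank1_rtr1 : rtr z A1 1 = rtr z A 1 + k * s 2.
by rewrite !rtr_def !rpow1 rank1_res; exact: rank1_trace1. Qed.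
Lemma rank1_rtr2 : rtr z A1 2 = rtr z A 2 + (2 * k * s 3 + k ^+ 2 * s 2 ^+ 2).
have := rank1_trace2 k ww wQw.
by rewrite !rtr_def !rpow2 rank1_res. Qed.
Lemma rank1_rtr3 : rtr z A1 3 = rtr z A 3 +
 (3 * k * s 4 + 3 * k ^+ 2 * s 3 * s 2 + k ^+ 3 * s 2 ^+ 3).
have e (B : 'M[C]_n) : rpow z B 3 = res z B *m (res z B *m res z B).
by rewrite rpowS rpow2.
have := rank1_trace3 k ww wQw wQQw.
by rewrite !rtr_def !e rank1_res.
Qed.
Lemma rank1_rq v : rq (res z A1) v =
 rq (res z A) v + k * nsq (vdot v (res z A *m x)).
rewrite rank1_res rqD rqZ; congr (_ + _ * _).
by rewrite rq_gram vsq1 vdotC nsqJ.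
Qed.
End RankOneUpdate.

(** * Resolvent traces and forms when the spectral parameter moves *)

Section ResolventFunctionals.
Context (R : realType) (n : nat).
Notation C := R[i].
Implicit Types (A : 'M[C]_n) (z h K : R).
Let den_gt0 A z a : below A z -> 0 < (z - eig A a)^-1.
by move=> b; rewrite invr_gt0 subr_gt0. Qed.
Lemma rtr_ge0 A z r : herm A -> below A z -> 0 <= rtr z A r.
by move=> hA b; rewrite rtrE // sumr_ge0 // => a _; rewrite exprn_ge0 // ltW // den_gt0.
Qed.
Lemma rq_rpow_ge0 A z r v : herm A -> below A z -> 0 <= rq (rpow z A r) v.
move=> hA b; rewrite rq_rpow // sumr_ge0 // => a _.
by rewrite mulr_ge0 ?wt_ge0 // exprn_ge0 // ltW // den_gt0.
Qed.
Lemma frob2_rpow A z r : herm A -> below A z -> frob2 (rpow z A r) = rtr z A r.*2.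
move=> hA b; rewrite rpow_fcal // frob2_fcal rtrE //.
by apply: eq_bigr => a _; rewrite -exprM muln2.
Qed.
(** If M is the norm of the resolvent, M^3 is at most its third trace S, and the k-th trace is at
    most S M^(k-3). Cubing avoids fractional exponents. One bound on the third trace thus controls
    all higher ones. *)
Lemma rtr_expr3 A z k : herm A -> below A z -> (3 <= k)%N ->
 rtr z A k ^+ 3 <= rtr z A 3 ^+ k.
move=> hA b k3; rewrite !rtrE //; set S := \sum_a _ ^+ 3.
have a0 a : 0 <= (z - eig A a)^-1 by rewrite ltW // den_gt0.
have aS a : (z - eig A a)^-1 ^+ 3 <= S.
by rewrite /S (bigD1 a) //= lerDl sumr_ge0 // => c _; rewrite exprn_ge0.
have S0 : 0 <= S by rewrite sumr_ge0 // => c _; rewrite exprn_ge0.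
case: (posnP n) => [n0|n0].
have e F : \sum_(a < n) F a = 0 :> R.
apply: big1 => i _; have := ltn_ord i.
by move: (nat_of_ord i) => j; rewrite n0.
by rewrite /S !e expr0n /= exprn_ge0.
pose M := \big[Num.max/0]_a (z - eig A a)^-1.
have aM a : (z - eig A a)^-1 <= M by rewrite /M (bigD1 a) //= le_max lexx.
have M0 : 0 <= M by exact: le_trans (a0 (Ordinal n0)) (aM _).
have MS : M ^+ 3 <= S.
rewrite /M; elim/big_ind: _ => // [|u v hu hv]; first by rewrite expr0n.
by rewrite /Num.max; case: ifP.
have : \sum_a (z - eig A a)^-1 ^+ k <= S * M ^+ (k - 3).
rewrite /S mulr_suml; apply: ler_sum => a _.
rewrite -{1}(subnKC k3) exprD ler_wpM2l ?exprn_ge0 //.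
by rewrite lerXn2r ?nnegrE.
have l0 : 0 <= \sum_a (z - eig A a)^-1 ^+ k.
by apply: sumr_ge0 => a _; rewrite exprn_ge0.
move=> h; have M3 : 0 <= M ^+ (k - 3) by rewrite exprn_ge0.
apply: (letr ((S * M ^+ (k - 3)) ^+ 3)).
by rewrite lerXn2r ?nnegrE // mulr_ge0.
have -> : S ^+ k = S ^+ 3 * S ^+ (k - 3) by rewrite -exprD subnKC.
rewrite exprMn; apply: ler_wpM2l; first by rewrite exprn_ge0.
rewrite -exprM mulnC exprM lerXn2r ?nnegrE //; exact: exprn_ge0.
Qed.
Lemma rtr2_le A z : herm A -> below A z -> rtr z A 2 <= n%:R + rtr z A 3.
move=> hA b; rewrite !rtrE // -[n%:R]mulr1 mulr_natl -[n in _ *+ n]card_ord -sumr_const -big_split.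
apply: ler_sum => a _ /=.
have : 0 <= (z - eig A a)^-1 by rewrite ltW // den_gt0.
move: _^-1 => y y0; rewrite exprS [y ^+ 3]exprS expr1 expr2.
have [y1|/ltW y1] := lerP y 1.
have : 0 <= y * (y * y) by rewrite !mulr_ge0.
 nra.
have : 0 <= y * y * (y - 1) by rewrite !mulr_ge0 // subr_ge0.
lra.
Qed.

Section Shift.
Variables (A : 'M[C]_n) (z z' h : R)
 (hA : herm A) (bA : below A z) (h0 : 0 <= h) (zE : z' = z + h).
Lemma below_shift : below A z'.
by apply: belowW bA; rewrite zE lerDl. Qed.
Let b' : below A z' := below_shift.
Let shiftE a : (z - eig A a)^-1 =
 (z' - eig A a)^-1 + h * (z - eig A a)^-1 * (z' - eig A a)^-1.
have d1 : z - eig A a != 0 by rewrite gt_eqF // subr_gt0.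
have d2 : z' - eig A a != 0 by rewrite gt_eqF // subr_gt0.
rewrite zE in d2 *.
by move: (eig A a) d1 d2 => l d1 d2; field; rewrite d2 d1.
Qed.
Let bern (y : R) r : 0 <= y -> 1 + r%:R * y <= (1 + y) ^+ r.
move=> y0; elim: r => [|r IH]; first by rewrite mul0r addr0.
rewrite exprS; apply: (letr ((1 + y) * (1 + r%:R * y))).
have : 0 <= r%:R * y ^+ 2 by rewrite mulr_ge0 ?sqr_ge0.
by rewrite -[r.+1%:R]natr1 expr2; move: (r%:R : R) => u; lra.
by apply: ler_wpM2l => //; rewrite addr_ge0.
Qed.
(** With v and u the values of an inverse distance before and after the shift, v = u + h v u >= u (1
    + h u); Bernoulli's inequality handles the r-th power. *)
Lemma rtr_shift r : rtr z' A r + r%:R * h * rtr z' A r.+1 <= rtr z A r.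
rewrite !rtrE // mulr_sumr -big_split; apply: ler_sum => a _ /=.
have p := ltW (den_gt0 a bA); have p' := ltW (den_gt0 a b').
set u := (z' - _)^-1 in p' *; set v := (z - _)^-1 in p *.
have vE : v = u + h * v * u by exact: shiftE.
have uv : u <= v by rewrite vE lerDl !mulr_ge0.
have -> : u ^+ r + r%:R * h * u ^+ r.+1 = u ^+ r * (1 + r%:R * (h * u)).
by rewrite exprS; ring.
apply: (letr (u ^+ r * (1 + h * u) ^+ r)).
by apply: ler_wpM2l; [exact: exprn_ge0|apply: bern; exact: mulr_ge0].
rewrite -exprMn lerXn2r ?nnegrE ?mulr_ge0 ?addr_ge0 ?mulr_ge0 //.
by rewrite vE mulrDr mulr1 lerD2l mulrC; apply: ler_wpM2r => //; apply: ler_wpM2l.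
Qed.
Lemma rq_shift_lower v :
 rq (res z' A) v + h * rq (rpow z' A 2) v <= rq (res z A) v.
rewrite -(rpow1 z' A) -(rpow1 z A).
rewrite (rq_rpow 1 v hA b') (rq_rpow 1 v hA bA) (rq_rpow 2 v hA b') mulr_sumr -big_split; apply: ler_sum => a _ /=.
have p := ltW (den_gt0 a bA); have p' := ltW (den_gt0 a b').
rewrite mulrA -mulrDl; apply: ler_wpM2r; first exact: wt_ge0.
set u := (z' - _)^-1 in p' *; set t := (z - _)^-1 in p *.
have vE : t = u + h * t * u by exact: shiftE.
have uv : u <= t by rewrite vE lerDl !mulr_ge0.
rewrite !expr1 [leRHS]vE lerD2l expr2 mulrA; apply: ler_wpM2r => //.
exact: ler_wpM2l.
Qed.
(** The converse of [rq_shift_lower] up to second order: v = u + h v u and v <= K give v <= u (1 + h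
    K). *)
Lemma rq_shift_upper K v : (forall a, (z - eig A a)^-1 <= K) ->
 rq (res z A) v <=
 rq (res z' A) v + h * (1 + h * K) * rq (rpow z' A 2) v.
move=> hK; rewrite -(rpow1 z' A) -(rpow1 z A).
rewrite (rq_rpow 1 v hA b') (rq_rpow 1 v hA bA) (rq_rpow 2 v hA b') mulr_sumr -big_split; apply: ler_sum => a _ /=.
have p := ltW (den_gt0 a bA); have p' := ltW (den_gt0 a b').
rewrite mulrA -mulrDl; apply: ler_wpM2r; first exact: wt_ge0.
have := hK a.
set u := (z' - _)^-1 in p' *; set t := (z - _)^-1 in p *.
have vE : t = u + h * t * u by exact: shiftE.
move=> tK; rewrite !expr1 {1}vE lerD2l expr2 -!mulrA; apply: ler_wpM2l => //.
rewrite mulrA; apply: ler_wpM2r => //.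
rewrite {1}vE mulrDl mul1r lerD2l -!mulrA; apply: ler_wpM2l => //.
exact: ler_wpM2r.
Qed.
End Shift.
Lemma herm0 : herm (0 : 'M[C]_n). by rewrite /herm adjmx0. Qed.
Lemma below0 z : 0 < z -> below (0 : 'M[C]_n) z.
move=> z0; apply/(belowP _ herm0) => v v0.
by rewrite rq_def mul0mx vdot0r mulr_gt0 // vsq_gt0.
Qed.
Lemma res0 z : 0 < z -> res z (0 : 'M[C]_n) = ((z^-1)%:C)%C%:M.
move=> z0; apply: res_uniq; [exact: herm0|exact: below0|].
by rewrite subr0 mul_scalar_mx scale_scalar_mx -rmorphM /= mulfV ?gt_eqF.
Qed.
Lemma rtr0 z r : 0 < z -> rtr z (0 : 'M[C]_n) r = n%:R * z^-1 ^+ r.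
move=> z0; rewrite rtr_def; have -> : rpow z (0 : 'M[C]_n) r = ((z^-1 ^+ r)%:C)%C%:M.
 elim: r => [|r IH]; first by rewrite rpow0.
by rewrite rpowS IH res0 // mul_scalar_mx scale_scalar_mx -rmorphM -exprS.
by rewrite mxtrace_scalar -rmorphMn /= mulr_natl.
Qed.
End ResolventFunctionals.

(** * Measurability of complex and matrix-valued maps *)

Section ComplexMeasurability.
Context d (T : measurableType d) (R : realType).
Notation C := R[i].
Definition cmeas (f : T -> C) :=
 mfunT (fun w => cRe (f w)) /\
 mfunT (fun w => cIm (f w)).
Lemma cmeas_cst c : cmeas (fun=> c).
by split; exact: measurable_cst. Qed.
Lemma cmeas_real (f : T -> R) : mfunT f ->
 cmeas (fun w => (f w)%:C)%C.
by split => //; exact: measurable_cst. Qed.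
Lemma cmeasD f g : cmeas f -> cmeas g -> cmeas (fun w => f w + g w).
move=> [f1 f2] [g1 g2]; split.
by under eq_fun do rewrite Re_add; exact: measurable_funD.
by under eq_fun do rewrite Im_add; exact: measurable_funD.
Qed.
Lemma cmeasM f g : cmeas f -> cmeas g -> cmeas (fun w => f w * g w).
move=> [f1 f2] [g1 g2]; split.
under eq_fun do rewrite Re_mul.
by apply: measurable_funB; apply: measurable_funM.
under eq_fun do rewrite Im_mul.
by apply: measurable_funD; apply: measurable_funM.
Qed.
Lemma cmeas_conj f : cmeas f -> cmeas (fun w => Num.conj (f w)).
move=> [f1 f2]; split; first by under eq_fun do rewrite cRe_conj.
under eq_fun do rewrite cIm_conj.
exact: (measurableT_comp (@oppr_measurable R setT)).
Qed.
Lemma cmeas_sum (I : Type) (s : seq I) (F : I -> T -> C) :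
 (forall i, cmeas (F i)) -> cmeas (fun w => \sum_(i <- s) F i w).
move=> h; elim: s => [|a s IH].
by under eq_fun do rewrite big_nil; by [].
by under eq_fun do rewrite big_cons; exact: cmeasD.
Qed.
Lemma cmeas_prod (I : Type) (s : seq I) (F : I -> T -> C) :
 (forall i, cmeas (F i)) -> cmeas (fun w => \prod_(i <- s) F i w).
move=> h; elim: s => [|a s IH].
by under eq_fun do rewrite big_nil; by [].
by under eq_fun do rewrite big_cons; exact: cmeasM.
Qed.
Lemma nsq_measurable f : cmeas f -> mfunT (fun w => nsq (f w)).
by move=> [f1 f2]; apply: measurable_funD; apply: measurable_funX.
Qed.
Lemma cinvE (x : C) : x^-1 = ((nsq x)^-1%:C)%C * Num.conj x.
have [->|x0] := eqVneq x 0; first by rewrite invr0 rmorph0 mulr0.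
apply: (mulIf x0); rewrite mulVf // -mulrA nsqE -rmorphM /= mulVf //.
by rewrite nsq_eq0.
Qed.
Lemma cmeasV f : cmeas f -> cmeas (fun w => (f w)^-1).
move=> mf; under eq_fun do rewrite cinvE.
apply: cmeasM; last exact: cmeas_conj.
by apply: cmeas_real; apply: measurable_funV; exact: nsq_measurable.
Qed.
Lemma cmeas_if (b : T -> bool) f : mfunT b -> cmeas f ->
 cmeas (fun w => if b w then f w else 0).
move=> mb [f1 f2]; split.
rewrite (_ : (fun w => _) = fun w => if b w then cRe (f w) else 0).
by apply: measurable_fun_ifT.
by apply/funext => w; case: ifP.
rewrite (_ : (fun w => _) = fun w => if b w then cIm (f w) else 0).
by apply: measurable_fun_ifT.
by apply/funext => w; case: ifP.
Qed.
Definition mxmeas m n (F : T -> 'M[C]_(m, n)) :=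
 forall i j, cmeas (fun w => F w i j).
Lemma mxmeas_cst m n (A : 'M[C]_(m, n)) : mxmeas (fun=> A).
by []. Qed.
Lemma mxmeasD m n (F G : T -> 'M[C]_(m, n)) : mxmeas F -> mxmeas G ->
 mxmeas (fun w => F w + G w).
by move=> f g i j; under eq_fun do rewrite mxE; exact: cmeasD.
Qed.
Lemma mxmeasZ m n a (F : T -> 'M[C]_(m, n)) : cmeas a -> mxmeas F ->
 mxmeas (fun w => a w *: F w).
by move=> f g i j; under eq_fun do rewrite mxE; exact: cmeasM.
Qed.
Lemma mxmeasB m n (F G : T -> 'M[C]_(m, n)) : mxmeas F -> mxmeas G ->
 mxmeas (fun w => F w - G w).
move=> f g; under eq_fun do rewrite -scaleN1r.
by apply: mxmeasD => //; apply: mxmeasZ => //; by [].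
Qed.
Lemma mxmeasM m n p (F : T -> 'M[C]_(m, n)) (G : T -> 'M[C]_(n, p)) :
 mxmeas F -> mxmeas G -> mxmeas (fun w => F w *m G w).
move=> f g i j; under eq_fun do rewrite mxE.
by apply: cmeas_sum => k; exact: cmeasM.
Qed.
Lemma mxmeas_adj m n (F : T -> 'M[C]_(m, n)) : mxmeas F ->
 mxmeas (fun w => (F w) ^t*).
by move=> f i j; under eq_fun do rewrite !mxE; exact: cmeas_conj.
Qed.
Lemma mxmeas_sum (I : Type) (s : seq I) m n (F : I -> T -> 'M[C]_(m, n)) :
 (forall i, mxmeas (F i)) -> mxmeas (fun w => \sum_(i <- s) F i w).
move=> h; elim: s => [|a s IH].
by under eq_fun do rewrite big_nil; by [].
by under eq_fun do rewrite big_cons; exact: mxmeasD.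
Qed.
Lemma mxmeas_if m n (b : T -> bool) (F : T -> 'M[C]_(m, n)) :
 mfunT b -> mxmeas F -> mxmeas (fun w => if b w then F w else 0).
move=> mb f i j.
rewrite (_ : (fun w => _) = fun w => if b w then F w i j else 0).
exact: cmeas_if.
by apply/funext => w; case: ifP => // _; rewrite mxE.
Qed.
Lemma cmeas_det n (F : T -> 'M[C]_n) : mxmeas F -> cmeas (fun w => \det (F w)).
move=> f; rewrite /determinant; apply: cmeas_sum => s.
by apply: cmeasM; [by []|apply: cmeas_prod => i; exact: f].
Qed.
Lemma cmeas_tr n (F : T -> 'M[C]_n) : mxmeas F -> cmeas (fun w => \tr (F w)).
by move=> f; apply: cmeas_sum => i; exact: f. Qed.
Lemma mxmeas_adjugate n (F : T -> 'M[C]_n) : mxmeas F ->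
 mxmeas (fun w => \adj (F w)).
move=> f i j; under eq_fun do rewrite mxE.
apply: cmeasM; first by [].
by apply: cmeas_det => a b; under eq_fun do rewrite !mxE; exact: f.
Qed.
Lemma mxmeas_res n z (F : T -> 'M[C]_n) : mxmeas F ->
 mxmeas (fun w => res z (F w)).
move=> f; rewrite res.unlock.
have h : mxmeas (fun w => (z%:C)%C%:M - F w).
by apply: mxmeasB => //; by [].
by apply: mxmeasZ; [apply: cmeasV; exact: cmeas_det|exact: mxmeas_adjugate].
Qed.
Lemma mxmeas_rpow n z r (F : T -> 'M[C]_n) : mxmeas F ->
 mxmeas (fun w => rpow z (F w) r).
move=> f; elim: r => [|r IH].
by under eq_fun do rewrite rpow0; by [].
by under eq_fun do rewrite rpowS; apply: mxmeasM => //; exact: mxmeas_res.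
Qed.
Lemma rq_measurable n (F : T -> 'M[C]_n) (v : T -> 'cV[C]_n) :
 mxmeas F -> mxmeas v -> mfunT (fun w => rq (F w) (v w)).
move=> f g; rewrite rq.unlock /vdot.
have h : mxmeas (fun w => (v w) ^t* *m (F w *m v w)).
by apply: mxmeasM; [exact: mxmeas_adj|exact: mxmeasM].
exact: (h 0 0).1.
Qed.
Lemma rtr_measurable n z r (F : T -> 'M[C]_n) : mxmeas F ->
 mfunT (fun w => rtr z (F w) r).
move=> f; rewrite rtr.unlock.
exact: (cmeas_tr (mxmeas_rpow z r f)).1.
Qed.
End ComplexMeasurability.

(** * The deterministic barrier argument of the first pass *)

Section BarrierArithmetic.
Context (R : realType).
Implicit Types (x y u b : R).
(** One step of the discrete Riccati recursion: adding b y^2 to y lowers the bound u on 1/y by b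
    only. *)
Lemma inv_step u b y : 0 <= b -> b < u -> y <= u^-1 -> 0 <= y ->
 y + b * y ^+ 2 <= (u - b)^-1.
move=> b0 bu yu y0; have u0 : 0 < u by exact: le_lt_trans bu.
have ub : 0 < u - b by rewrite subr_gt0.
apply: (letr (u^-1 + b * u^-1 ^+ 2)).
apply: lerD => //; apply: ler_wpM2l => //.
by rewrite lerXn2r ?nnegrE // invr_ge0 ltW.
rewrite -[leRHS]mul1r ler_pdivlMr //.
have -> : (u^-1 + b * u^-1 ^+ 2) * (u - b) = 1 - (b * u^-1) ^+ 2.
by field; rewrite gt_eqF.
by rewrite gerBl sqr_ge0.
Qed.
(** [w] is the value of 1/(1 - s) at the ideal point s = e/x. The errors of [t] and [d] cost at most
    eps/4 in w (1 - s), and (1 + eps/2) (1 - eps/4) >= 1. *)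
Lemma pole_bound (x eps kap e w wmax emax t d s : R) :
 0 < eps -> eps <= 1 -> 0 <= kap -> 0 <= e -> e <= emax -> 0 < w ->
 w <= wmax -> w * (1 - e * x^-1) = 1 ->
 4 * wmax * (2 * emax + 1) * kap <= eps ->
 t <= x^-1 + 2 * kap -> d <= kap -> s = e * t + d ->
 s < 1 /\ (1 - s)^-1 <= (1 + eps / 2) * w.
move=> eps0 eps1 kap0 e0 ee w0 ww we hk ht hd ->.
have h1 : e * t <= e * x^-1 + 2 * emax * kap.
apply: (letr (e * (x^-1 + 2 * kap))); first exact: ler_wpM2l.
rewrite mulrDr lerD2l.
have : (emax - e) * kap >= 0 by rewrite mulr_ge0 // subr_ge0.
 lra.
have h2 : 1 - e * x^-1 - (2 * emax + 1) * kap <= 1 - (e * t + d) by lra.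
have h3 : 1 - eps / 4 <= w * (1 - (e * t + d)).
apply: (letr (w * (1 - e * x^-1 - (2 * emax + 1) * kap))); last first.
by apply: ler_wpM2l => //; exact: ltW.
rewrite mulrBr we.
have : 0 <= (wmax - w) * ((2 * emax + 1) * kap).
rewrite mulr_ge0 ?subr_ge0 // mulr_ge0 //.
have := le_trans e0 ee; lra.
 lra.
have s1 : 0 < 1 - (e * t + d).
rewrite -(pmulr_rgt0 _ w0); apply: lt_le_trans h3; lra.
split; first by rewrite -subr_gt0.
rewrite -[leLHS]mul1r ler_pdivrMr // -mulrA.
apply: (letr ((1 + eps / 2) * (1 - eps / 4))).
have : 0 <= eps * (1 - eps / 2) by apply: mulr_ge0; lra.
 lra.
by apply: ler_wpM2l => //; lra.
Qed.
End BarrierArithmetic.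

Section Barrier.
Context (R : realType) (n : nat).
Variables (n0 : (0 < n)%N)
 (x eps kap K3 emin emax wmax u0 t20 t30 : R) (e w : nat -> R)
 (t1 t2 t3 t1' t2' t3' t4' s1 s2 s3 s4 : nat -> R)
 (good : nat -> Prop).
Let nv : R := n%:R^-1.
Let c1 := 1 + eps / 2.
(** The parameter step. In this section [t1], [t2], [t3] are the normalised traces of the resolvent
    powers, primes mark their values after the parameter step, and [s1], ..., [s4] are the forms at
    the new column. The factor 1 + eps beats the factor [c1] = 1 + eps/2 allowed in [k i], so each
    step removes at least what the rank-one update adds. *)
Let h i := (1 + eps) * w i * e i * nv.
Let k i := (1 - s1 i)^-1.
Hypotheses (eps0 : 0 < eps) (eps1 : eps <= 1)
 (kap0 : 0 < kap) (kap1 : kap <= 1)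
 (emin0 : 0 < emin) (he1 : forall i, emin <= e i)
 (he2 : forall i, e i <= emax)
 (hw0 : forall i, 0 < w i) (hw1 : forall i, w i <= wmax)
 (hwe : forall i, w i * (1 - e i * x^-1) = 1)
 (hkap : 4 * wmax * (2 * emax + 1) * kap <= eps).
(** Constants of the recursion for the third trace: [bar_b2] bounds [s2], [bar_L] is the coefficient
    of the mixed term in s3 s2, and [bar_M] bounds the cubic term. *)
Definition bar_b2 := emax / u0.
Definition bar_L := 12 * wmax * bar_b2.
Definition bar_M := 8 * wmax ^+ 3 * bar_b2 ^+ 3.
Notation b2 := bar_b2.
Notation L := bar_L.
Notation M := bar_M.
Let L' := L * wmax * emax.
Let Y0 := t20 + 4 * kap + kap / emin.
Variables (t20_gt0 : 0 < t20) (t30_ge0 : 0 <= t30) (u0_gt0 : 0 < u0)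
 (hu : u0 <= Y0^-1 - \sum_(j < n) nv * (c1 * w j * e j) ^+ 2)
 (hK3 : (t30 + 2 * (6 + L) + M) * expR (L' + 1) <= K3)
 (good0 : good 0%N) (h10 : t1 0%N <= x^-1) (h20 : t2 0%N <= t20)
 (h30 : t3 0%N <= t30)
 (pos : forall i, (i <= n)%N -> good i ->
 [/\ 0 <= t2 i, 0 <= t3 i &
 [/\ 0 <= t2' i, 0 <= t3' i, 0 <= t4' i &
 [/\ 0 <= s2 i, 0 <= s3 i & 0 <= s4 i]]])
 (shift : forall i, (i < n)%N -> good i ->
 [/\ t1' i + h i * t2' i <= t1 i, t2' i + 2 * h i * t3' i <= t2 i &
 t3' i + 3 * h i * t4' i <= t3 i])
 (next : forall i, (i < n)%N -> good i -> s1 i < 1 ->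
 [/\ good i.+1, t1 i.+1 = t1' i + nv * (k i * s2 i),
 t2 i.+1 = t2' i + nv * (2 * k i * s3 i + k i ^+ 2 * s2 i ^+ 2) &
 t3 i.+1 = t3' i + nv * (3 * k i * s4 i + 3 * k i ^+ 2 * s3 i * s2 i +
 k i ^+ 3 * s2 i ^+ 3)]).
Let S (s t : nat -> R) N := \sum_(i < N) nv * (w i * (s i - e i * t i)).
Let ok N := forall i, (i < N)%N -> good i /\ t3' i <= K3.
Hypotheses (sums : forall N, (N <= n)%N -> ok N ->
 [/\ `|S s2 t2' N| <= kap, `|S s3 t3' N| <= kap & `|S s4 t4' N| <= kap])
 (point : forall i, (i < n)%N -> good i -> t3' i <= K3 ->
 `|s1 i - e i * t1' i| <= kap /\ `|s2 i - e i * t2' i| <= kap).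
Let nv0 : 0 < nv. by nneg. Qed.
Let emax0 : 0 < emax. exact: lt_le_trans emin0 (le_trans (he1 0) (he2 0)). Qed.
Let wmax0 : 0 < wmax. exact: lt_le_trans (hw0 0) (hw1 0). Qed.
Let e0 i : 0 < e i. exact: lt_le_trans (he1 i). Qed.
Let b20 : 0 < b2. by nneg. Qed.
Let L0 : 0 < L. by nneg. Qed.
Let M0 : 0 < M. by nneg. Qed.
Let L'0 : 0 < L'. by nneg. Qed.
Let Y00 : 0 < Y0. by nneg. Qed.
Let u i := Y0^-1 - \sum_(j < i) nv * (c1 * w j * e j) ^+ 2.
Let u_ge i : (i <= n)%N -> u0 <= u i.
move=> iN; apply: (le_trans hu); rewrite lerD2l lerN2.
rewrite -(subnKC iN) big_split_ord /= lerDl sumr_ge0 // => j _.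
by nneg.
Qed.
(** The second trace with its martingale part removed. The slack 4 kap outweighs that part, and kap
    / emin absorbs the error in s2, so that s2 <= e Y and the recursion for [Y] is a pure Riccati
    inequality. [V] is built likewise from the third trace. *)
Let Y i := t2 i - 2 * c1 * S s3 t3' i + 4 * kap + kap / emin.
Let V i := t3 i - 3 * c1 * S s4 t4' i - L * S s3 t3' i + (6 + L) * kap.
Let V0 := t30 + 2 * (6 + L).
(** The fluctuation bounds are available only while the third trace is at most [K3], so that bound
    belongs to the induction. [t1] stays near 1/x, [Y] follows the Riccati bound with denominators
    at least [u0], and [V + M] grows at most geometrically (discrete Gronwall). *)
Let inv i := [/\ ok i, good i, t1 i <= x^-1 + c1 * S s2 t2' i, Y i <= (u i)^-1 &
 V i + M <= (V0 + M) * (1 + nv * (L' + 1)) ^+ i].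
Let S_S s t i : S s t i.+1 = S s t i + nv * (w i * (s i - e i * t i)).
by rewrite /S big_ord_recr. Qed.
Let inv0 : inv 0%N.
split => //.
- by rewrite /S big_ord0 mulr0 addr0.
- rewrite /Y /u /S !big_ord0 subr0 invrK mulr0 subr0 /Y0.
by rewrite !lerD2r.
- rewrite /V /S !big_ord0 !mulr0 !subr0 expr0 mulr1 lerD2r /V0.
have : 0 <= (6 + L) * (1 - kap) by rewrite mulr_ge0 ?subr_ge0 // addr_ge0 // ltW // L0.
have : 0 <= 6 + L by nneg.
by move: (6 + L) => z; have := h30; lra.
Qed.
Let grow i : (i <= n)%N -> (1 + nv * (L' + 1)) ^+ i <= expR (L' + 1).
move=> iN; have a0 : 0 <= L' + 1 by nneg.
have b0 : 1 <= 1 + nv * (L' + 1) by rewrite lerDl mulr_ge0 // ltW.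
apply: (letr ((1 + nv * (L' + 1)) ^+ n)); first exact: ler_weXn2l.
have -> : expR (L' + 1) = expR (nv * (L' + 1)) ^+ n.
rewrite -expRM_natr mulrAC /nv mulVf ?mul1r //.
by rewrite pnatr_eq0 -lt0n.
apply: lerXn2r; rewrite ?nnegrE ?expR_ge0 //; first exact: le_trans b0.
exact: expR_ge1Dx.
Qed.
Let step i : (i < n)%N -> inv i -> inv i.+1.
move=> iN [oki gi I1 I2 I3].
have iN' := ltnW iN.
have [S2b S3b S4b] := sums iN' oki.
have [t2p t3p [t2p' t3p' t4p' [s2p s3p s4p]]] := pos iN' gi.
have [f1 f2 f3] := shift iN gi.
have hp : 0 <= h i by nneg.
have c1b : 0 < c1 /\ c1 <= 3 / 2 by move: eps0 eps1; rewrite /c1 => a b; split; lra.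
have [c10 c12] := c1b.
move: S2b S3b S4b; rewrite !ler_norml => /andP[S2l S2u] /andP[S3l S3u] /andP[S4l S4u].
have cS (s : R) : - kap <= s -> s <= kap -> - (3 / 2 * kap) <= c1 * s <= 3 / 2 * kap.
move=> h1 h2; have k0 := ltW kap0.
have : `|c1 * s| <= 3 / 2 * kap.
rewrite normrM gtr0_norm //; apply: ler_pM => //; first exact: ltW.
by rewrite ler_norml h1 h2.
by rewrite ler_norml.
have /andP[c2l c2u] := cS _ S2l S2u.
have /andP[c3l c3u] := cS _ S3l S3u.
have /andP[c4l c4u] := cS _ S4l S4u.
have LS3 : L * S s3 t3' i <= L * kap by rewrite ler_pM2l.
have Vt3 : t3 i <= V i.
by rewrite /V; move: LS3 c4u; move: (S s4 _ _) (S s3 _ _) => a b; lra.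
(* This closes the circle: the Gronwall bound at step [i], which uses earlier increments only,
   licenses the pointwise fluctuation bound at step [i]. *)
have t3K : t3 i <= K3.
apply: le_trans hK3; apply: (letr (V i + M)).
by apply: (le_trans Vt3); rewrite lerDl ltW.
apply: (le_trans I3); apply: ler_pM => //.
 - by rewrite /V0; nneg.
 - by nneg.
 - exact: grow.
have t3K' : t3' i <= K3.
apply: le_trans t3K; apply: le_trans f3.
by rewrite lerDl; nneg.
have [D1 D2] := point iN gi t3K'.
have okS : ok i.+1.
move=> j; rewrite ltnS leq_eqVlt => /orP[/eqP -> //|]; exact: oki.
move: D1 D2; rewrite !ler_norml => /andP[D1l D1u] /andP[D2l D2u].
have t1b : t1' i <= x^-1 + 2 * kap.
have : 0 <= h i * t2' i by nneg.
by move: I1 f1 c2u; lra.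
have [s1lt kb] := @pole_bound R x eps kap (e i) (w i) wmax emax (t1' i)
 (s1 i - e i * t1' i) (s1 i) eps0 eps1 (ltW kap0) (ltW (e0 i)) (he2 i) (hw0 i)
 (hw1 i) (hwe i) hkap t1b D1u (esym (subrKC _ _)).
have [gS n1 n2 n3] := next iN gi s1lt.
rewrite -/(k i) -/c1 in kb.
have k0 : 0 < k i by rewrite invr_gt0 subr_gt0.
have cw0 : 0 < c1 * w i by nneg.
have ei := e0 i; have wi := hw0 i.
have Yt : t2 i + kap / emin <= Y i.
by rewrite /Y; move: c3u; move: (S s3 _ _) => a; lra.
have Yp : 0 <= Y i.
by apply: le_trans Yt; rewrite addr_ge0 // divr_ge0 // ltW.
have kape : kap <= e i * (kap / emin).
rewrite mulrA ler_pdivlMr // mulrC; apply: ler_wpM2r => //; exact: ltW.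
have t2le : t2' i <= t2 i.
have : 0 <= 2 * h i * t3' i by nneg.
 lra.
have s2Y : s2 i <= e i * Y i.
apply: (letr (e i * (t2 i + kap / emin))); last by rewrite ler_pM2l.
have : e i * t2' i <= e i * t2 i by rewrite ler_pM2l.
by rewrite mulrDr; lra.
have ui : u0 <= u i := u_ge iN'.
have uS : u0 <= u i.+1 := u_ge iN.
have uSE : u i.+1 = u i - nv * (c1 * w i * e i) ^+ 2.
by rewrite /u big_ord_recr /= opprD addrA.
have hE : h i = (1 + eps) * (nv * (w i * e i)) by rewrite /h; ring.
have cE : (1 + eps) = c1 + eps / 2 by rewrite /c1; lra.
(* The decrease due to the parameter step covers the mean of the rank-one increase, with eps/2 to
   spare. *)
have drop (t : R) : 0 <= t -> nv * (c1 * w i * (e i * t)) <= h i * t.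
move=> tt; rewrite hE cE.
have : 0 <= eps / 2 * (nv * (w i * e i) * t) by rewrite !mulr_ge0 // ltW.
move=> H; apply: (letr (nv * (c1 * w i * (e i * t)) + eps / 2 * (nv * (w i * e i) * t))).
by rewrite lerDl.
by rewrite le_eqVlt; apply/orP; left; apply/eqP; ring.
have ks (s : R) : 0 <= s -> k i * s <= c1 * w i * s by move=> ss; apply: ler_wpM2r.
split => //.
- rewrite n1 S_S mulrDr.
have d2 := drop _ t2p'.
have : nv * (k i * s2 i) <= nv * (c1 * w i * s2 i) by rewrite ler_pM2l // ks.
have -> : c1 * (nv * (w i * (s2 i - e i * t2' i))) =
 nv * (c1 * w i * s2 i) - nv * (c1 * w i * (e i * t2' i)) by ring.
by move: I1 f1; lra.
- have Ystep : Y i.+1 <= Y i + nv * (c1 * w i * e i) ^+ 2 * Y i ^+ 2.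
rewrite /Y n2 S_S.
have d3 := drop _ t3p'.
have k3 : nv * (2 * k i * s3 i) <= nv * (2 * (c1 * w i * s3 i)).
by rewrite ler_pM2l // -mulrA ler_pM2l // ks.
have k4 : nv * (k i ^+ 2 * s2 i ^+ 2) <= nv * (c1 * w i * e i) ^+ 2 * Y i ^+ 2.
rewrite -mulrA ler_pM2l // -!exprMn; apply: lerXn2r; [nneg|nneg|].
by rewrite -[leRHS]mulrA; apply: ler_pM => //; exact: ltW.
have -> : 2 * c1 * (S s3 t3' i + nv * (w i * (s3 i - e i * t3' i))) =
 2 * c1 * S s3 t3' i + nv * (2 * (c1 * w i * s3 i)) - 2 * (nv * (c1 * w i * (e i * t3' i))).
by ring.
rewrite [nv * (_ + _)]mulrDr.
move: k4; rewrite /Y; move: (nv * _ * _ ^+ 2) (nv * (k i ^+ 2 * _)) => z1 z2.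
by move: f2; lra.
apply: (le_trans Ystep); rewrite uSE; apply: inv_step => //.
by rewrite mulr_ge0 ?sqr_ge0 // ltW.
by rewrite -subr_gt0 -uSE; exact: lt_le_trans uS.
- have Yu : Y i <= u0^-1.
by apply: (le_trans I2); rewrite lef_pV2 ?posrE //; exact: lt_le_trans ui.
have s2b : s2 i <= b2.
apply: (le_trans s2Y); rewrite /b2; apply: ler_pM => //; exact: ltW.
have kw : k i <= 3 / 2 * wmax.
apply: (le_trans kb); apply: ler_pM => //; exact: ltW.
have d4 := drop _ t4p'.
have k4 : nv * (3 * k i * s4 i) <= nv * (3 * (c1 * w i * s4 i)).
by rewrite ler_pM2l // -mulrA ler_pM2l // ks.
(* The factors 3, 3/2 and 3/2 give 27/4, rounded up to the 12 in [L]. *)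
have k32 : nv * (3 * k i ^+ 2 * s3 i * s2 i) <= nv * (L * (w i * s3 i)).
rewrite ler_pM2l //.
have q1 : k i * s2 i <= 3 / 2 * wmax * b2 by apply: ler_pM => //; exact: ltW.
have q2 : k i * s3 i <= 3 / 2 * (w i * s3 i).
apply: (le_trans (ks _ s3p)); rewrite -mulrA; apply: ler_wpM2r => //.
by nneg.
have q3 : (k i * s3 i) * (k i * s2 i) <= (3 / 2 * (w i * s3 i)) * (3 / 2 * wmax * b2).
by apply: ler_pM; [nneg|nneg| |].
have q4 : 0 <= wmax * b2 * (w i * s3 i) by nneg.
have -> : 3 * k i ^+ 2 * s3 i * s2 i = 3 * ((k i * s3 i) * (k i * s2 i)) by ring.
rewrite /L; have -> : 12 * wmax * b2 * (w i * s3 i) = 12 * (wmax * b2 * (w i * s3 i)) by ring.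
move: q3; have -> : (3 / 2 * (w i * s3 i)) * (3 / 2 * wmax * b2) = 9 / 4 * (wmax * b2 * (w i * s3 i)) by field.
move: (wmax * _ * _) q4 (k i * _ * _) => z z0 z1; lra.
have k33 : nv * (k i ^+ 3 * s2 i ^+ 3) <= nv * M.
rewrite ler_pM2l // /M -exprMn.
have -> : 8 * wmax ^+ 3 * b2 ^+ 3 = (2 * wmax * b2) ^+ 3 by ring.
apply: lerXn2r; [nneg|nneg|].
apply: ler_pM => //; first exact: ltW.
by apply: (le_trans kw); apply: ler_wpM2r; [exact: ltW|lra].
have lt3 : nv * (L * (w i * (e i * t3' i))) <= nv * (L' * t3 i).
rewrite ler_pM2l // /L' -2!mulrA ler_pM2l //.
apply: ler_pM; [nneg|nneg|exact: hw1|].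
apply: ler_pM; [nneg|nneg|exact: he2|].
by apply: le_trans f3; rewrite lerDl; nneg.
have Vstep : V i.+1 <= V i + nv * (L' * t3 i + M).
rewrite /V n3 !S_S.
have -> : 3 * c1 * (S s4 t4' i + nv * (w i * (s4 i - e i * t4' i))) =
 3 * c1 * S s4 t4' i + nv * (3 * (c1 * w i * s4 i)) - 3 * (nv * (c1 * w i * (e i * t4' i))).
by ring.
have -> : L * (S s3 t3' i + nv * (w i * (s3 i - e i * t3' i))) =
 L * S s3 t3' i + nv * (L * (w i * s3 i)) - nv * (L * (w i * (e i * t3' i))) by ring.
rewrite ![nv * (_ + _)]mulrDr.
move: k4 k32 k33 lt3 d4 f3.
move: (nv * (3 * k i * s4 i)) (nv * (3 * k i ^+ 2 * s3 i * s2 i)) (nv * (k i ^+ 3 * _)).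
move: (nv * (L * (w i * s3 i))) (nv * (L * (w i * (e i * _)))) (nv * (3 * (c1 * w i * s4 i))).
move: (nv * (c1 * w i * _)) (nv * (L' * _)) (nv * M) => z1 z2 z3 z4 z5 z6 z7 z8 z9.
have -> : 3 * h i * t4' i = 3 * (h i * t4' i) by ring.
 lra.
have V00 : 0 <= V i by exact: le_trans Vt3.
apply: (letr ((V i + M) * (1 + nv * (L' + 1)))).
apply: (le_trans (lerD Vstep (lexx M))).
have : nv * (L' * t3 i) <= nv * (L' * V i) by rewrite ler_pM2l // ler_pM2l.
have : 0 <= nv * V i by rewrite mulr_ge0 // ltW.
have : 0 <= nv * (L' * M) by nneg.
have -> : (V i + M) * (1 + nv * (L' + 1)) = V i + M + nv * (L' * V i) + nv * V i + nv * (L' * M) + nv * M.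
by ring.
rewrite [nv * (_ + _)]mulrDr; lra.
rewrite exprSr mulrA; apply: ler_wpM2r => //.
by rewrite addr_ge0 // mulr_ge0 ?addr_ge0 // ltW.
Qed.
Lemma barrier i : (i <= n)%N -> good i /\ ok i.
move=> iN; suff [] : inv i by [].
by elim: i iN => [|i IH] iN; [by []|apply: step => //; apply: IH; exact: ltnW].
Qed.
End Barrier.

(** * Concentration of quadratic forms in the columns *)

Section Block.
Context d (T : measurableType d) (R : realType) (P : probability T R)
 (I : finType) (X : I -> {RV P >-> (R * R)%type})
 (q : nat) (b : 'I_q -> I).
Hypothesis injb : injective b.
Notation C := R[i].
Definition bseq : seq I := [seq b a | a <- enum 'I_q].
Definition bcol (w : T) : 'cV[C]_q := \col_a cplx (X (b a) w).
(** Forms were indexed by the whole family of entries, so a matrix on the positions of one block is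
    extended by zero. *)
Definition blift (F : 'I_q -> 'I_q -> R) (s t : I) : R :=
 if [pick a | b a == s] is Some a then
 if [pick a | b a == t] is Some a' then F a a' else 0
 else 0.
Let pickE a : [pick a' | b a' == b a] = Some a.
case: pickP => [a' /eqP /injb -> //|/(_ a)].
by rewrite eqxx.
Qed.
Let bliftE F a a' : blift F (b a) (b a') = F a a'.
by rewrite /blift !pickE. Qed.
Lemma bseq_uniq : uniq bseq.
by rewrite map_inj_uniq // enum_uniq. Qed.
Lemma mem_bseq a : b a \in bseq.
by apply: map_f; rewrite mem_enum. Qed.
Lemma bseqP s : s \in bseq -> exists a, s = b a.
by case/mapP => a _ ->; exists a. Qed.
Let sum_bseq (F : I -> R) : \sum_(s <- bseq) F s = \sum_a F (b a).
by rewrite big_map big_enum. Qed.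
Let reM (M : 'M[C]_q) a a' := cRe (M a a').
Let imM (M : 'M[C]_q) a a' := cIm (M a a').
Lemma quadform_rq (M : 'M[C]_q) w : herm M ->
 quadform X (blift (reM M)) (blift (imM M)) bseq w =
 rq M (bcol w) - cRe (\tr M).
move=> hM; rewrite /quadform !sum_bseq /mxtrace Re_sum; congr (_ - _); last first.
by apply: eq_bigr => a _; rewrite bliftE.
rewrite rq_def vdotE Re_sum; apply: eq_bigr => a _; rewrite sum_bseq.
rewrite [(M *m _) a 0]mxE mulr_sumr Re_sum; apply: eq_bigr => a' _.
rewrite !bliftE /reM /imM !mxE !Re_mul !Im_mul cRe_conj cIm_conj /cplx /=.
by move: (cRe _) (cIm _) => x y; ring.
Qed.
Lemma frob2_blift (M : 'M[C]_q) :
 \sum_(s <- bseq) \sum_(t <- bseq)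
 (blift (reM M) s t ^+ 2 + blift (imM M) s t ^+ 2) = frob2 M.
rewrite sum_bseq frob2E; apply: eq_bigr => a _; rewrite sum_bseq.
by apply: eq_bigr => a' _; rewrite !bliftE.
Qed.
Lemma blift_sym (M : 'M[C]_q) s t : herm M ->
 blift (reM M) s t = blift (reM M) t s /\ blift (imM M) s t = - blift (imM M) t s.
move=> hM; rewrite /blift.
case: pickP => [a _|_]; case: pickP => [a' _|_]; rewrite ?oppr0 //.
by rewrite /reM /imM -{1 3}hM !mxE cRe_conj cIm_conj.
Qed.
Lemma blift_meas d' (T' : measurableType d') (F : T' -> 'M[C]_q) s t :
 mxmeas F -> mfunT (fun w => blift (reM (F w)) s t) /\
 mfunT (fun w => blift (imM (F w)) s t).
move=> mF; rewrite /blift.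
case: pickP => [a _|_]; last by split; exact: measurable_cst.
case: pickP => [a' _|_]; last by split; exact: measurable_cst.
exact: mF.
Qed.
Lemma bcol_measurable (K : seq I) : {subset bseq <= K} ->
 mxmeas (bcol : pastT X K -> 'cV[C]_q).
move=> bK a j; split; under eq_fun do rewrite mxE /=.
by apply: past_fst; apply: bK; exact: mem_bseq.
by apply: past_snd; apply: bK; exact: mem_bseq.
Qed.
End Block.

Section SamplePath.
Context d (T : measurableType d) (R : realType) (P : probability T R)
 (I : finType) (X : I -> {RV P >-> (R * R)%type}).
Notation C := R[i].
Variables (m : nat) (B : R)
 (stdX : std_array X m B).
Lemma block_moment q (b : 'I_q -> I) (K : seq I) (N : T -> 'M[C]_q) (tau : R) :
 injective b -> (forall a, b a \notin K) ->
 mxmeas (N : pastT X K -> 'M[C]_q) ->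
 (forall w, herm (N w)) -> (forall w, frob2 (N w) <= tau) ->
 mfunT (fun w => rq (N w) (bcol X b w) - cRe (\tr (N w))) /\
 (\int[P]_w ((rq (N w) (bcol X b w) - cRe (\tr (N w))) ^+ m.*2.+2)%:E <=
 ((quadK m B * tau) ^+ m.+1)%:E)%E.
move=> injb bK mN hN Nt.
have E w : rq (N w) (bcol X b w) - cRe (\tr (N w)) =
 adform X (bseq b) (fun w => blift b (fun a a' => cRe (N w a a')))
 (fun w => blift b (fun a a' => cIm (N w a a'))) w.
by rewrite -(quadform_rq X injb).
split.
rewrite (funext E); apply: (@meas_adformT _ _ _ _ _ X (bseq b) K) => s t.
exact: (blift_meas b s t mN).1.
exact: (blift_meas b s t mN).2.
under eq_integral do rewrite E.
apply: (adform_moment stdX (K' := K)).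
- exact: bseq_uniq.
- by move=> s /bseqP[a ->].
- by move=> s t; exact: (blift_meas b s t mN).1.
- by move=> s t; exact: (blift_meas b s t mN).2.
- by move=> w s t; exact: (blift_sym b s t (hN w)).1.
- by move=> w s t; exact: (blift_sym b s t (hN w)).2.
- by move=> w; rewrite (frob2_blift injb).
Qed.
Context (n q : nat) (blk : 'I_n -> 'I_q -> I).
Hypothesis inj_blk : forall i j a b, blk i a = blk j b -> i = j /\ a = b.
Let injb i : injective (blk i). by move=> a b /inj_blk []. Qed.
Definition before (i : nat) : seq I :=
 [seq s <- enum I | [exists j : 'I_n, (j < i)%N && (s \in bseq (blk j))]].
(** Columns are numbered by naturals, as the induction along the path requires, with the value 0
    beyond the last one. *)
Definition ncol (i : nat) (w : T) : 'cV[C]_q :=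
 if insub i is Some i' then bcol X (blk i') w else 0.
Lemma mem_before i s :
 (s \in before i) = [exists j : 'I_n, (j < i)%N && (s \in bseq (blk j))].
by rewrite mem_filter mem_enum andbT. Qed.
Lemma ncol_measurable i j : (j < i)%N ->
 mxmeas (ncol j : pastT X (before i) -> 'cV[C]_q).
move=> ji; rewrite /ncol; case: insubP => [j' _ jE|_]; last by [].
apply: bcol_measurable => s sb; rewrite mem_before; apply/existsP; exists j'.
by rewrite jE ji.
Qed.
(** The martingale increment attached to a matrix that depends on the earlier columns only. *)
Definition dev (N : nat -> T -> 'M[C]_q) i w : R :=
 rq (N i w) (ncol i w) - cRe (\tr (N i w)).
Variables (N : nat -> T -> 'M[C]_q) (tau : R)
 (mN : forall i,
 mxmeas (N i : pastT X (before i) -> 'M[C]_q))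
 (hN : forall i w, herm (N i w))
 (Nt : forall i w, frob2 (N i w) <= tau).
Let blk_before (i : 'I_n) a : blk i a \notin before i.
rewrite mem_before; apply/negP => /existsP[j /andP[ji /bseqP[a' /inj_blk[ij _]]]].
by rewrite ij ltnn in ji.
Qed.
Lemma dev_moment i : (i < n)%N -> mfunT (dev N i) /\
 (\int[P]_w (dev N i w ^+ m.*2.+2)%:E <= ((quadK m B * tau) ^+ m.+1)%:E)%E.
move=> iN; have := block_moment (injb (i := Ordinal iN)) (blk_before (Ordinal iN))
 (@mN i) (@hN i) (@Nt i).
suff -> : dev N i = (fun w => rq (N i w) (bcol X (blk (Ordinal iN)) w) -
 cRe (\tr (N i w))) by [].
apply/funext => w; rewrite /dev /ncol; case: insubP => [j _ jE|]; last by rewrite iN.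
by congr (rq _ (bcol _ (blk _) _) - _); apply: val_inj.
Qed.
Lemma dev_sum_moment M : (M <= n)%N ->
 mfunT (fun w => \sum_(i < M) dev N i w) /\
 (\int[P]_w ((\sum_(i < M) dev N i w) ^+ m.*2.+2)%:E <=
 ((M%:R * (4 * taylorK m * (quadK m B * tau))) ^+ m.+1)%:E)%E.
move=> Mn; split.
by apply: measurable_sum => i; apply: (dev_moment _).1; exact: leq_trans (ltn_ord i) Mn.
pose J i := if insub i is Some i' then bseq (blk i') else [::].
pose a i w s t := if insub i is Some i' then
 blift (blk i') (fun a a' => cRe (N i w a a')) s t else 0.
pose b i w s t := if insub i is Some i' then
 blift (blk i') (fun a a' => cIm (N i w a a')) s t else 0.
have E w : \sum_(i < M) dev N i w = adsum X J a b M w.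
apply: eq_bigr => i _; rewrite /dev /ncol /adform /J /a /b.
case: insubP => [i' _ iE|]; last by rewrite (leq_trans (ltn_ord i) Mn).
by rewrite -(quadform_rq X (injb (i := i'))).
under eq_integral do rewrite E.
have tau0 : 0 <= tau by apply: le_trans (Nt 0 point); exact: frob2_ge0.
apply: (adsum_moment stdX (K' := before)).
- by move=> i; rewrite /J; case: insubP => // i' _ _; exact: bseq_uniq.
- move=> i s; rewrite /J; case: insubP => // i' _ iE /bseqP[c ->].
by rewrite -iE; by [].
- move=> i s; rewrite /J; case: insubP => // i' _ iE si; rewrite mem_before.
by apply/existsP; exists i'; rewrite iE ltnSn.
- move=> i s; rewrite !mem_before => /existsP[j /andP[ji sj]].
by apply/existsP; exists j; rewrite sj andbT (ltn_trans ji).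
- move=> i s t; rewrite /a; case: insubP => [i' _ _|_]; last exact: measurable_cst.
exact: (blift_meas (blk i') s t (@mN i)).1.
- move=> i s t; rewrite /b; case: insubP => [i' _ _|_]; last exact: measurable_cst.
exact: (blift_meas (blk i') s t (@mN i)).2.
- move=> i w s t; rewrite /a; case: insubP => // i' _ _.
exact: (blift_sym (blk i') s t (hN i w)).1.
- move=> i w s t; rewrite /b; case: insubP => [i' _ _|_]; last by rewrite oppr0.
exact: (blift_sym (blk i') s t (hN i w)).2.
- move=> i w; rewrite /J /a /b; case: insubP => [i' _ _|_]; last by rewrite big_nil.
by rewrite (frob2_blift (injb (i := i'))).
Qed.
End SamplePath.
Lemma cube_root (R : realType) (a : R) : 0 <= a -> exists2 r, 0 <= r & r ^+ 3 = a.
move=> a0; exists (a `^ 3^-1); first exact: powR_ge0.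
by rewrite -powR_mulrn ?powR_ge0 // -powRrM mulVf // powRr1.
Qed.
Lemma rqZv (R : realType) q (M : 'M[R[i]]_q) (a : R) v :
 rq M ((a%:C)%C *: v) = a ^+ 2 * rq M v.
rewrite !rq_def -scalemxAr vdotZr vdotZl conjR mulrA -rmorphM.
by rewrite Re_mul /= mul0r subr0.
Qed.
HB.lock Definition dev_const (R : realType) (B : R) : R :=
 4 * taylorK 8 * quadK 8 B.

(** * The path of spectral parameters and its gates *)

Section Path.
Context d (T : measurableType d) (R : realType) (P : probability T R)
 (I : finType) (X : I -> {RV P >-> (R * R)%type}).
Notation C := R[i].
Context (n q : nat) (blk : 'I_n -> 'I_q -> I).
Variable eta : nat -> R.
Notation nv := (n%:R^-1 : R).
Notation e j := (eta j ^+ 2).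
Definition xcol j w : 'cV[C]_q := ((eta j * Num.sqrt nv)%:C)%C *: ncol X blk j w.
Definition acc i w : 'M[C]_q := \sum_(j < i) xcol j w *m (xcol j w) ^t*.
(** The ideal Sherman-Morrison factor 1/(1 - x_j^H Q x_j) when the normalised trace of the resolvent
    is 1/x. *)
Definition wgt (x : R) j : R := (1 - e j * x^-1)^-1.
(** The starting point q x / n gives the zero matrix a resolvent with normalised trace exactly 1/x.
    At speed s = 1 each later step compensates, to first order, the gain in trace from the next
    column. *)
Definition zeta (x s : R) i : R :=
 q%:R * nv * x + s * \sum_(j < i) nv * (wgt x j * e j).
(** All Sherman-Morrison denominators before step [i] were positive, so no eigenvalue has crossed
    the path. The event depends on the first [i] columns only, which keeps cut-off matrices
    adapted. *)
Fixpoint gate x s i w : bool :=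
 if i is j.+1 then
 gate x s j w && (rq (res (zeta x s i) (acc j w)) (xcol j w) < 1)
 else true.
Lemma accS i w : acc i.+1 w = acc i w + xcol i w *m (xcol i w) ^t*.
by rewrite /acc big_ord_recr. Qed.
Lemma acc_herm i w : herm (acc i w).
elim: i => [|i IH]; first by rewrite /acc big_ord0; exact: herm0.
by rewrite accS; apply: hermD => //; exact: herm_gram.
Qed.
Lemma zetaS x s i : zeta x s i.+1 = zeta x s i + s * (nv * (wgt x i * e i)).
by rewrite /zeta big_ord_recr /= mulrDr addrA. Qed.
Lemma xcol_meas i j : (j < i)%N ->
 mxmeas (xcol j : pastT X (before blk i) -> 'cV[C]_q).
move=> ji; apply: mxmeasZ; first by [].
exact: ncol_measurable.
Qed.
Lemma acc_meas i j : (j <= i)%N ->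
 mxmeas (acc j : pastT X (before blk i) -> 'M[C]_q).
move=> ji; apply: mxmeas_sum => k.
have ki : (k < i)%N by exact: leq_trans (ltn_ord k) ji.
by apply: mxmeasM; [|apply: mxmeas_adj]; exact: xcol_meas.
Qed.
Lemma gate_meas x s i j : (j <= i)%N ->
 mfunT
 (gate x s j : pastT X (before blk i) -> bool).
elim: j => [|j IH] ji; first exact: measurable_cst.
apply: measurable_and; first exact: IH (ltnW ji).
apply: measurable_fun_ltr => //; apply: rq_measurable; last exact: xcol_meas.
by apply: mxmeas_res; apply: acc_meas; exact: ltnW.
Qed.

Section Positivity.
Variables (x s : R)
 (n0 : (0 < n)%N) (q0 : (0 < q)%N) (x0 : 0 < x) (s0 : 0 <= s)
 (w0 : forall j, 0 < wgt x j).
Let nv0 : 0 < nv. by nneg. Qed.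
Lemma zeta0_gt0 : 0 < zeta x s 0.
by rewrite /zeta big_ord0 mulr0 addr0 !mulr_gt0 // ltr0n. Qed.
Lemma zeta_step_ge0 i : 0 <= s * (nv * (wgt x i * e i)).
by nneg.
Qed.
Lemma gate_below i w : gate x s i w -> below (acc i w) (zeta x s i).
elim: i => [_|i IH /= /andP[gi qi]].
by rewrite /acc big_ord0; apply: below0; exact: zeta0_gt0.
rewrite accS; apply: rank1_below => //; first exact: acc_herm.
by apply: belowW (IH gi); rewrite zetaS lerDl zeta_step_ge0.
Qed.
Lemma gate_below' i w : gate x s i w -> below (acc i w) (zeta x s i.+1).
by move=> /gate_below; apply: belowW; rewrite zetaS lerDl zeta_step_ge0. Qed.
End Positivity.

(* The resolvent powers along the path, cut off so as to be bounded. *)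
Definition noise x s K3 (c : nat -> R) r i w : 'M[C]_q :=
 if gate x s i w && (nv * rtr (zeta x s i.+1) (acc i w) 3 <= K3)
 then ((c i)%:C)%C *: rpow (zeta x s i.+1) (acc i w) r else 0.
Lemma noise_meas x s K3 c r i :
 mxmeas (noise x s K3 c r i : pastT X (before blk i) -> 'M[C]_q).
apply: mxmeas_if.
apply: measurable_and; first exact: gate_meas.
apply: measurable_fun_ler => //; apply: measurable_funM => //.
by apply: rtr_measurable; exact: acc_meas.
apply: mxmeasZ; first by [].
by apply: mxmeas_rpow; exact: acc_meas.
Qed.
Lemma dev_noise x s K3 c r i w : gate x s i w ->
 nv * rtr (zeta x s i.+1) (acc i w) 3 <= K3 ->
 dev X blk (noise x s K3 c r) i w =
 c i * (rq (rpow (zeta x s i.+1) (acc i w) r) (ncol X blk i w) -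
 rtr (zeta x s i.+1) (acc i w) r).
move=> g k; rewrite /dev /noise g k /= rqZ mxtraceZ Re_mul /= mul0r subr0.
by rewrite rtr_def mulrBr.
Qed.

Section NoiseBounds.
Variables (x s K3 : R)
 (n0 : (0 < n)%N) (q0 : (0 < q)%N) (x0 : 0 < x) (s0 : 0 <= s)
 (w0 : forall j, 0 < wgt x j)
 (K31 : 1 <= K3).
Let nv0 : 0 < nv. by nneg. Qed.
Let nR : 1 <= n%:R :> R. by rewrite ler1n. Qed.
Let nK : 1 <= n%:R * K3. by rewrite mulr_ege1. Qed.
Lemma noise_herm c r i w : herm (noise x s K3 c r i w).
rewrite /noise; case: ifP => [/andP[g _]|_]; last exact: herm0.
have b := gate_below' n0 q0 x0 s0 w0 g.
rewrite /herm adjmxZ conjR (rpow_fcal r (acc_herm i w) b).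
by rewrite fcal_herm.
Qed.
Lemma noise_frob2 c r k i w (cm tau : R) : (2 <= r <= k)%N -> `|c i| <= cm ->
 0 <= tau -> tau ^+ 3 = cm ^+ 6 * (n%:R * K3) ^+ k.*2 ->
 frob2 (noise x s K3 c r i w) <= tau.
move=> /andP[r2 rk] ccm tau0 tauE; rewrite /noise.
case: ifP => [/andP[g k3]|_]; last first.
by rewrite frob2E big1 // => a _; rewrite big1 // => b _; rewrite mxE nsq0.
have b := gate_below' n0 q0 x0 s0 w0 g.
have hA := acc_herm i w.
rewrite frob2Z nsqR (frob2_rpow r hA b).
have t0 := rtr_ge0 r.*2 hA b.
rewrite -(@ler_pXn2r _ 3) ?nnegrE //; last by nneg.
rewrite tauE exprMn.
have t3 := rtr_ge0 3 hA b.
have cm0 : 0 <= cm by exact: le_trans ccm.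
apply: ler_pM; [by nneg|exact: exprn_ge0| |].
rewrite (exprM cm 2 3); apply: lerXn2r; rewrite ?nnegrE ?sqr_ge0 //.
by rewrite -real_normK ?num_real // lerXn2r ?nnegrE.
have r3 : (3 <= r.*2)%N by rewrite -[3%N]/(1.*2.+1)%N ltn_double.
apply: (le_trans (rtr_expr3 hA b r3)).
apply: (letr ((n%:R * K3) ^+ r.*2)).
apply: lerXn2r; rewrite ?nnegrE //; first exact: le_trans nK.
by rewrite mulrC -ler_pdivrMr ?(lt_le_trans ltr01 nR) // mulrC.
by apply: ler_weXn2l => //; rewrite leq_double.
Qed.
(** For r = 1 the exponent 2 lies below 3, out of reach of [rtr_expr3]; y^2 <= 1 + y^3 replaces it,
    at the price of the dimension [q]. *)
Lemma noise_frob2_1 c i w (cm : R) : `|c i| <= cm ->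
 frob2 (noise x s K3 c 1 i w) <= cm ^+ 2 * (q%:R + n%:R * K3).
move=> ccm; rewrite /noise.
have qn : 0 <= q%:R + n%:R * K3 by nneg.
case: ifP => [/andP[g k3]|_]; last first.
rewrite frob2E big1; first by nneg.
move=> a _.
by rewrite big1 // => b _; rewrite mxE nsq0.
have b := gate_below' n0 q0 x0 s0 w0 g.
have hA := acc_herm i w.
rewrite frob2Z nsqR (frob2_rpow 1 hA b).
apply: ler_pM; rewrite ?sqr_ge0 ?rtr_ge0 //.
by rewrite -real_normK ?num_real // lerXn2r ?nnegrE // (le_trans _ ccm).
apply: (le_trans (rtr2_le hA b)); rewrite lerD2l.
by rewrite mulrC -ler_pdivrMr ?(lt_le_trans ltr01 nR) // mulrC.
Qed.
Variables (B : R)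
 (stdX : std_array X 8 B)
 (inj_blk : forall i j a b, blk i a = blk j b -> i = j /\ a = b).
Notation momK := (dev_const B).
Lemma dev_const_ge0 : 0 <= momK.
have := quadK_ge0 stdX; rewrite dev_const.unlock => k0.
by nneg.
Qed.
Let quadK_le : quadK 8 B <= momK.
have := @taylorK_ge1 R 8; have := quadK_ge0 stdX; rewrite dev_const.unlock.
by move: (quadK _ _) (taylorK _) => a b a0 b1; rewrite ler_peMl //; lra.
Qed.

(* [(n K tau)^9 <= C / n^3] since [tau^3] is of order [n^-4] *)
Lemma noise_sum_moment c r cm M : (2 <= r <= 4)%N ->
 (forall i, `|c i| <= cm * nv ^+ 2) -> (M <= n)%N ->
 mfunT (fun w => \sum_(i < M) dev X blk (noise x s K3 c r) i w) /\
 (\int[P]_w ((\sum_(i < M) dev X blk (noise x s K3 c r) i w) ^+ 18)%:E <=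
 ((momK ^+ 3 * (cm ^+ 6 * K3 ^+ 8)) ^+ 3 * nv ^+ 3)%:E)%E.
move=> rr cc Mn.
have cm0 : 0 <= cm.
have := le_trans (normr_ge0 _) (cc 0); rewrite pmulr_lge0 // exprn_gt0 //.
have K30 : 0 <= K3 by exact: le_trans K31.
have a0 : 0 <= (cm * nv ^+ 2) ^+ 6 * (n%:R * K3) ^+ 4.*2.
by nneg.
have [tau tau0 tauE] := cube_root a0.
have [m1 m2] := dev_sum_moment stdX inj_blk
 (fun i => @noise_meas x s K3 c r i) (fun i w => @noise_herm c r i w)
 (fun i w => @noise_frob2 c r 4 i w (cm * nv ^+ 2) tau rr (cc i) tau0 tauE) Mn.
split => //; apply: (le_trans m2); rewrite lee_fin.
have -> : 4 * taylorK 8 * (quadK 8 B * tau) = momK * tau by rewrite dev_const.unlock mulrA.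
have k0 := dev_const_ge0; move: momK k0 => k k0.
have -> : (k ^+ 3 * (cm ^+ 6 * K3 ^+ 8)) ^+ 3 * nv ^+ 3 =
 ((n%:R * (k * tau)) ^+ 3) ^+ 3.
rewrite -[LHS]exprMn; congr (_ ^+ 3); rewrite !exprMn tauE.
rewrite (_ : 4.*2 = 8)%N //.
have nn : n%:R != 0 :> R by rewrite pnatr_eq0 -lt0n.
by move: (n%:R : R) nn => N nn; field.
rewrite -exprM; apply: lerXn2r; [nneg|nneg|].
by apply: ler_wpM2r; [nneg|rewrite ler_nat].
Qed.
Lemma noise2_moment c cm i : (forall i, `|c i| <= cm * nv) -> (i < n)%N ->
 mfunT (dev X blk (noise x s K3 c 2) i) /\
 (\int[P]_w (dev X blk (noise x s K3 c 2) i w ^+ 18)%:E <=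
 ((momK ^+ 3 * (cm ^+ 6 * K3 ^+ 4)) ^+ 3 * nv ^+ 3)%:E)%E.
move=> cc iN.
have cm0 : 0 <= cm.
by have := le_trans (normr_ge0 _) (cc 0); rewrite pmulr_lge0.
have K30 : 0 <= K3 by exact: le_trans K31.
have a0 : 0 <= (cm * nv) ^+ 6 * (n%:R * K3) ^+ 2.*2.
by nneg.
have [tau tau0 tauE] := cube_root a0.
have [m1 m2] := dev_moment stdX inj_blk
 (fun i => @noise_meas x s K3 c 2 i) (fun i w => @noise_herm c 2 i w)
 (fun i w => @noise_frob2 c 2 2 i w (cm * nv) tau isT (cc i) tau0 tauE) iN.
split => //; apply: (le_trans m2); rewrite lee_fin.
apply: (letr ((momK * tau) ^+ 9)).
have k0 := dev_const_ge0; have k1 := quadK_ge0 stdX.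
by apply: lerXn2r; [nneg|nneg|exact: ler_wpM2r].
have -> : (momK * tau) ^+ 9 = (momK ^+ 3 * (cm ^+ 6 * K3 ^+ 4)) ^+ 3 * nv ^+ 6.
have -> : (momK * tau) ^+ 9 = ((momK * tau) ^+ 3) ^+ 3 by rewrite -exprM.
have -> : nv ^+ 6 = (nv ^+ 2) ^+ 3 by rewrite -exprM.
rewrite [(momK * tau) ^+ 3]exprMn tauE -[RHS]exprMn; congr (_ ^+ 3).
rewrite (_ : 2.*2 = 4)%N //; move: momK => k.
have nn : n%:R != 0 :> R by rewrite pnatr_eq0 -lt0n.
by move: (n%:R : R) nn => N nn; field.
have k0 := dev_const_ge0; apply: ler_wpM2l; first nneg.
by apply: ler_wiXn2l => //; rewrite ?(ltW nv0) // invf_le1 ?ltr0n.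
Qed.
Lemma noise1_moment c cm cq i : (forall i, `|c i| <= cm * nv) -> (i < n)%N ->
 q%:R <= cq * n%:R ->
 mfunT (dev X blk (noise x s K3 c 1) i) /\
 (\int[P]_w (dev X blk (noise x s K3 c 1) i w ^+ 18)%:E <=
 ((momK * (cm ^+ 2 * (cq + K3))) ^+ 9 * nv ^+ 3)%:E)%E.
move=> cc iN qn.
have cm0 : 0 <= cm.
by have := le_trans (normr_ge0 _) (cc 0); rewrite pmulr_lge0.
have K30 : 0 <= K3 by exact: le_trans K31.
have [m1 m2] := dev_moment stdX inj_blk
 (fun i => @noise_meas x s K3 c 1 i) (fun i w => @noise_herm c 1 i w)
 (fun i w => @noise_frob2_1 c i w (cm * nv) (cc i)) iN.
split => //; apply: (le_trans m2); rewrite lee_fin.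
have cq0 : 0 <= cq.
by have := le_trans (ler0n R q) qn; rewrite pmulr_lge0 // (lt_le_trans ltr01).
have qK0 : 0 <= q%:R + n%:R * K3 by nneg.
apply: (letr ((momK * (cm ^+ 2 * (cq + K3)) * nv) ^+ 9)).
have k0 := dev_const_ge0; have k1 := quadK_ge0 stdX.
apply: lerXn2r; [nneg|nneg|].
rewrite -[leRHS]mulrA; apply: ler_pM => //; first nneg.
have -> : cm ^+ 2 * (cq + K3) * nv = (cm * nv) ^+ 2 * (cq * n%:R + n%:R * K3).
have nn : n%:R != 0 :> R by rewrite pnatr_eq0 -lt0n.
by move: (n%:R : R) nn => N nn; field.
by apply: ler_wpM2l; [by nneg|rewrite lerD2r].
have k0 := dev_const_ge0; rewrite exprMn; apply: ler_wpM2l; first nneg.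
by apply: ler_wiXn2l => //; rewrite ?(ltW nv0) // invf_le1 ?ltr0n.
Qed.
End NoiseBounds.
End Path.
Lemma lt18_norm (R : realType) (y kap : R) : 0 < kap -> y ^+ 18 < kap ^+ 18 -> `|y| <= kap.
move=> k0; rewrite -[y ^+ 18](exprD_norm 9 y) -[9.*2]/18%N.
move=> h; rewrite leNgt; apply/negP => h'; move: h; apply/negP; rewrite -leNgt.
by apply: lerXn2r; rewrite ?nnegrE ?(ltW k0) ?(ltW h').
Qed.

(** * Summability of the first-pass errors *)

Section FirstPass.
Context d (T : measurableType d) (R : realType) (P : probability T R)
 (I : finType) (X : I -> {RV P >-> (R * R)%type}).
Notation C := R[i].
Context (n q : nat) (blk : 'I_n -> 'I_q -> I).
Variables (eta : nat -> R)
 (n0 : (0 < n)%N) (q0 : (0 < q)%N).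
Notation nv := (n%:R^-1 : R).
Notation e j := (eta j ^+ 2).
Variables (x s K3 emax wmax : R)
 (x0 : 0 < x) (s0 : 0 <= s)
 (he : forall j, e j <= emax)
 (hw0 : forall j, 0 < wgt eta x j) (hw1 : forall j, wgt eta x j <= wmax)
 (K31 : 1 <= K3).
(** The weights of the sums in the barrier: one factor 1/n normalises the traces, the other is the
    variance scale of a column entry. [c2] serves for single increments. *)
Let c1 i := nv * (wgt eta x i * (e i * nv)).
Let c2 i := e i * nv.
Let S r M w := \sum_(i < M) dev X blk (noise X blk eta x s K3 c1 r) i w.
Let D r i w := dev X blk (noise X blk eta x s K3 c2 r) i w.
(** Collecting every partial sum and every increment in one nonnegative variable makes a single
    integral bound control them all, uniformly along the path. *)
Definition path_error w : R :=
 \sum_(M < n.+1) (S 2 M w ^+ 18 + S 3 M w ^+ 18 + S 4 M w ^+ 18) +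
 \sum_(i < n) (D 1 i w ^+ 18 + D 2 i w ^+ 18).
Let p18 (y : R) : 0 <= y ^+ 18.
exact: (exprD_ge0 9 y). Qed.
Lemma path_error_ge0 w : 0 <= path_error w.
by rewrite addr_ge0 //; apply: sumr_ge0 => i _; rewrite !addr_ge0.
Qed.
Let lerDl' (a b : R) : 0 <= b -> a <= a + b.
by rewrite lerDl. Qed.
Let part3 (a b c : R) : 0 <= a -> 0 <= b -> 0 <= c ->
 [/\ a <= a + b + c, b <= a + b + c & c <= a + b + c].
by move=> *; split; lra. Qed.
Lemma path_errorP w kap : 0 < kap -> path_error w < kap ^+ 18 ->
 (forall M, (M <= n)%N ->
 [/\ `|S 2 M w| <= kap, `|S 3 M w| <= kap & `|S 4 M w| <= kap]) /\
 (forall i, (i < n)%N -> `|D 1 i w| <= kap /\ `|D 2 i w| <= kap).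
move=> k0 h; split => [M Mn|i iN].
have hh : S 2 M w ^+ 18 + S 3 M w ^+ 18 + S 4 M w ^+ 18 <= path_error w.
rewrite -(@inordK n M) //; apply: (letr (\sum_(M < n.+1)
 (S 2 M w ^+ 18 + S 3 M w ^+ 18 + S 4 M w ^+ 18))).
rewrite (bigD1 (inord M)) //=; apply: lerDl'; apply: sumr_ge0 => i _.
by rewrite !addr_ge0.
by apply: lerDl'; apply: sumr_ge0 => i _; rewrite addr_ge0.
have [a2 a3 a4] := part3 (p18 (S 2 M w)) (p18 (S 3 M w)) (p18 (S 4 M w)).
split; apply: (lt18_norm k0); apply: le_lt_trans h.
 - exact: le_trans a2 hh.
 - exact: le_trans a3 hh.
 - exact: le_trans a4 hh.
have hh : D 1 i w ^+ 18 + D 2 i w ^+ 18 <= path_error w.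
apply: (letr (\sum_(i < n) (D 1 i w ^+ 18 + D 2 i w ^+ 18))).
rewrite (bigD1 (Ordinal iN)) //=; apply: lerDl'; apply: sumr_ge0 => j _.
by rewrite addr_ge0.
by rewrite /path_error addrC; apply: lerDl'; apply: sumr_ge0 => j _; rewrite !addr_ge0.
have [_ a1 a2] := part3 (lexx 0) (p18 (D 1 i w)) (p18 (D 2 i w)).
rewrite !add0r in a1 a2.
split; apply: (lt18_norm k0); apply: le_lt_trans h.
- exact: le_trans a1 hh.
- exact: le_trans a2 hh.
Qed.
Variables (B : R)
 (stdX : std_array X 8 B)
 (inj_blk : forall i j a b, blk i a = blk j b -> i = j /\ a = b)
 (cq : R)
 (hcq : q%:R <= cq * n%:R).
Definition path_const : R :=
 6 * ((dev_const B ^+ 3 * ((wmax * emax) ^+ 6 * K3 ^+ 8)) ^+ 3) +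
 ((dev_const B * (emax ^+ 2 * (cq + K3))) ^+ 9 +
 (dev_const B ^+ 3 * (emax ^+ 6 * K3 ^+ 4)) ^+ 3).
Let nv0 : 0 < nv. by nneg. Qed.
Let emax0 : 0 <= emax. exact: le_trans (sqr_ge0 (eta 0)) (he 0). Qed.
Let c1b i : `|c1 i| <= (wmax * emax) * nv ^+ 2.
have w0 := hw0 i; have e0 := sqr_ge0 (eta i).
rewrite ger0_norm; last by rewrite /c1; move: (eta i ^+ 2) e0 => z z0; nneg.
have -> : c1 i = wgt eta x i * e i * nv ^+ 2 by rewrite /c1; ring.
apply: ler_wpM2r; first by [].
by apply: ler_pM => //; exact: ltW.
Qed.
Let c2b i : `|c2 i| <= emax * nv.
rewrite ger0_norm; last by nneg.
by apply: ler_wpM2r => //; exact: ltW.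
Qed.
Let mS r M : (2 <= r <= 4)%N -> (M <= n)%N -> mfunT (S r M).
move=> rr Mn; exact: (noise_sum_moment n0 q0 x0 s0 hw0 K31 stdX inj_blk rr c1b Mn).1.
Qed.
Let measurable_sum' N (F : 'I_N -> T -> R) : (forall i, mfunT (F i)) ->
 mfunT (fun w => \sum_(i < N) F i w).
by move=> h; exact: (@measurable_sum _ _ _ _ _ (index_enum _)). Qed.
Let mD1 i : (i < n)%N -> mfunT (D 1 i).
move=> iN; exact: (noise1_moment n0 q0 x0 s0 hw0 K31 stdX inj_blk c2b iN hcq).1.
Qed.
Let mD2 i : (i < n)%N -> mfunT (D 2 i).
move=> iN; exact: (noise2_moment n0 q0 x0 s0 hw0 K31 stdX inj_blk c2b iN).1.
Qed.
Lemma meas_path_error : mfunT path_error.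
apply: measurable_funD; apply: measurable_sum' => i.
have iN : (i <= n)%N by rewrite -ltnS.
by apply: measurable_funD; [apply: measurable_funD|]; apply: measurable_funX; exact: mS.
by apply: measurable_funD; apply: measurable_funX; [exact: mD1|exact: mD2].
Qed.
Lemma path_error_integral :
 (\int[P]_w (path_error w)%:E <= (path_const / n%:R ^+ 2)%:E)%E.
set A1 := (dev_const B ^+ 3 * ((wmax * emax) ^+ 6 * K3 ^+ 8)) ^+ 3.
set A2 := (dev_const B * (emax ^+ 2 * (cq + K3))) ^+ 9.
set A3 := (dev_const B ^+ 3 * (emax ^+ 6 * K3 ^+ 4)) ^+ 3.
have hS r M : (2 <= r <= 4)%N -> (M <= n)%N ->
 (\int[P]_w (S r M w ^+ 18)%:E <= (A1 * nv ^+ 3)%:E)%E.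
move=> rr Mn; exact: (noise_sum_moment n0 q0 x0 s0 hw0 K31 stdX inj_blk rr c1b Mn).2.
have hD1 i : (i < n)%N -> (\int[P]_w (D 1 i w ^+ 18)%:E <= (A2 * nv ^+ 3)%:E)%E.
move=> iN; exact: (noise1_moment n0 q0 x0 s0 hw0 K31 stdX inj_blk c2b iN hcq).2.
have hD2 i : (i < n)%N -> (\int[P]_w (D 2 i w ^+ 18)%:E <= (A3 * nv ^+ 3)%:E)%E.
move=> iN; exact: (noise2_moment n0 q0 x0 s0 hw0 K31 stdX inj_blk c2b iN).2.
have m18 (f : T -> R) : mfunT f -> mfunT (fun w => (f w ^+ 18)%:E).
by move=> mf; apply/measurable_EFinP; exact: measurable_funX.
have sum_cst N (z : R) : (N%:R * z)%:E = (\sum_(i < N) z%:E)%E.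
by rewrite sumEFin sumr_const card_ord mulr_natl.
have p18E (f : T -> R) w : (0 <= (f w ^+ 18)%:E)%E by rewrite lee_fin.
have I1 : (\int[P]_w (\sum_(M < n.+1) (S 2 M w ^+ 18 + S 3 M w ^+ 18 + S 4 M w ^+ 18))%:E
 <= (n.+1%:R * (3 * (A1 * nv ^+ 3)))%:E)%E.
under eq_integral do rewrite -sumEFin.
rewrite ge0_integral_sum //; last 2 first.
 - move=> M; apply/measurable_EFinP.
have MN : (M <= n)%N by rewrite -ltnS.
by apply: measurable_funD; [apply: measurable_funD|]; apply: measurable_funX; exact: mS.
 - by move=> M w _; rewrite lee_fin !addr_ge0.
rewrite sum_cst.
apply: lee_sum => M _; have MN : (M <= n)%N by rewrite -ltnS.
under eq_integral do rewrite !EFinD.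
rewrite ge0_integralD //; [|by move=> w _; rewrite adde_ge0|by apply: emeasurable_funD; apply: m18; exact: mS|by apply: m18; exact: mS].
rewrite ge0_integralD //; [|by apply: m18; exact: mS|by apply: m18; exact: mS].
rewrite (_ : 3 * _ = A1 * nv ^+ 3 + A1 * nv ^+ 3 + A1 * nv ^+ 3); last by ring.
by rewrite !EFinD; apply: leeD; [apply: leeD|]; exact: hS.
have I2 : (\int[P]_w (\sum_(i < n) (D 1 i w ^+ 18 + D 2 i w ^+ 18))%:E
 <= (n%:R * (A2 * nv ^+ 3 + A3 * nv ^+ 3))%:E)%E.
under eq_integral do rewrite -sumEFin.
rewrite ge0_integral_sum //; last 2 first.
 - move=> M; apply/measurable_EFinP.
by apply: measurable_funD; apply: measurable_funX; [exact: mD1|exact: mD2].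
 - by move=> M w _; rewrite lee_fin !addr_ge0.
rewrite sum_cst.
apply: lee_sum => i _.
under eq_integral do rewrite !EFinD.
rewrite ge0_integralD //; [|by apply: m18; exact: mD1|by apply: m18; exact: mD2].
by rewrite EFinD; apply: leeD; [exact: hD1|exact: hD2].
rewrite /path_error; under eq_integral do rewrite EFinD.
have mI1 : mfunT (fun w => (\sum_(M < n.+1) (S 2 M w ^+ 18 + S 3 M w ^+ 18 + S 4 M w ^+ 18))%:E).
apply/measurable_EFinP; apply: measurable_sum' => M.
have MN : (M <= n)%N by rewrite -ltnS.
by apply: measurable_funD; [apply: measurable_funD|]; apply: measurable_funX; exact: mS.
have mI2 : mfunT (fun w => (\sum_(i < n) (D 1 i w ^+ 18 + D 2 i w ^+ 18))%:E).
apply/measurable_EFinP; apply: measurable_sum' => M.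
by apply: measurable_funD; apply: measurable_funX; [exact: mD1|exact: mD2].
rewrite ge0_integralD //; last 2 first.
- by move=> w _; rewrite lee_fin; apply: sumr_ge0 => i _; rewrite !addr_ge0.
- by move=> w _; rewrite lee_fin; apply: sumr_ge0 => i _; rewrite !addr_ge0.
apply: (le_trans (leeD I1 I2)); rewrite -EFinD lee_fin /path_const -/A1 -/A2 -/A3.
have nn : 1 <= n%:R :> R by rewrite ler1n.
have A10 : 0 <= A1.
have w00 := le_trans (ltW (hw0 0)) (hw1 0).
have k0 := dev_const_ge0 stdX; have K30 := le_trans ler01 K31.
by rewrite /A1; nneg.
(* The 6 is 3, for three families of sums, times 2, from n + 1 <= 2 n. *)
have -> : (6 * A1 + (A2 + A3)) / n%:R ^+ 2 =
 n%:R * (A2 * nv ^+ 3 + A3 * nv ^+ 3) + 6 * A1 * n%:R * nv ^+ 3.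
have n1 : n%:R != 0 :> R by rewrite pnatr_eq0 -lt0n.
by move: (n%:R : R) n1 => N n1; field.
rewrite addrC lerD2l -natr1.
have : 0 <= A1 * nv ^+ 3 * (n%:R - 1) by rewrite mulr_ge0 ?subr_ge0 // mulr_ge0 // exprn_ge0 // ltW.
move: (nv ^+ 3) => z; move: (n%:R : R) => N; lra.
Qed.
End FirstPass.

(** * The noise spectrum stays below the path *)

Section FirstPassGate.
Context d (T : measurableType d) (R : realType) (P : probability T R)
 (I : finType) (X : I -> {RV P >-> (R * R)%type}).
Notation C := R[i].
Context (n q : nat) (blk : 'I_n -> 'I_q -> I).
Variables (eta : nat -> R)
 (n0 : (0 < n)%N) (q0 : (0 < q)%N).
Notation nv := (n%:R^-1 : R).
Notation e j := (eta j ^+ 2).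
Let nv0 : 0 < nv. by nneg. Qed.
Lemma rq_xcol i w (M : 'M[C]_q) :
 rq M (xcol X blk eta i w) = e i * nv * rq M (ncol X blk i w).
by rewrite rqZv exprMn sqr_sqrtr // ltW. Qed.
Variables (x eps kap K3 emin emax wmax u0 t20 t30 : R)
 (x0 : 0 < x) (eps0 : 0 < eps) (eps1 : eps <= 1)
 (kap0 : 0 < kap) (kap1 : kap <= 1)
 (emin0 : 0 < emin) (he1 : forall i, emin <= e i)
 (he2 : forall i, e i <= emax)
 (ex : emax < x)
 (hw1 : forall i, wgt eta x i <= wmax)
 (hkap : 4 * wmax * (2 * emax + 1) * kap <= eps)
 (t30_ge0 : 0 <= t30) (u0_gt0 : 0 < u0)
 (hu : u0 <= (t20 + 4 * kap + kap / emin)^-1 -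
 \sum_(j < n) nv * ((1 + eps / 2) * wgt eta x j * e j) ^+ 2)
 (hK3 : (t30 + 2 * (6 + bar_L emax wmax u0) + bar_M emax wmax u0) *
 expR (bar_L emax wmax u0 * wmax * emax + 1) <= K3)
 (K31 : 1 <= K3)
 (h20 : nv * q%:R * (q%:R * nv * x)^-1 ^+ 2 <= t20)
 (h30 : nv * q%:R * (q%:R * nv * x)^-1 ^+ 3 <= t30).
Lemma wgt_eq i : wgt eta x i * (1 - e i * x^-1) = 1.
have h : 0 < 1 - e i * x^-1.
by rewrite subr_gt0 ltr_pdivrMr // mul1r (le_lt_trans (he2 i)).
by rewrite /wgt mulVf // gt_eqF.
Qed.
Lemma wgt_gt0 i : 0 < wgt eta x i.
by rewrite /wgt invr_gt0 subr_gt0 ltr_pdivrMr // mul1r (le_lt_trans (he2 i)).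
Qed.
Let s : R := 1 + eps.
Let s0 : 0 <= s. by nneg. Qed.
(** The barrier applied to true resolvent traces: [shift] is monotonicity in the parameter, [next]
    the Sherman-Morrison formula. The cut-offs in [noise] are inactive as long as [ok] holds, so the
    bounded martingales equal the real fluctuations. *)
Lemma first_pass_gate w i : path_error X blk eta x s K3 w < kap ^+ 18 ->
 (i <= n)%N -> gate X blk eta x s i w.
move=> herr iN.
have [hS hD] := path_errorP kap0 herr.
pose z j := zeta n q eta x s j.
pose A j := acc X blk eta j w.
pose xc j := xcol X blk eta j w.
pose t r j : R := nv * rtr (z j) (A j) r.
pose t' r j : R := nv * rtr (z j.+1) (A j) r.
pose sf r j : R := rq (rpow (z j.+1) (A j) r) (xc j).
have gb j : gate X blk eta x s j w -> below (A j) (z j).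
exact: (gate_below n0 q0 x0 s0 wgt_gt0).
have gb' j : gate X blk eta x s j w -> below (A j) (z j.+1).
exact: (gate_below' n0 q0 x0 s0 wgt_gt0).
have hA j : herm (A j) by exact: acc_herm.
have step0 j : 0 <= s * (nv * (wgt eta x j * e j)).
by apply: zeta_step_ge0 => //; exact: wgt_gt0.
have zS j : z j.+1 = z j + s * (nv * (wgt eta x j * e j)) by exact: zetaS.
have z00 : 0 < z 0%N by exact: (zeta0_gt0 eta s n0 q0 x0).
have nq : nv * q%:R != 0 by rewrite mulf_neq0 ?gt_eqF // ltr0n.
have z0E : z 0%N = q%:R * nv * x by rewrite /z /zeta big_ord0 mulr0 addr0.
have t0E r : t r 0%N = nv * q%:R * (q%:R * nv * x)^-1 ^+ r.
by rewrite /t /A /acc big_ord0 rtr0 // z0E mulrA.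
refine (proj1 (@barrier R n n0 x eps kap K3 emin emax wmax u0 t20 t30 (fun j => e j)
 (wgt eta x) (t 1) (t 2) (t 3) (t' 1) (t' 2) (t' 3) (t' 4) (sf 1) (sf 2) (sf 3) (sf 4)
 (fun j => gate X blk eta x s j w) eps0 eps1 kap0 kap1 emin0 he1 he2 wgt_gt0 hw1
 wgt_eq hkap t30_ge0 u0_gt0 hu hK3 isT _ _ _ _ _ _ _ _ i iN)).
- rewrite t0E expr1 [q%:R * nv]mulrC invfM mulrA mulfV ?mul1r //.
- by rewrite t0E.
- by rewrite t0E.
- move=> j _ g.
have b := gb _ g; have b' := gb' _ g.
have p r : 0 <= t r j by rewrite /t mulr_ge0 ?(ltW nv0) // rtr_ge0.
have p' r : 0 <= t' r j by rewrite /t' mulr_ge0 ?(ltW nv0) // rtr_ge0.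
have ps r : 0 <= sf r j by exact: rq_rpow_ge0.
by [].
- move=> j jn g.
have b := gb _ g.
have sh r : t' r j + r%:R * (s * wgt eta x j * e j * nv) * t' r.+1 j <= t r j.
have := rtr_shift (hA j) b (step0 j) (zS j) r.
move/(ler_wpM2l (ltW nv0)); rewrite -/(t r j); apply: le_trans.
by rewrite /t' le_eqVlt; apply/orP; left; apply/eqP; ring.
by have := sh 1%N; have := sh 2%N; have := sh 3%N; rewrite mul1r.
- move=> j jn g; rewrite /sf rpow1 => s1.
have b' := gb' _ g.
split.
 + by rewrite /= g.
 + rewrite /t /A accS (rank1_rtr1 (hA j) b' s1) mulrDr.
by [].
 + by rewrite /t /A accS (rank1_rtr2 (hA j) b' s1) mulrDr.
 + by rewrite /t /A accS (rank1_rtr3 (hA j) b' s1) mulrDr.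
- move=> N Nn ok.
have SE r : \sum_(j < N) nv * (wgt eta x j * (sf r j - e j * t' r j)) =
 \sum_(j < N) dev X blk (noise X blk eta x s K3
 (fun i => nv * (wgt eta x i * (e i * nv))) r) j w.
apply: eq_bigr => j _; have [g k3] := ok _ (ltn_ord j).
rewrite (dev_noise _ _ g k3) /sf /t' rq_xcol.
by rewrite -/(z j.+1) -/(A j); ring.
by rewrite !SE; exact: hS.
- move=> j jn g k3.
have DE r : sf r j - e j * t' r j =
 dev X blk (noise X blk eta x s K3 (fun i => e i * nv) r) j w.
rewrite (dev_noise _ _ g k3) /sf /t' rq_xcol.
by rewrite -/(z j.+1) -/(A j); ring.
by rewrite !DE; exact: hD.
Qed.
End FirstPassGate.

(* The noise part of the data: the entries of column [i] in dimension [q n]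
 are the variables [X n (blk n i a)], scaled by [eta n i]. *)
Record noise_array d (T : measurableType d) (R : realType) (P : probability T R)
 := NoiseArray {
 na_I : nat -> finType;
 na_X : forall n, na_I n -> {RV P >-> (R * R)%type};
 na_q : nat -> nat;
 na_blk : forall n, 'I_n -> 'I_(na_q n) -> na_I n;
 na_eta : nat -> nat -> R;
 na_L : nat;
 na_p : 'I_na_L -> R;
 na_sigma : 'I_na_L -> R;
 na_c : R;
 na_B : R;
 na_std : forall n, std_array (@na_X n) 8 na_B;
 na_inj : forall n i j a b, @na_blk n i a = @na_blk n j b -> i = j /\ a = b;
 na_c0 : 0 < na_c;
 na_aspect : (n%:R / (na_q n)%:R : R) @[n \oo] --> na_c;
 na_sigma0 : forall l, 0 < na_sigma l;
 na_p0 : forall l, 0 < na_p l;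
 na_etaP : forall n j, exists l, na_eta n j = na_sigma l;
 na_avg : forall g : R -> R,
 (\sum_(j < n) n%:R^-1 * g (na_eta n j ^+ 2)) @[n \oo] -->
 \sum_l na_p l * g (na_sigma l ^+ 2) }.
Arguments na_inj {d T R P} _.
Arguments na_p {d T R P} _.
Arguments na_sigma {d T R P} _.
Arguments na_sigma0 {d T R P} _.
Arguments na_p0 {d T R P} _.
Arguments na_etaP {d T R P} _.
Arguments na_aspect {d T R P} _.
Arguments na_avg {d T R P} _.
Arguments na_X {d T R P} _ n _.
Arguments na_blk {d T R P} _ n _ _.

(** * First pass: choice of constants and almost sure gates *)

Section FirstPassLimit.
Context d (T : measurableType d) (R : realType) (P : probability T R).
Variable a : noise_array P.
Notation q := (na_q a).
Notation c := (na_c a).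
Notation sg l := (na_sigma a l ^+ 2).
Notation p := (na_p a).
Notation gaten n := (gate (na_X a n) (na_blk a n) (na_eta a n)).
Lemma na_near_n0 : \forall n \near \oo, (0 < n)%N.
by []. Qed.
Lemma na_near_q : \forall n \near \oo,
 (0 < q n)%N /\ (q n)%:R <= 2 / c * n%:R.
have c0 := na_c0 a.
have c2 : c / 2 < c by lra.
near=> n.
have h : c / 2 < n%:R / (q n)%:R by near: n; exact: (cvgr_gt c (na_aspect a)).
have q0 : (0 < q n)%N.
by rewrite lt0n; apply: contraTneq h => ->; rewrite invr0 mulr0 -leNgt divr_ge0 // ltW.
split => //.
have q0' : 0 < (q n)%:R :> R by nneg.
have cc : 0 < 2 / c by nneg.
have : c / 2 * (q n)%:R < n%:R by rewrite -ltr_pdivlMr.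
move/ltW/(ler_wpM2l (ltW cc)); apply: le_trans; rewrite mulrA.
by rewrite (_ : 2 / c * (c / 2) = 1) ?mul1r // mulrA divfK ?divff // gt_eqF.
Unshelve. all: end_near.
Qed.
Let L0 : (0 < na_L a)%N.
by have [l _] := na_etaP a 0%N 0%N; exact: leq_ltn_trans (leq0n l) (ltn_ord l). Qed.
Let l0 : 'I_(na_L a) := Ordinal L0.
Lemma na_e_lower : exists2 m, 0 < m & forall n j, m <= na_eta a n j ^+ 2.
have [l _ hl] := @Order.TotalTheory.arg_minP _ _ _ l0 xpredT (fun l => sg l) isT.
exists (sg l); first by rewrite exprn_gt0 // na_sigma0.
by move=> n j; have [l' ->] := na_etaP a n j; exact: hl.
Qed.
Lemma na_e_upper x : (forall l, sg l < x) ->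
 exists2 M, M < x & forall n j, na_eta a n j ^+ 2 <= M.
move=> h; have [l _ hl] := @Order.TotalTheory.arg_maxP _ _ _ l0 xpredT (fun l => sg l) isT.
exists (sg l) => // n j; have [l' ->] := na_etaP a n j; exact: hl.
Qed.
Lemma na_x_gt0 x : (forall l, sg l < x) -> 0 < x.
by move=> h; apply: lt_trans (h l0); rewrite exprn_gt0 // na_sigma0. Qed.
(** The Riccati bound needs its final denominator to be positive. In the limit that denominator is
    (x^2/c) A(x), so there is room for small [eps] and [kap]. *)
Lemma first_pass x : (forall l, sg l < x) -> 0 < fun_A c p (na_sigma a) x ->
 exists2 eps0, 0 < eps0 & forall eps, 0 < eps -> eps <= eps0 ->
 {ae P, forall w, \forall n \near \oo, forall i, (i <= n)%N ->
 gaten n x (1 + eps) i w}.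
move=> hx Ax; have x0 := na_x_gt0 hx; have c0 := na_c0 a.
have [emin emin0 he1] := na_e_lower; have [emax ex he2] := na_e_upper hx.
pose G (e : R) := (1 - e * x^-1)^-1 * e.
pose avg2 := \sum_l p l * G (sg l) ^+ 2.
have avg20 : 0 <= avg2.
by apply: sumr_ge0 => l _; rewrite mulr_ge0 ?sqr_ge0 // ltW // na_p0.
(* The limiting final value of the inverse of the second trace; all slacks below are fractions of
   it. *)
pose D := x ^+ 2 / c - avg2.
have D0 : 0 < D.
have -> : D = x ^+ 2 / c * fun_A c p (na_sigma a) x; last by nneg.
rewrite /D /fun_A /avg2 mulrBr mulr1; congr (_ - _).
rewrite mulrA (_ : x ^+ 2 / c * c = x ^+ 2) ?divfK ?gt_eqF // mulr_sumr.
apply: eq_bigr => l _; rewrite /G.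
have h1 : x - sg l != 0 by rewrite gt_eqF // subr_gt0.
have h2 : x != 0 by rewrite gt_eqF.
by move: (p l) (na_sigma a l) h1 => pl s h1; field; rewrite ?h1 ?h2.
pose wmax := (1 - emax / x)^-1.
have wmax0 : 0 < wmax by rewrite invr_gt0 subr_gt0 ltr_pdivrMr // mul1r.
have emax0 : 0 < emax by exact: lt_le_trans emin0 (le_trans (he1 0%N 0%N) (he2 0%N 0%N)).
have hw1 n i : wgt (na_eta a n) x i <= wmax.
have h (y : R) : y < x -> 0 < 1 - y / x by move=> yx; rewrite subr_gt0 ltr_pdivrMr // mul1r.
rewrite /wgt lef_pV2 ?posrE ?h // ?(le_lt_trans (he2 n i)) //.
by rewrite lerD2l lerN2 ler_pM2r ?invr_gt0.
(* For eps <= 1 the square of 1 + eps/2 is at most 1 + 5 eps / 4; this choice keeps the resulting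
   loss 5 eps avg2 / 4 below D/2. *)
pose m := Num.min 1 (2 * D / (5 * (avg2 + 1))).
have a15 : 0 < 5 * (avg2 + 1) by lra.
exists m; first by rewrite lt_min ltr01 /= !divr_gt0 // mulr_gt0.
move=> eps eps0; rewrite le_min => /andP[eps1 epsD].
have epsD' : 5 / 4 * eps * avg2 <= D / 2.
move: epsD; rewrite ler_pdivlMr // => h.
have : 0 <= eps by nneg.
by lra.
have xc0 : 0 < x ^+ 2 / c by nneg.
have Dx : D <= x ^+ 2 / c by rewrite /D lerBlDr lerDl.
(* An upper bound for the initial value of [Y]. It lies 2 g above the limit c/x^2 of the initial
   second trace: one [g] for convergence in n, one for the slack 4 kap + kap / emin. *)
pose Ys := (x ^+ 2 / c - D / 8)^-1.
have Ys0 : 0 < x ^+ 2 / c - D / 8 by lra.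
pose g := (Ys - c / x ^+ 2) / 2.
have cx0 : 0 < c / x ^+ 2 by nneg.
have g0 : 0 < g.
rewrite divr_gt0 // subr_gt0 /Ys -[c / _]invrK ltf_pV2 ?posrE ?invr_gt0 //.
by rewrite invfM invrK mulrC; lra.
pose t20 := c / x ^+ 2 + g.
have t200 : 0 < t20 by nneg.
pose t30 := c ^+ 2 / x ^+ 3 + 1.
have t300 : 0 <= t30 by nneg.
(* What remains of D after losing D/8 at the start, D/8 in the average and D/2 to [eps]. *)
pose u0 := D / 4.
have u00 : 0 < u0 by nneg.
pose kk := 4 + emin^-1.
have kk0 : 0 < kk by nneg.
pose ww := 4 * wmax * (2 * emax + 1).
have ww0 : 0 < ww by rewrite /ww !pmulr_rgt0 //; lra.
pose kap := Num.min 1 (Num.min (g / kk) (eps / ww)).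
have kap0 : 0 < kap by rewrite !lt_min ltr01 (divr_gt0 g0 kk0) (divr_gt0 eps0 ww0).
have kap1 : kap <= 1 by rewrite ge_min lexx.
have hkap : 4 * wmax * (2 * emax + 1) * kap <= eps.
by rewrite -/ww mulrC -ler_pdivlMr // !ge_min lexx !orbT.
have kapg : 4 * kap + kap / emin <= g.
rewrite -[kap / emin]mulrC -mulrDl -/kk mulrC -ler_pdivlMr //.
by rewrite !ge_min lexx !orbT.
pose K3 := Num.max 1 ((t30 + 2 * (6 + bar_L emax wmax u0) + bar_M emax wmax u0) *
 expR (bar_L emax wmax u0 * wmax * emax + 1)).
have K31 : 1 <= K3 by rewrite le_max lexx.
have hK3 : (t30 + 2 * (6 + bar_L emax wmax u0) + bar_M emax wmax u0) *
 expR (bar_L emax wmax u0 * wmax * emax + 1) <= K3 by rewrite le_max lexx orbT.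
have ratio : \forall n \near \oo, [/\ (0 < n)%N, (0 < q n)%N, (q n)%:R <= 2 / c * n%:R :> R,
 n%:R^-1 * (q n)%:R * ((q n)%:R * n%:R^-1 * x)^-1 ^+ 2 <= t20 :> R &
 n%:R^-1 * (q n)%:R * ((q n)%:R * n%:R^-1 * x)^-1 ^+ 3 <= t30].
have l2 : n%:R / (q n)%:R / x ^+ 2 @[n \oo] --> c / x ^+ 2.
by apply: cvgMl; exact: (na_aspect a).
have l3 : (n%:R / (q n)%:R) ^+ 2 / x ^+ 3 @[n \oo] --> c ^+ 2 / x ^+ 3.
by apply: cvgMl; rewrite !expr2; apply: cvgM; exact: (na_aspect a).
have e2 : c / x ^+ 2 < t20 by rewrite ltrDl.
have e3 : c ^+ 2 / x ^+ 3 < t30 by rewrite ltrDl.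
near=> n.
have n0 : (0 < n)%N by near: n; by [].
have [q0 qn] : (0 < q n)%N /\ (q n)%:R <= 2 / c * n%:R by near: n; exact: na_near_q.
have n1 : n%:R != 0 :> R by rewrite pnatr_eq0 -lt0n.
have q1 : (q n)%:R != 0 :> R by rewrite pnatr_eq0 -lt0n.
have x1 : x != 0 by rewrite gt_eqF.
split => //.
have -> : n%:R^-1 * (q n)%:R * ((q n)%:R * n%:R^-1 * x)^-1 ^+ 2 = n%:R / (q n)%:R / x ^+ 2 :> R.
by move: (n%:R : R) ((q n)%:R : R) n1 q1 => u v n1 q1; field; rewrite n1 q1 x1.
by apply: ltW; near: n; exact: (cvgr_lt _ l2).
have -> : n%:R^-1 * (q n)%:R * ((q n)%:R * n%:R^-1 * x)^-1 ^+ 3 = (n%:R / (q n)%:R) ^+ 2 / x ^+ 3 :> R.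
by move: (n%:R : R) ((q n)%:R : R) n1 q1 => u v n1 q1; field; rewrite n1 q1 x1.
by apply: ltW; near: n; exact: (cvgr_lt _ l3).
have hu : \forall n \near \oo, u0 <= (t20 + 4 * kap + kap / emin)^-1 -
 \sum_(j < n) n%:R^-1 * ((1 + eps / 2) * wgt (na_eta a n) x j * na_eta a n j ^+ 2) ^+ 2.
have := na_avg a (fun e => G e ^+ 2); rewrite -/avg2 => l2.
have D8 : avg2 < avg2 + D / 18 by lra.
near=> n.
have : \sum_(j < n) n%:R^-1 * G (na_eta a n j ^+ 2) ^+ 2 < avg2 + D / 18 by near: n; exact: (cvgr_lt _ l2).
set av := \sum_(j < n) _ => hav.
have -> : \sum_(j < n) n%:R^-1 * ((1 + eps / 2) * wgt (na_eta a n) x j * na_eta a n j ^+ 2) ^+ 2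
 = (1 + eps / 2) ^+ 2 * av.
rewrite mulr_sumr; apply: eq_bigr => j _.
by rewrite -[(1 + _) * _ * _]mulrA exprMn mulrCA.
have e1 : (1 + eps / 2) ^+ 2 <= 1 + 5 / 4 * eps.
rewrite expr2; have : 0 <= eps * (1 - eps) by rewrite mulr_ge0 ?subr_ge0 // ltW.
by lra.
have e2 : (1 + eps / 2) ^+ 2 * av <= D / 8 + (avg2 + D / 2).
apply: (letr ((1 + 5 / 4 * eps) * (avg2 + D / 18))).
apply: ler_pM => //; [by nneg| |exact: ltW].
by nneg.
rewrite mulrDl mul1r mulrDr.
have : eps * D <= D by rewrite ler_piMl // ltW.
by lra.
have e3 : x ^+ 2 / c - D / 8 <= (t20 + 4 * kap + kap / emin)^-1.
rewrite -[X in X <= _]invrK lef_pV2 ?posrE ?invr_gt0 //.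
have : Ys = c / x ^+ 2 + 2 * g by rewrite /g [2 * _]mulrC divfK // addrC subrK.
by rewrite -/Ys -addrA /t20; move: kapg; clear; lra.
have : 0 < kap / emin by nneg.
by move: t200 kap0; clear; lra.
by rewrite /u0; move: e2 e3; rewrite /D; lra.
pose V n w : R := if (0 < n)%N && (0 < q n)%N then
 path_error (na_X a n) (na_blk a n) (na_eta a n) x (1 + eps) K3 w else 0.
have s0 : 0 <= 1 + eps by lra.
have w0 n j : 0 < wgt (na_eta a n) x j by exact: (wgt_gt0 x0 (he2 n) ex).
have V0 : {ae P, forall w, V n w @[n \oo] --> (0 : R)}.
apply: (@ae_cvg0_integrals _ _ _ _ (path_const K3 emax wmax (na_B a) (2 / c))).
 - move=> n; rewrite /V; case b: ((0 < n)%N && (0 < q n)%N); last exact: measurable_cst.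
have /andP[n0 q0] := b.
have qbound : (q n)%:R <= (q n)%:R * n%:R :> R by rewrite ler_peMr // ler1n.
exact: (meas_path_error n0 q0 x0 s0 (he2 n) (w0 n) (hw1 n) K31 (na_std a n)
 (@na_inj _ _ _ _ a n)
 qbound).
 - by move=> n w; rewrite /V; case: ifP => // _; exact: path_error_ge0.
 - apply: filterS ratio => n [n0 q0 qn _ _].
rewrite /V n0 q0 /=.
exact: (path_error_integral n0 q0 x0 s0 (he2 n) (w0 n) (hw1 n) K31 (na_std a n)
 (@na_inj _ _ _ _ a n) qn).
have good : forall w, V n w @[n \oo] --> (0 : R) -> \forall n \near \oo, forall i, (i <= n)%N ->
 gaten n x (1 + eps) i w.
move=> w Vw; have k18 : 0 < kap ^+ 18 by exact: exprn_gt0.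
near=> n.
have [n0 q0 qn h2 h3] : [/\ (0 < n)%N, (0 < q n)%N, (q n)%:R <= 2 / c * n%:R :> R,
 n%:R^-1 * (q n)%:R * ((q n)%:R * n%:R^-1 * x)^-1 ^+ 2 <= t20 :> R &
 n%:R^-1 * (q n)%:R * ((q n)%:R * n%:R^-1 * x)^-1 ^+ 3 <= t30] by near: n.
have hun : u0 <= (t20 + 4 * kap + kap / emin)^-1 -
 \sum_(j < n) n%:R^-1 * ((1 + eps / 2) * wgt (na_eta a n) x j * na_eta a n j ^+ 2) ^+ 2 by near: n.
have : V n w < kap ^+ 18 by near: n; exact: (cvgr_lt _ Vw).
rewrite /V n0 q0 /= => herr i iN.
exact: (first_pass_gate n0 q0 x0 eps0 eps1 kap0 kap1 emin0 (he1 n) (he2 n) ex (hw1 n)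
 hkap t300 u00 hun hK3 h2 h3 herr iN).
by move: V0; apply: filterS.
Unshelve. all: end_near.
Qed.
End FirstPassLimit.

(** * Resolvent forms summed over the columns of a fixed matrix *)

Section MatrixForm.
Context (R : realType).
Notation C := R[i].
(** The real part of tr (V^H M V). A single column gives a quadratic form, and V = n^(-1/2) times
    the identity the normalised trace, so one argument serves for both. *)
Definition mform q m (M : 'M[C]_q) (V : 'M[C]_(q, m)) : R :=
 \sum_j rq M (col j V).
Lemma mform_scalar q (M : 'M[C]_q) (r : R) :
 mform M ((r%:C)%C%:M : 'M[C]_q) = r ^+ 2 * cRe (\tr M).
rewrite /mform /mxtrace Re_sum mulr_sumr; apply: eq_bigr => j _.
have -> : col j ((r%:C)%C%:M : 'M[C]_q) = (r%:C)%C *: delta_mx j 0.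
by apply/colP => i; rewrite !mxE eqxx andbT mulr_natr.
rewrite rqZv rq_def; congr (_ * cRe _).
rewrite vdotE (bigD1 j) //= big1 ?addr0 => [|i ij].
rewrite !mxE eqxx /= conjC1 mul1r (bigD1 j) //= big1 ?addr0 => [|l lj].
by rewrite mxE eqxx mulr1.
by rewrite mxE (negbTE lj) mulr0.
by rewrite mxE (negbTE ij) /= conjC0 mul0r.
Qed.
Context (q m : nat) (A : 'M[C]_q) (V : 'M[C]_(q, m)).
Lemma mform_rank1 (x : 'cV[C]_q) z : herm A -> below A z -> rq (res z A) x < 1 ->
 mform (res z (A + x *m x ^t*)) V = mform (res z A) V +
 (1 - rq (res z A) x)^-1 * rq (res z A *m (V *m V ^t*) *m res z A) x.
move=> hA b q1; rewrite /mform.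
under eq_bigr do rewrite (rank1_rq hA b q1).
rewrite big_split -mulr_sumr /=; congr (_ + _ * _).
have hQ := res_herm hA b.
have -> : res z A *m (V *m V ^t*) *m res z A = (res z A *m V) *m (res z A *m V) ^t*.
by rewrite adjmxM hQ !mulmxA.
rewrite rq_gram adjmxM hQ -mulmxA vsq_def; apply: eq_bigr => j _.
rewrite /vdot [in RHS]mxE mxE; congr nsq; apply: eq_bigr => i _.
by rewrite !mxE.
Qed.
Lemma mform_rpow2 z : herm A -> below A z ->
 mform (rpow z A 2) V = cRe (\tr (res z A *m (V *m V ^t*) *m res z A)).
move=> hA b; have hQ := res_herm hA b.
have -> : res z A *m (V *m V ^t*) *m res z A = (res z A *m V) *m (res z A *m V) ^t*.
by rewrite adjmxM hQ !mulmxA.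
rewrite -frob2_tr frob2_col; apply: eq_bigr => j _.
rewrite rpowS rpow1 rq_def -mulmxA vdotMr hQ vdotvv /=.
by congr vsq; rewrite !colE mulmxA.
Qed.
Lemma frob2_sandwich z K : herm A -> below A z ->
 (forall a, (z - eig A a)^-1 <= K) ->
 frob2 (res z A *m (V *m V ^t*) *m res z A) <= K ^+ 4 * frob2 (V *m V ^t*).
move=> hA b hK; have hQ := res_herm hA b; have hW := herm_gram V.
have K2 a : ((z - eig A a)^-1) ^+ 2 <= K ^+ 2.
have p : 0 <= (z - eig A a)^-1 by rewrite invr_ge0 subr_ge0 ltW.
by rewrite lerXn2r ?nnegrE // (le_trans p).
rewrite -mulmxA {1}(res_fcal hA b).
apply: (le_trans (frob2_fcal_mul _ K2)).
rewrite -frob2_adj adjmxM hQ hW (res_fcal hA b).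
rewrite (exprM K 2 2) [(K ^+ 2) ^+ 2]expr2 -mulrA; apply: ler_wpM2l; first by nneg.
exact: (frob2_fcal_mul _ K2).
Qed.
Lemma mform_shift_lower z z' h : herm A -> below A z -> 0 <= h -> z' = z + h ->
 mform (res z' A) V + h * mform (rpow z' A 2) V <= mform (res z A) V.
move=> hA b h0 zE; rewrite /mform mulr_sumr -big_split; apply: ler_sum => j _.
exact: rq_shift_lower.
Qed.
Lemma mform_shift_upper z z' h K : herm A -> below A z -> 0 <= h -> z' = z + h ->
 (forall a, (z - eig A a)^-1 <= K) ->
 mform (res z A) V <=
 mform (res z' A) V + h * (1 + h * K) * mform (rpow z' A 2) V.
move=> hA b h0 zE hK; rewrite /mform mulr_sumr -big_split; apply: ler_sum => j _.
exact: rq_shift_upper.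
Qed.
Lemma mform_rpow2_ge0 z : herm A -> below A z -> 0 <= mform (rpow z A 2) V.
by move=> hA b; apply: sumr_ge0 => j _; exact: rq_rpow_ge0. Qed.
End MatrixForm.

(** * One-step estimates from above and from below *)

Section SandwichArithmetic.
Context (R : realType).
Variables (sg eps x e w : R)
 (sgP : sg = 1 \/ sg = -1) (eps0 : 0 < eps) (eps1 : eps <= 1)
 (w0 : 0 < w) (e0 : 0 <= e) (we : w * (1 - e * x^-1) = 1).
(** The sign [sg] treats two bounds at once: an upper one along the path of speed 1 + eps and a
    lower one along the path of speed 1 - eps. *)
Lemma signed_pole dl s1 : s1 < 1 -> sg * s1 <= sg * (e * x^-1) + dl ->
 w * dl <= eps / 4 ->
 sg * (1 - s1)^-1 <= sg * (1 + sg * eps / 2) * w.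
move=> s11 h wd.
have u0 : 0 < 1 - s1 by rewrite subr_gt0.
have hw := ler_wpM2l (ltW w0) h.
have e2 : 0 <= eps * (1 - eps) by rewrite mulr_ge0 ?subr_ge0 // ltW.
case: sgP => sE; rewrite sE in h hw *.
rewrite !mul1r -[_^-1]mul1r ler_pdivrMr // -mulrA.
have : 1 - eps / 4 <= w * (1 - s1).
by move: we hw; rewrite mulrBr mulr1; move: (e * x^-1) => y; lra.
have h2 : 0 <= 1 + eps / 2 by move: eps0; lra.
move=> /(ler_wpM2l h2) hh; apply: le_trans hh.
have -> : (1 + eps / 2) * (1 - eps / 4) = 1 + (eps * (1 - eps) + eps) / 8 by field.
by rewrite lerDl divr_ge0 // addr_ge0 // ltW.
rewrite !mulN1r !mulNr lerN2 -[leRHS]mul1r ler_pdivlMr // -mulrA.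
have : w * (1 - s1) <= 1 + eps / 4.
by move: we hw; rewrite mulrBr mulr1; move: (e * x^-1) => y; lra.
have h2 : 0 <= 1 - eps / 2 by move: eps1; lra.
move=> /(ler_wpM2l h2) hh; apply: (le_trans hh).
by have := sqr_ge0 eps; rewrite mulrBl mulrDr expr2; lra.
Qed.
(** Moving the parameter removes between h tau and h (1 + h K0) tau from the form, and the new
    column adds k r. The deviation of the speed from 1 outweighs the error eps/2 in [k] and, for
    [sg = -1], also the second-order term h K0. *)
Lemma signed_step nv h K0 k r tau dl F F' F1 : 0 <= nv -> 0 <= tau -> 0 <= r ->
 0 <= h -> h = (1 + sg * eps) * (nv * (w * e)) -> h * K0 <= eps / 2 ->
 sg * k <= sg * (1 + sg * eps / 2) * w -> dl = w * r - w * (e * nv) * tau ->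
 F' + h * tau <= F -> F <= F' + h * (1 + h * K0) * tau -> F1 = F' + k * r ->
 sg * (F1 - F) <= sg * (1 + sg * eps / 2) * dl.
move=> nv0 tau0 r0 h0 hE hK hk -> lo up ->.
have y0 : 0 <= nv * (w * e) * tau by nneg.
have hkr := ler_wpM2r r0 hk.
have ey0 : 0 <= eps * (nv * (w * e) * tau) by nneg.
have eey0 : 0 <= eps * (eps * (nv * (w * e) * tau)) by nneg.
case: sgP => sE; rewrite sE in hE hk hkr *.
move: lo hkr; rewrite hE; move: y0 ey0.
rewrite !mul1r (_ : w * (e * nv) * tau = nv * (w * e) * tau); last by ring.
by rewrite -mulrA; move: (nv * (w * e) * tau) => y; lra.
have up' : F <= F' + (h * tau + eps / 2 * (h * tau)).
apply: (le_trans up); rewrite lerD2l -mulrA [h * ((1 + _) * _)]mulrCA mulrDl mul1r lerD2l.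
by apply: ler_wpM2r => //; rewrite mulr_ge0.
move: up' hkr; rewrite hE; move: y0 ey0 eey0.
rewrite !mulN1r (_ : w * (e * nv) * tau = nv * (w * e) * tau); last by ring.
by rewrite -!mulrA; move: (nv * (w * (e * tau))) => y; lra.
Qed.
End SandwichArithmetic.

(** * Second pass: forms along a path at positive distance from the spectrum *)

Section SecondPass.
Context d (T : measurableType d) (R : realType) (P : probability T R)
 (I : finType) (X : I -> {RV P >-> (R * R)%type}).
Notation C := R[i].
Context (n q : nat) (blk : 'I_n -> 'I_q -> I).
Variables (eta : nat -> R)
 (n0 : (0 < n)%N) (q0 : (0 < q)%N).
Notation nv := (n%:R^-1 : R).
Notation e j := (eta j ^+ 2).
Let nv0 : 0 < nv. by nneg. Qed.
Variables (x1 s1 x s K0 emax wmax : R)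
 (x10 : 0 < x1) (s10 : 0 <= s1) (x0 : 0 < x) (s0 : 0 <= s) (K00 : 0 < K0)
 (w10 : forall j, 0 < wgt eta x1 j)
 (w0 : forall j, 0 < wgt eta x j)
 (he : forall j, e j <= emax) (hw1 : forall j, wgt eta x j <= wmax)
 (gap : forall i, (i <= n)%N ->
 zeta n q eta x1 s1 i + K0^-1 <= zeta n q eta x s i).
Let emax0 : 0 <= emax. exact: le_trans (sqr_ge0 (eta 0)) (he 0). Qed.
Let A i w := acc X blk eta i w.
Let z i := zeta n q eta x s i.
Let Q' i w := res (z i.+1) (A i w).
Let h i : R := s * (nv * (wgt eta x i * e i)).
Let h0 i : 0 <= h i. by nneg. Qed.
Let zS i : z i.+1 = z i + h i. exact: zetaS. Qed.
Let hA i w : herm (A i w). exact: acc_herm. Qed.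
Let cut i w := (i < n)%N && gate X blk eta x1 s1 i w.

(* The noise terms with the resolvents cut off by the gate of an inner path,
 which keeps them bounded in operator norm. *)
Definition flow m (V : 'M[C]_(q, m)) i w : 'M[C]_q :=
 if cut i w then
 ((nv * (wgt eta x i * e i))%:C)%C *: (Q' i w *m (V *m V ^t*) *m Q' i w)
 else 0.
Definition flow1 i w : 'M[C]_q :=
 if cut i w then ((e i * nv)%:C)%C *: Q' i w else 0.
Let gap_eig i w : (i <= n)%N -> gate X blk eta x1 s1 i w ->
 forall a, eig (A i w) a + K0^-1 < z i.
move=> iN g a; apply: lt_le_trans (gap iN); rewrite ltrD2r.
exact: (gate_below n0 q0 x10 s10 w10 g).
Qed.
Lemma second_below i w : (i <= n)%N -> gate X blk eta x1 s1 i w ->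
 below (A i w) (z i).
move=> iN g a; apply: lt_trans (gap_eig iN g a).
by rewrite ltrDl invr_gt0.
Qed.
Let cut_below i w : cut i w -> below (A i w) (z i.+1).
move=> /andP[iN g]; apply: belowW (second_below (ltnW iN) g).
by rewrite zS lerDl.
Qed.
Let cut_norm i w : cut i w -> forall a, (z i.+1 - eig (A i w) a)^-1 <= K0.
move=> /andP[iN g] a; have := gap_eig (ltnW iN) g a => h'.
rewrite -[leRHS]invrK lef_pV2 ?posrE ?invr_gt0 //.
by rewrite lerBrDl zS (le_trans (ltW h')) // lerDl.
by rewrite subr_gt0; apply: cut_below; apply/andP.
Qed.
Lemma flow_measurable m (V : 'M[C]_(q, m)) i :
 mxmeas (flow V i : pastT X (before blk i) -> 'M[C]_q).
have mQ : mxmeas (Q' i : pastT X (before blk i) -> 'M[C]_q).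
by apply: mxmeas_res; exact: acc_meas.
apply: mxmeas_if.
by apply: measurable_and; [exact: measurable_cst|exact: gate_meas].
apply: mxmeasZ; first by [].
by apply: mxmeasM => //; apply: mxmeasM => //; by [].
Qed.
Lemma flow1_measurable i :
 mxmeas (flow1 i : pastT X (before blk i) -> 'M[C]_q).
apply: mxmeas_if.
by apply: measurable_and; [exact: measurable_cst|exact: gate_meas].
apply: mxmeasZ; first by [].
by apply: mxmeas_res; exact: acc_meas.
Qed.
Lemma flow_herm m (V : 'M[C]_(q, m)) i w : herm (flow V i w).
rewrite /flow; case: ifP => [c|_]; last exact: herm0.
have hQ := res_herm (hA i w) (cut_below c).
by rewrite /herm adjmxZ conjR !adjmxM hQ adjmxK !mulmxA.
Qed.
Lemma flow1_herm i w : herm (flow1 i w).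
rewrite /flow1; case: ifP => [c|_]; last exact: herm0.
by rewrite /herm adjmxZ conjR (res_herm (hA i w) (cut_below c)).
Qed.
Let frob2_0 : frob2 (0 : 'M[C]_q) = 0.
by rewrite frob2E big1 // => a _; rewrite big1 // => b _; rewrite mxE nsq0.
Qed.
Lemma flow_frob2 m (V : 'M[C]_(q, m)) v i w : frob2 (V *m V ^t*) <= v ->
 frob2 (flow V i w) <= (wmax * emax * nv) ^+ 2 * (K0 ^+ 4 * v).
move=> hv; have v0 := le_trans (frob2_ge0 _) hv.
rewrite /flow; case: ifP => [c|_]; last first.
by rewrite frob2_0 mulr_ge0 ?sqr_ge0 // mulr_ge0 // exprn_ge0 // ltW.
rewrite frob2Z nsqR; apply: ler_pM; [by nneg|exact: frob2_ge0| |].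
have w00 := w0 i; have e0 := sqr_ge0 (eta i).
have a0 : 0 <= wgt eta x i * e i by nneg.
have b0 : wgt eta x i * e i <= wmax * emax.
by apply: ler_pM => //; exact: ltW.
have c0 : nv * (wgt eta x i * e i) <= wmax * emax * nv.
by rewrite mulrC; apply: ler_wpM2r => //; exact: ltW.
apply: lerXn2r c0; rewrite nnegrE; first by nneg.
exact: mulr_ge0 (le_trans a0 b0) (ltW nv0).
apply: (le_trans (frob2_sandwich V (hA i w) (cut_below c) (cut_norm c))).
by apply: ler_wpM2l => //; rewrite exprn_ge0 // ltW.
Qed.
Lemma flow1_frob2 i w : frob2 (flow1 i w) <= (emax * nv) ^+ 2 * (q%:R * K0 ^+ 2).
rewrite /flow1; case: ifP => [c|_]; last first.
by rewrite frob2_0 mulr_ge0 ?sqr_ge0 // mulr_ge0 // sqr_ge0.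
rewrite frob2Z nsqR; apply: ler_pM; [by nneg|exact: frob2_ge0| |].
have e0 := sqr_ge0 (eta i).
have c0 : e i * nv <= emax * nv by apply: ler_wpM2r => //; exact: ltW.
apply: lerXn2r c0; rewrite nnegrE; first by nneg.
by nneg.
rewrite /Q' (res_fcal (hA i w) (cut_below c)) frob2_fcal.
rewrite -[q in q%:R * _]card_ord -sum1_card natr_sum mulr_suml.
apply: ler_sum => a _; rewrite mul1r lerXn2r ?nnegrE ?(cut_norm c) ?(ltW K00) //.
by rewrite invr_ge0 subr_ge0 ltW // cut_below.
Qed.
Let S m (V : 'M[C]_(q, m)) M w := \sum_(i < M) dev X blk (flow V) i w.
Definition flow_error m (V : 'M[C]_(q, m)) w : R :=
 \sum_(M < n.+1) S V M w ^+ 18 + \sum_(i < n) dev X blk flow1 i w ^+ 18.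
Let p18 (y : R) : 0 <= y ^+ 18.
exact: (exprD_ge0 9 y). Qed.
Lemma flow_error_ge0 m (V : 'M[C]_(q, m)) w : 0 <= flow_error V w.
by nneg. Qed.
Lemma flow_errorP m (V : 'M[C]_(q, m)) w kap : 0 < kap ->
 flow_error V w < kap ^+ 18 ->
 (forall M, (M <= n)%N -> `|S V M w| <= kap) /\
 (forall i, (i < n)%N -> `|dev X blk flow1 i w| <= kap).
move=> k0 hh; split => [M Mn|i iN]; apply: (lt18_norm k0); apply: le_lt_trans hh.
rewrite -(@inordK n M) //; apply: (letr (\sum_(M < n.+1) S V M w ^+ 18)).
by rewrite (bigD1 (inord M)) //= lerDl sumr_ge0.
by rewrite /flow_error lerDl sumr_ge0.
apply: (letr (\sum_(i < n) dev X blk flow1 i w ^+ 18)).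
by rewrite (bigD1 (Ordinal iN)) //= lerDl sumr_ge0.
by rewrite /flow_error lerDr sumr_ge0.
Qed.

Section Moments.
Variables (B : R)
 (stdX : std_array X 8 B)
 (inj_blk : forall i j a b, blk i a = blk j b -> i = j /\ a = b)
 (cq v : R)
 (hcq : q%:R <= cq * n%:R).
Definition flow_const : R :=
 2 * (dev_const B * ((wmax * emax) ^+ 2 * (K0 ^+ 4 * v))) ^+ 9 +
 (dev_const B * (emax ^+ 2 * (cq * K0 ^+ 2))) ^+ 9.
Context (m : nat) (V : 'M[C]_(q, m)).
Hypothesis hv : frob2 (V *m V ^t*) <= v.
Let mom_S M : (M <= n)%N -> mfunT (S V M) /\
 (\int[P]_w (S V M w ^+ 18)%:E <=
 ((dev_const B * ((wmax * emax) ^+ 2 * (K0 ^+ 4 * v))) ^+ 9 * nv ^+ 3)%:E)%E.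
move=> Mn.
have [m1 m2] := dev_sum_moment stdX inj_blk
 (flow_measurable V) (flow_herm V) (fun i w => flow_frob2 i w hv) Mn.
split => //; apply: (le_trans m2); rewrite lee_fin.
have v0 := le_trans (frob2_ge0 _) hv.
have k0 := dev_const_ge0 stdX.
have w00 := le_trans (ltW (w0 0)) (hw1 0).
rewrite [4 * taylorK 8 * _]mulrA (_ : 4 * taylorK 8 * quadK 8 B = dev_const B); last by rewrite dev_const.unlock.
move: (dev_const B) k0 => k k0.
apply: (letr ((k * ((wmax * emax) ^+ 2 * (K0 ^+ 4 * v)) * nv) ^+ 9)).
have K40 : 0 <= K0 ^+ 4 by nneg.
have kk0 : 0 <= (wmax * emax * nv) ^+ 2 * (K0 ^+ 4 * v) by nneg.
rewrite -[8.+1]/9%N.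
apply: lerXn2r; rewrite ?nnegrE.
 - by nneg.
 - by nneg.
apply: (letr (n%:R * (k * ((wmax * emax * nv) ^+ 2 * (K0 ^+ 4 * v))))).
by apply: ler_wpM2r; rewrite ?ler_nat // mulr_ge0.
rewrite le_eqVlt; apply/orP; left; apply/eqP.
have nn : n%:R != 0 :> R by rewrite pnatr_eq0 -lt0n.
by move: (n%:R : R) nn => N nn; field.
rewrite exprMn; apply: ler_wpM2l.
by rewrite exprn_ge0 // mulr_ge0 // mulr_ge0 ?sqr_ge0 // mulr_ge0 // exprn_ge0 // ltW.
by apply: ler_wiXn2l => //; rewrite ?(ltW nv0) // invf_le1 ?ltr0n // ler1n.
Qed.
Let mom_D i : (i < n)%N -> mfunT (dev X blk flow1 i) /\
 (\int[P]_w (dev X blk flow1 i w ^+ 18)%:E <=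
 ((dev_const B * (emax ^+ 2 * (cq * K0 ^+ 2))) ^+ 9 * nv ^+ 3)%:E)%E.
move=> iN.
have [m1 m2] := dev_moment stdX inj_blk
 flow1_measurable flow1_herm flow1_frob2 iN.
split => //; apply: (le_trans m2); rewrite lee_fin.
have k0 := dev_const_ge0 stdX; have kq := quadK_ge0 stdX.
have kk : quadK 8 B <= dev_const B.
have := @taylorK_ge1 R 8; rewrite dev_const.unlock; move: kq.
by move: (quadK _ _) (taylorK _) => a b a0 b1; rewrite ler_peMl //; lra.
move: (dev_const B) (quadK 8 B) kk k0 kq => k k' kk k0 kq.
have cq0 : 0 <= cq.
by have := le_trans (ler0n R q) hcq; rewrite pmulr_lge0 // ltr0n.
have qK : 0 <= (emax * nv) ^+ 2 * (q%:R * K0 ^+ 2).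
by nneg.
have qK' : 0 <= emax ^+ 2 * (cq * K0 ^+ 2).
by nneg.
apply: (letr ((k * (emax ^+ 2 * (cq * K0 ^+ 2)) * nv) ^+ 9)).
rewrite -[8.+1]/9%N; apply: lerXn2r; rewrite ?nnegrE.
 - by nneg.
 - by nneg.
rewrite -[leRHS]mulrA; apply: ler_pM => //.
apply: (letr ((emax * nv) ^+ 2 * (cq * n%:R * K0 ^+ 2))).
by apply: ler_wpM2l; rewrite ?sqr_ge0 //; apply: ler_wpM2r; rewrite ?sqr_ge0.
rewrite le_eqVlt; apply/orP; left; apply/eqP.
have nn : n%:R != 0 :> R by rewrite pnatr_eq0 -lt0n.
by move: (n%:R : R) nn => N nn; field.
rewrite exprMn; apply: ler_wpM2l.
by rewrite exprn_ge0 // mulr_ge0 // mulr_ge0 ?sqr_ge0 // mulr_ge0 ?sqr_ge0.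
by apply: ler_wiXn2l => //; rewrite ?(ltW nv0) // invf_le1 ?ltr0n // ler1n.
Qed.
Let m18 (f : T -> R) : mfunT f -> mfunT (fun w => (f w ^+ 18)%:E).
by move=> mf; apply/measurable_EFinP; exact: measurable_funX. Qed.
Lemma meas_flow_error : mfunT (flow_error V).
apply: measurable_funD; apply: (@measurable_sum _ _ _ _ _ (index_enum _)) => i.
by apply: measurable_funX; apply: (mom_S _).1; rewrite -ltnS.
by apply: measurable_funX; exact: (mom_D _).1.
Qed.
Lemma flow_error_integral :
 (\int[P]_w (flow_error V w)%:E <= (flow_const / n%:R ^+ 2)%:E)%E.
set A1 := (dev_const B * ((wmax * emax) ^+ 2 * (K0 ^+ 4 * v))) ^+ 9.
set A2 := (dev_const B * (emax ^+ 2 * (cq * K0 ^+ 2))) ^+ 9.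
have sum_cst N (y : R) : (N%:R * y)%:E = (\sum_(i < N) y%:E)%E.
by rewrite sumEFin sumr_const card_ord mulr_natl.
have I1 : (\int[P]_w (\sum_(M < n.+1) S V M w ^+ 18)%:E <= (n.+1%:R * (A1 * nv ^+ 3))%:E)%E.
under eq_integral do rewrite -sumEFin.
rewrite ge0_integral_sum //; last 2 first.
 - by move=> M; apply: m18; apply: (mom_S _).1; rewrite -ltnS.
 - by move=> M w _; rewrite lee_fin.
by rewrite sum_cst; apply: lee_sum => M _; apply: (mom_S _).2; rewrite -ltnS.
have I2 : (\int[P]_w (\sum_(i < n) dev X blk flow1 i w ^+ 18)%:E <= (n%:R * (A2 * nv ^+ 3))%:E)%E.
under eq_integral do rewrite -sumEFin.
rewrite ge0_integral_sum //; last 2 first.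
 - by move=> M; apply: m18; exact: (mom_D _).1.
 - by move=> M w _; rewrite lee_fin.
by rewrite sum_cst; apply: lee_sum => M _; exact: (mom_D _).2.
rewrite /flow_error; under eq_integral do rewrite EFinD.
rewrite ge0_integralD //; last 4 first.
- by move=> w _; rewrite lee_fin sumr_ge0.
- apply/measurable_EFinP; apply: (@measurable_sum _ _ _ _ _ (index_enum _)) => i.
by apply: measurable_funX; apply: (mom_S _).1; rewrite -ltnS.
- by move=> w _; rewrite lee_fin sumr_ge0.
- apply/measurable_EFinP; apply: (@measurable_sum _ _ _ _ _ (index_enum _)) => i.
by apply: measurable_funX; exact: (mom_D _).1.
apply: (le_trans (leeD I1 I2)); rewrite -EFinD lee_fin /flow_const -/A1 -/A2.
have A10 : 0 <= A1.
have v0 := le_trans (frob2_ge0 _) hv.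
rewrite exprn_ge0 // mulr_ge0 ?(dev_const_ge0 stdX) // mulr_ge0 ?sqr_ge0 //.
by nneg.
have -> : (2 * A1 + A2) / n%:R ^+ 2 = n%:R * (A2 * nv ^+ 3) + 2 * A1 * n%:R * nv ^+ 3.
have n1 : n%:R != 0 :> R by rewrite pnatr_eq0 -lt0n.
by move: (n%:R : R) n1 => N n1; field.
rewrite addrC lerD2l -natr1.
have : 0 <= A1 * nv ^+ 3 * (n%:R - 1).
by rewrite mulr_ge0 ?subr_ge0 ?ler1n // mulr_ge0 // exprn_ge0 // ltW.
move: (nv ^+ 3) => y; move: (n%:R : R) => N; lra.
Qed.
End Moments.

Section Conclusion.
Variables (sg eps kap cq : R) (w : T)
 (sgP : sg = 1 \/ sg = -1) (eps0 : 0 < eps) (eps1 : eps <= 1)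
 (sE : s = 1 + sg * eps) (kap0 : 0 < kap) (ex : emax < x)
 (hcq : q%:R <= cq * n%:R)
 (hkap : wmax * (emax * (2 * kap + 4 * (wmax * emax * nv) * (cq * K0 ^+ 2)) + kap) <= eps / 4)
 (hK0 : 2 * (wmax * emax * nv) * K0 <= eps / 2)
 (gates : forall i, (i <= n)%N -> gate X blk eta x1 s1 i w).
Let F m (V : 'M[C]_(q, m)) i := mform (res (z i) (A i w)) V.
(** With this matrix the form is the normalised trace. It has to be controlled before any other
    form, because the factors 1/(1 - ss) depend on it. *)
Let V0 : 'M[C]_q := ((Num.sqrt nv)%:C)%C%:M.
Let r m (V : 'M[C]_(q, m)) i :=
 rq (Q' i w *m (V *m V ^t*) *m Q' i w) (xcol X blk eta i w).
Let tau m (V : 'M[C]_(q, m)) i := mform (rpow (z i.+1) (A i w) 2) V.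
Let ss i := rq (Q' i w) (xcol X blk eta i w).
Let cutP i : (i < n)%N -> cut i w.
by move=> iN; rewrite /cut iN gates // ltnW. Qed.
Let h_le i : h i <= 2 * (wmax * emax * nv).
have w00 := w0 i; have e0 := sqr_ge0 (eta i).
have s2 : s <= 2.
by rewrite sE; case: sgP => ->; rewrite ?mul1r ?mulN1r; move: eps0 eps1; lra.
rewrite /h; apply: ler_pM => //; first by nneg.
rewrite mulrC; apply: ler_wpM2r; first exact: ltW.
by apply: ler_pM => //; exact: ltW.
Qed.
Let ss_lt1 i : (i < n)%N -> ss i < 1.
move=> iN; have b := cut_below (cutP iN).
apply: (rank1_lt1 (hA i w) b).
have := second_below iN (gates iN); rewrite /A accS; exact.
Qed.
Let step_pole m (V : 'M[C]_(q, m)) i : (i < n)%N ->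
 sg * (1 - ss i)^-1 <= sg * (1 + sg * eps / 2) * wgt eta x i ->
 sg * (F V i.+1 - F V i) <=
 sg * (1 + sg * eps / 2) * dev X blk (flow V) i w.
move=> iN hk; have c := cutP iN; have b' := cut_below c.
have b := second_below (ltnW iN) (gates (ltnW iN)).
apply: (signed_step sgP eps0 (w0 i) (sqr_ge0 _)
 (nv := nv) (h := h i) (K0 := K0) (k := (1 - ss i)^-1) (r := r V i) (tau := tau V i)
 (F' := mform (Q' i w) V)).
- exact: ltW.
- exact: mform_rpow2_ge0.
- rewrite /r; have hQ := res_herm (hA i w) b'.
have -> : Q' i w *m (V *m V ^t*) *m Q' i w = (Q' i w *m V) *m (Q' i w *m V) ^t*.
by rewrite adjmxM hQ !mulmxA.
by rewrite rq_gram vsq_ge0.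
- exact: h0.
- by rewrite /h sE.
- by apply: le_trans hK0; apply: ler_wpM2r; [exact: ltW|by []].
- exact: hk.
- rewrite /dev /flow c rqZ mxtraceZ Re_mul /= mul0r subr0 /r rq_xcol /tau mform_rpow2 //.
by rewrite -/(Q' i w); ring.
- exact: mform_shift_lower.
- apply: mform_shift_upper => // a; have := gap_eig (ltnW iN) (gates (ltnW iN)) a => h'.
rewrite -[leRHS]invrK lef_pV2 ?posrE ?invr_gt0 ?subr_gt0 //.
by rewrite lerBrDl ltW.
- by rewrite /F {1}/A accS; exact: (mform_rank1 V (hA i w) b' (ss_lt1 iN)).
Qed.
(** Once the factors 1/(1 - ss) before [M] are bounded, the increments of the form are dominated by
    martingale increments, whose partial sums are at most [kap] in absolute value. *)
Let telescope_pole m (V : 'M[C]_(q, m)) M : flow_error V w < kap ^+ 18 -> (M <= n)%N ->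
 (forall i, (i < M)%N -> sg * (1 - ss i)^-1 <= sg * (1 + sg * eps / 2) * wgt eta x i) ->
 sg * (F V M - F V 0) <= 2 * kap.
move=> err Mn hk.
have : sg * (F V M - F V 0) <= sg * (1 + sg * eps / 2) * S V M w.
rewrite -(telescope_sumr (F V) (leq0n M)) big_mkord !mulr_sumr.
apply: ler_sum => i _; apply: step_pole; first exact: leq_trans (ltn_ord i) Mn.
exact: hk.
move=> hh; apply: (le_trans hh).
have := (flow_errorP kap0 err).1 M Mn; rewrite ler_norml => /andP[a1 a2].
have ek : eps * kap <= kap by rewrite ler_piMl // ltW.
have b1 : 0 <= 1 + eps / 2 by move: eps0; lra.
have b2 : 0 <= 1 - eps / 2 by move: eps1; lra.
have k00 := ltW (mulr_gt0 eps0 kap0).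
case: sgP => ->; rewrite ?mul1r ?mulN1r.
by have := ler_wpM2l b1 a2; move: (_ * S V M w) => y; lra.
rewrite !mulNr; have := ler_wpM2l b2 a1.
by move: (_ * S V M w) => y; lra.
Qed.
Let F0 m (V : 'M[C]_(q, m)) : F V 0 = (q%:R * nv * x)^-1 * frob2 V.
have z00 : 0 < z 0%N by exact: (zeta0_gt0 eta s n0 q0 x0).
rewrite /F /A /acc big_ord0 (res0 _ z00) frob2_col mulr_sumr; apply: eq_bigr => j _.
by rewrite rq_scalar /z /zeta big_ord0 mulr0 addr0.
Qed.
(** Strong induction: the earlier factors bound the normalised trace up to step [i] by telescoping,
    and a trace on the right side of 1/x bounds the i-th factor. *)
Lemma pole_bound_all i : flow_error V0 w < kap ^+ 18 -> (i < n)%N ->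
 sg * (1 - ss i)^-1 <= sg * (1 + sg * eps / 2) * wgt eta x i.
move=> err; elim/ltn_ind: i => i IH iN.
have c := cutP iN; have b' := cut_below c.
have b := second_below (ltnW iN) (gates (ltnW iN)).
have hi : sg * (F V0 i - F V0 0) <= 2 * kap.
apply: telescope_pole => //; first exact: ltnW.
by move=> j ji; apply: IH => //; exact: ltn_trans ji iN.
have sq : Num.sqrt nv ^+ 2 = nv by rewrite sqr_sqrtr // ltW.
have F00 : F V0 0 = x^-1.
rewrite F0 frob2_scalar sq.
have n1 : n%:R != 0 :> R by rewrite pnatr_eq0 -lt0n.
have q1 : q%:R != 0 :> R by rewrite pnatr_eq0 -lt0n.
have xx : x != 0 by rewrite gt_eqF.
by move: (n%:R : R) (q%:R : R) n1 q1 => u v n1 q1; field; rewrite xx n1 q1.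
have D := (flow_errorP kap0 err).2 i iN.
have Fp : F V0 i.+1 = F V0 i.+1 by [].
set t' := mform (Q' i w) V0.
have t'E : t' = nv * cRe (\tr (Q' i w)) by rewrite /t' mform_scalar sq.
have DE : dev X blk flow1 i w = ss i - e i * t'.
by rewrite /dev /flow1 c rqZ mxtraceZ Re_mul /= mul0r subr0 /ss rq_xcol t'E; ring.
have lo : t' + h i * tau V0 i <= F V0 i by exact: mform_shift_lower.
have up : F V0 i <= t' + h i * (1 + h i * K0) * tau V0 i.
apply: mform_shift_upper => // a; have := gap_eig (ltnW iN) (gates (ltnW iN)) a => h'.
rewrite -[leRHS]invrK lef_pV2 ?posrE ?invr_gt0 ?subr_gt0 //.
by rewrite lerBrDl ltW.
have tau0 : 0 <= tau V0 i by exact: mform_rpow2_ge0.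
have cK0 : 0 <= cq * K0 ^+ 2.
have cq0 : 0 <= cq by have := le_trans (ler0n R q) hcq; rewrite pmulr_lge0 // ltr0n.
by nneg.
have tauB : tau V0 i <= cq * K0 ^+ 2.
rewrite /tau mform_scalar sq -rtr_def rtrE //.
have : \sum_a (z i.+1 - eig (A i w) a)^-1 ^+ 2 <= q%:R * K0 ^+ 2.
rewrite -[q in q%:R * _]card_ord -sum1_card natr_sum mulr_suml.
apply: ler_sum => a _; rewrite mul1r lerXn2r ?nnegrE ?(cut_norm c) ?(ltW K00) //.
by rewrite invr_ge0 subr_ge0 ltW // b'.
move=> /(ler_wpM2l (ltW nv0)) hh; apply: (le_trans hh).
rewrite mulrA; apply: ler_wpM2r; first by nneg.
by rewrite mulrC ler_pdivrMr // ltr0n.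
have hK : h i * K0 <= 1.
apply: (letr (eps / 2)); last by move: eps1; lra.
by apply: le_trans hK0; apply: ler_wpM2r; [exact: ltW|by []].
have ht0 : 0 <= h i * tau V0 i by nneg.
have ht : h i * tau V0 i <= 2 * (wmax * emax * nv) * (cq * K0 ^+ 2).
by apply: ler_pM => //; by [].
have up' : F V0 i <= t' + 4 * (wmax * emax * nv) * (cq * K0 ^+ 2).
apply: (le_trans up); rewrite lerD2l.
apply: (letr (2 * (h i * tau V0 i))); last first.
by move: ht; rewrite -!mulrA; move: (wmax * _) => y; lra.
by rewrite mulrAC mulrC; apply: ler_wpM2r => //; move: hK; lra.
have lo' : t' <= F V0 i by apply: le_trans lo; rewrite lerDl.
have hkap' := hkap; set hb := 4 * (wmax * emax * nv) * (cq * K0 ^+ 2) in up' hkap'.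
have hb0 : 0 <= hb by rewrite -(lerD2l t') addr0; exact: le_trans up'.
have st' : sg * t' <= sg * x^-1 + (2 * kap + hb).
by move: hi; rewrite F00; case: sgP => ->; rewrite ?mul1r ?mulN1r; lra.
have eb := sqr_ge0 (eta i); have w00 := w0 i.
apply: (@signed_pole R sg eps x (e i) _ sgP eps0 eps1 (w0 i)
 (wgt_eq x0 he ex i) (emax * (2 * kap + hb) + kap)).
- exact: ss_lt1.
- have := ler_wpM2l eb st'; move: D; rewrite DE ler_norml => /andP[d1 d2].
have : e i * (2 * kap + hb) <= emax * (2 * kap + hb).
by apply: ler_wpM2r => //; move: hb0 (kap0); lra.
move: d1 d2; case: sgP => ->; rewrite ?mul1r ?mulN1r ?mulrN; lra.
- apply: le_trans hkap'; apply: ler_wpM2r => //.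
by rewrite addr_ge0 ?(ltW kap0) // mulr_ge0 // addr_ge0 // mulr_ge0 // ltW.
Qed.
Lemma second_pass_form m (V : 'M[C]_(q, m)) :
 flow_error V0 w < kap ^+ 18 -> flow_error V w < kap ^+ 18 ->
 sg * (mform (res (z n) (A n w)) V - (q%:R * nv * x)^-1 * frob2 V) <= 2 * kap.
move=> err0 err; rewrite -F0; apply: telescope_pole => // i iN.
exact: pole_bound_all.
Qed.
End Conclusion.
End SecondPass.

(** * The limit map phi, and the second pass in the limit *)

Section SecondPassLimit.
Context d (T : measurableType d) (R : realType) (P : probability T R).
Variable a : noise_array P.
Notation q := (na_q a).
Notation c := (na_c a).
Notation sg2 l := (na_sigma a l ^+ 2).
Notation p := (na_p a).
Notation accn n w := (acc (na_X a n) (na_blk a n) (na_eta a n) n w).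
Notation zetan x s n := (zeta n (q n) (na_eta a n) x s n).
Notation gaten n := (gate (na_X a n) (na_blk a n) (na_eta a n)).
Notation flown n := (flow_error (na_X a n) (na_blk a n) (na_eta a n)).
Definition admissible x := (forall l, sg2 l < x) /\ 0 < fun_A c p (na_sigma a) x.
Definition na_sum x := \sum_l p l * ((1 - sg2 l * x^-1)^-1 * sg2 l).
(** The limit of the end point of the path of speed [s]. At s = 1 it is x (1 + c sum_l p_l sigma_l^2
    / (x - sigma_l^2)) / c. *)
Definition na_phi x s := x / c + s * na_sum x.
Let c0 := na_c0 a.
Lemma na_sumE x : (forall l, sg2 l < x) ->
 na_sum x = \sum_l p l * sg2 l + \sum_l p l * na_sigma a l ^+ 4 / (x - sg2 l).
move=> hx; have x0 := na_x_gt0 hx.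
rewrite -big_split; apply: eq_bigr => l _ /=.
have h1 : x - sg2 l != 0 by rewrite gt_eqF // subr_gt0.
have h2 : x != 0 by rewrite gt_eqF.
by move: (p l) (na_sigma a l) h1 => pl s h1; field; rewrite ?h1 ?h2.
Qed.
Lemma na_phiB x y : (forall l, sg2 l < x) -> (forall l, sg2 l < y) ->
 na_phi y 1 - na_phi x 1 = (y - x) * (c^-1 -
 \sum_l p l * na_sigma a l ^+ 4 / ((x - sg2 l) * (y - sg2 l))).
move=> hx hy; rewrite /na_phi !na_sumE // !mul1r.
set s1 := \sum_l p l * sg2 l; set s2 := (X in y / c + (s1 + X)).
set s3 := (X in x / c + (s1 + X)).
suff E : (y - x) * (\sum_l p l * na_sigma a l ^+ 4 / ((x - sg2 l) * (y - sg2 l))) = s3 - s2.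
by rewrite mulrBr E mulrBl; ring.
rewrite mulr_sumr /s2 /s3 -sumrB; apply: eq_bigr => l _.
have h1 : x - sg2 l != 0 by rewrite gt_eqF // subr_gt0.
have h2 : y - sg2 l != 0 by rewrite gt_eqF // subr_gt0.
by move: (p l) (na_sigma a l) h1 h2 => pl s h1 h2; field; rewrite ?h1 ?h2.
Qed.
Lemma fun_A_le x y : (forall l, sg2 l < x) -> x <= y ->
 fun_A c p (na_sigma a) x <= fun_A c p (na_sigma a) y.
move=> hx xy; rewrite /fun_A lerD2l lerN2; apply: ler_wpM2l; first exact: ltW.
apply: ler_sum => l _; apply: ler_wpM2l.
by rewrite mulr_ge0 ?(ltW (na_p0 a l)) // exprn_ge0 // ltW // na_sigma0.
have x1 : 0 < x - sg2 l by rewrite subr_gt0.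
have y1 : 0 < y - sg2 l by rewrite subr_gt0 (lt_le_trans (hx l)).
rewrite lef_pV2 ?posrE ?exprn_gt0 //.
by rewrite lerXn2r ?nnegrE ?(ltW x1) ?(ltW y1) // lerD2r.
Qed.
Lemma admissibleW x y : admissible x -> x <= y -> admissible y.
move=> [hx Ax] xy; split => [l|]; first exact: lt_le_trans (hx l) xy.
exact: lt_le_trans Ax (fun_A_le hx xy).
Qed.
(** phi has derivative A/c and [A] is nondecreasing beyond the noise levels. The exact formula
    [na_phiB] for the secants gives both bounds without differentiation. *)
Lemma na_phiB_bounds x y : (forall l, sg2 l < x) -> x <= y ->
 (y - x) * (fun_A c p (na_sigma a) x / c) <= na_phi y 1 - na_phi x 1 /\
 na_phi y 1 - na_phi x 1 <= (y - x) * (fun_A c p (na_sigma a) y / c).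
move=> hx xy; have hy l : sg2 l < y by exact: lt_le_trans (hx l) xy.
have hp l : 0 <= p l * na_sigma a l ^+ 4.
by rewrite mulr_ge0 ?(ltW (na_p0 a l)) // exprn_ge0 // ltW // na_sigma0.
rewrite na_phiB //; split.
- apply: ler_wpM2l; first by rewrite subr_ge0.
rewrite /fun_A mulrBl mul1r lerD2l lerN2 mulrAC divff ?gt_eqF // mul1r.
apply: ler_sum => l _; apply: ler_wpM2l; first exact: hp.
have x1 : 0 < x - sg2 l by rewrite subr_gt0.
have y1 : 0 < y - sg2 l by rewrite subr_gt0.
rewrite lef_pV2 ?posrE ?exprn_gt0 ?mulr_gt0 // expr2; apply: ler_wpM2l; first exact: ltW.
by rewrite lerD2r.
- apply: ler_wpM2l; first by rewrite subr_ge0.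
rewrite /fun_A mulrBl mul1r lerD2l lerN2 mulrAC divff ?gt_eqF // mul1r.
apply: ler_sum => l _; apply: ler_wpM2l; first exact: hp.
have x1 : 0 < x - sg2 l by rewrite subr_gt0.
have y1 : 0 < y - sg2 l by rewrite subr_gt0.
rewrite lef_pV2 ?posrE ?exprn_gt0 ?mulr_gt0 // expr2; apply: ler_wpM2r; first exact: ltW.
by rewrite lerD2r.
Qed.
Lemma na_phi_lt x y : admissible x -> x < y -> na_phi x 1 < na_phi y 1.
move=> [hx Ax] xy; rewrite -subr_gt0; apply: lt_le_trans (na_phiB_bounds hx (ltW xy)).1.
by rewrite mulr_gt0 ?subr_gt0 // divr_gt0.
Qed.
Lemma na_aspectV : (q n)%:R / n%:R @[n \oo] --> c^-1.
have h : (n%:R / (q n)%:R)^-1 @[n \oo] --> c^-1.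
by apply: cvgV; [rewrite gt_eqF|exact: na_aspect].
suff -> : (fun n => (q n)%:R / n%:R : R) = (fun n => (n%:R / (q n)%:R)^-1) by [].
by apply/funext => n; rewrite invfM invrK mulrC.
Qed.
Lemma zeta_cvg x s : zetan x s n @[n \oo] --> na_phi x s.
rewrite /na_phi; apply: cvgD.
by rewrite [x / c]mulrC; apply: cvgMl; exact: na_aspectV.
apply: cvgMr; have := na_avg a (fun e => (1 - e * x^-1)^-1 * e); exact.
Qed.
Lemma na_sum_ge0 x : (forall l, sg2 l < x) -> 0 <= na_sum x.
move=> hx; have x0 := na_x_gt0 hx; apply: sumr_ge0 => l _.
rewrite mulr_ge0 ?(ltW (na_p0 a l)) // mulr_ge0 ?sqr_ge0 //.
by rewrite invr_ge0 subr_ge0 ler_pdivrMr // mul1r ltW.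
Qed.
Lemma wgt_bound x : (forall l, sg2 l < x) -> exists2 wmax, 0 < wmax &
 exists2 emax, 0 <= emax /\ emax < x & forall n j,
 [/\ 0 < wgt (na_eta a n) x j, wgt (na_eta a n) x j <= wmax & na_eta a n j ^+ 2 <= emax].
move=> hx; have x0 := na_x_gt0 hx; have [emax ex he] := na_e_upper hx.
have h (y : R) : y < x -> 0 < 1 - y / x by move=> yx; rewrite subr_gt0 ltr_pdivrMr // mul1r.
exists (1 - emax / x)^-1; first by rewrite invr_gt0 h.
exists emax; first by split => //; exact: le_trans (sqr_ge0 _) (he 0%N 0%N).
move=> n j; have e1 := le_lt_trans (he n j) ex.
split => //; first by rewrite /wgt invr_gt0 h.
rewrite /wgt lef_pV2 ?posrE ?h // ?(le_lt_trans (he n i)) //.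
by rewrite lerD2l lerN2 ler_pM2r ?invr_gt0.
Qed.
(** The inner path has the larger weights and speed, so it approaches the outer one at every step;
    the distance at the end is the smallest. *)
Lemma gap_path x1 x s1 s n i : (forall l, sg2 l < x1) -> x1 <= x -> 0 <= s ->
 s <= s1 -> (i <= n)%N ->
 zetan x s n - zetan x1 s1 n <=
 zeta n (q n) (na_eta a n) x s i - zeta n (q n) (na_eta a n) x1 s1 i.
move=> hx xx s0 ss iN.
suff h k : zeta n (q n) (na_eta a n) x s (i + k) - zeta n (q n) (na_eta a n) x1 s1 (i + k) <=
 zeta n (q n) (na_eta a n) x s i - zeta n (q n) (na_eta a n) x1 s1 i.
by have := h (n - i)%N; rewrite subnKC.
elim: k => [|k IH]; first by rewrite addn0.
rewrite addnS; apply: le_trans IH; rewrite !zetaS.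
set u := zeta _ _ _ x _ _; set v := zeta _ _ _ x1 _ _.
set y := wgt _ x _; set y1 := wgt _ x1 _.
have x10 := na_x_gt0 hx.
have [l eE] := na_etaP a n (i + k)%N.
have hy l' : sg2 l' < x by exact: lt_le_trans (hx l') xx.
have yy : y <= y1.
have h (t z : R) : 0 < z -> t < z -> 0 < 1 - t / z by move=> z0 tz; rewrite subr_gt0 ltr_pdivrMr // mul1r.
rewrite /y /y1 /wgt lef_pV2 ?posrE ?h ?eE ?(lt_le_trans x10) //.
by rewrite lerD2l lerN2; apply: ler_wpM2l; rewrite ?sqr_ge0 // lef_pV2 ?posrE // (lt_le_trans x10).
have y0 : 0 <= y.
by rewrite /y /wgt invr_ge0 subr_ge0 ler_pdivrMr ?(lt_le_trans x10) // mul1r eE ltW.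
have : s * (n%:R^-1 * (y * na_eta a n (i + k) ^+ 2)) <= s1 * (n%:R^-1 * (y1 * na_eta a n (i + k) ^+ 2)).
have n1 : 0 <= n%:R^-1 :> R by rewrite invr_ge0.
apply: ler_pM => //; first by rewrite mulr_ge0 // mulr_ge0 // sqr_ge0.
by apply: ler_wpM2l => //; apply: ler_wpM2r; rewrite ?sqr_ge0.
lra.
Qed.
(** The first pass at [x1] keeps the spectrum below the inner path, hence at a fixed distance below
    the path from [x]. There all resolvents are bounded in norm and the errors are again
    summable. *)
Lemma second_pass x1 x kap : admissible x1 -> x1 < x -> 0 < kap ->
 exists2 eps0, 0 < eps0 & forall eps sg (m : nat -> nat) (V : forall n, 'M[R[i]]_(q n, m n)) v,
 0 < eps -> eps <= eps0 -> sg = 1 \/ sg = -1 ->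
 (\forall n \near \oo, frob2 (V n *m (V n) ^t*) <= v) ->
 {ae P, forall w, \forall n \near \oo,
 below (accn n w) (zetan x (1 + sg * eps) n) /\
 sg * (mform (res (zetan x (1 + sg * eps) n) (accn n w)) (V n) -
 ((q n)%:R * n%:R^-1 * x)^-1 * frob2 (V n)) <= kap}.
move=> adx1 xx kap00; have [hx1 Ax1] := adx1.
have [hx Ax] : admissible x by exact: admissibleW adx1 (ltW xx).
have x10 := na_x_gt0 hx1; have x0 := na_x_gt0 hx.
pose D := na_phi x 1 - na_phi x1 1.
have D0 : 0 < D by rewrite subr_gt0; exact: na_phi_lt.
have [e1 e10 pass1] := first_pass hx1 Ax1.
have S0 := na_sum_ge0 hx; have S10 := na_sum_ge0 hx1.
(* Changing both speeds by at most [ee] moves the end points by at most D/4 in total in the limit,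
   which leaves a gap of at least D/2. *)
pose ee := Num.min e1 (Num.min 1 (D / (4 * (na_sum x + na_sum x1 + 1)))).
have den0 : 0 < 4 * (na_sum x + na_sum x1 + 1) by lra.
have ee0 : 0 < ee by rewrite !lt_min e10 ltr01 divr_gt0.
have eeD : ee * (na_sum x + na_sum x1) <= D / 4.
have : ee <= D / (4 * (na_sum x + na_sum x1 + 1)) by rewrite !ge_min lexx !orbT.
by rewrite ler_pdivlMr // => h; lra.
have ee1 : ee <= 1 by rewrite !ge_min lexx !orbT.
have eee1 : ee <= e1 by rewrite !ge_min lexx.
exists ee => // eps sg m V v eps0 epse sgP hV.
have eps1 : eps <= 1 by exact: le_trans epse ee1.
pose s1 := 1 + ee; pose s := 1 + sg * eps.
have s10 : 0 <= s1 by rewrite addr_ge0 // ltW.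
have s0 : 0 <= s by rewrite /s; case: sgP => ->; rewrite ?mul1r ?mulN1r; lra.
have ss1 : s <= s1 by rewrite /s /s1; case: sgP => ->; rewrite ?mul1r ?mulN1r; lra.
have gapD : D / 2 <= na_phi x s - na_phi x1 s1.
have : eps * na_sum x <= ee * na_sum x by exact: ler_wpM2r.
have : 0 <= eps * na_sum x by rewrite mulr_ge0 // ltW.
move: D0 eeD; rewrite /D /na_phi /s /s1 !(mulrDl 1) mulrDr !mul1r.
have ex0 : sg * eps * na_sum x = eps * na_sum x \/ sg * eps * na_sum x = - (eps * na_sum x).
by case: sgP => ->; rewrite ?mul1r ?mulN1r ?mulNr; [left|right].
by case: ex0 => ->; move: (x / c) (x1 / c) (na_sum x) (na_sum x1) (ee * na_sum x) (ee * na_sum x1) (eps * _) => *; lra.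
(* The limiting gap is at least D/2, so the gap exceeds D/4 for large n. *)
pose K0 := 4 / D; have K00 : 0 < K0 by rewrite divr_gt0.
have [wmax wmax0 [emax [emax0 ex] hw]] := wgt_bound hx.
have [wmax1 _ [emax1 _ hw1]] := wgt_bound hx1.
have w10 n j : 0 < wgt (na_eta a n) x1 j by have [] := hw1 n j.
have w0 n j : 0 < wgt (na_eta a n) x j by have [] := hw n j.
have hwm n j : wgt (na_eta a n) x j <= wmax by have [] := hw n j.
have he n j : na_eta a n j ^+ 2 <= emax by have [] := hw n j.
pose cq : R := 2 / c.
have cq0 : 0 <= cq by rewrite divr_ge0 // ltW.
pose kk := Num.min (kap / 2) (eps / 8 / (wmax * (2 * emax + 1))).
have we0 : 0 < wmax * (2 * emax + 1) by rewrite mulr_gt0 //; lra.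
have kk0 : 0 < kk by rewrite lt_min !divr_gt0.
have kk2 : 2 * kk <= kap.
have : kk <= kap / 2 by rewrite ge_min lexx.
by lra.
have kkw : wmax * (2 * emax + 1) * kk <= eps / 8.
by rewrite mulrC -ler_pdivlMr // ge_min lexx orbT.
have nv0 : n%:R^-1 @[n \oo] --> (0 : R).
by apply/gtr0_cvgV0; [near=> n; rewrite ltr0n; near: n; exact: na_near_n0|exact: cvgr_idn].
have big1 : \forall n \near \oo, wmax * (emax * (2 * kk + 4 * (wmax * emax * n%:R^-1) * (cq * K0 ^+ 2)) + kk) <= eps / 4.
have e8 : 0 < eps / 8 by rewrite divr_gt0.
have l1 : wmax * emax * 4 * (wmax * emax) * (cq * K0 ^+ 2) * n%:R^-1 @[n \oo] --> (0 : R).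
by rewrite -[X in _ --> X](mulr0 (wmax * emax * 4 * (wmax * emax) * (cq * K0 ^+ 2))); apply: cvgMr.
near=> n.
have : wmax * emax * 4 * (wmax * emax) * (cq * K0 ^+ 2) * n%:R^-1 < eps / 8 by near: n; exact: (cvgr_lt _ l1).
set A := (X in X < _); set B := (X in _ -> X <= _).
have -> : B = wmax * (2 * emax + 1) * kk + A by rewrite /A /B; ring.
by move: kkw; move: A (wmax * _ * kk) => A' B'; lra.
have big2 : \forall n \near \oo, 2 * (wmax * emax * n%:R^-1) * K0 <= eps / 2.
have e2 : 0 < eps / 2 by rewrite divr_gt0.
have l1 : 2 * (wmax * emax) * K0 * n%:R^-1 @[n \oo] --> (0 : R).
by rewrite -[X in _ --> X](mulr0 (2 * (wmax * emax) * K0)); apply: cvgMr.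
near=> n.
have : 2 * (wmax * emax) * K0 * n%:R^-1 < eps / 2 by near: n; exact: (cvgr_lt _ l1).
by move/ltW; apply: le_trans; rewrite le_eqVlt; apply/orP; left; apply/eqP; ring.
have gapn : \forall n \near \oo, forall i, (i <= n)%N ->
 zeta n (q n) (na_eta a n) x1 s1 i + K0^-1 <= zeta n (q n) (na_eta a n) x s i.
have l1 : zetan x s n - zetan x1 s1 n @[n \oo] --> na_phi x s - na_phi x1 s1.
by apply: cvgB; exact: zeta_cvg.
have lt1 : D / 4 < na_phi x s - na_phi x1 s1 by lra.
near=> n => i iN.
have h : D / 4 < zetan x s n - zetan x1 s1 n by near: n; exact: (cvgr_gt _ l1).
have := gap_path hx1 (ltW xx) s0 ss1 iN.
by rewrite /K0 invfM invrK [_^-1 * D]mulrC; lra.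
pose ok n := (0 < n)%N /\ (0 < q n)%N /\ (q n)%:R <= cq * n%:R /\
 forall i, (i <= n)%N ->
 zeta n (q n) (na_eta a n) x1 s1 i + K0^-1 <= zeta n (q n) (na_eta a n) x s i.
have near_ok : \forall n \near \oo, ok n.
near=> n; have [q0 qn] : (0 < q n)%N /\ (q n)%:R <= 2 / c * n%:R by near: n; exact: na_near_q.
by split; [|split => //; split => //]; near: n => //; exact: na_near_n0.
have errors m' (V' : forall n, 'M[R[i]]_(q n, m' n)) v' : (\forall n \near \oo, frob2 (V' n *m (V' n) ^t*) <= v') ->
 {ae P, forall w, \forall n \near \oo,
 flown n x1 s1 x s (V' n) w < kk ^+ 18}.
move=> hV'.
pose E n w : R := if `[< ok n /\ frob2 (V' n *m (V' n) ^t*) <= v' >] then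
 flown n x1 s1 x s (V' n) w else 0.
have E0 : {ae P, forall w, E n w @[n \oo] --> (0 : R)}.
apply: (@ae_cvg0_integrals _ _ _ _ (flow_const K0 emax wmax (na_B a) cq v')).
 - move=> n; rewrite /E; case: asboolP => [[[n0 [q0 [qn gp]]] vn]|_]; last exact: measurable_cst.
exact: (meas_flow_error n0 q0 x10 s10 s0 K00 (w10 n) (w0 n) (he n) (hwm n) gp
 (na_std a n)
 (@na_inj _ _ _ _ a n) qn vn).
 - by move=> n w; rewrite /E; case: ifP => // _; exact: flow_error_ge0.
 - apply: filterS2 near_ok hV' => n okn vn; have [n0 [q0 [qn gp]]] := okn.
rewrite /E asboolT //.
exact: (flow_error_integral n0 q0 x10 s10 s0 K00 (w10 n) (w0 n) (he n) (hwm n) gp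
 (na_std a n)
 (@na_inj _ _ _ _ a n) qn vn).
apply: filterS E0 => w Ew; have k18 : 0 < kk ^+ 18 by exact: exprn_gt0.
near=> n.
have : E n w < kk ^+ 18 by near: n; exact: (cvgr_lt _ Ew).
by rewrite /E asboolT //; split; near: n.
pose V0 n : 'M[R[i]]_(q n) := ((Num.sqrt n%:R^-1)%:C)%C%:M.
have g1 := pass1 ee ee0 eee1.
have g3 := errors _ V _ hV.
have hV0 : \forall n \near \oo, frob2 (V0 n *m (V0 n) ^t*) <= cq.
near=> n; have [n0 [q0 [qn _]]] : ok n by near: n.
have nn : 0 < n%:R :> R by rewrite ltr0n.
have nv00 : 0 <= n%:R^-1 :> R by rewrite invr_ge0 ltW.
rewrite /V0 adjmx_scalar conjR -scalar_mxM -rmorphM -expr2 sqr_sqrtr //.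
rewrite frob2_scalar expr2 mulrA ler_pdivrMr //.
apply: (letr cq); first by rewrite ler_pdivrMr.
by rewrite ler_peMr // ler1n.
have g2 := errors _ V0 _ hV0.
apply: filterS3 g1 g2 g3 => w h1 h2 h3.
have hb : \forall n \near \oo, ok n /\ (forall i, (i <= n)%N -> gaten n x1 s1 i w).
by apply: filterS2 near_ok h1 => n; split.
have hb2 : \forall n \near \oo, (ok n /\ (forall i, (i <= n)%N -> gaten n x1 s1 i w)) /\
 flown n x1 s1 x s (V0 n) w < kk ^+ 18 /\
 flown n x1 s1 x s (V n) w < kk ^+ 18.
by apply: filterS3 hb h2 h3 => n.
apply: filterS3 big1 big2 hb2 => n b1 b2 [[[n0 [q0 [qn gp]]] gg] [f2 f3]].
split.
exact: (second_below n0 q0 x10 s10 K00 (w10 n) gp (leqnn n) (gg _ (leqnn n))).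
apply: le_trans kk2.
exact: (second_pass_form n0 q0 x10 s10 x0 s0 K00 (w10 n) (w0 n) (he n) (hwm n) gp sgP eps0 eps1
 erefl kk0 ex qn b1 b2 gg f2 f3).
Unshelve. all: end_near.
Qed.
End SecondPassLimit.
Lemma cvg_of_dist (R : realType) (u : nat -> R) (l : R) :
 (forall k, \forall n \near \oo, `|u n - l| <= k.+1%:R^-1) -> u n @[n \oo] --> l.
move=> h; apply/cvgrPdist_le => e e0.
have [k _ hk] : \forall k \near \oo, k.+1%:R^-1 < e.
exact: (near_infty_natSinv_lt (PosNum e0)).
apply: filterS (h k) => n hn; rewrite distrC (le_trans hn) // ltW //.
exact: hk (leqnn k).
Qed.

(** * Almost sure limits of resolvent forms at phi(x) *)

Section ResolventLimit.
Context d (T : measurableType d) (R : realType) (P : probability T R).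
Variable a : noise_array P.
Notation q := (na_q a).
Notation c := (na_c a).
Notation p := (na_p a).
Notation accn n w := (acc (na_X a n) (na_blk a n) (na_eta a n) n w).
Notation zetan x s n := (zeta n (q n) (na_eta a n) x s n).
Notation phi x := (na_phi a x 1).
Let c0 := na_c0 a.
(** Room to the left of [x], where the inner path of the second pass starts. *)
Definition regular x := exists2 x1, x1 < x & admissible a x1.
Lemma mform_le q' m (A : 'M[R[i]]_q') (V : 'M[R[i]]_(q', m)) z z' : herm A ->
 below A z -> z <= z' -> mform (res z' A) V <= mform (res z A) V.
move=> hA b zz; have h0 : 0 <= z' - z by rewrite subr_ge0.
have zE : z' = z + (z' - z) by rewrite addrC subrK.
apply: le_trans (mform_shift_lower V hA b h0 zE).
rewrite lerDl mulr_ge0 //; apply: mform_rpow2_ge0 => //; exact: belowW zz b.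
Qed.
Let eps_small (S D e1 : R) : 0 <= S -> 0 < D -> 0 < e1 -> exists eps, [/\ 0 < eps, eps <= e1 & eps * S < D].
move=> S0 D0 e10; exists (Num.min e1 (D / (S + 1))).
have S1 : 0 < S + 1 by rewrite ltr_wpDl.
have e0 : 0 < Num.min e1 (D / (S + 1)) by rewrite lt_min e10 divr_gt0.
split => //; first by rewrite ge_min lexx.
have : Num.min e1 (D / (S + 1)) <= D / (S + 1) by rewrite ge_min lexx orbT.
rewrite ler_pdivlMr // mulrDr mulr1; lra.
Qed.
Lemma adm_lt x : admissible a x -> forall l, na_sigma a l ^+ 2 < x. by case. Qed.
Lemma initial_cvg x (ell : R) (f : nat -> R) : 0 < x -> f n @[n \oo] --> ell ->
 ((q n)%:R * n%:R^-1 * x)^-1 * f n @[n \oo] --> c / x * ell.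
move=> x0 hf; apply: cvgM => //.
have -> : c / x = (c^-1 * x)^-1 by rewrite invfM invrK.
apply: cvgV; first by rewrite mulf_neq0 ?invr_neq0 ?gt_eqF.
by apply: cvgMl; exact: na_aspectV.
Qed.
(** Squeezing: the fast path from x - dl ends below phi(x), the slow path from x + dl ends above it,
    and forms of the resolvent decrease in the parameter. The two initial values tend to c ell / (x
    - dl) and c ell / (x + dl). *)
Lemma resolvent_form_cvg x (m : nat -> nat) (V : forall n, 'M[R[i]]_(q n, m n)) v ell :
 regular x -> (\forall n \near \oo, frob2 (V n *m (V n) ^t*) <= v) ->
 frob2 (V n) @[n \oo] --> ell ->
 {ae P, forall w, (\forall n \near \oo, below (accn n w) (phi x)) /\
 mform (res (phi x) (accn n w)) (V n) @[n \oo] --> c / x * ell}.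
move=> [x1 x1x ad1] hV hell.
have ell0 : 0 <= ell.
by apply: ler_cvg_to (cvg_cst 0) hell _; near=> n; exact: frob2_ge0.
have x10 := na_x_gt0 (adm_lt ad1).
have x0 : 0 < x by exact: lt_trans x1x.
(* A Lipschitz constant of y |-> c ell / y to the right of [x1], made positive by the 1. *)
pose K := c * ell / (x1 * x1) + 1.
have K0 : 0 < K by rewrite ltr_wpDl // divr_ge0 ?mulr_ge0 // ltW.
have close y y' : x1 <= y -> y <= y' -> c / y * ell - c / y' * ell <= (y' - y) * K.
move=> h1 h2; have y0 := lt_le_trans x10 h1; have y0' := lt_le_trans y0 h2.
have -> : c / y * ell - c / y' * ell = (y' - y) * (c * ell / (y * y')).
by field; rewrite !gt_eqF.
apply: ler_wpM2l; first by rewrite subr_ge0.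
rewrite /K; apply: le_trans (_ : c * ell / (x1 * x1) <= _); last by rewrite lerDl.
apply: ler_wpM2l; first by nneg.
rewrite lef_pV2 ?posrE ?mulr_gt0 //; apply: ler_pM; rewrite ?(ltW x10) //.
exact: le_trans h2.
have main (k : nat) : {ae P, forall w, \forall n \near \oo, below (accn n w) (phi x) /\
 `|mform (res (phi x) (accn n w)) (V n) - c / x * ell| <= k.+1%:R^-1}.
pose kap : R := k.+1%:R^-1 / 4.
have kap0 : 0 < kap by nneg.
have kapE : k.+1%:R^-1 = 4 * kap by rewrite /kap mulrC divfK.
rewrite kapE; pose dl := Num.min ((x - x1) / 2) (kap / K).
have xx1 : 0 < x - x1 by rewrite subr_gt0.
have dl0 : 0 < dl by rewrite lt_min !divr_gt0.
have dlx : dl <= (x - x1) / 2 by rewrite ge_min lexx.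
have dlK : dl * K <= kap by rewrite -ler_pdivlMr // ge_min lexx orbT.
pose x' := x - dl; pose x'' := x + dl.
have [h1 h2 h3 h4] : [/\ x1 < x', x' < x, x1 < x'' & x < x''].
by rewrite /x' /x''; split; lra.
have ad' : admissible a x' by exact: admissibleW (ltW h1).
have ad : admissible a x by exact: admissibleW (ltW x1x).
have ad'' : admissible a x'' by exact: admissibleW (ltW h3).
have [e1 e10 up] := second_pass ad1 h1 kap0.
have [e2 e20 lo] := second_pass ad1 h3 kap0.
have D1 : 0 < phi x - phi x' by rewrite subr_gt0; exact: na_phi_lt.
have D2 : 0 < phi x'' - phi x by rewrite subr_gt0; exact: na_phi_lt.
have [f1 [f10 f11 f12]] := eps_small (na_sum_ge0 (adm_lt ad')) D1 e10.
have [f2 [f20 f21 f22]] := eps_small (na_sum_ge0 (adm_lt ad'')) D2 e20.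
have U := up f1 1 m V v f10 f11 (or_introl erefl) hV.
have L := lo f2 (-1) m V v f20 f21 (or_intror erefl) hV.
have z1 : \forall n \near \oo, zetan x' (1 + 1 * f1) n <= phi x.
have : na_phi a x' (1 + 1 * f1) < phi x.
by move: f12; rewrite /na_phi !(mulrDl 1) !mul1r; lra.
move=> h; have hh := cvgr_lt _ (@zeta_cvg _ _ _ _ a x' (1 + 1 * f1)) _ h.
by apply: filterS (hh _) => n; exact: ltW.
have z2 : \forall n \near \oo, phi x <= zetan x'' (1 + -1 * f2) n.
have : phi x < na_phi a x'' (1 + -1 * f2).
by move: f22; rewrite /na_phi !(mulrDl 1) !mul1r mulN1r mulNr; lra.
move=> h; have hh := cvgr_gt _ (@zeta_cvg _ _ _ _ a x'' (1 + -1 * f2)) _ h.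
by apply: filterS (hh _) => n; exact: ltW.
have x'0 := lt_trans x10 h1; have x''0 := lt_trans x10 h3.
have i1 : \forall n \near \oo, ((q n)%:R * n%:R^-1 * x')^-1 * frob2 (V n) <= c / x' * ell + kap.
have h : c / x' * ell < c / x' * ell + kap by rewrite ltrDl.
by near=> n; apply: ltW; near: n; exact: (cvgr_lt _ (initial_cvg x'0 hell)).
have i2 : \forall n \near \oo, c / x'' * ell - kap <= ((q n)%:R * n%:R^-1 * x'')^-1 * frob2 (V n).
have h : c / x'' * ell - kap < c / x'' * ell by rewrite ltrBlDr ltrDl.
by near=> n; apply: ltW; near: n; exact: (cvgr_gt _ (initial_cvg x''0 hell)).
apply: filterS2 U L => w U L.
have UU : \forall n \near \oo, below (accn n w) (phi x) /\
 mform (res (phi x) (accn n w)) (V n) <= c / x * ell + 4 * kap.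
apply: filterS3 U z1 i1 => n [b Un] zn i1n.
split; first exact: belowW zn b.
have := mform_le (V n) (acc_herm _ _ _ _ _) b zn.
have := close x' x (ltW h1) (ltW h2).
have -> : x - x' = dl by rewrite /x' opprB addrC subrK.
by move: Un; rewrite mul1r; lra.
apply: filterS3 UU L (filterI z2 i2) => n [b Un] [_ Ln] [zn i2n]; split => //.
have := mform_le (V n) (acc_herm _ _ _ _ _) b zn.
have := close x x'' (ltW x1x) (ltW h4).
have -> : x'' - x = dl by rewrite /x'' addrC addKr.
rewrite ler_norml; move: Ln; rewrite mulN1r => *; apply/andP; split; last by lra.
by lra.
move: main => /ae_foralln; apply: filterS => w h.
split; first by apply: filterS (h 0%N) => n [].
by apply: cvg_of_dist => k; apply: filterS (h k) => n [].
Unshelve. all: end_near.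
Qed.
End ResolventLimit.

(** * Quadratic forms in the coefficient vectors *)

Section ConjugateForms.
Context (R : realType).
Notation C := R[i].
Definition conjm m n (M : 'M[C]_(m, n)) : 'M[C]_(m, n) := map_mx Num.conj M.
Lemma conjm_mul m n p (A : 'M[C]_(m, n)) (B : 'M[C]_(n, p)) :
 conjm (A *m B) = conjm A *m conjm B.
exact: map_mxM. Qed.
Lemma vdot_conj n (u v : 'cV[C]_n) : vdot (conjm u) (conjm v) = Num.conj (vdot u v).
rewrite !vdotE rmorph_sum; apply: eq_bigr => i _.
by rewrite !mxE rmorphM.
Qed.
Lemma rq_conj n (M : 'M[C]_n) v : rq (conjm M) v = rq M (conjm v).
have h (x : C) : cRe (Num.conj x) = cRe x by rewrite cRe_conj.
have vE : v = conjm (conjm v) by apply/colP => i; rewrite !mxE conjCK.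
by rewrite !rq_def {1 2}vE -conjm_mul vdot_conj h.
Qed.
Lemma frob2_conj m n (M : 'M[C]_(m, n)) : frob2 (conjm M) = frob2 M.
by rewrite !frob2E; apply: eq_bigr => i _; apply: eq_bigr => j _; rewrite mxE nsqJ.
Qed.
Lemma herm_conj n (M : 'M[C]_n) : herm M -> herm (conjm M).
by move=> hM; rewrite /herm -[in RHS]hM; apply/matrixP => i j; rewrite !mxE. Qed.
Lemma Re_tr_conj n (M : 'M[C]_n) : cRe (\tr (conjm M)) = cRe (\tr M).
by rewrite /mxtrace !Re_sum; apply: eq_bigr => i _; rewrite mxE cRe_conj. Qed.
End ConjugateForms.

Section CoefficientForms.
Context d (T : measurableType d) (R : realType) (P : probability T R)
 (I : finType) (X : I -> {RV P >-> (R * R)%type}).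
Notation C := R[i].
Context (n k : nat) (zblk : 'I_n -> 'I_k -> I).
Definition zmx w : 'M[C]_(n, k) := \matrix_(i, j) Num.conj (cplx (X (zblk i j) w)).
Let pr (s : 'I_(n * k)) : 'I_n * 'I_k := enum_val (cast_ord (esym (mxvec_cast n k)) s).
Let b s := zblk (pr s).1 (pr s).2.
Let prK i j : pr (mxvec_index i j) = (i, j).
by rewrite /pr /mxvec_index cast_ordK enum_rankK. Qed.
Let pr_inj : injective pr.
by move=> s t /enum_val_inj /cast_ord_inj. Qed.
Variable a : 'cV[C]_k.
(** Writes a combination of coefficient columns as the conjugate of [W] applied to the flattened
    array of entries. The conjugations come from z^(j)_i being the conjugate of z_ij. *)
Let W : 'M[C]_(n, n * k) :=
 \matrix_(i, s) if (pr s).1 == i then Num.conj (a (pr s).2 0) else 0.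
Let sum_pr (F : 'I_n -> 'I_k -> C) : \sum_s F (pr s).1 (pr s).2 = \sum_i \sum_j F i j.
rewrite pair_big /= (reindex (fun p : 'I_n * 'I_k => mxvec_index p.1 p.2)) /=.
by apply: eq_bigr => -[i j] _ /=; rewrite prK.
exists pr => [[i j] _|s _]; first exact: prK.
by case/mxvec_indexP: s => i j; rewrite prK.
Qed.
Let W_bcol w : conjm (W *m bcol X b w) = zmx w *m a.
apply/colP => i; rewrite !mxE.
under eq_bigr do rewrite !mxE.
rewrite (sum_pr (fun i' j => (if i' == i then Num.conj (a j 0) else 0) * cplx (X (zblk i' j) w))).
rewrite (bigD1 i) //= [X in _ + X]big1 ?addr0; last first.
by move=> i' /negbTE ->; rewrite big1 // => j _; rewrite mul0r.
rewrite eqxx rmorph_sum; apply: eq_bigr => j _.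
by rewrite rmorphM /= conjCK mxE mulrC.
Qed.
Let WW : W *m W ^t* = ((vsq a)%:C)%C%:M.
apply/matrixP => i i'; rewrite !mxE.
under eq_bigr do rewrite !mxE.
rewrite (sum_pr (fun i1 j => (if i1 == i then Num.conj (a j 0) else 0) *
 Num.conj (if i1 == i' then Num.conj (a j 0) else 0))).
rewrite (bigD1 i) //= [X in _ + X]big1 ?addr0; last first.
by move=> i1 /negbTE ->; rewrite big1 // => j _; rewrite mul0r.
rewrite eqxx; case: eqVneq => [_|_]; last first.
by rewrite mulr0n big1 // => j _; rewrite conjC0 mulr0.
by rewrite mulr1n -vdotvv vdotE; apply: eq_bigr => j _; rewrite conjCK.
Qed.
Variables (B : R)
 (stdX : std_array X 8 B)
 (inj_zblk : forall i j a b, zblk i a = zblk j b -> i = j /\ a = b).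
(** Matrices built from the noise belong to the past of the coefficients, so the adapted bound
    applies to W^H conj(M) W. Since W W^H is |a|^2 times the identity, its trace and Frobenius norm
    are those of [M] up to powers of |a|. *)
Lemma coef_moment (K : seq I) (M : T -> 'M[C]_n) tau :
 (forall i j, zblk i j \notin K) ->
 mxmeas (M : pastT X K -> 'M[C]_n) ->
 (forall w, herm (M w)) -> (forall w, frob2 (M w) <= tau) ->
 mfunT (fun w => rq (M w) (zmx w *m a) - vsq a * cRe (\tr (M w))) /\
 (\int[P]_w ((rq (M w) (zmx w *m a) - vsq a * cRe (\tr (M w))) ^+ 18)%:E <=
 ((quadK 8 B * (vsq a ^+ 2 * tau)) ^+ 9)%:E)%E.
move=> zK mM hM Mt.
pose N w := W ^t* *m conjm (M w) *m W.
have E w : rq (M w) (zmx w *m a) - vsq a * cRe (\tr (M w)) =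
 rq (N w) (bcol X b w) - cRe (\tr (N w)).
congr (_ - _).
by rewrite -W_bcol -rq_conj !rq_def -!mulmxA [X in _ = cRe X]vdotMr adjmxK.
rewrite /N mxtrace_mulC mulmxA WW mul_scalar_mx mxtraceZ Re_mul /= mul0r subr0.
by rewrite Re_tr_conj.
have injb : injective b.
by move=> s t /inj_zblk[h1 h2]; apply: pr_inj; rewrite (surjective_pairing (pr s)) h1 h2 -surjective_pairing.
have bK s : b s \notin K by exact: zK.
have mN : mxmeas (N : pastT X K -> 'M[C]_(n * k)).
apply: mxmeasM; last by [].
apply: mxmeasM; first by [].
have -> : (fun w => conjm (M w)) = (fun w => ((M w)^T) ^t*).
by apply/funext => w; apply/matrixP => i j; rewrite !mxE.
apply: mxmeas_adj => i j.
have -> : (fun w => (M w)^T i j) = (fun w => M w j i) by apply/funext => w; rewrite mxE.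
exact: mM.
have hN w : herm (N w).
by rewrite /herm /N !adjmxM adjmxK (herm_conj (hM w)) mulmxA.
have Nt w : frob2 (N w) <= vsq a ^+ 2 * tau.
have -> : frob2 (N w) = vsq a ^+ 2 * frob2 (M w).
rewrite frob2_tr hN -(frob2_conj (M w)) frob2_tr (herm_conj (hM w)) /N.
have -> : W ^t* *m conjm (M w) *m W *m (W ^t* *m conjm (M w) *m W) =
 W ^t* *m (conjm (M w) *m (W *m W ^t*) *m conjm (M w) *m W) by rewrite !mulmxA.
rewrite mxtrace_mulC -[_ *m W *m _]mulmxA !WW !mul_mx_scalar -!scalemxAl !mxtraceZ.
by rewrite !Re_mul /= !mul0r !subr0 mulrA expr2.
by apply: ler_wpM2l => //; by nneg.
have := block_moment stdX injb bK mN hN Nt.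
by rewrite (funext E); under [in X in _ -> X]eq_integral do rewrite E.
Qed.
End CoefficientForms.

(** * The companion matrix X^H Q X *)

Section GramResolvent.
Context (R : realType) (q n : nat) (X : 'M[R[i]]_(q, n)) (z K : R).
Notation C := R[i].
Let A := X *m X ^t*.
Notation Q := (res z A).
Hypotheses (z0 : 0 <= z) (bA : below A z) (hK : forall a, (z - eig A a)^-1 <= K).
Let hA : herm A. exact: herm_gram. Qed.
Let hQ : herm Q. exact: res_herm. Qed.
Lemma res_gram : Q *m A = (z%:C)%C *: Q - 1%:M.
have [r1 _] := res_mul hA bA.
by rewrite -r1 mulmxBr mul_mx_scalar opprB addrC subrK.
Qed.
Definition gram_form := X ^t* *m Q *m X.
Lemma gram_form_herm : herm gram_form.
by rewrite /herm /gram_form !adjmxM hQ adjmxK mulmxA. Qed.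
(** Cyclicity of the trace and Q A = z Q - 1. *)
Lemma gram_form_tr : cRe (\tr gram_form) = z * rtr z A 1 - q%:R.
rewrite /gram_form -mulmxA mxtrace_mulC -mulmxA -/A res_gram mxtraceD mxtraceZ.
by rewrite Re_add Re_mul /= mul0r subr0 rtr_def rpow1 raddfN /= mxtrace1 Re_opp -(rmorph_nat (real_complex R)).
Qed.
Let inv0 a : 0 <= (z - eig A a)^-1.
by rewrite invr_ge0 subr_ge0 ltW. Qed.
Lemma rtr2_bound : rtr z A 2 <= q%:R * K ^+ 2.
rewrite rtrE // -[q in q%:R * _]card_ord -sum1_card natr_sum mulr_suml.
by apply: ler_sum => a _; rewrite mul1r lerXn2r ?nnegrE ?inv0 // (le_trans (inv0 a)).
Qed.
Lemma rq_rpow2_bound v : rq (rpow z A 2) v <= K ^+ 2 * vsq v.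
rewrite rq_rpow // -(wt_sum A v) mulr_sumr; apply: ler_sum => a _.
apply: ler_wpM2r; first exact: wt_ge0.
by rewrite lerXn2r ?nnegrE ?inv0 // (le_trans (inv0 a)).
Qed.
Lemma gram_form_frob2 : frob2 gram_form <= q%:R * (z ^+ 2 * K ^+ 2 + 1).
rewrite frob2_tr gram_form_herm.
have -> : \tr (gram_form *m gram_form) = \tr ((Q *m A) *m (Q *m A)).
by rewrite /A /gram_form -!mulmxA mxtrace_mulC !mulmxA.
rewrite res_gram.
rewrite mulmxBl mul1mx mulmxBr mulmx1 -scalemxAl -scalemxAr.
have -> : Q *m Q = rpow z A 2 by rewrite rpowS rpow1.
have trN (M : 'M[C]_q) : \tr (- M) = - \tr M by exact: raddfN.
rewrite !(mxtraceD, trN, mxtraceZ) mxtrace1.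
rewrite !(Re_add, Re_opp) !(Re_mul, Im_mul) /= ?mul0r ?addr0 ?subr0 -!rtr_def.
have -> : cRe (\tr Q) = rtr z A 1 by rewrite rtr_def rpow1.
have -> : cRe (q%:R : C) = q%:R by rewrite -(rmorph_nat (real_complex R)).
have t0 : 0 <= z * rtr z A 1 by rewrite mulr_ge0 // rtr_ge0.
have := ler_wpM2l (sqr_ge0 z) rtr2_bound; rewrite expr2; move: t0.
by rewrite mulrDr mulr1 mulrCA !mulrA; lra.
Qed.
Lemma gram_column v : vsq (X ^t* *m (Q *m v)) <= z * K ^+ 2 * vsq v.
rewrite -rq_gram -/A rq_def.
have -> : vdot (Q *m v) (A *m (Q *m v)) = vdot v ((z%:C)%C *: (rpow z A 2 *m v) - Q *m v).
rewrite vdotMl hQ [Q *m (A *m _)]mulmxA res_gram mulmxBl mul1mx -scalemxAl.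
by rewrite rpowS rpow1 mulmxA.
rewrite vdotBr vdotZr Re_sub Re_mul /= mul0r subr0 -!rq_def -mulrA.
have : 0 <= rq Q v by rewrite -(rpow1 z A); exact: rq_rpow_ge0.
have := ler_wpM2l z0 (rq_rpow2_bound v); lra.
Qed.
End GramResolvent.

(** * Almost sure limits of forms mixing noise and coefficients *)

Section CoefficientLimits.
Context d (T : measurableType d) (R : realType) (P : probability T R).
Variable a : noise_array P.
Notation C := R[i].
Notation q := (na_q a).
Notation c := (na_c a).
Notation accn n w := (acc (na_X a n) (na_blk a n) (na_eta a n) n w).
Notation zetan x s n := (zeta n (q n) (na_eta a n) x s n).
Notation phi x := (na_phi a x 1).
Context (k : nat) (zblk : forall n, 'I_n -> 'I_k -> na_I a n).
Hypotheses (inj_zblk : forall n i j b b', @zblk n i b = @zblk n j b' -> i = j /\ b = b')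
 (zblk_blk : forall n i b j b', @zblk n i b <> na_blk a n j b').
Definition na_z n w : 'M[C]_(n, k) := zmx (na_X a n) (@zblk n) w.
Definition na_x n w : 'M[C]_(q n, n) :=
 \matrix_(i, j) xcol (na_X a n) (na_blk a n) (na_eta a n) j w i 0.
Lemma na_x_gram n w : na_x n w *m (na_x n w) ^t* = accn n w.
apply/matrixP => i j; rewrite mxE /acc summxE; apply: eq_bigr => l _.
by rewrite !mxE big_ord1 !mxE.
Qed.
Let pastn n := pastT (na_X a n) (before (na_blk a n) n).
(** A squared Frobenius norm of order n makes the 18th moment of the centred form of order n^9; the
    prefactor n^-18 leaves n^-9. *)
Lemma coef_form_cvg (M : forall n, T -> 'M[C]_n) b tau :
 (\forall n \near \oo, [/\ mxmeas (M n : pastn n -> 'M[C]_n), (forall w, herm (M n w)) &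
 forall w, frob2 (M n w) <= tau * n%:R]) ->
 {ae P, forall w, n%:R^-1 * (rq (M n w) (na_z n w *m b) - vsq b * cRe (\tr (M n w)))
 @[n \oo] --> (0 : R)}.
move=> hM; pose V n w := n%:R^-1 * (rq (M n w) (na_z n w *m b) - vsq b * cRe (\tr (M n w))).
pose ok n := [/\ mxmeas (M n : pastn n -> 'M[C]_n), (forall w, herm (M n w)) &
 forall w, frob2 (M n w) <= tau * n%:R].
pose E n w : R := if `[< ok n >] then V n w ^+ 18 else 0.
have zK n i j : @zblk n i j \notin before (na_blk a n) n.
rewrite mem_before; apply/negP => /existsP[j' /andP[_ /bseqP[b']]].
exact: zblk_blk.
have mom n : ok n -> _ := fun h => coef_moment b (na_std a n) (@inj_zblk n) (zK n)
 (let: And3 m _ _ := h in m) (let: And3 _ m _ := h in m) (let: And3 _ _ m := h in m).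
have E0 : {ae P, forall w, E n w @[n \oo] --> (0 : R)}.
apply: (@ae_cvg0_integrals _ _ _ _ ((quadK 8 (na_B a) * (vsq b ^+ 2 * tau)) ^+ 9)).
 - move=> n; rewrite /E; case: asboolP => [okn|_]; last exact: measurable_cst.
by apply: measurable_funX; apply: measurable_funM; [exact: measurable_cst|exact: (mom n okn).1].
 - by move=> n w; rewrite /E; case: ifP => // _; exact: (exprD_ge0 9).
 - apply: filterS2 hM (na_near_n0) => n okn n0; rewrite /E asboolT // /V.
have nn : 0 < n%:R :> R by nneg.
have tau0 : 0 <= tau.
have [_ _ h] := okn; have := le_trans (frob2_ge0 _) (h point).
by rewrite pmulr_lge0.
have c9 : 0 <= n%:R^-1 ^+ 18 :> R by [].
under eq_integral do rewrite exprMn EFinM.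
rewrite ge0_integralZl //; first last.
 - by move=> w _; rewrite lee_fin (exprD_ge0 9).
 - by apply/measurable_EFinP; apply: measurable_funX; exact: (mom n okn).1.
have h18 : (0 <= (n%:R^-1 ^+ 18)%:E :> \bar R)%E by [].
apply: (le_trans (lee_wpmul2l h18 (mom n okn).2)); rewrite -EFinM lee_fin.
have k0 : 0 <= quadK 8 (na_B a) * (vsq b ^+ 2 * tau).
by rewrite mulr_ge0 ?(quadK_ge0 (na_std a 0)) // mulr_ge0 // sqr_ge0.
have -> : n%:R^-1 ^+ 18 * (quadK 8 (na_B a) * (vsq b ^+ 2 * (tau * n%:R))) ^+ 9 =
 (quadK 8 (na_B a) * (vsq b ^+ 2 * tau)) ^+ 9 * n%:R^-1 ^+ 9.
have n1 : n%:R != 0 :> R by rewrite gt_eqF.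
by rewrite -[18%N]/(9 + 9)%N exprD -exprMn -!exprMn; congr (_ ^+ 9); field.
apply: ler_wpM2l; first by nneg.
rewrite -exprVn; apply: ler_wiXn2l; [by []|by rewrite invf_le1 // ler1n|by []].
apply: filterS E0 => w Ew; apply: cvg_of_dist => m.
have m0 : 0 < (m.+1%:R^-1 : R) ^+ 18 by [].
have h1 := cvgr_lt _ Ew _ m0; apply: filterS2 hM (h1 _) => n okn.
rewrite /E asboolT // subr0 -/(V n w) => h.
by apply: lt18_norm h; rewrite invr_gt0 ltr0n.
Qed.
Lemma na_x_meas n : mxmeas (na_x n : pastn n -> 'M[C]_(q n, n)).
move=> i j; have -> : (fun w => na_x n w i j) = (fun w => xcol (na_X a n) (na_blk a n) (na_eta a n) j w i 0).
by apply/funext => w; rewrite mxE.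
exact: xcol_meas.
Qed.
Lemma coef_norm_cvg b :
 {ae P, forall w, n%:R^-1 * vsq (na_z n w *m b) @[n \oo] --> vsq b}.
have h : \forall n \near \oo, [/\ mxmeas ((fun=> 1%:M) : pastn n -> 'M[C]_n),
 (forall w : T, herm (1%:M : 'M[C]_n)) & forall w : T, frob2 (1%:M : 'M[C]_n) <= 1 * n%:R :> R].
near=> n; have E1 : 1%:M = ((1 : R)%:C)%C%:M :> 'M[C]_n by [].
split; [by []|by move=> w; rewrite E1; exact: herm_scalar|].
by move=> w; rewrite E1 frob2_scalar expr1n mulr1 mul1r.
have := coef_form_cvg b h; apply: filterS => w hw.
have -> : vsq b = 0 + vsq b by rewrite add0r.
have : n%:R^-1 * (rq 1%:M (na_z n w *m b) - vsq b * cRe (\tr (1%:M : 'M[C]_n))) + vsq b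
 @[n \oo] --> 0 + vsq b by apply: cvgD => //; exact: cvg_cst.
apply: cvg_trans; apply: near_eq_cvg; apply: filterS na_near_n0 => n n0.
have E1 : 1%:M = ((1 : R)%:C)%C%:M :> 'M[C]_n by [].
rewrite mxtrace1 -(rmorph_nat (real_complex R)) /= E1 rq_scalar mul1r mulrBr mulrCA mulVf ?mulr1 ?subrK //.
by rewrite pnatr_eq0 -lt0n.
Unshelve. all: end_near.
Qed.
(** Moment bounds ask for matrices bounded for every outcome. On the gate of an inner path the
    resolvent at phi(x) has norm at most [K]; off it the matrices below are replaced by 0, which
    almost surely changes nothing for large n. *)
Let cut_exists x : regular a x -> exists x1 s1 K, [/\ 0 < K, 0 <= phi x,
 {ae P, forall w, \forall n \near \oo, gate (na_X a n) (na_blk a n) (na_eta a n) x1 s1 n w} &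
 \forall n \near \oo, (0 < n)%N /\ (q n)%:R <= 2 / c * n%:R /\
 forall w, gate (na_X a n) (na_blk a n) (na_eta a n) x1 s1 n w ->
 below (accn n w) (phi x) /\ forall b, (phi x - eig (accn n w) b)^-1 <= K].
move=> [x1 x1x ad1]; have [hx1 A1] := ad1.
have [e1 e10 pass] := first_pass hx1 A1.
have S0 := na_sum_ge0 hx1.
pose D := phi x - phi x1; have D0 : 0 < D by rewrite subr_gt0; exact: na_phi_lt.
pose ee := Num.min e1 (D / (2 * (na_sum a x1 + 1))).
have S1 : 0 < 2 * (na_sum a x1 + 1) by rewrite mulr_gt0 // ltr_wpDl.
have ee0 : 0 < ee by rewrite lt_min e10 divr_gt0.
have eD : ee * na_sum a x1 <= D / 2.
have : ee <= D / (2 * (na_sum a x1 + 1)) by rewrite ge_min lexx orbT.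
by rewrite ler_pdivlMr // => h; lra.
exists x1, (1 + ee), (4 / D); split.
- by nneg.
- have hx l : na_sigma a l ^+ 2 < x by exact: lt_trans (hx1 l) x1x.
rewrite /na_phi mul1r addr_ge0 ?na_sum_ge0 // divr_ge0 ?(ltW (na_c0 a)) //.
exact: ltW (na_x_gt0 hx).
- have := pass ee ee0 _; rewrite ge_min lexx => /(_ isT).
by apply: filterS => w; apply: filterS => n; apply.
have lt1 : na_phi a x1 (1 + ee) < phi x - D / 4.
have DE : phi x = D + phi x1 by rewrite subrK.
by rewrite DE /na_phi (mulrDl 1) mul1r; lra.
have h := cvgr_lt _ (@zeta_cvg _ _ _ _ a x1 (1 + ee)) _ lt1.
apply: filterS3 (h _) (na_near_q a) na_near_n0 => n zn [q0 qn] n0.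
split => //; split => // w g.
have x10 := na_x_gt0 hx1; have s10 : 0 <= 1 + ee by nneg.
have [wm _ [em _ hw]] := wgt_bound hx1.
have w0 j : 0 < wgt (na_eta a n) x1 j by have [] := hw n j.
have b := gate_below n0 q0 x10 s10 w0 g.
have hb l : eig (accn n w) l + D / 4 < phi x by move: (b l) zn; lra.
have D4 : 0 < D / 4 by nneg.
split => [l|l]; first by apply: lt_trans (hb l); rewrite ltrDl.
have hb' := hb l; rewrite -[leRHS]invrK invfM invrK mulrC.
by rewrite lef_pV2 ?posrE // ?subr_gt0; move: (eig _ _) hb' => y; lra.
Qed.
Lemma res_trace_cvg x : regular a x ->
 {ae P, forall w, n%:R^-1 * rtr (phi x) (accn n w) 1 @[n \oo] --> x^-1}.
move=> rx; have [x1 x1x [hx1 _]] := rx.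
have x0 : 0 < x by exact: lt_trans (na_x_gt0 hx1) x1x.
pose V n : 'M[C]_(q n) := ((Num.sqrt n%:R^-1)%:C)%C%:M.
have sq n : Num.sqrt n%:R^-1 ^+ 2 = n%:R^-1 :> R by rewrite sqr_sqrtr // invr_ge0.
have hV : \forall n \near \oo, frob2 (V n *m (V n) ^t*) <= 2 / c.
apply: filterS2 (na_near_q a) na_near_n0 => n [q0 qn] n0.
have nn : 0 < n%:R :> R by nneg.
rewrite /V adjmx_scalar conjR -scalar_mxM -rmorphM -expr2 sq.
rewrite frob2_scalar expr2 mulrA ler_pdivrMr //.
apply: (letr (2 / c)); first by rewrite ler_pdivrMr.
by rewrite ler_peMr ?ler1n // divr_ge0 // ltW // na_c0.
have hell : frob2 (V n) @[n \oo] --> c^-1.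
have -> : (fun n => frob2 (V n)) = (fun n => (q n)%:R / n%:R).
by apply/funext => n; rewrite frob2_scalar sq.
exact: na_aspectV.
have := resolvent_form_cvg rx hV hell; apply: filterS => w [_].
have -> : c / x / c = x^-1.
by rewrite mulrAC divff ?mul1r // gt_eqF // na_c0.
apply: cvg_trans; apply: near_eq_cvg; apply: nearW => n.
by rewrite mform_scalar sq rtr_def rpow1.
Qed.
Let res_measurable z n : mxmeas ((fun w => res z (accn n w)) : pastn n -> 'M[C]_(q n)).
by apply: mxmeas_res; exact: acc_meas. Qed.
(** The form concentrates at |b|^2 times the normalised trace of X^H Q X, that is phi(x) tr Q / n -
    q / n. *)
Lemma coef_gram_cvg x b : regular a x ->
 {ae P, forall w, n%:R^-1 * rq (gram_form (na_x n w) (phi x)) (na_z n w *m b)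
 @[n \oo] --> vsq b * (phi x / x - c^-1)}.
move=> rx; have [x1 [s1 [K [K0 p0 hg hb]]]] := cut_exists rx.
pose g n w := gate (na_X a n) (na_blk a n) (na_eta a n) x1 s1 n w.
pose M n w : 'M[C]_n := if g n w then gram_form (na_x n w) (phi x) else 0.
have gE n w : accn n w = na_x n w *m (na_x n w) ^t* by rewrite na_x_gram.
have hM : \forall n \near \oo, [/\ mxmeas (M n : pastn n -> 'M[C]_n), (forall w, herm (M n w)) &
 forall w, frob2 (M n w) <= (2 / c * ((phi x) ^+ 2 * K ^+ 2 + 1)) * n%:R].
apply: filterS hb => n [n0 [qn gb]]; split.
 - apply: mxmeas_if; first exact: gate_meas.
have mX : mxmeas (na_x n : pastn n -> 'M[C]_(q n, n)) by exact: na_x_meas.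
apply: mxmeasM => //; apply: mxmeasM; first exact: mxmeas_adj.
have := @res_measurable (phi x) n.
by rewrite (_ : (fun w => res _ _) = (fun w => res (phi x) (na_x n w *m (na_x n w) ^t*))) //;
apply/funext => w; rewrite gE.
 - move=> w; rewrite /M; case: ifP => [gw|_]; last exact: herm0.
by have [bb _] := gb w gw; apply: gram_form_herm; rewrite -gE.
 - have KK : 0 <= (phi x) ^+ 2 * K ^+ 2 + 1 by nneg.
move=> w; rewrite /M; case: ifP => [gw|_].
have [bb kk] := gb w gw; rewrite gE in bb kk.
apply: (le_trans (gram_form_frob2 p0 bb kk)).
by rewrite [leRHS]mulrAC; apply: ler_wpM2r.
have -> : frob2 (0 : 'M[C]_n) = 0.
by rewrite frob2E big1 // => i _; rewrite big1 // => j _; rewrite mxE nsq0.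
by rewrite mulr_ge0 // mulr_ge0 // divr_ge0 // ltW // na_c0.
have h1 := coef_form_cvg b hM; have h2 := res_trace_cvg rx.
apply: filterS3 hg h1 h2 => w gw Mw tw.
have tw2 : vsq b * (phi x * (n%:R^-1 * rtr (phi x) (accn n w) 1) - (q n)%:R / n%:R) @[n \oo] -->
 vsq b * (phi x / x - c^-1).
by apply: cvgMr; apply: cvgB; [exact: cvgMr|exact: na_aspectV].
rewrite -[X in _ --> X]add0r.
have hD : n%:R^-1 * (rq (M n w) (na_z n w *m b) - vsq b * cRe (\tr (M n w))) +
 vsq b * (phi x * (n%:R^-1 * rtr (phi x) (accn n w) 1) - (q n)%:R / n%:R) @[n \oo] -->
 0 + vsq b * (phi x / x - c^-1) by exact: cvgD.
move: hD.
apply: cvg_trans; apply: near_eq_cvg; apply: filterS2 hb gw => n [n0 [qn gb]] gnw.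
have [bb _] := gb w gnw; rewrite gE in bb.
rewrite /= /M /g gnw (gram_form_tr bb) -gE /=.
move: (rq _ _) (rtr _ _ _) => y t; have n1 : n%:R != 0 :> R by rewrite pnatr_eq0 -lt0n.
by move: (n%:R : R) n1 => N n1; field.
Qed.
(** The squared modulus is the form of a rank-one matrix y y^H at the coefficients. Its trace |y|^2
    stays bounded, so division by n sends it to 0. *)
Lemma coef_cross_cvg x b (u : forall n, 'cV[C]_(q n)) : regular a x ->
 (forall n, vsq (u n) <= 1) ->
 {ae P, forall w, n%:R^-1 * nsq (vdot (u n) (res (phi x) (accn n w) *m na_x n w *m (na_z n w *m b)))
 @[n \oo] --> (0 : R)}.
move=> rx u1; have [x1 [s1 [K [K0 p0 hg hb]]]] := cut_exists rx.
pose g n w := gate (na_X a n) (na_blk a n) (na_eta a n) x1 s1 n w.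
pose y n w := (na_x n w) ^t* *m (res (phi x) (accn n w) *m u n).
pose M n w : 'M[C]_n := if g n w then y n w *m (y n w) ^t* else 0.
have gE n w : accn n w = na_x n w *m (na_x n w) ^t* by rewrite na_x_gram.
have yb n w : below (accn n w) (phi x) -> (forall b, (phi x - eig (accn n w) b)^-1 <= K) ->
 vsq (y n w) <= phi x * K ^+ 2.
move=> bb kk; rewrite /y; rewrite gE in bb kk *.
apply: (le_trans (gram_column p0 bb kk _)).
by rewrite ler_piMr // mulr_ge0 // sqr_ge0.
have pK : 0 <= phi x * K ^+ 2 by nneg.
have hM : \forall n \near \oo, [/\ mxmeas (M n : pastn n -> 'M[C]_n), (forall w, herm (M n w)) &
 forall w, frob2 (M n w) <= (phi x * K ^+ 2) ^+ 2 * n%:R].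
apply: filterS hb => n [n0 [qn gb]]; split.
 - apply: mxmeas_if; first exact: gate_meas.
have my : mxmeas (y n : pastn n -> 'cV[C]_n).
apply: mxmeasM; first by apply: mxmeas_adj; exact: na_x_meas.
by apply: mxmeasM; [exact: res_measurable|by []].
by apply: mxmeasM => //; exact: mxmeas_adj.
 - move=> w; rewrite /M; case: ifP => [gw|_]; [exact: herm_gram|exact: herm0].
 - move=> w; rewrite /M; case: ifP => [gw|_].
have [bb kk] := gb w gw; rewrite frob2_rank1.
apply: (letr ((phi x * K ^+ 2) ^+ 2)).
by rewrite lerXn2r ?nnegrE ?vsq_ge0 // yb.
by rewrite ler_peMr ?sqr_ge0 // ler1n.
have -> : frob2 (0 : 'M[C]_n) = 0.
by rewrite frob2E big1 // => i _; rewrite big1 // => j _; rewrite mxE nsq0.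
by nneg.
have h1 := coef_form_cvg b hM.
apply: filterS2 hg h1 => w gw Mw.
have nv0 : n%:R^-1 @[n \oo] --> (0 : R).
by apply/gtr0_cvgV0; [near=> n; rewrite ltr0n; near: n; exact: na_near_n0|exact: cvgr_idn].
have up : n%:R^-1 * (rq (M n w) (na_z n w *m b) - vsq b * cRe (\tr (M n w))) +
 vsq b * (phi x * K ^+ 2) * n%:R^-1 @[n \oo] --> (0 : R).
rewrite -[X in _ --> X]addr0; apply: cvgD => //.
by rewrite -[X in _ --> X](mulr0 (vsq b * (phi x * K ^+ 2))); exact: cvgMr.
apply: (squeeze_cvgr _ (cvg_cst 0) up); apply: filterS2 hb gw => n [n0 [qn gb]] gnw.
have [bb kk] := gb w gnw.
have nv : 0 <= n%:R^-1 :> R by [].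
rewrite mulr_ge0 ?nsq_ge0 //=.
rewrite /M /g gnw rq_gram vsq1.
have -> : vdot (u n) (res (phi x) (accn n w) *m na_x n w *m (na_z n w *m b)) =
 vdot (y n w) (na_z n w *m b).
by rewrite /y !vdotMl adjmxK (res_herm (acc_herm _ _ _ _ _) bb) !mulmxA.
have -> : cRe (\tr (y n w *m (y n w) ^t*)) = vsq (y n w).
by rewrite -frob2_tr frob2_col big_ord1; congr vsq; apply/colP => i; rewrite mxE.
rewrite mulrBr -addrA lerDl addrC subr_ge0 mulrC; apply: ler_wpM2r => //.
by apply: ler_wpM2l; [exact: vsq_ge0|exact: yb].
Unshelve. all: end_near.
Qed.
End CoefficientLimits.

(** * Variational bounds for ordered eigenvalues *)

Section CountingEigenvalues.
Context (R : realType).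
Notation C := R[i].
Lemma exists_kernel m q (N : 'M[C]_(m, q)) : (m < q)%N ->
 exists2 c : 'cV[C]_q, c != 0 & N *m c = 0.
move=> mq; have : kermx N^T != 0.
by rewrite kermx_eq0 /row_free neq_ltn (leq_ltn_trans (rank_leq_col _) mq).
case/rowV0Pn => v /sub_kermxP vN v0; exists v^T; first by rewrite trmx_eq0.
by rewrite -[N]trmxK -trmx_mul vN trmx0.
Qed.
Context (q : nat) (S V : 'M[C]_q) (lam : 'I_q -> R).
Hypotheses (VV : V ^t* *m V = 1%:M)
 (SE : S = V *m diag_mx (\row_a (lam a)%:C%C) *m V ^t*).
Let VV' : V *m V ^t* = 1%:M. exact: mulmx1C. Qed.
Lemma eigsys_rq u : rq S u = \sum_a lam a * nsq ((V ^t* *m u) a 0).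
rewrite rq_def SE -!mulmxA vdotMr vdotE Re_sum.
apply: eq_bigr => a _; rewrite mul_diag_mx !mxE mulrCA nsqE.
by rewrite Re_mulCl.
Qed.
Lemma eigsys_vsq u : vsq u = \sum_a nsq ((V ^t* *m u) a 0).
by rewrite -(vsq_def (V ^t* *m u)) vsq_isom // adjmxK. Qed.
Hypothesis lam_sorted : forall a b : 'I_q, (a <= b)%N -> lam b <= lam a.
(** Courant-Fischer: [i] linear constraints cannot exhaust the span of the first i + 1 eigenvectors,
    on which the form is at least [lam i] times the squared norm. *)
Lemma eig_lt (i : 'I_q) (N : 'M[C]_(i, q)) z :
 (forall u, u != 0 -> N *m u = 0 -> rq S u < z * vsq u) -> lam i < z.
move=> h; rewrite ltNge; apply/negP => zi.
(* These rows force the coordinates after [i] to vanish; with the [i] rows of [N] there are q - 1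
   equations in q unknowns. *)
pose sel : 'M[C]_(q - i.+1, q) := \matrix_(r, a) (a == i.+1 + r :> nat)%:R.
have iq := ltn_ord i.
have [c c0] := @exists_kernel _ _ (col_mx (N *m V) sel) (ltac:(lia)).
rewrite mul_col_mx => /eqP; rewrite col_mx_eq0 => /andP[/eqP Nc /eqP sc].
have ci (a : 'I_q) : (i < a)%N -> c a 0 = 0.
move=> ia; have ra : (a - i.+1 < q - i.+1)%N by rewrite ltn_sub2r //; exact: leq_trans (ltn_ord a).
have aE : (i.+1 + Ordinal ra)%N = a by exact: subnKC ia.
have selE b : sel (Ordinal ra) b = (b == a)%:R.
by rewrite mxE; congr (nat_of_bool _)%:R; exact: (congr1 (fun m => (b : nat) == m) aE).
have := congr1 (fun D : 'cV[C]_(q - i.+1) => D (Ordinal ra) 0) sc.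
rewrite mxE mxE; under eq_bigr do rewrite selE.
rewrite (bigD1 a) //= eqxx mul1r big1 ?addr0 // => b /negbTE ->.
by rewrite mul0r.
have u0 : V *m c != 0.
by apply: contra c0 => /eqP e; rewrite -[c]mul1mx -VV -mulmxA e mulmx0.
have := h _ u0; rewrite mulmxA => /(_ Nc); apply/negP; rewrite -leNgt.
rewrite eigsys_rq eigsys_vsq mulmxA VV mul1mx mulr_sumr; apply: ler_sum => a _.
have [ia|ai] := ltnP i a; first by rewrite ci // nsq0 !mulr0.
by apply: ler_wpM2r; [exact: nsq_ge0|exact: le_trans zi (lam_sorted ai)].
Qed.
(** The dual bound: some nonzero combination of the i + 1 columns is orthogonal to the first [i]
    eigenvectors. *)
Lemma eig_ge (i : 'I_q) (L : 'M[C]_(q, i.+1)) z :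
 (forall c, c != 0 -> L *m c != 0 /\ z * vsq (L *m c) <= rq S (L *m c)) -> z <= lam i.
move=> h; pose N : 'M[C]_(i, i.+1) := \matrix_(b, j) (V ^t* *m L) (widen_ord (ltnW (ltn_ord i)) b) j.
have [c c0 Nc] := exists_kernel N (ltnSn i).
have [u0 hz] := h c c0.
have ub (b : 'I_q) : (b < i)%N -> (V ^t* *m (L *m c)) b 0 = 0.
move=> bi; suff e : (V ^t* *m (L *m c)) b 0 = (N *m c) (Ordinal bi) 0 by rewrite e Nc mxE.
rewrite mulmxA [LHS]mxE [RHS]mxE; apply: eq_bigr => j _; congr (_ * _); rewrite [RHS]mxE.
by apply: (congr1 (fun b' => (V ^t* *m L) b' j)); exact: val_inj.
rewrite leNgt; apply/negP => iz; move: hz; apply/negP; rewrite -ltNge.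
have vu : 0 < vsq (L *m c) by exact: vsq_gt0.
apply: le_lt_trans (_ : lam i * vsq (L *m c) < _); last by rewrite ltr_pM2r.
rewrite eigsys_rq eigsys_vsq mulr_sumr; apply: ler_sum => a _.
have [ai|ia] := ltnP a i; first by rewrite ub // nsq0 !mulr0.
by apply: ler_wpM2r; [exact: nsq_ge0|exact: lam_sorted].
Qed.

(* If A has more than k + i eigenvalues above t, some combination of its
 eigenvectors is orthogonal both to U and to the first i eigenvectors of S. *)
Lemma eig_ge_bulk (i : 'I_q) k (U : 'M[C]_(q, k)) (A : 'M[C]_q) t : herm A ->
 (forall u, U ^t* *m u = 0 -> rq S u = rq A u) ->
 (k + i < #|[pred a | (t <= eig A a)%R]|)%N -> t <= lam i.
move=> hA hU; set J := [pred a | _] => cJ.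
pose W := eigbasis A.
have WW : W *m W ^t* = 1%:M.
by rewrite /W eigbasis.unlock; exact/unitarymxP/spectral_unitarymx.
pose F : 'M[C]_(q, #|J|) := \matrix_(a, r) (a == enum_val r)%:R.
pose N : 'M[C]_(i, q) := \matrix_(b, a) (V ^t*) (widen_ord (ltnW (ltn_ord i)) b) a.
have [c c0] := @exists_kernel _ _ (col_mx (U ^t* *m W ^t* *m F) (N *m W ^t* *m F)) cJ.
rewrite mul_col_mx => /eqP; rewrite col_mx_eq0 => /andP[/eqP Uc /eqP Nc].
pose u := W ^t* *m (F *m c).
have FcE (r : 'I_#|J|) : (F *m c) (enum_val r) 0 = c r 0.
rewrite mxE (bigD1 r) //= mxE eqxx mul1r big1 ?addr0 // => r' rr.
by rewrite mxE (inj_eq enum_val_inj) eq_sym (negbTE rr) mul0r.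
have FcJ a : a \notin J -> (F *m c) a 0 = 0.
move=> aJ; rewrite mxE big1 // => r _; rewrite mxE; case: eqP => [e|_]; last by rewrite mul0r.
by move: aJ; rewrite e enum_valP.
have Wu : W *m u = F *m c by rewrite /u mulmxA WW mul1mx.
have u0 : u != 0.
apply: contra c0 => /eqP e; apply/eqP/colP => r.
by rewrite -FcE -Wu e mulmx0 !mxE.
have Uu : U ^t* *m u = 0 by rewrite /u !mulmxA in Uc *.
have Nu : N *m u = 0 by rewrite /u !mulmxA in Nc *.
have ub (b : 'I_q) : (b < i)%N -> (V ^t* *m u) b 0 = 0.
move=> bi; suff e : (V ^t* *m u) b 0 = (N *m u) (Ordinal bi) 0 by rewrite e Nu mxE.
rewrite [LHS]mxE [RHS]mxE; apply: eq_bigr => j _; congr (_ * _); rewrite [RHS]mxE.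
by apply: (congr1 (fun b' => (V ^t*) b' j)); exact: val_inj.
have up : t * vsq u <= rq A u.
rewrite rq_eig // -(wt_sum A) mulr_sumr; apply: ler_sum => a _.
have [aJ|aJ] := boolP (a \in J).
by apply: ler_wpM2r; [exact: wt_ge0|exact: aJ].
by rewrite wt_def -/W Wu FcJ // nsq0 !mulr0.
have lo : rq S u <= lam i * vsq u.
rewrite eigsys_rq eigsys_vsq mulr_sumr; apply: ler_sum => a _.
have [ai|ia] := ltnP a i; first by rewrite ub // nsq0 !mulr0.
by apply: ler_wpM2r; [exact: nsq_ge0|exact: lam_sorted].
rewrite hU // in lo; have := le_trans up lo.
by rewrite ler_pM2r // vsq_gt0.
Qed.
End CountingEigenvalues.

(** * Estimates for small matrices *)

Section SmallMatrices.
Context (R : realType).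
Notation C := R[i].
Lemma vdot_amgm n (u v : 'cV[C]_n) : 2 * `|cRe (vdot u v)| <= vsq u + vsq v.
have h (w : 'cV[C]_n) : 0 <= vsq u + vsq w + 2 * cRe (vdot u w).
have : 0 <= cRe (vdot (u + w) (u + w)) by rewrite vdotvv /= vsq_ge0.
rewrite vdotDl !vdotDr !Re_add !vdotvv /= [vdot w u]vdotC cRe_conj.
by move: (cRe _) => y; lra.
have h1 := h v; have := h (- v).
have -> : vsq (- v) = vsq v by rewrite -scaleN1r vsqZ nsqN /nsq /= expr1n expr0n addr0 mul1r.
rewrite vdotNr Re_opp; have [y0|y0] := ger0P (cRe (vdot u v)); lra.
Qed.
Lemma vdot_amgmZ n (u v : 'cV[C]_n) (t : R) : 0 < t ->
 2 * `|cRe (vdot u v)| <= t * vsq u + t^-1 * vsq v.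
move=> t0; have st : 0 < Num.sqrt t by rewrite sqrtr_gt0.
have := vdot_amgm ((Num.sqrt t)%:C%C *: u) ((Num.sqrt t)^-1%:C%C *: v).
rewrite vdotZl vdotZr conjR mulrA -rmorphM mulfV ?gt_eqF // rmorph1 mul1r.
by rewrite !vsqZ !nsqR exprVn sqr_sqrtr // ltW.
Qed.
Lemma vsq_mulmx m n (M : 'M[C]_(m, n)) v : vsq (M *m v) <= frob2 M * vsq v.
rewrite vsq_def frob2E mulr_suml; apply: ler_sum => i _.
have [->|v0] := eqVneq v 0.
by rewrite mulmx0 mxE nsq0 mulr_ge0 ?vsq_ge0 // sumr_ge0 // => j _; exact: nsq_ge0.
have vv : 0 < vsq v by exact: vsq_gt0.
pose r : 'cV[C]_n := \col_j Num.conj (M i j).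
have rE : (M *m v) i 0 = vdot r v.
by rewrite vdotE mxE; apply: eq_bigr => j _; rewrite mxE conjCK.
have sE : \sum_j nsq (M i j) = vsq r.
by rewrite vsq_def; apply: eq_bigr => j _; rewrite mxE nsqJ.
rewrite rE sE.
(* positivity of |r - (<v,r>/|v|^2) v|^2 *)
have : 0 <= cRe (vdot (r - ((vsq v)^-1%:C%C * vdot v r) *: v) (r - ((vsq v)^-1%:C%C * vdot v r) *: v)).
by rewrite vdotvv /= vsq_ge0.
rewrite vdotBl !vdotBr !vdotZl !vdotZr !vdotvv rmorphM /= conjR -[Num.conj (vdot v r)]vdotC.
have nE : vdot r v * vdot v r = (nsq (vdot r v))%:C%C.
by rewrite [vdot v r]vdotC mulrC nsqE.
have -> : (vsq v)^-1%:C%C * vdot r v * vdot v r = ((vsq v)^-1 * nsq (vdot r v))%:C%C.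
by rewrite -mulrA nE -rmorphM.
rewrite [X in _ - X - _](_ : _ = ((vsq v)^-1 * nsq (vdot r v))%:C%C); last first.
by rewrite -mulrA [vdot v r * _]mulrC nE -rmorphM.
rewrite [X in _ - _ - (_ - X)](_ : _ = ((vsq v)^-1 * nsq (vdot r v))%:C%C); last first.
have -> : (vsq v)^-1%:C%C * vdot r v * ((vsq v)^-1%:C%C * vdot v r * (vsq v)%:C%C) =
 (vsq v)^-1%:C%C * (vdot r v * vdot v r) * ((vsq v)^-1%:C%C * (vsq v)%:C%C) by ring.
by rewrite nE -!rmorphM mulVf ?mulr1 // gt_eqF.
rewrite subrr subr0 -rmorphB /= subr_ge0 => h.
by have := ler_wpM2r (ltW vv) h; rewrite mulrAC mulVf ?mul1r // gt_eqF.
Qed.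
Lemma vdot_small m n (M : 'M[C]_(m, n)) u v dl : 0 < dl -> frob2 M <= dl ^+ 2 ->
 2 * `|cRe (vdot u (M *m v))| <= dl * (vsq u + vsq v).
move=> d0 hM; have h := vdot_amgmZ u (M *m v) d0.
have : dl^-1 * vsq (M *m v) <= dl * vsq v.
rewrite ler_pdivrMl // mulrA -expr2; apply: (le_trans (vsq_mulmx M v)).
by apply: ler_wpM2r => //; exact: vsq_ge0.
by move: h; move: (`|_|) => y; lra.
Qed.
Lemma rq_small n (M : 'M[C]_n) v dl : 0 < dl -> frob2 M <= dl ^+ 2 ->
 `|rq M v| <= dl * vsq v.
by move=> d0 /(vdot_small v v d0); rewrite -rq_def; move: `|_| => y; lra.
Qed.
End SmallMatrices.

(** * The spiked matrix as a finite-rank perturbation of the noise *)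

Section SpikeForms.
Context (R : realType) (q n k : nat).
Notation C := R[i].
Variables (X : 'M[C]_(q, n)) (U : 'M[C]_(q, k)) (Z : 'M[C]_(n, k)) (th : 'I_k -> R).
Definition spike_diag : 'M[C]_k := diag_mx (\row_j (th j)%:C%C).
Notation Th := spike_diag.
Definition spiked : 'M[C]_(q, n) := U *m Th *m Z ^t* + X.
Notation Y := spiked.
Lemma spike_diagE p j : (Th *m p) j 0 = (th j)%:C%C * p j (0 : 'I_1) :> C.
by rewrite mul_diag_mx !mxE. Qed.
Lemma spike_diag_herm : herm Th.
apply/matrixP => i j; rewrite !mxE; rewrite [in LHS]eq_sym; case: eqVneq => [->|ij].
by rewrite !mulr1n conjR.
by rewrite !mulr0n conjC0.
Qed.
Lemma vsq_spike_diag p : vsq (Th *m p) = \sum_j th j ^+ 2 * nsq (p j 0).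
by rewrite vsq_def; apply: eq_bigr => j _; rewrite spike_diagE nsqM nsqR. Qed.
Lemma vsqD m (u v : 'cV[C]_m) : vsq (u + v) = vsq u + vsq v + 2 * cRe (vdot u v).
have -> : vsq (u + v) = cRe (vdot (u + v) (u + v)) by rewrite vdotvv.
rewrite vdotDl !vdotDr !Re_add !vdotvv /= [vdot v u]vdotC cRe_conj.
by move: (cRe _) => y; ring.
Qed.
Lemma rqDv m (M : 'M[C]_m) u v : herm M ->
 rq M (u + v) = rq M u + rq M v + 2 * cRe (vdot u (M *m v)).
move=> hM; rewrite !rq_def mulmxDr vdotDl !vdotDr !Re_add.
rewrite [vdot v (M *m u)]vdotC [vdot (M *m u) v]vdotMl hM cRe_conj.
by move: (cRe _) => y; ring.
Qed.
Lemma spiked_adj (u : 'cV[C]_q) : Y ^t* *m u = Z *m (Th *m (U ^t* *m u)) + X ^t* *m u.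
by rewrite adjmxD !adjmxM adjmxK spike_diag_herm mulmxDl !mulmxA. Qed.
Variables (z : R).
Notation A := (X *m X ^t*).
Notation Q := (res z A).
Hypothesis bA : below A z.
Let hA : herm A. exact: herm_gram. Qed.
Let hQ : herm Q. exact: res_herm. Qed.
Let B := z%:C%C%:M - A.
Let hB : herm B. by apply: hermB => //; exact: herm_scalar. Qed.
Let QB : Q *m B = 1%:M. exact: (res_mul hA bA).1. Qed.
Let BQ : B *m Q = 1%:M. exact: (res_mul hA bA).2. Qed.
Let B_ge0 v : 0 <= rq B v.
have [->|v0] := eqVneq v 0; first by rewrite rq_def mulmx0 vdot0r.
by rewrite rqB rq_scalar subr_ge0 ltW //; exact: (belowP z hA).1.
Qed.
(** With [forms_Z] and [forms_X], all that the spikes see of the noise at level [z]. Almost surely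
    at z = phi(x) they tend to c/x and 1 + phi(x)/x - 1/c times the identity, and to 0. *)
Definition forms_U := U ^t* *m Q *m U.
Definition forms_Z := Z ^t* *m Z + Z ^t* *m gram_form X z *m Z.
Definition forms_X := U ^t* *m Q *m X *m Z.
Lemma forms_U_herm : herm forms_U.
by rewrite /herm /forms_U !adjmxM hQ adjmxK mulmxA. Qed.
Lemma rq_forms_U p : rq forms_U p = rq Q (U *m p).
by rewrite !rq_def /forms_U vdotMl -!mulmxA. Qed.
Lemma rq_forms_Z p : rq forms_Z p = vsq (Z *m p) + rq (gram_form X z) (Z *m p).
rewrite rqD; congr (_ + _); last by rewrite !rq_def vdotMl -!mulmxA.
by rewrite rq_def -mulmxA -vdotMl vdotvv.
Qed.
Let center (u : 'cV[C]_q) := Q *m (X *m (Z *m (Th *m (U ^t* *m u)))).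
(** Completing the square in [u]: the term linear in [u] is absorbed by shifting [u] by [center u],
    the solution of B v = X Z a with a = Th U^H u. *)
Lemma spike_identity u : vsq (Y ^t* *m u) - z * vsq u =
 rq forms_Z (Th *m (U ^t* *m u)) - rq B (u - center u).
rewrite spiked_adj vsqD rq_forms_Z; set a := Th *m _.
have -> : center u = Q *m (X *m (Z *m a)) by [].
set u0 := Q *m _.
have Bu0 : B *m u0 = X *m (Z *m a) by rewrite /u0 mulmxA BQ mul1mx.
have -> : u - u0 = - u0 + u by rewrite addrC.
rewrite rqDv // [vdot _ (B *m u)]vdotMr hB mulmxN Bu0 vdotNl Re_opp.
have -> : rq B (- u0) = rq (gram_form X z) (Z *m a).
rewrite !rq_def mulmxN vdotNl vdotNr opprK Bu0 /gram_form -!mulmxA.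
by rewrite /u0 vdotMl hQ -[RHS]/(cRe _) vdotMr adjmxK.
rewrite rqB rq_scalar rq_gram.
have -> : vdot (X *m (Z *m a)) u = vdot (Z *m a) (X ^t* *m u) by rewrite vdotMl.
by move: (cRe _) (rq _ _) (vsq u) => x1 x2 x3; ring.
Qed.
Variables (f g dl : R)
 (f0 : 0 < f) (d0 : 0 < dl)
 (hU : frob2 (forms_U - f%:C%C%:M) <= dl ^+ 2)
 (hZ : frob2 (forms_Z - g%:C%C%:M) <= dl ^+ 2)
 (hX : frob2 forms_X <= dl ^+ 2).
Lemma rq_forms_U_near p : `|rq forms_U p - f * vsq p| <= dl * vsq p.
by rewrite -rq_scalar -rqB; exact: rq_small. Qed.
Lemma rq_forms_Z_near p : `|rq forms_Z p - g * vsq p| <= dl * vsq p.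
by rewrite -rq_scalar -rqB; exact: rq_small. Qed.
(** Given its image under U^H, a vector has B-form at least that of the inverse of [forms_U] at this
    image, about |p|^2 / f here. The sign is thus decided by g |a|^2 - |p|^2 / f. *)
Lemma spike_upper u p a : p = U ^t* *m u -> a = Th *m p ->
 vsq (Y ^t* *m u) - z * vsq u <=
 g * vsq a - f^-1 * vsq p +
 dl * (vsq a + f^-1 * (vsq p + vsq a) + f^-1 ^+ 2 * vsq p).
move=> pE aE; rewrite spike_identity -pE -aE.
set y := u - center u.
pose mu := f^-1%:C%C *: p.
(* completing the square: the form B at y is at least its value at the
 minimizer with the same image under U^* *)
have lower : 2 * cRe (vdot mu (U ^t* *m y)) - rq forms_U mu <= rq B y.
have := B_ge0 (- (Q *m (U *m mu)) + y).
rewrite rqDv // [vdot _ (B *m y)]vdotMr hB mulmxN.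
have e : B *m (Q *m (U *m mu)) = U *m mu by rewrite mulmxA BQ mul1mx.
rewrite e vdotNl Re_opp vdotMl.
have -> : rq B (- (Q *m (U *m mu))) = rq forms_U mu.
by rewrite rq_forms_U !rq_def mulmxN vdotNl vdotNr opprK e vdotMl hQ.
by move: (cRe _) => t; lra.
have Uy : U ^t* *m y = p - forms_X *m a.
by rewrite mulmxBr -pE /center -pE -aE /forms_X !mulmxA.
have f10 : 0 < f^-1 by rewrite invr_gt0.
have nmu : vsq mu = f^-1 ^+ 2 * vsq p by rewrite vsqZ nsqR.
have := rq_forms_U_near mu; have := rq_forms_Z_near a.
have := vdot_small p a d0 hX.
move: lower; rewrite Uy vdotBr /mu !vdotZl conjR -/mu vdotvv nmu.
rewrite -rmorphM Re_sub Re_mulCl /=.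
have -> : f * (f^-1 ^+ 2 * vsq p) = f^-1 * vsq p by rewrite expr2 !mulrA mulfV ?gt_eqF // mul1r.
rewrite !ler_norml; move: (cRe _) (rq forms_U mu) (rq B y) (rq forms_Z a) => E G b1 z1.
move=> h1 h2 /andP[h3 h4] /andP[h5 h6].
have h2' : f^-1 * (2 * E) <= f^-1 * (dl * (vsq p + vsq a)).
apply: ler_wpM2l; first exact: ltW.
by apply: le_trans h2; rewrite ler_wpM2l // ler_norm.
move: h1 h2' h3 h4 h5 h6; rewrite [f^-1 * (2 * E)]mulrCA !mulrDr; move: (f^-1 * E) => FE.
lra.
Qed.
(** Attains the bound in [spike_upper]: the first term is the centre, and the second corrects the
    image under U^H to be [p]. Here [res 0 (- forms_U)] is the inverse of [forms_U]. *)
Definition spike_lift : 'M[C]_(q, k) :=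
 Q *m X *m Z *m Th +
 Q *m U *m res 0 (- forms_U) *m (1%:M - forms_X *m Th).
Lemma spike_lower p a : dl < f -> a = Th *m p ->
 U ^t* *m (spike_lift *m p) = p /\
 (g - dl) * vsq a - (f - dl)^-1 * vsq (p - forms_X *m a) <=
 vsq (Y ^t* *m (spike_lift *m p)) - z * vsq (spike_lift *m p).
move=> df aE.
have hG : herm (- forms_U) by rewrite /herm adjmxN forms_U_herm.
have fd0 : 0 < f - dl by rewrite subr_gt0.
have G_ge v : (f - dl) * vsq v <= rq forms_U v.
by have := rq_forms_U_near v; rewrite ler_norml => /andP[h _]; move: h; lra.
have bG : below (- forms_U) 0.
apply/(belowP 0 hG) => v v0; rewrite mul0r rqN oppr_lt0.
by apply: lt_le_trans (G_ge v); rewrite mulr_gt0 // vsq_gt0.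
have e0 : ((0 : R)%:C)%C%:M = 0 :> 'M[C]_k.
by apply/matrixP => i j; rewrite !mxE; case: (i == j).
have [_] := res_mul hG bG; rewrite opprK e0 add0r => Ginv.
pose w := p - forms_X *m a; pose mu := res 0 (- forms_U) *m w.
have Gmu : forms_U *m mu = w by rewrite mulmxA Ginv mul1mx.
have LE : spike_lift *m p = Q *m (X *m (Z *m a)) + Q *m (U *m mu).
have wE : w = (1%:M - forms_X *m Th) *m p by rewrite mulmxBl mul1mx /w aE mulmxA.
by rewrite /spike_lift mulmxDl aE /mu wE !mulmxA.
have UL : U ^t* *m (spike_lift *m p) = p.
rewrite LE mulmxDr.
have -> : U ^t* *m (Q *m (X *m (Z *m a))) = forms_X *m a by rewrite /forms_X !mulmxA.
have -> : U ^t* *m (Q *m (U *m mu)) = forms_U *m mu by rewrite /forms_U !mulmxA.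
by rewrite Gmu addrC subrK.
split => //; rewrite spike_identity UL -aE.
have -> : spike_lift *m p - center (spike_lift *m p) = Q *m (U *m mu).
by rewrite /center UL -aE LE addrC addKr.
have -> : rq B (Q *m (U *m mu)) = rq forms_U mu.
by rewrite rq_forms_U !rq_def [B *m _]mulmxA BQ mul1mx vdotMl hQ.
have := rq_forms_Z_near a; rewrite ler_norml => /andP[hz _].
suff : rq forms_U mu <= (f - dl)^-1 * vsq w by move: hz; lra.
have := vdot_amgmZ mu w fd0; have := G_ge mu.
rewrite rq_def Gmu => h1 h2.
by have := ler_norm (cRe (vdot mu w)); move: h1 h2; move: (cRe _) => t; lra.
Qed.

(* The eigenvector equations, tested against the resolvent at a fixed point z. *)
Section Eigenvector.
Variables (uh : 'cV[C]_q) (wh : 'cV[C]_n) (p r : 'cV[C]_k) (t : R)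
 (t0 : t != 0) (twh : t%:C%C *: wh = Y ^t* *m uh) (tuh : t%:C%C *: uh = Y *m wh)
 (pE : p = U ^t* *m uh) (rE : r = Z ^t* *m wh).
Definition spike_src := t%:C%C *: (U *m (Th *m r)) + X *m (Z *m (Th *m p)).
Let spikedE (v : 'cV[C]_n) : Y *m v = U *m (Th *m (Z ^t* *m v)) + X *m v.
by rewrite mulmxDl !mulmxA. Qed.
Let cancel_source (a b c v : 'cV[C]_q) : v - c = a + b + (v - (a + (b + c))).
by rewrite [a + (b + c)]addrA opprD addrCA [a + b + _]addrA subrr add0r. Qed.
(** The singular vector is a resolvent image of a vector built from [p] and [r] only, up to an error
    proportional to the distance from [z] to the squared singular value. *)
Lemma eigvec_source : uh = Q *m (spike_src + (z - t ^+ 2)%:C%C *: uh).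
have e : B *m uh = spike_src + (z - t ^+ 2)%:C%C *: uh.
have tw : (t ^+ 2)%:C%C *: uh =
 t%:C%C *: (U *m (Th *m r)) + (X *m (Z *m (Th *m p)) + X *m (X ^t* *m uh)).
rewrite expr2 rmorphM -scalerA tuh spikedE scalerDr -rE [t%:C%C *: (X *m wh)]scalemxAr twh.
by rewrite spiked_adj -pE mulmxDr.
rewrite /B mulmxBl mul_scalar_mx rmorphB scalerBl tw -mulmxA.
exact: cancel_source.
by rewrite -e mulmxA QB mul1mx.
Qed.
Lemma eigvec_p : p = t%:C%C *: (forms_U *m (Th *m r)) + forms_X *m (Th *m p) +
 (z - t ^+ 2)%:C%C *: (U ^t* *m (Q *m uh)).
rewrite {1}pE {1}eigvec_source /spike_src !mulmxDr -!scalemxAr.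
by rewrite /forms_U /forms_X !mulmxA.
Qed.
Lemma eigvec_r : t%:C%C *: r = forms_Z *m (Th *m p) + t%:C%C *: (forms_X ^t* *m (Th *m r)) +
 (z - t ^+ 2)%:C%C *: (Z ^t* *m (X ^t* *m (Q *m uh))).
have XE : X ^t* *m uh = t%:C%C *: (X ^t* *m (Q *m (U *m (Th *m r)))) +
 X ^t* *m (Q *m (X *m (Z *m (Th *m p)))) + (z - t ^+ 2)%:C%C *: (X ^t* *m (Q *m uh)).
by rewrite {1}eigvec_source /spike_src !mulmxDr -!scalemxAr.
rewrite {1}rE scalemxAr twh spiked_adj -pE mulmxDr XE !mulmxDr -!scalemxAr.
rewrite /forms_Z mulmxDl /forms_X /gram_form !adjmxM hQ adjmxK !mulmxA -!addrA; congr (_ + _).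
by rewrite addrCA.
Qed.
Lemma vsq_wh : vsq wh = vsq uh.
have h : t%:C%C * vdot wh wh = t%:C%C * vdot uh uh.
by rewrite -!vdotZr tuh vdotMr -twh vdotZl conjR vdotZr.
have tC : t%:C%C != 0 :> C by apply: contra t0 => /eqP/(congr1 (@cRe R)) /= ->.
by have := mulfI tC h; rewrite !vdotvv => /(congr1 (@cRe R)).
Qed.
Lemma rq_source : rq Q spike_src =
 t ^+ 2 * rq forms_U (Th *m r) + (rq forms_Z (Th *m p) - vsq (Z *m (Th *m p))) +
 2 * t * cRe (vdot (Th *m r) (forms_X *m (Th *m p))).
rewrite /spike_src rqDv // rqZv -rq_forms_U rq_forms_Z.
set a := vsq (Z *m _); rewrite [a + _]addrC addrK.
congr (_ + _ + _).
by rewrite !rq_def /gram_form -!mulmxA [X in _ = cRe X]vdotMr adjmxK.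
rewrite vdotZl conjR Re_mulCl vdotMl mulrA.
by rewrite /forms_X -!mulmxA.
Qed.
End Eigenvector.
End SpikeForms.

(** * Norm bounds for isometries and near-isometries *)

Section Contractions.
Context (R : realType).
Notation C := R[i].
Lemma vsq_isom_adj m k (U : 'M[C]_(m, k)) u : U ^t* *m U = 1%:M -> vsq (U ^t* *m u) <= vsq u.
move=> UU; have := vdot_amgm (U *m (U ^t* *m u)) u; rewrite vsq_isom //.
have -> : vdot (U *m (U ^t* *m u)) u = (vsq (U ^t* *m u))%:C%C by rewrite vdotMl vdotvv.
by rewrite /= ger0_norm ?vsq_ge0 //; lra.
Qed.
Lemma vsq_gram m k (W : 'M[C]_(m, k)) b : vsq (W *m b) = rq (W ^t* *m W) b.
by rewrite rq_def -mulmxA vdotMr adjmxK vdotvv. Qed.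
Lemma vsq_adj_le m k (W : 'M[C]_(m, k)) u : frob2 (W ^t* *m W - 1%:M) <= 1 ->
 vsq (W ^t* *m u) <= 2 * vsq u.
move=> h; have t2 : 0 < 2^-1 :> R by [].
have := vdot_amgmZ (W *m (W ^t* *m u)) u t2; rewrite invrK.
have -> : vdot (W *m (W ^t* *m u)) u = (vsq (W ^t* *m u))%:C%C by rewrite vdotMl vdotvv.
rewrite /= ger0_norm ?vsq_ge0 //.
have : vsq (W *m (W ^t* *m u)) <= 2 * vsq (W ^t* *m u).
have h1 : frob2 (W ^t* *m W - 1%:M) <= 1 ^+ 2 by rewrite expr1n.
have := rq_small (W ^t* *m u) ltr01 h1; rewrite rqB -vsq_gram.
have -> : (1%:M : 'M[C]_k) = ((1 : R)%:C)%C%:M by [].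
by rewrite rq_scalar ler_norml => /andP[_]; lra.
lra.
Qed.
Lemma vsq_sum4 m (u1 u2 u3 u4 : 'cV[C]_m) :
 vsq (u1 + u2 + u3 + u4) <= 4 * (vsq u1 + vsq u2 + vsq u3 + vsq u4).
have h (u v : 'cV[C]_m) : vsq (u + v) <= 2 * (vsq u + vsq v).
rewrite vsqD; have := vdot_amgm u v; have := ler_norm (cRe (vdot u v)).
by move: (cRe _) => y; lra.
rewrite -addrA; have := h (u1 + u2) (u3 + u4); have := h u1 u2; have := h u3 u4; lra.
Qed.
Lemma vdot_bound m (u v : 'cV[C]_m) a b : 0 <= a -> 0 <= b -> vsq u <= a ^+ 2 -> vsq v <= b ^+ 2 ->
 `|cRe (vdot u v)| <= a * b.
move=> a0 b0 ua vb.
have h : cRe (vdot u v) ^+ 2 <= (a * b) ^+ 2.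
apply: (letr (nsq (vdot u v))); first by rewrite /nsq lerDl sqr_ge0.
rewrite -vsq1; apply: (le_trans (vsq_mulmx _ _)); rewrite frob2_adj exprMn.
apply: ler_pM => //; [exact: frob2_ge0|exact: vsq_ge0|].
rewrite frob2_col big_ord1 (_ : col 0 u = u) //.
by apply/colP => i; rewrite mxE.
rewrite -[a * b]ger0_norm ?mulr_ge0 //.
by rewrite -ler_sqr ?nnegrE // -!normrX !ger0_norm ?sqr_ge0.
Qed.
End Contractions.

(** * Quantitative eigenvector equations *)

Section EigenvectorErrors.
Context (R : realType) (q n k : nat).
Notation C := R[i].
Variables (X : 'M[C]_(q, n)) (U : 'M[C]_(q, k)) (Z : 'M[C]_(n, k)) (th : 'I_k -> R).
Notation A := (X *m X ^t*).
Notation Th := (spike_diag th).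
Notation Y := (spiked X U Z th).
Variables (uh : 'cV[C]_q) (wh : 'cV[C]_n) (p r : 'cV[C]_k) (t : R)
 (t0 : t != 0) (twh : t%:C%C *: wh = Y ^t* *m uh) (tuh : t%:C%C *: uh = Y *m wh)
 (pE : p = U ^t* *m uh) (rE : r = Z ^t* *m wh) (uh1 : vsq uh = 1)
 (UU : U ^t* *m U = 1%:M)
 (ZZ : frob2 (Z ^t* *m Z - 1%:M) <= 1)
 (T : R)
 (hT : forall v, vsq (Th *m v) <= T * vsq v)
 (T0 : 0 <= T).
Lemma vsq_p_le1 : vsq p <= 1. by rewrite pE -uh1; exact: vsq_isom_adj. Qed.
Lemma vsq_r_le2 : vsq r <= 2.
by rewrite rE; apply: (le_trans (vsq_adj_le _ ZZ)); rewrite (vsq_wh t0 twh tuh) uh1 mulr1. Qed.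
Let Tp : vsq (Th *m p) <= T.
by apply: (le_trans (hT p)); rewrite ler_piMr // vsq_p_le1. Qed.
Let Tr : vsq (Th *m r) <= T * 2.
by apply: (le_trans (hT r)); apply: ler_wpM2l => //; exact: vsq_r_le2. Qed.

Section ErrorAt.
Variables (z K dl f g : R)
 (z0 : 0 <= z) (bA : below A z) (hK : forall a, (z - eig A a)^-1 <= K)
 (d0 : 0 < dl)
 (eU : frob2 (forms_U X U z - f%:C%C%:M) <= dl ^+ 2)
 (eZ : frob2 (forms_Z X Z z - g%:C%C%:M) <= dl ^+ 2)
 (eX : frob2 (forms_X X U Z z) <= dl ^+ 2).
Notation Q := (res z A).
Lemma vsq_Q (v : 'cV[C]_q) : vsq (Q *m v) <= K ^+ 2 * vsq v.
have <- : rq (rpow z A 2) v = vsq (Q *m v).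
rewrite rpowS rpow1 rq_def -mulmxA vdotMr (res_herm (herm_gram X) bA).
by rewrite vdotvv.
exact: rq_rpow2_bound.
Qed.
(** Four errors: [forms_U] against its limit, [t] and [f] against their limits, the cross form, and
    the distance from [z] to t^2. *)
Lemma eigvec_p_error s f' : vsq (p - (s * f')%:C%C *: (Th *m r)) <=
 4 * (t ^+ 2 * (dl ^+ 2 * (T * 2)) + (t * f - s * f') ^+ 2 * (T * 2) + dl ^+ 2 * T +
 (z - t ^+ 2) ^+ 2 * K ^+ 2).
have e : p - (s * f')%:C%C *: (Th *m r) =
 t%:C%C *: ((forms_U X U z - f%:C%C%:M) *m (Th *m r)) +
 (t * f - s * f')%:C%C *: (Th *m r) + forms_X X U Z z *m (Th *m p) +
 (z - t ^+ 2)%:C%C *: (U ^t* *m (Q *m uh)).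
have tr := eigvec_p bA twh tuh pE rE; rewrite mulmxBl mul_scalar_mx.
move: tr; move: (Th *m r) (forms_U _ _ _ *m _) (forms_X _ _ _ _ *m _) (_ *: (U ^t* *m _)) => v a1 a2 a3 tr.
have e1 : (t * f - s * f')%:C%C = t%:C%C * f%:C%C - (s * f')%:C%C :> C by rewrite rmorphB rmorphM.
apply/colP => i; rewrite tr !mxE e1; ring.
rewrite e; apply: (le_trans (vsq_sum4 _ _ _ _)); apply: ler_wpM2l => //.
rewrite !vsqZ !nsqR; apply: lerD; [apply: lerD; [apply: lerD|]|].
- apply: ler_wpM2l; first exact: sqr_ge0.
apply: (le_trans (vsq_mulmx _ _)); apply: ler_pM => //; [exact: frob2_ge0|exact: vsq_ge0].
- by apply: ler_wpM2l; rewrite ?sqr_ge0.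
- by apply: (le_trans (vsq_mulmx _ _)); apply: ler_pM => //; [exact: frob2_ge0|exact: vsq_ge0].
- apply: ler_wpM2l; first exact: sqr_ge0.
by apply: (le_trans (vsq_isom_adj _ UU)); apply: (le_trans (vsq_Q _)); rewrite uh1 mulr1.
Qed.
Lemma eigvec_r_error s g' : vsq (s%:C%C *: r - g'%:C%C *: (Th *m p)) <=
 4 * ((s - t) ^+ 2 * 2 + (2 * (dl ^+ 2 * T) + 2 * ((g - g') ^+ 2 * T)) +
 t ^+ 2 * (dl ^+ 2 * (T * 2)) + (z - t ^+ 2) ^+ 2 * (2 * (z * K ^+ 2))).
have e : s%:C%C *: r - g'%:C%C *: (Th *m p) =
 (s - t)%:C%C *: r +
 ((forms_Z X Z z - g%:C%C%:M) *m (Th *m p) + (g - g')%:C%C *: (Th *m p)) +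
 t%:C%C *: ((forms_X X U Z z) ^t* *m (Th *m r)) +
 (z - t ^+ 2)%:C%C *: (Z ^t* *m (X ^t* *m (Q *m uh))).
have tr := eigvec_r bA twh tuh pE rE; rewrite mulmxBl mul_scalar_mx.
move: tr; move: (Th *m p) (forms_Z _ _ _ *m _) (t%:C%C *: (_ *m _)) (_ *: (Z ^t* *m _)) => v a1 a2 a3 tr.
have e1 : (s - t)%:C%C = s%:C%C - t%:C%C :> C by rewrite rmorphB.
have e2 : (g - g')%:C%C = g%:C%C - g'%:C%C :> C by rewrite rmorphB.
apply/colP => i; have := congr1 (fun M : 'cV[C]_k => M i 0) tr; rewrite !mxE e1 e2 => h.
transitivity (s%:C%C * r i 0 - t%:C%C * r i 0 + (a1 i 0 + a2 i 0 + a3 i 0) - g'%:C%C * v i 0).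
by rewrite h; ring.
 ring.
rewrite e; apply: (le_trans (vsq_sum4 _ _ _ _)); apply: ler_wpM2l => //.
have two (u v : 'cV[C]_k) : vsq (u + v) <= 2 * vsq u + 2 * vsq v.
rewrite vsqD; have := vdot_amgm u v; have := ler_norm (cRe (vdot u v)).
by move: (cRe _) => y; lra.
apply: lerD; [apply: lerD; [apply: lerD|]|].
- by rewrite vsqZ nsqR; apply: ler_wpM2l; [exact: sqr_ge0|exact: vsq_r_le2].
- apply: (le_trans (two _ _)); rewrite vsqZ nsqR; apply: lerD; apply: ler_wpM2l => //.
by apply: (le_trans (vsq_mulmx _ _)); apply: ler_pM => //; [exact: frob2_ge0|exact: vsq_ge0].
by apply: ler_wpM2l; rewrite ?sqr_ge0.
- rewrite vsqZ nsqR; apply: ler_wpM2l; first exact: sqr_ge0.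
apply: (le_trans (vsq_mulmx _ _)); rewrite frob2_adj.
by apply: ler_pM => //; [exact: frob2_ge0|exact: vsq_ge0].
- rewrite vsqZ nsqR; apply: ler_wpM2l; first exact: sqr_ge0.
apply: (le_trans (vsq_adj_le _ ZZ)); apply: ler_wpM2l => //.
by apply: (le_trans (gram_column z0 bA hK _)); rewrite uh1 mulr1.
Qed.
Lemma rq_source_near : `|rq Q (spike_src X U Z th p r t) -
 (t ^+ 2 * (f * vsq (Th *m r)) + g * vsq (Th *m p) - vsq (Z *m (Th *m p)))| <=
 dl * (t ^+ 2 * (T * 2) + T + `|t| * (T * 3)).
rewrite (rq_source U Z th bA).
have := rq_forms_U_near d0 eU (Th *m r); have := rq_forms_Z_near d0 eZ (Th *m p).
have := vdot_small (Th *m r) (Th *m p) d0 eX.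
have Tr' := Tr; have Tp' := Tp.
set E := cRe _; set w1 := vsq (Th *m r) in Tr' *; set w2 := vsq (Th *m p) in Tp' *.
set G1 := rq _ _; set G2 := rq _ _; set zz := vsq _ => h1 h2 h3.
have -> : t ^+ 2 * G2 + (G1 - zz) + 2 * t * E - (t ^+ 2 * (f * w1) + g * w2 - zz) =
 t ^+ 2 * (G2 - f * w1) + (G1 - g * w2) + t * (2 * E) by ring.
have t2 := sqr_ge0 t.
apply: (le_trans (ler_normD _ _)); apply: (letr (t ^+ 2 * (dl * (T * 2)) + dl * T + `|t| * (dl * (T * 3)))); last first.
by rewrite le_eqVlt; apply/orP; left; apply/eqP; ring.
apply: lerD.
apply: (le_trans (ler_normD _ _)); apply: lerD.
rewrite normrM (ger0_norm t2); apply: ler_wpM2l => //; apply: (le_trans h3).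
by apply: ler_wpM2l => //; exact: ltW.
by apply: (le_trans h2); apply: ler_wpM2l => //; exact: ltW.
rewrite normrM; apply: ler_wpM2l => //; rewrite normrM ger0_norm //.
apply: (le_trans h1); apply: ler_wpM2l; first exact: ltW.
by move: Tr' Tp'; lra.
Qed.
Lemma source_near : vsq (uh - Q *m spike_src X U Z th p r t) <= ((z - t ^+ 2) * K) ^+ 2.
rewrite {1}(eigvec_source bA twh tuh pE rE) mulmxDr addrC addKr -scalemxAr vsqZ nsqR exprMn.
by apply: ler_wpM2l; rewrite ?sqr_ge0 // (le_trans (vsq_Q _)) // uh1 mulr1.
Qed.
End ErrorAt.
Variables (z1 z2 K dl f1 f2 g1 g2 : R)
 (z12 : z1 < z2) (K0 : 0 <= K) (d0 : 0 < dl)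
 (b1 : below A z1) (b2 : below A z2)
 (hK1 : forall a, (z1 - eig A a)^-1 <= K)
 (hK2 : forall a, (z2 - eig A a)^-1 <= K)
 (eU1 : frob2 (forms_U X U z1 - f1%:C%C%:M) <= dl ^+ 2)
 (eZ1 : frob2 (forms_Z X Z z1 - g1%:C%C%:M) <= dl ^+ 2)
 (eX1 : frob2 (forms_X X U Z z1) <= dl ^+ 2)
 (eU2 : frob2 (forms_U X U z2 - f2%:C%C%:M) <= dl ^+ 2)
 (eZ2 : frob2 (forms_Z X Z z2 - g2%:C%C%:M) <= dl ^+ 2)
 (eX2 : frob2 (forms_X X U Z z2) <= dl ^+ 2).
Let y := spike_src X U Z th p r t.
Let e1 := `|z1 - t ^+ 2| * K.
Let e2 := `|z2 - t ^+ 2| * K.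
Let cerr := t ^+ 2 * (T * 2) + T + `|t| * (T * 3).
(** Normalisation comes from two spectral parameters: both Q(z1) y and Q(z2) y are close to the unit
    vector [uh], while by the resolvent identity their inner product is the difference quotient of
    the form of Q at y. This replaces a derivative of the resolvent. *)
Lemma eigvec_norm_error :
 `|t ^+ 2 * ((f1 - f2) / (z2 - z1)) * vsq (Th *m r) +
 (g1 - g2) / (z2 - z1) * vsq (Th *m p) - 1| <=
 e1 + e2 + e1 * e2 + 2 * dl * cerr / (z2 - z1).
have hA : herm A by exact: herm_gram.
have dz : 0 < z2 - z1 by rewrite subr_gt0.
have e10 : 0 <= e1 by rewrite mulr_ge0.
have e20 : 0 <= e2 by rewrite mulr_ge0.
have sq (z : R) : ((z - t ^+ 2) * K) ^+ 2 = (`|z - t ^+ 2| * K) ^+ 2.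
by rewrite !exprMn real_normK ?num_real.
pose d1 := uh - res z1 A *m y; pose d2 := uh - res z2 A *m y.
have vd1 : vsq d1 <= e1 ^+ 2 by rewrite /e1 -sq; exact: (source_near b1 hK1).
have vd2 : vsq d2 <= e2 ^+ 2 by rewrite /e2 -sq; exact: (source_near b2 hK2).
have uh1' : vsq uh <= 1 ^+ 2 by rewrite uh1 expr1n.
have near1 : `|cRe (vdot (res z1 A *m y) (res z2 A *m y)) - 1| <= e1 + e2 + e1 * e2.
(* Expand around [uh], whose squared norm is the 1 on the left. *)
have -> : cRe (vdot (res z1 A *m y) (res z2 A *m y)) - 1 =
 - cRe (vdot d1 uh) - cRe (vdot uh d2) + cRe (vdot d1 d2).
have y1 : res z1 A *m y = uh - d1 by rewrite /d1 subKr.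
have y2 : res z2 A *m y = uh - d2 by rewrite /d2 subKr.
rewrite y1 y2 vdotBl !vdotBr !Re_sub vdotvv uh1 /=.
by move: (cRe (vdot d1 uh)) (cRe _) (cRe _) => a1 a2 a3; ring.
have n1 := vdot_bound e10 ler01 vd1 uh1'; have n2 := vdot_bound ler01 e20 uh1' vd2.
have n3 := vdot_bound e10 e20 vd1 vd2.
apply: (le_trans (ler_normD _ _)); apply: lerD => //.
rewrite -opprD normrN; apply: (le_trans (ler_normD _ _)); rewrite mulr1 in n1; rewrite mul1r in n2.
exact: lerD.
have diff : rq (res z1 A) y - rq (res z2 A) y =
 (z2 - z1) * cRe (vdot (res z1 A *m y) (res z2 A *m y)).
have [r1 _] := res_mul hA b1; have [_ r2] := res_mul hA b2.
have E : res z1 A - res z2 A = (z2 - z1)%:C%C *: (res z1 A *m res z2 A).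
rewrite -[res z1 A in LHS]mulmx1 -r2 mulmxA -[res z2 A in X in _ - X]mul1mx -r1 -mulmxBl -mulmxBr.
have -> : z2%:C%C%:M - A - (z1%:C%C%:M - A) = (z2 - z1)%:C%C%:M.
by rewrite opprB addrA subrK rmorphB raddfB.
by rewrite mul_mx_scalar -scalemxAl.
rewrite -rqB E rqZ rq_def -mulmxA; congr (_ * cRe _).
by rewrite [RHS]vdotMl (res_herm hA b1).
have s1 := rq_source_near b1 d0 eU1 eZ1 eX1.
have s2 := rq_source_near b2 d0 eU2 eZ2 eX2.
rewrite -/y -/cerr in s1 s2.
set w1 := vsq (Th *m r) in s1 s2 *; set w2 := vsq (Th *m p) in s1 s2 *.
set F := cRe _ in near1 diff.
have -> : t ^+ 2 * ((f1 - f2) / (z2 - z1)) * w1 + (g1 - g2) / (z2 - z1) * w2 - 1 =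
 (F - 1) + ((t ^+ 2 * (f1 * w1) + g1 * w2 - vsq (Z *m (Th *m p)) - rq (res z1 A) y) -
 (t ^+ 2 * (f2 * w1) + g2 * w2 - vsq (Z *m (Th *m p)) - rq (res z2 A) y)) / (z2 - z1).
have FE : F = (rq (res z1 A) y - rq (res z2 A) y) / (z2 - z1).
by rewrite diff mulrC mulKf // gt_eqF.
by rewrite FE; field; rewrite gt_eqF.
apply: (le_trans (ler_normD _ _)); apply: lerD => //.
rewrite normrM [`|_^-1|]gtr0_norm ?invr_gt0 //; apply: ler_wpM2r; first by rewrite invr_ge0 ltW.
apply: (le_trans (ler_normB _ _)); rewrite -mulrA mulr2n mulrDl mul1r.
by apply: lerD; rewrite distrC.
Qed.
End EigenvectorErrors.

(** * Limits of singular values and vectors, given the limits of the forms *)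

Section SpikeLimits.
Context (R : realType) (k : nat) (q : nat -> nat).
Notation C := R[i].
Variables (X : forall n, 'M[C]_(q n, n)) (U : forall n, 'M[C]_(q n, k)) (Z : forall n, 'M[C]_(n, k))
 (th : 'I_k -> R) (alpha c : R) (phi : R -> R) (D : R -> Prop)
 (th0 : forall j, 0 < th j) (th_sorted : forall i j : 'I_k, (i <= j)%N -> th j <= th i)
 (c0 : 0 < c) (alpha0 : 0 < alpha)
 (Uiso : forall n, (U n) ^t* *m U n = 1%:M).
Notation A n := (X n *m (X n) ^t*).
Notation f x := (c / x).
Notation g x := (1 + phi x / x - c^-1).
Hypotheses (g0 : forall x, alpha < x -> 0 <= g x)
 (hbelow : forall x, D x -> alpha < x -> \forall n \near \oo, below (A n) (phi x))
 (hU : forall x, D x -> alpha < x ->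
 frob2 (forms_U (X n) (U n) (phi x) - (f x)%:C%C%:M) @[n \oo] --> (0 : R))
 (hZ : forall x, D x -> alpha < x ->
 frob2 (forms_Z (X n) (Z n) (phi x) - (g x)%:C%C%:M) @[n \oo] --> (0 : R))
 (hX : forall x, D x -> alpha < x ->
 frob2 (forms_X (X n) (U n) (Z n) (phi x)) @[n \oo] --> (0 : R)).
Notation Y n := (spiked (X n) (U n) (Z n) th).
Variables (V : forall n, 'M[C]_(q n)) (lam : forall n, 'I_(q n) -> R)
 (VV : forall n, (V n) ^t* *m V n = 1%:M)
 (SE : forall n, Y n *m (Y n) ^t* = V n *m diag_mx (\row_a (@lam n a)%:C%C) *m (V n) ^t*)
 (lam_sorted : forall n (a b : 'I_(q n)), (a <= b)%N -> @lam n b <= @lam n a).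
(** [D] stands for a dense set of levels, later the rationals: the almost sure limits hold
    simultaneously at countably many points. *)
Let forms_near x dl : D x -> alpha < x -> 0 < dl -> \forall n \near \oo,
 [/\ below (A n) (phi x), frob2 (forms_U (X n) (U n) (phi x) - (f x)%:C%C%:M) <= dl ^+ 2,
 frob2 (forms_Z (X n) (Z n) (phi x) - (g x)%:C%C%:M) <= dl ^+ 2 &
 frob2 (forms_X (X n) (U n) (Z n) (phi x)) <= dl ^+ 2].
move=> Dx ax d0; have d2 : 0 < dl ^+ 2 by exact: exprn_gt0.
near=> n; split; first by near: n; exact: hbelow.
- by apply: ltW; near: n; exact: (cvgr_lt _ (hU Dx ax)).
- by apply: ltW; near: n; exact: (cvgr_lt _ (hZ Dx ax)).
- by apply: ltW; near: n; exact: (cvgr_lt _ (hX Dx ax)).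
Unshelve. all: end_near.
Qed.
(** On vectors orthogonal to the first [i] spike directions, |Th p|^2 is at most th_i^2 |p|^2, and
    [spike_upper] is negative because g th_i^2 < 1/f. *)
Lemma spike_above (i : 'I_k) x : D x -> alpha < x -> g x * th i ^+ 2 < x / c ->
 \forall n \near \oo, forall a : 'I_(q n), a = i :> nat -> @lam n a < phi x.
move=> Dx ax hlt; have x0 : 0 < x by exact: lt_trans ax.
have f0 : 0 < f x by rewrite divr_gt0.
have fV : (f x)^-1 = x / c by rewrite invfM invrK mulrC.
pose K := th i ^+ 2 + (f x)^-1 * (1 + th i ^+ 2) + (f x)^-1 ^+ 2.
have t2 : 0 <= th i ^+ 2 by exact: sqr_ge0.
have fi0 : 0 < (f x)^-1 by rewrite invr_gt0.
have K0 : 0 < K.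
by rewrite /K ltr_wpDl ?exprn_gt0 // addr_ge0 // mulr_ge0 ?(ltW fi0) // addr_ge0.
(* Small enough for all error terms, gathered in [K], to stay below the strict gap. *)
pose dl := (x / c - g x * th i ^+ 2) / (2 * (K + `|g x| + 1)).
have den : 0 < 2 * (K + `|g x| + 1) by rewrite mulr_gt0 // addr_gt0 // ltr_pwDl.
have d0 : 0 < dl by rewrite divr_gt0 // subr_gt0.
have dK : dl * K < x / c - g x * th i ^+ 2.
rewrite -[ltRHS](divfK (lt0r_neq0 den)) -/dl ltr_pM2l //.
by have := normr_ge0 (g x); move: K0; lra.
apply: filterS (forms_near Dx ax d0) => n [b eU eZ eX] a ai.
have iq : (i < q n)%N by rewrite -ai.
have ik : (a <= k)%N by rewrite ai ltnW.
pose N : 'M[C]_(a, q n) := \matrix_(b, l) ((U n) ^t*) (widen_ord ik b) l.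
apply: (eig_lt (VV n) (SE n) (@lam_sorted n) (i := a) (N := N)) => u u0 Nu.
rewrite rq_gram; set p := (U n) ^t* *m u.
have pj (j : 'I_k) : (j < i)%N -> p j 0 = 0.
rewrite -ai => ja; have := congr1 (fun M : 'cV[C]_a => M (Ordinal ja) 0) Nu.
rewrite [RHS]mxE => <-; rewrite /p [LHS]mxE [RHS]mxE; apply: eq_bigr => l _; congr (_ * _).
by rewrite [RHS]mxE; apply: (congr1 (fun j' => ((U n) ^t*) j' l)); exact: val_inj.
have aB : vsq (spike_diag th *m p) <= th i ^+ 2 * vsq p.
rewrite vsq_spike_diag (vsq_def p) mulr_sumr; apply: ler_sum => j _.
have [ji|ij] := ltnP j i; first by rewrite pj // nsq0 !mulr0.
apply: ler_wpM2r; first exact: nsq_ge0.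
by rewrite lerXn2r ?nnegrE ?(ltW (th0 _)) // th_sorted.
have [p0|p0] := eqVneq p 0.
rewrite spiked_adj -/p p0 !mulmx0 add0r -rq_gram.
exact: (belowP (phi x) (herm_gram (X n))).1 b u u0.
have := spike_upper b f0 d0 eU eZ eX (th := th) (u := u) erefl erefl; rewrite -/p fV.
have vp : 0 < vsq p by exact: vsq_gt0.
have va := vsq_ge0 (spike_diag th *m p).
set v := vsq p in aB vp *; set w := vsq _ in aB va * => h.
rewrite -subr_lt0; apply: le_lt_trans h _.
have h1 : dl * (w + x / c * (v + w) + (x / c) ^+ 2 * v) <= dl * K * v.
rewrite -[leRHS]mulrA; apply: ler_wpM2l; first exact: ltW.
have xc := ltW fi0; rewrite fV in xc.
have := ler_wpM2l xc aB; rewrite /K fV; move: aB; move: (x / c) (th i ^+ 2) => y s; lra.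
have h2 : dl * K * v < (x / c - g x * th i ^+ 2) * v by rewrite ltr_pM2r.
have h3 : g x * w <= g x * (th i ^+ 2 * v) by apply: ler_wpM2l => //; exact: g0.
by move: h1 h2 h3; rewrite mulrBl; move: (g x) => y; lra.
Qed.
Lemma vsqB_le m (u v : 'cV[C]_m) dl : 0 < dl ->
 vsq (u - v) <= (1 + dl) * vsq u + (1 + dl^-1) * vsq v.
move=> d0; rewrite vsqD vdotNr Re_opp.
have -> : vsq (- v) = vsq v by rewrite -scaleN1r vsqZ nsqN /nsq /= expr1n expr0n addr0 mul1r.
have := vdot_amgmZ u v d0; have := ler_norm (- cRe (vdot u v)); rewrite normrN.
by move: (cRe _) => y; lra.
Qed.
(** The lifts of the first i + 1 coordinate vectors span a space on which |Th p|^2 is at least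
    th_i^2 |p|^2, so [spike_lower] is nonnegative there. *)
Lemma spike_below (i : 'I_k) x : D x -> alpha < x -> x / c < g x * th i ^+ 2 ->
 \forall n \near \oo, forall a : 'I_(q n), a = i :> nat -> phi x <= @lam n a.
move=> Dx ax hlt; have x0 : 0 < x by exact: lt_trans ax.
have f0 : 0 < f x by rewrite divr_gt0.
have t2 : 0 < th i ^+ 2 by rewrite exprn_gt0.
pose T := \sum_j th j ^+ 2.
have T0 : 0 <= T by apply: sumr_ge0 => j _; exact: sqr_ge0.
have gap : 0 < f x * g x * th i ^+ 2 - 1.
have e : f x * (x / c) = 1 by rewrite mulrA divfK ?gt_eqF // divff ?gt_eqF.
have := hlt; rewrite -(ltr_pM2l f0) e mulrA; lra.
have gg := g0 ax.
pose G := g x * th i ^+ 2 + f x * T + 1 + 2 * T.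
have G0 : 0 < G.
rewrite /G ltr_pwDl ?mulr_ge0 // ltr_wpDl // addr_ge0 // mulr_ge0 //; exact: ltW.
pose dl := Num.min (Num.min 1 (f x / 2)) ((f x * g x * th i ^+ 2 - 1) / G).
have d0 : 0 < dl by rewrite !lt_min ltr01 (divr_gt0 f0) // (divr_gt0 gap G0).
have d1 : dl <= 1 by rewrite !ge_min lexx.
have df2 : dl <= f x / 2 by rewrite !ge_min lexx orbT.
have dG : dl * G <= f x * g x * th i ^+ 2 - 1.
by rewrite -ler_pdivlMr // ge_min lexx orbT.
have df : dl < f x by lra.
apply: filterS (forms_near Dx ax d0) => n [b eU eZ eX] a ai.
have ik : (a.+1 <= k)%N by rewrite ai.
pose F : 'M[C]_(k, a.+1) := \matrix_(j, l) (j == l :> nat)%:R.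
have FE c' (j : 'I_k) (ja : (j < a.+1)%N) : (F *m c') j 0 = c' (Ordinal ja) (0 : 'I_1).
rewrite mxE (bigD1 (Ordinal ja)) //= mxE eqxx mul1r big1 ?addr0 // => l lj.
by rewrite mxE eq_sym (negbTE (lj : (l : nat) != j)) mul0r.
pose LL := spike_lift (X n) (U n) (Z n) th (phi x).
apply: (eig_ge (VV n) (SE n) (@lam_sorted n) (i := a) (L := LL *m F)) => c' c'0.
rewrite -mulmxA; set p := F *m c'.
have p0 : p != 0.
apply: contra c'0 => /eqP e; apply/eqP/colP => l.
have la : (l < k)%N by exact: leq_trans (ltn_ord l) ik.
have := FE c' (Ordinal la) (ltn_ord l); rewrite -/p e !mxE => e0.
by rewrite [RHS]e0; congr (c' _ _); exact: val_inj.
have pj (j : 'I_k) : (i < j)%N -> p j 0 = 0.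
rewrite -ai => aj; rewrite mxE big1 // => l _; rewrite mxE; case: eqP => [e|_]; last by rewrite mul0r.
by have := ltn_ord l; rewrite -e ltnS leqNgt aj.
have [ULp lo] := spike_lower b d0 eU eZ df (th := th) (p := p) erefl.
split.
by apply: contra p0 => /eqP e; rewrite -ULp e mulmx0.
rewrite rq_gram -subr_ge0; apply: le_trans lo.
have vp : 0 < vsq p by exact: vsq_gt0.
have aB : th i ^+ 2 * vsq p <= vsq (spike_diag th *m p).
rewrite vsq_spike_diag (vsq_def p) mulr_sumr; apply: ler_sum => j _.
have [ij|ji] := ltnP i j; first by rewrite pj // nsq0 !mulr0.
apply: ler_wpM2r; first exact: nsq_ge0.
by rewrite lerXn2r ?nnegrE ?(ltW (th0 _)) // th_sorted.
have aT : vsq (spike_diag th *m p) <= T * vsq p.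
rewrite vsq_spike_diag (vsq_def p) mulr_sumr; apply: ler_sum => j _.
apply: ler_wpM2r; first exact: nsq_ge0.
by rewrite /T (bigD1 j) //= lerDl sumr_ge0 // => l _; exact: sqr_ge0.
have h1 := vsqB_le p (forms_X (X n) (U n) (Z n) (phi x) *m (spike_diag th *m p)) d0.
have h2 := le_trans (vsq_mulmx (forms_X (X n) (U n) (Z n) (phi x)) (spike_diag th *m p))
 (ler_wpM2r (vsq_ge0 _) eX).
rewrite subr_ge0 ler_pdivrMl ?subr_gt0 //.
apply: le_trans h1 _.
set w := vsq (spike_diag th *m p) in aB aT h2 *; set v := vsq p in vp aB aT *.
have h3 : (1 + dl^-1) * vsq (forms_X (X n) (U n) (Z n) (phi x) *m (spike_diag th *m p)) <= (dl + dl ^+ 2) * w.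
have -> : (dl + dl ^+ 2) * w = (1 + dl^-1) * (dl ^+ 2 * w).
by rewrite expr2; field; rewrite gt_eqF.
by apply: ler_wpM2l h2; rewrite addr_ge0 // invr_ge0 ltW.
apply: (letr ((1 + dl) * v + (dl + dl ^+ 2) * w)); first by rewrite lerD2l.
have w0 : 0 <= w by exact: vsq_ge0.
(* everything reduces to dl * G <= f g th^2 - 1 *)
have e1 : (dl + dl ^+ 2) * w <= 2 * dl * (T * v).
apply: ler_pM => //; first by rewrite addr_ge0 ?sqr_ge0 // ltW.
by rewrite expr2 mulrDl mul1r lerD2l ler_piMl // ltW.
have e2 : (f x - dl) * (g x * (th i ^+ 2 * v)) <= (f x - dl) * (g x * w).
apply: ler_wpM2l; first by rewrite subr_ge0 ltW.
exact: ler_wpM2l.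
have e3 := ler_wpM2r (ltW vp) dG; rewrite /G in e3.
have e4 : (f x - dl) * (dl * w) <= f x * (dl * (T * v)).
apply: ler_pM; [by rewrite subr_ge0 ltW|by rewrite mulr_ge0 // ltW|by rewrite lerBlDr lerDl ltW|].
by apply: ler_wpM2l => //; exact: ltW.
have -> : (f x - dl) * ((g x - dl) * w) = (f x - dl) * (g x * w) - (f x - dl) * (dl * w) by ring.
move: e1 e2 e3 e4; move: (f x) (g x) (th i ^+ 2) => ff gg' s.
set a1 := (ff - dl) * (gg' * w); set a2 := (ff - dl) * (dl * w); set a3 := (dl + _) * w.
rewrite !(mulrDl, mulrBl, mulrDr, mul1r, mulNr, mulrN) => e1 e2 e3 e4.
lra.
Qed.
Variables (phi0 : forall x, alpha < x -> 0 < phi x)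
 (phi_mono : forall x y, alpha < x -> x < y -> phi x < phi y)
 (b : R)
 (phi_b : forall x, alpha < x -> b < phi x)
 (D_dense : forall x y, x < y -> exists z, [/\ D z, x < z & z < y])
 (hratio : (q n)%:R / n%:R @[n \oo] --> c^-1)
 (htr : forall x, D x -> alpha < x ->
 n%:R^-1 * rtr (phi x) (A n) 1 @[n \oo] --> x^-1).
(* the slope of [phi] vanishes at [alpha] *)
Hypothesis flat : forall e, 0 < e -> exists x y, [/\ D x, D y, alpha < x, x < y & y < alpha + 1] /\
 phi y - phi x <= e * (y - x).
Lemma below_norm x y n : x < y -> phi x < phi y -> below (A n) (phi x) ->
 forall a, (phi y - eig (A n) a)^-1 <= (phi y - phi x)^-1.
move=> xy pxy bb a; have := bb a => h.
by rewrite lef_pV2 ?posrE ?subr_gt0 // ?(lt_trans h) // lerD2l lerN2 ltW.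
Qed.
(** If at most k + i noise eigenvalues exceeded [t], the difference quotient of the normalised trace
    between phi(x1) and phi(x2) would stay bounded by about (q/n) (b - t)^-2. It tends to (1/x1 -
    1/x2) / (phi(x2) - phi(x1)), which the flatness of phi at the edge makes as large as desired. *)
Lemma bulk_below (i : 'I_k) t : t < b ->
 \forall n \near \oo, forall a : 'I_(q n), a = i :> nat -> t <= @lam n a.
move=> tb; have kap0 : 0 < b - t by rewrite subr_gt0.
(* Then e (b - t)^-2 / c is half of (alpha + 1)^-2, hence less than 1/(x1 x2). *)
pose e := c * (b - t) ^+ 2 / (2 * (alpha + 1) ^+ 2).
have a10 : 0 < alpha + 1 by rewrite addr_gt0.
have e0 : 0 < e by rewrite divr_gt0 // mulr_gt0 // exprn_gt0.
have [x1 [x2 [[D1 D2 ax1 x12 x2a] hf]]] := flat e0.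
have ax2 : alpha < x2 by exact: lt_trans x12.
have x10 : 0 < x1 by exact: lt_trans ax1.
have x20 : 0 < x2 by exact: lt_trans x12.
(* All noise eigenvalues are eventually below phi(y), which bounds the contribution of the few above
   [t]. *)
have [y [Dy ay yx1]] := D_dense ax1.
have p1 := phi_mono ay yx1; have p12 := phi_mono ax1 x12.
pose K := (phi x1 - phi y)^-1.
have dp : 0 < phi x2 - phi x1 by rewrite subr_gt0.
(* the trace difference exceeds what few eigenvalues above t allow *)
have lim1 : n%:R^-1 * rtr (phi x1) (A n) 1 - n%:R^-1 * rtr (phi x2) (A n) 1 -
 (phi x2 - phi x1) * ((q n)%:R / n%:R * (b - t) ^- 2 + (k + i)%:R * K ^+ 2 * n%:R^-1) @[n \oo] -->
 x1^-1 - x2^-1 - (phi x2 - phi x1) * (c^-1 * (b - t) ^- 2 + (k + i)%:R * K ^+ 2 * 0).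
apply: cvgB; first by apply: cvgB; exact: htr.
apply: cvgMr; apply: cvgD; first exact: cvgMl.
apply: cvgMr; apply/gtr0_cvgV0; last exact: cvgr_idn.
by near=> n; rewrite ltr0n; near: n; exact: nbhs_infty_gt.
have pos : 0 < x1^-1 - x2^-1 - (phi x2 - phi x1) * (c^-1 * (b - t) ^- 2 + (k + i)%:R * K ^+ 2 * 0).
rewrite mulr0 addr0 subr_gt0.
have dx : 0 < x2 - x1 by rewrite subr_gt0.
apply: (@le_lt_trans _ _ (e * (x2 - x1) * (c^-1 * (b - t) ^- 2))).
by apply: ler_wpM2r hf; rewrite mulr_ge0 ?invr_ge0 ?sqr_ge0 // ltW.
have -> : x1^-1 - x2^-1 = (x2 - x1) * (x1 * x2)^-1 by field; rewrite !gt_eqF.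
rewrite mulrAC mulrC ltr_pM2l // /e.
have -> : c * (b - t) ^+ 2 / (2 * (alpha + 1) ^+ 2) * (c^-1 * (b - t) ^- 2) = (2 * (alpha + 1) ^+ 2)^-1.
move: (b - t) (alpha + 1) kap0 a10 => u v u0 v0.
by field; rewrite !gt_eqF.
rewrite ltf_pV2 ?posrE ?mulr_gt0 ?exprn_gt0 //.
have : x1 * x2 <= (alpha + 1) ^+ 2.
by rewrite expr2; apply: ler_pM; rewrite ?ltW // (lt_trans x12).
by have := exprn_gt0 2 a10; lra.
near=> n.
have n0 : (0 < n)%N by near: n; exact: nbhs_infty_gt.
have b1 : below (A n) (phi y) by near: n; exact: hbelow.
have big : 0 < n%:R^-1 * rtr (phi x1) (A n) 1 - n%:R^-1 * rtr (phi x2) (A n) 1 -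
 (phi x2 - phi x1) * ((q n)%:R / n%:R * (b - t) ^- 2 + (k + i)%:R * K ^+ 2 * n%:R^-1).
by near: n; exact: (cvgr_gt _ lim1).
move=> a ai.
have hA : herm (A n) by exact: herm_gram.
apply: (eig_ge_bulk (VV n) (SE n) (@lam_sorted n) (i := a) (U := U n) hA).
by move=> u Uu; rewrite rq_gram spiked_adj Uu !mulmx0 add0r rq_gram.
rewrite ltnNge; apply/negP => few; move: big; apply/negP; rewrite -leNgt subr_le0.
have bb1 : below (A n) (phi x1) by apply: belowW b1; exact: ltW.
have bb2 : below (A n) (phi x2) by apply: belowW bb1; exact: ltW.
rewrite -mulrBr !rtrE // -sumrB.
have -> : \sum_l ((phi x1 - eig (A n) l)^-1 ^+ 1 - (phi x2 - eig (A n) l)^-1 ^+ 1) =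
 (phi x2 - phi x1) * \sum_l (phi x1 - eig (A n) l)^-1 * (phi x2 - eig (A n) l)^-1.
rewrite mulr_sumr; apply: eq_bigr => l _.
have h1 : phi x1 - eig (A n) l != 0 by rewrite gt_eqF // subr_gt0.
have h2 : phi x2 - eig (A n) l != 0 by rewrite gt_eqF // subr_gt0.
by move: (phi x1) (phi x2) (eig _ _) h1 h2 => u v z h1 h2; field; rewrite h1 h2.
rewrite mulrCA; apply: ler_wpM2l; first exact: ltW.
pose J := [pred l | (t <= eig (A n) l)%R].
have inv0 z l : below (A n) z -> 0 <= (z - eig (A n) l)^-1.
by move=> bz; rewrite invr_ge0 subr_ge0 ltW.
have hsum : \sum_l (phi x1 - eig (A n) l)^-1 * (phi x2 - eig (A n) l)^-1 <=
 (q n)%:R * (b - t) ^- 2 + (k + i)%:R * K ^+ 2.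
rewrite (bigID J) /= addrC; apply: lerD.
apply: (letr (\sum_(l < q n) (b - t) ^- 2)); last first.
by rewrite sumr_const card_ord mulr_natl.
rewrite [leRHS](bigID J) /= addrC -[leLHS]addr0; apply: lerD; last first.
by apply: sumr_ge0 => l _; rewrite invr_ge0 sqr_ge0.
apply: ler_sum => l; rewrite -ltNge => lt.
have h x : alpha < x -> (phi x - eig (A n) l)^-1 <= (b - t)^-1.
move=> ax; have := phi_b ax => pb; rewrite lef_pV2 ?posrE ?subr_gt0 //; lra.
by rewrite -exprVn expr2; apply: ler_pM; rewrite ?inv0 ?h.
apply: (letr (\sum_(l in J) K ^+ 2)); last first.
rewrite sumr_const -[X in X <= _]mulr_natl; apply: ler_wpM2r; rewrite ?sqr_ge0 //.
by rewrite ler_nat -ai; exact: few.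
apply: ler_sum => l _; rewrite expr2; apply: ler_pM; rewrite ?inv0 //.
exact: below_norm.
apply: le_trans (below_norm _ _ b1 l) _; [exact: lt_trans yx1 x12|exact: lt_trans p12|].
by rewrite /K lef_pV2 ?posrE ?subr_gt0 // ?(lt_trans p1) //; lra.
have nv : 0 <= n%:R^-1 :> R by rewrite invr_ge0.
apply: (le_trans (ler_wpM2l nv hsum)).
by rewrite mulrDr mulrA [n%:R^-1 * _]mulrC lerD2l mulrC.
Unshelve. all: end_near.
Qed.
Notation Th := (spike_diag th).
Variables (hI : frob2 ((Z n) ^t* *m Z n - 1%:M) @[n \oo] --> (0 : R))
 (s fb gb Fd Gd y0 : R)
 (s0 : 0 < s) (Dy0 : D y0) (ay0 : alpha < y0) (y0s : phi y0 < s ^+ 2)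
 (approx : forall e, 0 < e -> exists x1 x2,
 [/\ D x1, D x2, alpha < x1, alpha < x2 & phi x1 < phi x2] /\
 [/\ `|phi x1 - s ^+ 2| <= e, `|phi x2 - s ^+ 2| <= e & `|f x1 - fb| <= e] /\
 [/\ `|g x1 - gb| <= e, `|(f x1 - f x2) / (phi x2 - phi x1) - Fd| <= e &
 `|(g x1 - g x2) / (phi x2 - phi x1) - Gd| <= e])
 (uh : forall n, 'cV[C]_(q n)) (wh : forall n, 'cV[C]_n) (t : nat -> R)
 (ht : t n @[n \oo] --> s)
 (twh : forall n, t n != 0 -> (t n)%:C%C *: wh n = (Y n) ^t* *m uh n)
 (tuh : forall n, t n != 0 -> (t n)%:C%C *: uh n = Y n *m wh n)
 (uh1 : forall n, vsq (uh n) = 1).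
Let p n := (U n) ^t* *m uh n.
Let r n := (Z n) ^t* *m wh n.
Let T : R := \sum_j th j ^+ 2.
Let T0 : 0 <= T. by apply: sumr_ge0 => j _; exact: sqr_ge0. Qed.
Let hT v : vsq (Th *m v) <= T * vsq v.
rewrite vsq_spike_diag (vsq_def v) mulr_sumr; apply: ler_sum => j _.
apply: ler_wpM2r; first exact: nsq_ge0.
by rewrite /T (bigD1 j) //= lerDl sumr_ge0 // => l _; exact: sqr_ge0.
Qed.
(** Half the distance from s^2 to a level above the noise spectrum: at levels within [m] of s^2 the
    resolvent has norm at most 1/m. *)
Let m := (s ^+ 2 - phi y0) / 2.
Let m0 : 0 < m. by rewrite divr_gt0 // subr_gt0. Qed.
Let K := m^-1.
Let K0 : 0 <= K. by rewrite invr_ge0 ltW. Qed.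
Let good n : Prop := [/\ t n != 0, frob2 ((Z n) ^t* *m Z n - 1%:M) <= 1 & below (A n) (phi y0)].
Let near_good : \forall n \near \oo, good n.
near=> n; split; last by near: n; exact: hbelow.
by rewrite gt_eqF //; near: n; exact: (cvgr_gt _ ht).
by apply: ltW; near: n; exact: (cvgr_lt _ hI).
Unshelve. all: end_near.
Qed.
Let norm_bound x n : good n -> `|phi x - s ^+ 2| <= m ->
 below (A n) (phi x) /\ forall a, (phi x - eig (A n) a)^-1 <= K.
move=> [_ _ bl]; rewrite ler_norml => /andP[h _].
have hx : phi y0 + m <= phi x by move: h; rewrite /m; lra.
split => a; have := bl a => ba; first by apply: lt_le_trans hx; rewrite ltr_wpDr // ltW.
by rewrite lef_pV2 ?posrE // ?subr_gt0; move: (eig _ _) ba hx m0 => u; lra.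
Qed.
Let sq_cvg (u : nat -> R) (l : R) : u n @[n \oo] --> l -> u n ^+ 2 @[n \oo] --> l ^+ 2.
by move=> h; rewrite expr2; under eq_fun do rewrite expr2; exact: cvgM. Qed.
Let sqe (a e : R) : `|a| <= e -> a ^+ 2 <= e ^+ 2.
by move=> h; rewrite -real_normK ?num_real // lerXn2r ?nnegrE // (le_trans _ h). Qed.

(* pick [e] with [e * M < eps] *)
Let pick_e (M eps : R) : 0 <= M -> 0 < eps -> exists e, [/\ 0 < e, e <= 1, e <= m & e * M < eps].
move=> M0 eps0; have M1 : 0 < M + 1 by rewrite ltr_wpDl.
exists (Num.min (Num.min 1 m) (eps / (M + 1))).
have e0 : 0 < Num.min (Num.min 1 m) (eps / (M + 1)) by rewrite !lt_min ltr01 m0 divr_gt0.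
split => //; [by rewrite !ge_min lexx|by rewrite !ge_min lexx orbT|].
have : Num.min (Num.min 1 m) (eps / (M + 1)) <= eps / (M + 1) by rewrite ge_min lexx orbT.
rewrite ler_pdivlMr // mulrDr mulr1; lra.
Qed.
(** The level x1 is fixed close to the limit before n grows. The error bound tends to a value of
    order [e], which is arbitrary. *)
Lemma eigvec_p_cvg : vsq (p n - (s * fb)%:C%C *: (Th *m r n)) @[n \oo] --> (0 : R).
apply: cvg_of_dist => kk; set eps : R := _^-1.
have eps0 : 0 < eps by rewrite invr_gt0 ltr0n.
pose M := 4 * (s ^+ 2 * (T * 2) + s ^+ 2 * (T * 2) + T + K ^+ 2).
have M0 : 0 <= M by rewrite /M; nneg.
have [e [e0 e1 em eM]] := pick_e M0 eps0.
have [x1 [x2 [[D1 _ a1 _ _] [[p1 _ f1] _]]]] := approx e0.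
have ee : e ^+ 2 <= e by rewrite expr2 ler_piMl // ltW.
pose F (tt : R) := 4 * (tt ^+ 2 * (e ^+ 2 * (T * 2)) + (tt * f x1 - s * fb) ^+ 2 * (T * 2) +
 e ^+ 2 * T + (phi x1 - tt ^+ 2) ^+ 2 * K ^+ 2).
have Fl : F (t n) @[n \oo] --> F s.
apply: cvgMr; apply: cvgD; last first.
by apply: cvgMl; apply: sq_cvg; apply: cvgB; [exact: cvg_cst|exact: sq_cvg].
apply: cvgD; last exact: cvg_cst.
apply: cvgD; first by apply: cvgMl; exact: sq_cvg.
by apply: cvgMl; apply: sq_cvg; apply: cvgB; [exact: cvgMl|exact: cvg_cst].
have Fs : F s < eps.
apply: le_lt_trans eM; rewrite /F /M [leRHS]mulrCA; apply: ler_wpM2l => //.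
have h1 : (s * f x1 - s * fb) ^+ 2 <= s ^+ 2 * e.
rewrite -mulrBr exprMn; apply: ler_wpM2l; first exact: sqr_ge0.
exact: le_trans (sqe f1) ee.
have h2 : (phi x1 - s ^+ 2) ^+ 2 <= e by exact: le_trans (sqe p1) ee.
rewrite ![e * (_ + _)]mulrDr; apply: lerD; [apply: lerD; [apply: lerD|]|].
 - by rewrite mulrCA; apply: ler_wpM2r => //; rewrite mulr_ge0 ?sqr_ge0 // mulr_ge0.
 - by rewrite [leRHS]mulrA [e * _]mulrC; apply: ler_wpM2r => //; rewrite mulr_ge0.
 - by apply: ler_wpM2r.
 - by apply: ler_wpM2r => //; exact: sqr_ge0.
have h1 := forms_near D1 a1 e0; have h2 := cvgr_lt _ Fl _ Fs.
apply: filterS3 near_good h1 (h2 _) => n gn [_ eU _ eX] Ft.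
have [tn zz bl] := gn; have [bx kx] := norm_bound gn (le_trans p1 em).
rewrite subr0 ger0_norm ?vsq_ge0 // (le_trans _ (ltW Ft)) //.
exact: (eigvec_p_error tn (twh tn) (tuh tn) erefl erefl (uh1 n) (Uiso n) zz hT T0 bx kx eU eX).
Qed.
Lemma eigvec_r_cvg : vsq (s%:C%C *: r n - gb%:C%C *: (Th *m p n)) @[n \oo] --> (0 : R).
apply: cvg_of_dist => kk; set eps : R := _^-1.
have eps0 : 0 < eps by rewrite invr_gt0 ltr0n.
pose M := 4 * (2 * T + 2 * T + s ^+ 2 * (T * 2) + 2 * ((s ^+ 2 + 1) * K ^+ 2)).
have s1 : 0 <= s ^+ 2 + 1 by rewrite addr_ge0 // sqr_ge0.
have M0 : 0 <= M by rewrite /M; nneg.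
have [e [e0 e1 em eM]] := pick_e M0 eps0.
have [x1 [x2 [[D1 _ a1 _ _] [[p1 _ _] [g1 _ _]]]]] := approx e0.
have ee : e ^+ 2 <= e by rewrite expr2 ler_piMl // ltW.
have z0 : 0 <= phi x1 by rewrite ltW // phi0.
pose F (tt : R) := 4 * ((s - tt) ^+ 2 * 2 + (2 * (e ^+ 2 * T) + 2 * ((g x1 - gb) ^+ 2 * T)) +
 tt ^+ 2 * (e ^+ 2 * (T * 2)) + (phi x1 - tt ^+ 2) ^+ 2 * (2 * (phi x1 * K ^+ 2))).
have Fl : F (t n) @[n \oo] --> F s.
apply: cvgMr; apply: cvgD; last first.
by apply: cvgMl; apply: sq_cvg; apply: cvgB; [exact: cvg_cst|exact: sq_cvg].
apply: cvgD; last by apply: cvgMl; exact: sq_cvg.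
apply: cvgD; last exact: cvg_cst.
by apply: cvgMl; apply: sq_cvg; apply: cvgB => //; exact: cvg_cst.
have Fs : F s < eps.
apply: le_lt_trans eM; rewrite /F /M [leRHS]mulrCA; apply: ler_wpM2l => //.
have h1 : (g x1 - gb) ^+ 2 <= e by exact: le_trans (sqe g1) ee.
have h2 : (phi x1 - s ^+ 2) ^+ 2 <= e by exact: le_trans (sqe p1) ee.
have h3 : phi x1 <= s ^+ 2 + 1.
by move: p1; rewrite ler_norml => /andP[_]; move: e1; lra.
rewrite subrr expr0n mul0r add0r ![e * (_ + _)]mulrDr.
apply: lerD; [apply: lerD; [apply: lerD|]|].
 - by rewrite mulrCA; apply: ler_wpM2r => //; rewrite mulr_ge0.
 - by rewrite [leRHS]mulrCA; apply: ler_wpM2l => //; apply: ler_wpM2r.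
 - by rewrite mulrCA; apply: ler_wpM2r => //; rewrite mulr_ge0 ?sqr_ge0 // mulr_ge0.
 - have k2 := sqr_ge0 K.
apply: ler_pM => //; first exact: sqr_ge0.
by rewrite mulr_ge0 // mulr_ge0.
by apply: ler_wpM2l => //; apply: ler_wpM2r.
have h1 := forms_near D1 a1 e0; have h2 := cvgr_lt _ Fl _ Fs.
apply: filterS3 near_good h1 (h2 _) => n gn [_ _ eZ eX] Ft.
have [tn zz bl] := gn; have [bx kx] := norm_bound gn (le_trans p1 em).
rewrite subr0 ger0_norm ?vsq_ge0 // (le_trans _ (ltW Ft)) //.
exact: (eigvec_r_error tn (twh tn) (tuh tn) erefl erefl (uh1 n) (Uiso n) zz hT T0 z0 bx kx eZ eX).
Qed.
Lemma eigvec_norm_cvg : s ^+ 2 * Fd * vsq (Th *m r n) + Gd * vsq (Th *m p n)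
 @[n \oo] --> (1 : R).
apply: cvg_of_dist => kk; set eps : R := _^-1.
have eps0 : 0 < eps by rewrite invr_gt0 ltr0n.
pose cerr (tt : R) := tt ^+ 2 * (T * 2) + T + `|tt| * (T * 3).
have cerr0 tt : 0 <= cerr tt by rewrite !addr_ge0 // mulr_ge0 ?sqr_ge0 // mulr_ge0.
pose M := (K + K + K ^+ 2 + 2 * cerr s) + (s ^+ 2 * (T * 2) + T).
have M0 : 0 <= M by have := cerr0 s; rewrite /M; move: (cerr s) => u u0; nneg.
have [e [e0 e1 em eM]] := pick_e M0 eps0.
have [x1 [x2 [[D1 D2 a1 a2 p12] [[p1 p2 _] [_ hF hG]]]]] := approx e0.
have dz : 0 < phi x2 - phi x1 by rewrite subr_gt0.
(* The form errors get divided by the distance between the two levels, hence this scaling. *)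
pose dl := e * (phi x2 - phi x1).
have d0 : 0 < dl by rewrite mulr_gt0.
pose F12 := (f x1 - f x2) / (phi x2 - phi x1).
pose G12 := (g x1 - g x2) / (phi x2 - phi x1).
pose E1 (tt : R) := `|phi x1 - tt ^+ 2| * K.
pose E2 (tt : R) := `|phi x2 - tt ^+ 2| * K.
pose F (tt : R) := E1 tt + E2 tt + E1 tt * E2 tt + 2 * dl * cerr tt / (phi x2 - phi x1) +
 (`|tt ^+ 2 * F12 - s ^+ 2 * Fd| * (T * 2) + `|G12 - Gd| * T).
have El x : `|phi x - t n ^+ 2| * K @[n \oo] --> `|phi x - s ^+ 2| * K.
by apply: cvgMl; apply: cvg_norm; apply: cvgB; [exact: cvg_cst|exact: sq_cvg].
have cl : cerr (t n) @[n \oo] --> cerr s.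
apply: cvgD; last by apply: cvgMl; exact: cvg_norm.
by apply: cvgD; [apply: cvgMl; exact: sq_cvg|exact: cvg_cst].
have Fl : F (t n) @[n \oo] --> F s.
apply: cvgD; last first.
apply: cvgD; last exact: cvg_cst.
apply: cvgMl; apply: cvg_norm; apply: cvgB; last exact: cvg_cst.
by apply: cvgMl; exact: sq_cvg.
apply: cvgD; last by apply: cvgMl; exact: cvgMr.
apply: cvgD; first by apply: cvgD; exact: El.
by apply: cvgM; exact: El.
have Fs : F s < eps.
apply: le_lt_trans eM; rewrite /F /M [leRHS]mulrDr; apply: lerD.
rewrite /E1 /E2 [e * _]mulrDr [e * (_ + _)]mulrDr [e * (K + K)]mulrDr.
apply: lerD; [apply: lerD; [apply: lerD; exact: ler_wpM2r|]|].
apply: (letr (e * K * (1 * K))).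
by apply: ler_pM; rewrite ?mulr_ge0 //; apply: ler_wpM2r => //; exact: le_trans e1.
by rewrite mul1r -mulrA -expr2.
by rewrite /dl [leLHS](_ : _ = e * (2 * cerr s)) //; field; rewrite gt_eqF.
rewrite [leRHS]mulrDr; apply: lerD; last exact: ler_wpM2r.
rewrite -mulrBr normrM (ger0_norm (sqr_ge0 s)) -mulrA [leRHS]mulrCA.
by apply: ler_wpM2l; rewrite ?sqr_ge0 //; apply: ler_wpM2r => //; rewrite mulr_ge0.
have h1 := forms_near D1 a1 d0; have h2 := forms_near D2 a2 d0; have h3 := cvgr_lt _ Fl _ Fs.
have h12 : \forall n \near \oo, good n /\ F (t n) < eps by apply: filterS2 near_good (h3 _) => n.
apply: filterS3 h12 h1 h2 => n [gn Ft] [_ eU1 eZ1 eX1] [_ eU2 eZ2 eX2].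
have [tn zz bl] := gn; have [b1 k1] := norm_bound gn (le_trans p1 em).
have [b2 k2] := norm_bound gn (le_trans p2 em).
have := eigvec_norm_error tn (twh tn) (tuh tn) erefl erefl (uh1 n) (Uiso n) zz hT T0 p12 K0 d0
 b1 b2 k1 k2 eU1 eZ1 eX1 eU2 eZ2 eX2.
rewrite -/F12 -/G12 -/(p n) -/(r n) -/(E1 (t n)) -/(E2 (t n)) -/(cerr (t n)) => main.
have wr : vsq (Th *m r n) <= T * 2.
apply: (le_trans (hT _)); apply: ler_wpM2l => //.
exact: (vsq_r_le2 tn (twh tn) (tuh tn) erefl (uh1 n) zz).
have wp : vsq (Th *m p n) <= T.
by apply: (le_trans (hT _)); rewrite ler_piMr // (vsq_p_le1 erefl (uh1 n) (Uiso n)).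
rewrite (le_trans _ (ltW Ft)) //.
set w1 := vsq _ in main wr *; set w2 := vsq (Th *m p n) in main wp *.
have w10 : 0 <= w1 by exact: vsq_ge0.
have w20 : 0 <= w2 by exact: vsq_ge0.
have -> : s ^+ 2 * Fd * w1 + Gd * w2 - 1 = (t n ^+ 2 * F12 * w1 + G12 * w2 - 1) -
 ((t n ^+ 2 * F12 - s ^+ 2 * Fd) * w1 + (G12 - Gd) * w2) by ring.
apply: (le_trans (ler_normB _ _)); apply: lerD => //.
apply: (le_trans (ler_normD _ _)); rewrite !normrM (ger0_norm w10) (ger0_norm w20).
by apply: lerD; apply: ler_wpM2l.
Qed.
End SpikeLimits.
Lemma vnorm_sq (R : realType) m (v : 'cV[R[i]]_m) : vnorm v ^+ 2 = vsq v.
by rewrite /vnorm vdotvv /= sqr_sqrtr ?vsq_ge0. Qed.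
Local Notation "B ^!" := (orthomx (@Num.conj _) (mx_of_hermitian (hermitian1mx _)) B)
 : matrix_set_scope.

(** * Projections onto spans of nearly orthonormal vectors *)

Section SquaredProjection.
Context (R : realType) (m k : nat).
Notation C := R[i].
Implicit Types (W : 'M[C]_(m, k)) (v : 'cV[C]_m) (J : pred 'I_k).
Definition mask J : 'M[C]_k := diag_mx (\row_j ((J j)%:R : R)%:C%C).
Lemma maskE J (a : 'cV[C]_k) j : (mask J *m a) j 0 = ((J j)%:R : R)%:C%C * a j 0.
by rewrite mul_diag_mx !mxE. Qed.
Lemma vsq_mask J (a : 'cV[C]_k) : vsq (mask J *m a) = \sum_(j | J j) nsq (a j 0).
rewrite vsq_def [RHS]big_mkcond; apply: eq_bigr => j _.
by rewrite maskE nsqM nsqR; case: (J j); rewrite /= ?expr1n ?mul1r ?expr0n ?mul0r.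
Qed.
Lemma mask_adj J : (mask J) ^t* = mask J.
rewrite /mask; apply/matrixP => a b; rewrite !mxE eq_sym.
by case: eqP => [->|_]; rewrite ?mulr1n ?mulr0n ?conjR ?rmorph0.
Qed.
Lemma mask_idem J : mask J *m mask J = mask J.
apply/matrixP => a b; rewrite mul_diag_mx !mxE; case: eqP => [->|_]; last by rewrite !mulr0n mulr0.
by rewrite !mulr1n; case: (J b); rewrite ?mulr1 ?mulr0.
Qed.
(** The normal equations: the projection is W b with [b] supported in [J], and the residual is
    orthogonal to the selected columns. *)
Lemma sqproj_decomp v W J : exists b : 'cV[C]_k,
 [/\ mask J *m b = b, sqproj v W J = vsq (W *m b) &
 mask J *m (W ^t* *m (W *m b)) = mask J *m (W ^t* *m v)].
rewrite /sqproj vnorm_sq; set S := (\sum_(j | J j) _)%MS; set w := (v^T *m _)^T.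
have hS j : J j -> ((col j W)^T <= S)%MS.
by move=> Jj; rewrite -(genmxE (col j W)^T); apply: (sumsmx_sup j).
have hw : (w^T <= (W *m mask J)^T)%MS.
rewrite /w trmxK; apply: submx_trans (proj_ortho_sub _ _) _.
apply/sumsmx_subP => j Jj; rewrite genmxE.
have -> : (col j W)^T = row j (W *m mask J)^T.
apply/rowP => a; rewrite !mxE (bigD1 j) //= big1 => [|l lj]; last first.
by rewrite !mxE (negbTE lj) mulr0n mulr0.
by rewrite !mxE eqxx Jj mulr1n mulr1 addr0.
exact: row_sub.
have [D hD] := submxP hw.
have {}hD : w = W *m (mask J *m D^T).
by apply: trmx_inj; rewrite hD [in RHS]mulmxA [in RHS]trmx_mul trmxK.
exists (mask J *m D^T); rewrite -hD; split => //; first by rewrite mulmxA mask_idem.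
apply/eqP; rewrite eq_sym -subr_eq0 -mulmxBr -mulmxBr; apply/eqP/colP => j; rewrite maskE !mxE.
case Jj : (J j); last by rewrite mul0r.
have : ((v - w)^T <= (col j W)^T^!)%MS.
have -> : (v - w)^T = v^T - v^T *m proj_ortho S by rewrite linearB /= /w trmxK.
by apply: submx_trans (proj_ortho_compl_sub _ _) _; rewrite submx_ortho hS.
move=> /orthomx1P /matrixP /(_ 0 0); rewrite !mxE => h; rewrite mul1r -[RHS]h.
by apply: eq_bigr => a _; rewrite !mxE mulrC.
Qed.
(** A Gram matrix close to the identity makes the projection comparable to the sum of squared inner
    products, by duality with the normal equations. *)
Lemma sqproj_bounds v W J dl : 0 < dl -> dl < 1 -> frob2 (W ^t* *m W - 1%:M) <= dl ^+ 2 ->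
 (1 - dl) * sqproj v W J <= \sum_(j | J j) nsq ((W ^t* *m v) j 0) <= (1 + dl) * sqproj v W J.
move=> d0 d1 hW; have [b [Mb -> hb]] := sqproj_decomp v W J.
have near a : (1 - dl) * vsq a <= vsq (W *m a) <= (1 + dl) * vsq a.
have := rq_small a d0 hW; rewrite rqB -vsq_gram -[1%:M]/((1%:C%C)%:M) rq_scalar mul1r.
by rewrite ler_norml; move: (vsq _) (vsq _) => x y /andP[h1 h2]; apply/andP; split; lra.
rewrite -vsq_mask; set S := mask J *m (W ^t* *m v) in hb *; apply/andP; split.
have t0 : 0 < 1 - dl by rewrite subr_gt0.
have := vdot_amgmZ b S t0.
have -> : vdot b S = (vsq (W *m b))%:C%C.
by rewrite -hb vdotMr mask_adj Mb -vdotMl vdotvv.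
have /andP[hn _] := near b.
rewrite /= ger0_norm ?vsq_ge0 // => h.
have : vsq (W *m b) <= (1 - dl)^-1 * vsq S by move: h hn; move: (_^-1 * _) (_ * vsq b) => x y; lra.
by rewrite ler_pdivlMl.
have t0 : 0 < (1 + dl)^-1 by rewrite invr_gt0 addr_gt0.
have := vdot_amgmZ (W *m S) (W *m b) t0; rewrite invrK.
have -> : vdot (W *m S) (W *m b) = (vsq S)%:C%C.
have MS : mask J *m S = S by rewrite /S mulmxA mask_idem.
by rewrite vdotMl -{1}MS -{1}(mask_adj J) -vdotMr hb vdotvv.
rewrite /= ger0_norm ?vsq_ge0 // => h.
have /andP[_] := near S; rewrite -ler_pdivrMl ?addr_gt0 // => hn.
by move: h hn; move: (_^-1 * _) (_ * vsq (W *m b)) => x y; lra.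
Qed.
(** Spans ignore scaling, which allows passing from the coefficient vectors to their nearly
    orthonormal rescalings. *)
Lemma sqprojZ a v W J : a != 0 -> sqproj v (a *: W) J = sqproj v W J.
move=> a0; rewrite /sqproj; congr (vnorm (_ *m proj_ortho _)^T ^+ 2).
apply: eq_bigr => j _; apply: eq_genmx.
have -> : (col j (a *: W))^T = a *: (col j W)^T by apply/rowP => l; rewrite !mxE.
exact: eqmx_scale.
Qed.
End SquaredProjection.
Lemma sqproj_cvg (R : realType) (k : nat) (q : nat -> nat) (W : forall n, 'M[R[i]]_(q n, k))
 (v : forall n, 'cV[R[i]]_(q n)) (J : pred 'I_k) (l : R) :
 frob2 ((W n) ^t* *m W n - 1%:M) @[n \oo] --> (0 : R) ->
 \sum_(j | J j) nsq (((W n) ^t* *m v n) j 0) @[n \oo] --> l ->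
 sqproj (v n) (W n) J @[n \oo] --> l.
move=> hW hl.
(* The second term keeps the tolerance positive when the columns are exactly orthonormal. *)
pose dl n := Num.sqrt (frob2 ((W n) ^t* *m W n - 1%:M)) + n.+1%:R^-1.
have dl0 n : 0 < dl n by rewrite ltr_wpDl ?sqrtr_ge0 // invr_gt0 ltr0n.
have dlc : dl n @[n \oo] --> (0 : R).
rewrite -[X in _ --> X]addr0; apply: cvgD; last exact: cvg_harmonic.
rewrite -[X in _ --> X]sqrtr0; apply: (continuous_cvg _ _ hW); exact: sqrt_continuous.
have lo : (\sum_(j | J j) nsq (((W n) ^t* *m v n) j 0)) / (1 + dl n) @[n \oo] --> l.
rewrite -[X in _ --> X]divr1; apply: cvgM => //; apply: cvgV; first exact: oner_neq0.
by rewrite -[X in _ --> X]addr0; apply: cvgD => //; exact: cvg_cst.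
have hi : (\sum_(j | J j) nsq (((W n) ^t* *m v n) j 0)) / (1 - dl n) @[n \oo] --> l.
rewrite -[X in _ --> X]divr1; apply: cvgM => //; apply: cvgV; first exact: oner_neq0.
by rewrite -[X in _ --> X]subr0; apply: cvgB => //; exact: cvg_cst.
apply: squeeze_cvgr lo hi; have d1 := cvgr_lt _ dlc _ (@ltr01 R).
apply: filterS (d1 _) => n dn.
have hb : frob2 ((W n) ^t* *m W n - 1%:M) <= dl n ^+ 2.
rewrite -{1}[frob2 _]sqr_sqrtr ?frob2_ge0 // lerXn2r ?nnegrE ?sqrtr_ge0 // ?ltW //.
by rewrite ltrDl invr_gt0 ltr0n.
have /andP[h1 h2] := sqproj_bounds (v n) J (dl0 n) dn hb.
have dp : 0 < 1 + dl n by rewrite addr_gt0.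
have dm : 0 < 1 - dl n by rewrite subr_gt0.
by rewrite ler_pdivrMr // ler_pdivlMr // ![sqproj _ _ _ * _]mulrC h1 h2.
Qed.

(** * Complex limits through squared moduli *)

Section NsqLimits.
Context (R : realType).
Notation C := R[i].
Implicit Types (x y : nat -> C).
Lemma nsqD_le (a b : C) : nsq (a + b) <= 2 * (nsq a + nsq b).
case: a b => a1 a2 [b1 b2]; rewrite /nsq /=.
have := sqr_ge0 (a1 - b1); have := sqr_ge0 (a2 - b2); nra.
Qed.
Lemma realCM (a b : R) : a%:C%C * b%:C%C = (a * b)%:C%C.
by apply: complex_ext; rewrite /= ?mul0r ?mulr0 ?subr0 ?addr0. Qed.
Lemma sum_cvg0 (I : finType) (J : pred I) (u : I -> nat -> R) :
 (forall j, J j -> u j n @[n \oo] --> (0 : R)) ->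
 \sum_(j | J j) u j n @[n \oo] --> (0 : R).
move=> h; rewrite [X in _ --> X](_ : _ = \sum_(j | J j) 0); last by rewrite big1.
by apply: cvg_big => //; exact: add_continuous.
Qed.
Lemma nsq_cvg0D x y : nsq (x n) @[n \oo] --> (0 : R) -> nsq (y n) @[n \oo] --> (0 : R) ->
 nsq (x n + y n) @[n \oo] --> (0 : R).
move=> hx hy; have h : 2 * (nsq (x n) + nsq (y n)) @[n \oo] --> (0 : R).
by rewrite -(mulr0 2) -[X in _ * X]addr0; apply: cvgMr; exact: cvgD.
by apply: squeeze_cvgr (cvg_cst 0) h; near=> n; rewrite nsq_ge0 nsqD_le.
Unshelve. all: end_near.
Qed.
Lemma nsq_cvg0M x y (K : R) : (\forall n \near \oo, nsq (y n) <= K) ->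
 nsq (x n) @[n \oo] --> (0 : R) -> nsq (y n * x n) @[n \oo] --> (0 : R).
move=> hy hx; have h : K * nsq (x n) @[n \oo] --> (0 : R) by rewrite -(mulr0 K); exact: cvgMr.
apply: squeeze_cvgr (cvg_cst 0) h; apply: filterS hy => n yK.
by rewrite nsq_ge0 nsqM ler_wpM2r ?nsq_ge0.
Qed.
Lemma nsq_cvg0Z (a : C) x : nsq (x n) @[n \oo] --> (0 : R) ->
 nsq (a * x n) @[n \oo] --> (0 : R).
by apply: (@nsq_cvg0M x (fun=> a) (nsq a)); near=> n. Unshelve. all: end_near. Qed.
Lemma nsq_cvg0_Re x : nsq (x n) @[n \oo] --> (0 : R) ->
 cRe (x n) @[n \oo] --> (0 : R) /\ cIm (x n) @[n \oo] --> (0 : R).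
move=> hx; have hs : Num.sqrt (nsq (x n)) @[n \oo] --> (0 : R).
by rewrite -sqrtr0; apply: (continuous_cvg _ _ hx); exact: sqrt_continuous.
have hN : - Num.sqrt (nsq (x n)) @[n \oo] --> (0 : R) by rewrite -oppr0; exact: cvgN.
split; apply: squeeze_cvgr hN hs; near=> n; rewrite -ler_norml -sqrtr_sqr ler_wsqrtr // /nsq.
by rewrite lerDl sqr_ge0.
by rewrite lerDr sqr_ge0.
Unshelve. all: end_near.
Qed.
Lemma nsq_sub_cvg0 x y (K : R) : (\forall n \near \oo, nsq (y n) <= K) ->
 nsq (x n - y n) @[n \oo] --> (0 : R) -> nsq (x n) - nsq (y n) @[n \oo] --> (0 : R).
move=> hy hx.
have hy' : \forall n \near \oo, nsq (Num.conj (y n)) <= K by apply: filterS hy => n; rewrite nsqJ.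
have [h _] := nsq_cvg0_Re (nsq_cvg0M hy' hx).
have -> : (fun n => nsq (x n) - nsq (y n)) =
 (fun n => nsq (x n - y n) + 2 * cRe (Num.conj (y n) * (x n - y n))).
by apply/funext => n; case: (x n) (y n) => a1 a2 [b1 b2]; rewrite /nsq /=; ring.
rewrite -[X in _ --> X]addr0; apply: cvgD => //.
by rewrite -(mulr0 2); exact: cvgMr.
Qed.
End NsqLimits.

(** * Limits of the coordinates of the singular vectors along the spikes *)

Section Overlaps.
Context (R : realType) (k : nat).
Notation C := R[i].
Variables (th : 'I_k -> R) (i : 'I_k) (p r : nat -> 'cV[C]_k) (s fb gb Fd Gd lp : R).
Notation Th := (spike_diag th).
Hypotheses (th0 : forall j, 0 < th j) (s0 : 0 < s) (fg1 : fb * gb * th i ^+ 2 = 1)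
 (p1 : forall n, vsq (p n) <= 1)
 (hp : vsq (p n - (s * fb)%:C%C *: (Th *m r n)) @[n \oo] --> (0 : R))
 (hr : vsq (s%:C%C *: r n - gb%:C%C *: (Th *m p n)) @[n \oo] --> (0 : R))
 (hN : s ^+ 2 * Fd * vsq (Th *m r n) + Gd * vsq (Th *m p n) @[n \oo] --> (1 : R))
 (lpE : lp * (Fd * gb ^+ 2 * th i ^+ 4 + Gd * th i ^+ 2) = 1).
Let pb n j : nsq (p n j 0) <= 1.
apply: le_trans (p1 n); rewrite vsq_def (bigD1 j) //= lerDl.
by apply: sumr_ge0 => l _; exact: nsq_ge0.
Qed.
Let coord (v : nat -> 'cV[C]_k) j : vsq (v n) @[n \oo] --> (0 : R) ->
 nsq (v n j 0) @[n \oo] --> (0 : R).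
apply: squeeze_cvgr (cvg_cst 0); near=> n; rewrite nsq_ge0 vsq_def (bigD1 j) //= lerDl.
by apply: sumr_ge0 => l _; exact: nsq_ge0.
Unshelve. all: end_near.
Qed.
Let hpj j : nsq (p n j 0 - (s * fb * th j)%:C%C * r n j 0) @[n \oo] --> (0 : R).
have := coord j hp; apply: cvg_trans; apply: near_eq_cvg; near=> n.
rewrite !mxE [in LHS](_ : \sum__ _ = (Th *m r n) j 0); last by rewrite mxE.
rewrite spike_diagE mulrA; congr (nsq (_ - _ * _)); exact: realCM.
Unshelve. all: end_near.
Qed.
Let hrj j : nsq (s%:C%C * r n j 0 - (gb * th j)%:C%C * p n j 0) @[n \oo] --> (0 : R).
have := coord j hr; apply: cvg_trans; apply: near_eq_cvg; near=> n.
rewrite !mxE [in LHS](_ : \sum__ _ = (Th *m p n) j 0); last by rewrite mxE.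
rewrite spike_diagE mulrA; congr (nsq (_ - _ * _)); exact: realCM.
Unshelve. all: end_near.
Qed.
(** Eliminating r_j from the two limiting equations leaves (1 - fb gb th_j^2) p_j -> 0, and the
    factor vanishes only for th_j = th_i. *)
Let pother j : th j != th i -> nsq (p n j 0) @[n \oo] --> (0 : R).
move=> ji; have D0 : 1 - fb * gb * th j ^+ 2 != 0.
apply/eqP => h; case/eqP: ji; apply: (pexpIrn (n := 2)) => //; try by rewrite nnegrE ltW.
have fg0 : fb * gb != 0 by apply/eqP => h0; move: fg1; rewrite h0 mul0r => /eqP; rewrite eq_sym oner_eq0.
by apply: (mulfI fg0); rewrite fg1; lra.
have := nsq_cvg0Z ((1 - fb * gb * th j ^+ 2)^-1)%:C%C
 (nsq_cvg0D (hpj j) (nsq_cvg0Z (fb * th j)%:C%C (hrj j))).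
apply: cvg_trans; apply: near_eq_cvg; near=> n; congr nsq.
case: (p n j 0) (r n j 0) => a b [a' b']; apply: complex_ext => /=; field.
all: by [].
Unshelve. all: end_near.
Qed.
Lemma p_other_cvg : \sum_(j | th j != th i) nsq (p n j 0) @[n \oo] --> (0 : R).
by apply: sum_cvg0 => j; exact: pother.
Qed.
Let rp j : s ^+ 2 * nsq (r n j 0) - (gb * th j) ^+ 2 * nsq (p n j 0) @[n \oo] --> (0 : R).
have b : \forall n \near \oo, nsq ((gb * th j)%:C%C * p n j 0) <= (gb * th j) ^+ 2.
by near=> n; rewrite nsqM nsqR ler_piMr ?sqr_ge0.
have := nsq_sub_cvg0 b (hrj j).
by under eq_fun do rewrite !nsqM !nsqR.
Unshelve. all: end_near.
Qed.
Let rcvg j (l : R) : nsq (p n j 0) @[n \oo] --> l ->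
 nsq (r n j 0) @[n \oo] --> (gb * th j) ^+ 2 / s ^+ 2 * l.
move=> h; have : (s ^+ 2)^-1 * ((s ^+ 2 * nsq (r n j 0) - (gb * th j) ^+ 2 * nsq (p n j 0)) +
 (gb * th j) ^+ 2 * nsq (p n j 0)) @[n \oo] --> (s ^+ 2)^-1 * (0 + (gb * th j) ^+ 2 * l).
by apply: cvgMr; apply: cvgD; [exact: rp|exact: cvgMr].
rewrite add0r mulrCA mulrA; apply: cvg_trans; apply: near_eq_cvg; near=> n.
by rewrite /= subrK mulKf // expf_neq0 // gt_eqF.
Unshelve. all: end_near.
Qed.
Lemma r_other_cvg : \sum_(j | th j != th i) nsq (r n j 0) @[n \oo] --> (0 : R).
apply: sum_cvg0 => j ji; rewrite -[X in _ --> X](mulr0 ((gb * th j) ^+ 2 / s ^+ 2)).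
by apply: rcvg; exact: pother.
Qed.
(** In the normalisation, [r] is replaced by multiples of [p] and the coordinates with other
    amplitudes drop out. What remains is a fixed multiple of the wanted sum, with inverse [lp]. *)
Lemma p_same_cvg : \sum_(j | th j == th i) nsq (p n j 0) @[n \oo] --> lp.
pose N := Fd * gb ^+ 2 * th i ^+ 4 + Gd * th i ^+ 2.
pose E n := \sum_j (Fd * th j ^+ 2 * (s ^+ 2 * nsq (r n j 0) - (gb * th j) ^+ 2 * nsq (p n j 0))).
have hE : E n @[n \oo] --> (0 : R).
apply: sum_cvg0 => j _; rewrite -[X in _ --> X](mulr0 (Fd * th j ^+ 2)).
by apply: cvgMr; exact: rp.
pose O n := \sum_(j | th j != th i)
 ((Fd * gb ^+ 2 * th j ^+ 4 + Gd * th j ^+ 2) * nsq (p n j 0)).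
have hO : O n @[n \oo] --> (0 : R).
apply: sum_cvg0 => j ji.
rewrite -[X in _ --> X](mulr0 (Fd * gb ^+ 2 * th j ^+ 4 + Gd * th j ^+ 2)).
by apply: cvgMr; exact: pother.
have : lp * (s ^+ 2 * Fd * vsq (Th *m r n) + Gd * vsq (Th *m p n) - E n - O n) @[n \oo] -->
 lp * (1 - 0 - 0) by apply: cvgMr; apply: cvgB hO; exact: cvgB.
rewrite !subr0 mulr1; apply: cvg_trans; apply: near_eq_cvg; near=> n.
rewrite /= /E /O !vsq_spike_diag !mulr_sumr -big_split -sumrB /=.
rewrite (bigID (fun j => th j == th i)) /= [X in _ + X - _](eq_bigr
 (fun j => (Fd * gb ^+ 2 * th j ^+ 4 + Gd * th j ^+ 2) * nsq (p n j 0))); last by move=> j _; ring.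
rewrite addrK mulr_sumr; apply: eq_bigr => j /eqP ->.
by rewrite -[RHS]mul1r -lpE; ring.
Unshelve. all: end_near.
Qed.
Lemma r_same_cvg :
 \sum_(j | th j == th i) nsq (r n j 0) @[n \oo] --> (gb * th i) ^+ 2 / s ^+ 2 * lp.
have h : \sum_(j | th j == th i)
 (s ^+ 2 * nsq (r n j 0) - (gb * th j) ^+ 2 * nsq (p n j 0)) @[n \oo] --> (0 : R).
by apply: sum_cvg0 => j _; exact: rp.
have : (s ^+ 2)^-1 * (\sum_(j | th j == th i)
 (s ^+ 2 * nsq (r n j 0) - (gb * th j) ^+ 2 * nsq (p n j 0)) +
 (gb * th i) ^+ 2 * \sum_(j | th j == th i) nsq (p n j 0)) @[n \oo] -->
 (s ^+ 2)^-1 * (0 + (gb * th i) ^+ 2 * lp).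
by apply: cvgMr; apply: cvgD => //; apply: cvgMr; exact: p_same_cvg.
rewrite add0r mulrCA mulrA; apply: cvg_trans; apply: near_eq_cvg; near=> n.
rewrite /= !mulr_sumr -big_split mulr_sumr; apply: eq_bigr => j /eqP -> /=.
by rewrite subrK mulKf // expf_neq0 // gt_eqF.
Unshelve. all: end_near.
Qed.
(** Since r_j is close to (gb th_i / s) p_j, each product is nearly a multiple of |p_j|^2. The
    factors [kap] correct the norms of the coefficient vectors, which are only asymptotically sqrt
    n. *)
Lemma overlap_cvg (kap : nat -> 'I_k -> R) : (forall j, kap n j @[n \oo] --> (1 : R)) ->
 nsq (\sum_(j | th j == th i) Num.conj (p n j 0) * ((kap n j)%:C%C * r n j 0) -
 (gb * th i / s * lp)%:C%C) @[n \oo] --> (0 : R).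
move=> hk.
have kb j : \forall n \near \oo, nsq (kap n j)%:C%C <= 2 ^+ 2.
have h1 := cvgr_lt _ (hk j) 2 (ltr1n _ 2); have h2 := cvgr_gt _ (hk j) 0 ltr01.
apply: filterS2 (h1 _) (h2 _) => n a b.
by rewrite nsqR lerXn2r ?nnegrE // ltW.
have step j : th j == th i -> nsq (Num.conj (p n j 0) * ((kap n j)%:C%C * r n j 0) -
 (gb * th i / s * nsq (p n j 0))%:C%C) @[n \oo] --> (0 : R).
move=> /eqP ji.
have b1 : \forall n \near \oo, nsq (Num.conj (p n j 0)) <= 1 by near=> n; rewrite nsqJ.
have b2 : \forall n \near \oo, nsq (p n j 0) <= 1 by near=> n.
have k1 : nsq (kap n j - 1)%:C%C @[n \oo] --> (0 : R).
under eq_fun do rewrite nsqR expr2.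
by rewrite -(mulr0 0) -(subrr 1); apply: cvgM; apply: cvgB => //; exact: cvg_cst.
have := nsq_cvg0Z (s^-1)%:C%C (nsq_cvg0M b1 (nsq_cvg0D (nsq_cvg0M (kb j) (hrj j))
 (nsq_cvg0Z (gb * th j)%:C%C (nsq_cvg0M b2 k1)))).
apply: cvg_trans; apply: near_eq_cvg; near=> n; congr nsq; rewrite -ji.
case: (p n j 0) (r n j 0) => a b [a' b'].
by apply: complex_ext; rewrite /nsq /=; field; rewrite gt_eqF.
pose x n := \sum_(j | th j == th i) (Num.conj (p n j 0) * ((kap n j)%:C%C * r n j 0) -
 (gb * th i / s * nsq (p n j 0))%:C%C).
have hx : nsq (x n) @[n \oo] --> (0 : R).
have hs (J : seq 'I_k) : nsq (\sum_(j <- J | th j == th i)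
 (Num.conj (p n j 0) * ((kap n j)%:C%C * r n j 0) -
 (gb * th i / s * nsq (p n j 0))%:C%C)) @[n \oo] --> (0 : R).
 elim: J => [|j J IH]; first by under eq_fun do rewrite big_nil nsq0; exact: cvg_cst.
rewrite (_ : (fun n => _) = (fun n => nsq ((if th j == th i then
 Num.conj (p n j 0) * ((kap n j)%:C%C * r n j 0) -
 (gb * th i / s * nsq (p n j 0))%:C%C else 0) + \sum_(j <- J | th j == th i)
 (Num.conj (p n j 0) * ((kap n j)%:C%C * r n j 0) -
 (gb * th i / s * nsq (p n j 0))%:C%C)))); last first.
by apply/funext => n; rewrite big_cons; case: ifP => //; rewrite add0r.
case ji : (th j == th i); last first.
by rewrite (_ : (fun n => _) = (fun n => nsq (\sum_(j <- J | th j == th i)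
 (Num.conj (p n j 0) * ((kap n j)%:C%C * r n j 0) -
 (gb * th i / s * nsq (p n j 0))%:C%C)))) //; apply/funext => n; rewrite add0r.
by apply: nsq_cvg0D => //; exact: step.
exact: hs.
have hy : nsq (gb * th i / s * (\sum_(j | th j == th i) nsq (p n j 0) - lp))%:C%C
 @[n \oo] --> (0 : R).
have h : \sum_(j | th j == th i) nsq (p n j 0) - lp @[n \oo] --> lp - lp.
by apply: cvgB; [exact: p_same_cvg|exact: cvg_cst].
have h2 : (gb * th i / s) ^+ 2 * ((\sum_(j | th j == th i) nsq (p n j 0) - lp) *
 (\sum_(j | th j == th i) nsq (p n j 0) - lp)) @[n \oo] -->
 (gb * th i / s) ^+ 2 * ((lp - lp) * (lp - lp)) by apply: cvgMr; exact: cvgM.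
by move: h2; rewrite subrr !mulr0; under eq_fun do rewrite -expr2 -exprMn -nsqR.
have := nsq_cvg0D hx hy; apply: cvg_trans; apply: near_eq_cvg; near=> n; congr nsq.
rewrite /x sumrB -addrA; congr (_ + _).
have -> : \sum_(j | th j == th i) (gb * th i / s * nsq (p n j 0))%:C%C =
 (gb * th i / s * \sum_(j | th j == th i) nsq (p n j 0))%:C%C :> C.
rewrite mulr_sumr; apply: complex_ext; rewrite ?Re_sum ?Im_sum //=.
by rewrite big1.
by apply: complex_ext => /=; ring.
Unshelve. all: end_near.
Qed.
End Overlaps.

(** * Largest roots lie beyond the poles *)

Section PoleFunctions.
Context (R : realType) (L : nat) (w : 'I_L -> R) (sigma : 'I_L -> R) (K : R) (m : nat).
Hypotheses (w0 : forall l, 0 < w l) (K0 : 0 < K) (L0 : (0 < L)%N).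
Notation sg2 l := (sigma l ^+ 2).
Notation f x := (1 - K * \sum_l w l / (x - sg2 l) ^+ m.+1).
Lemma pole_cvg x : (forall l, x != sg2 l) -> f y @[y --> x] --> f x.
move=> hx; apply: cvgB; first exact: cvg_cst.
apply: cvgMr; apply: cvg_big => [|l _]; first exact: add_continuous.
apply: cvgMr; apply: cvgV; first by rewrite expf_neq0 // subr_eq0.
apply: (continuous_cvg _ (@exprn_continuous _ m.+1 _)).
by apply: cvgB; [exact: cvg_id|exact: cvg_cst].
Qed.
(** The intermediate value theorem to the right of the largest pole yields a root there, and the
    largest root is at least that one. It serves for A with exponent 2 and for B_i with exponent
    1. *)
Lemma pole_root_gt r : largest_root sigma (fun x => f x) r -> forall l, sg2 l < r.
move=> [dr _ rmax] l1.
have [l0 hl0] : exists l0, forall l, sg2 l <= sg2 l0.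
have := @arg_maxP _ _ _ (Ordinal L0) xpredT (fun l => sg2 l) isT.
by case=> l0 _ h; exists l0 => l; exact: h.
(* So close to the largest pole that its own term alone makes f <= 0. *)
pose a := sg2 l0 + Num.min 1 (K * w l0).
pose W := \sum_l w l.
(* At distance at least 1 each power of the distance dominates the distance itself, so the whole sum
   is at most K W / (b - sg2 l0) <= 1. *)
pose b := sg2 l0 + Num.max 1 (K * W).
have m0 : 0 < Num.min 1 (K * w l0) by rewrite lt_min ltr01 mulr_gt0.
have ab : a <= b.
by rewrite lerD2l; apply: le_trans (_ : 1 <= _); rewrite ?ge_min ?le_max lexx.
have pos x l : a <= x -> 0 < x - sg2 l.
by move=> ax; rewrite subr_gt0 (le_lt_trans (hl0 l)) // (lt_le_trans _ ax) // ltrDl.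
have fa : f a <= 0.
rewrite subr_le0; apply: (letr (K * (w l0 / (a - sg2 l0) ^+ m.+1))); last first.
rewrite ler_pM2l // (bigD1 l0) //= lerDl sumr_ge0 // => l _.
by rewrite divr_ge0 ?(ltW (w0 l)) // exprn_ge0 // ltW // pos.
have aE : a - sg2 l0 = Num.min 1 (K * w l0) by rewrite /a addrAC subrr add0r.
rewrite mulrA ler_pdivlMr ?exprn_gt0 ?pos // mul1r aE.
apply: (letr (Num.min 1 (K * w l0))); last by rewrite ge_min lexx orbT.
by rewrite exprS ler_piMr ?(ltW m0) // exprn_ile1 ?(ltW m0) // ge_min lexx.
have fb : 0 <= f b.
have bE : b - sg2 l0 = Num.max 1 (K * W) by rewrite /b addrAC subrr add0r.
have b1 : 1 <= b - sg2 l0 by rewrite bE le_max lexx.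
rewrite subr_ge0 mulr_sumr; apply: (letr (\sum_l K * w l / (b - sg2 l0))).
apply: ler_sum => l _; rewrite -mulrA; apply: ler_wpM2l; first exact: ltW.
apply: ler_wpM2l; first exact: ltW.
have bl : b - sg2 l0 <= b - sg2 l by rewrite lerB.
have b0 : 0 < b - sg2 l0 by exact: lt_le_trans b1.
have b2 : 0 < b - sg2 l by exact: lt_le_trans bl.
rewrite lef_pV2 ?posrE ?exprn_gt0 // [X in _ <= X]exprS; apply: (le_trans bl).
by rewrite ler_peMr ?(ltW b2) // exprn_ege1 // (le_trans b1).
rewrite -mulr_suml -mulr_sumr -/W ler_pdivrMr ?(lt_le_trans _ b1) // mul1r bE.
by rewrite le_max lexx orbT.
have cont : {within `[a, b], continuous (fun x => f x)}.
apply: continuous_in_subspaceT => x; rewrite inE /= in_itv /= => /andP[ax _].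
by apply: pole_cvg => l; rewrite -subr_eq0 gt_eqF // pos.
have h0 : Num.min (f a) (f b) <= 0 <= Num.max (f a) (f b).
by rewrite ge_min fa le_max fb orbT.
have [z + fz] := IVT ab cont h0; rewrite in_itv /= => /andP[az _].
apply: lt_le_trans (rmax z _ fz); first by rewrite -subr_gt0 pos.
by move=> l; rewrite -subr_eq0 gt_eqF // pos.
Qed.
End PoleFunctions.

(** * The limit map, its edge and its values at the roots *)

Section LimitMap.
Context d (T : measurableType d) (R : realType) (P : probability T R).
Variable a : noise_array P.
Notation c := (na_c a).
Notation p := (na_p a).
Notation sg2 l := (na_sigma a l ^+ 2).
Notation A := (fun_A c p (na_sigma a)).
Notation phi x := (na_phi a x 1).
Variables (p1 : \sum_l p l = 1)
 (alpha : R)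
 (alphaP : largest_root (na_sigma a) A alpha).
Let c0 := na_c0 a.
Let p0 := na_p0 a.
Lemma noise_levels : (0 < na_L a)%N.
rewrite lt0n; apply/eqP => L0; move: p1; rewrite big1 ?L0 => [/eqP|l _].
by rewrite eq_sym oner_eq0.
by have := ltn_ord l; rewrite {2}L0.
Qed.
Lemma alpha_gt l : sg2 l < alpha.
have w0 j : 0 < p j * na_sigma a j ^+ 4 by rewrite mulr_gt0 // exprn_gt0 // na_sigma0.
exact: (pole_root_gt w0 c0 noise_levels alphaP).
Qed.
Lemma alpha_gt0 : 0 < alpha.
by apply: le_lt_trans (alpha_gt (Ordinal noise_levels)); exact: sqr_ge0. Qed.
Lemma fun_A_cvg x : (forall l, sg2 l < x) -> A y @[y --> x] --> A x.
by move=> hx; apply: (@pole_cvg _ _ (fun l => p l * na_sigma a l ^+ 4)) => l; rewrite gt_eqF.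
Qed.
(** [A] is nondecreasing beyond the noise levels, and a zero after [alpha] would contradict
    maximality. *)
Lemma admissible_gt x : alpha < x -> admissible a x.
move=> ax; have hx l : sg2 l < x by exact: lt_trans (alpha_gt l) ax.
split => //; have [_ A0 amax] := alphaP.
rewrite lt_neqAle -{2}A0 fun_A_le ?(ltW ax) ?andbT //; last exact: alpha_gt.
apply/eqP => /esym h; have := amax x _ h; rewrite leNgt ax => /(_ _)/negP; apply => // l.
by rewrite gt_eqF.
Qed.
Lemma regular_gt x : alpha < x -> regular a x.
move=> ax; exists ((alpha + x) / 2); first by move: ax; lra.
by apply: admissible_gt; move: ax; lra.
Qed.
Lemma phi_mono x y : alpha < x -> x < y -> phi x < phi y.
by move=> ax; apply: na_phi_lt; exact: admissible_gt. Qed.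
Lemma phi_gt_edge x : alpha < x -> phi alpha < phi x.
move=> ax; have h1 : alpha < (alpha + x) / 2 by move: ax; lra.
have h2 : (alpha + x) / 2 < x by move: ax; lra.
apply: le_lt_trans (phi_mono h1 h2); rewrite -subr_ge0.
have := (na_phiB_bounds alpha_gt (ltW h1)).1; case: alphaP => _ -> _.
by rewrite mul0r mulr0.
Qed.
Lemma phi_cvg x : (forall l, sg2 l < x) -> phi y @[y --> x] --> phi x.
move=> hx; have x0 : x != 0 by rewrite gt_eqF // (na_x_gt0 hx).
apply: cvgD; first by apply: cvgMl; exact: cvg_id.
apply: cvgMr; apply: cvg_big => [|l _]; first exact: add_continuous.
apply: cvgMr; apply: cvgMl; apply: cvgV.
by rewrite subr_eq0 eq_sym -[_ / _ == 1](inj_eq (mulIf x0)) mulfVK // mul1r lt_eqF.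
apply: cvgB; first exact: cvg_cst.
by apply: cvgMr; apply: cvgV => //; exact: cvg_id.
Qed.
(** With total weight 1 the constant is distributed over the noise levels. This links the limit of
    [forms_Z] to the sum in B_i. *)
Lemma phi_mul_Stieltjes x : (forall l, sg2 l < x) ->
 1 + phi x / x - c^-1 = x * \sum_l p l / (x - sg2 l).
move=> hx; have x0 : x != 0 by rewrite gt_eqF // (na_x_gt0 hx).
have c1 : c != 0 by rewrite gt_eqF.
have -> : 1 + phi x / x - c^-1 = 1 + na_sum a x / x by rewrite /na_phi; field; rewrite x0 c1.
rewrite -{1}p1 /na_sum mulr_suml mulr_sumr -big_split; apply: eq_bigr => l _ /=.
have h1 : x - sg2 l != 0 by rewrite gt_eqF // subr_gt0.
by field; rewrite x0 h1.
Qed.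
Lemma form_gt0 x : (forall l, sg2 l < x) -> 0 < 1 + phi x / x - c^-1.
move=> hx; rewrite phi_mul_Stieltjes // mulr_gt0 ?(na_x_gt0 hx) //.
rewrite (bigD1 (Ordinal noise_levels)) //= ltr_pwDl ?divr_gt0 ?subr_gt0 // sumr_ge0 // => l _.
by rewrite divr_ge0 ?(ltW (p0 l)) // ltW // subr_gt0.
Qed.
Lemma phi_gt0 x : (forall l, sg2 l < x) -> 0 < phi x.
move=> hx; have x0 := na_x_gt0 hx; rewrite /na_phi mul1r ltr_pwDl ?divr_gt0 //.
apply: sumr_ge0 => l _; rewrite mulr_ge0 ?(ltW (p0 l)) // mulr_ge0 ?sqr_ge0 // invr_ge0.
by rewrite subr_ge0 ler_pdivrMr // mul1r ltW.
Qed.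

(* the gap condition of [bulk_below]: the slope of phi vanishes at the edge *)
Lemma phi_flat e : 0 < e -> exists2 dl, 0 < dl & forall x y, alpha < x -> x < y -> y < alpha + dl ->
 phi y - phi x <= (y - x) * e.
move=> e0; have [_ A0 _] := alphaP.
have ce : 0 < c * e by rewrite mulr_gt0.
have := fun_A_cvg alpha_gt; rewrite A0 => /cvgrPdist_lt /(_ _ ce) /nbhs_ballP[dl d0 hd].
exists dl => // x y ax xy yd; have hx l : sg2 l < x by exact: lt_trans (alpha_gt l) ax.
apply: le_trans (na_phiB_bounds hx (ltW xy)).2 _; apply: ler_wpM2l; first by rewrite subr_ge0 ltW.
rewrite ler_pdivrMr // mulrC; have := hd y.
rewrite /ball /= sub0r normrN => h; apply: le_trans (ler_norm _) _; apply: ltW; apply: h.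
by rewrite distrC ltr_norml; move: ax xy yd; lra.
Qed.

Section OneSpike.
Variables (t beta : R)
 (t0 : 0 < t) (betaP : largest_root (na_sigma a) (fun_B c p (na_sigma a) t) beta).
Notation B := (fun_B c p (na_sigma a) t).
Notation S x := (\sum_l p l / (x - sg2 l)).
Lemma beta_gt l : sg2 l < beta.
have K0 : 0 < c * t ^+ 2 by rewrite mulr_gt0 // exprn_gt0.
exact: (@pole_root_gt _ _ p _ _ 0 p0 K0 noise_levels _ betaP).
Qed.
Lemma fun_B_lt x y : (forall l, sg2 l < x) -> x < y -> B x < B y.
move=> hx xy; rewrite /fun_B ltrD2l ltrN2 ltr_pM2l ?mulr_gt0 ?exprn_gt0 //.
have lt1 l : p l / (y - sg2 l) < p l / (x - sg2 l).
rewrite ltr_pM2l // ltf_pV2 ?posrE ?subr_gt0 ?ltrD2r //; exact: lt_trans xy.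
pose l0 := Ordinal noise_levels.
by rewrite (bigD1 l0) // [X in _ < X](bigD1 l0) //=; apply: ltr_leD => //; apply: ler_sum => l _; apply: ltW.
Qed.
(** B_i is 1 minus the product of the limits of [forms_U] and [forms_Z] times theta_i^2, so its sign
    tells which of [spike_above] and [spike_below] applies. *)
Lemma fun_BE x : (forall l, sg2 l < x) ->
 (0 < B x) = ((1 + phi x / x - c^-1) * t ^+ 2 < x / c) /\
 (B x < 0) = (x / c < (1 + phi x / x - c^-1) * t ^+ 2).
move=> hx; have x0 := na_x_gt0 hx; rewrite phi_mul_Stieltjes // /fun_B subr_gt0 subr_lt0.
have -> : x * S x * t ^+ 2 = c * t ^+ 2 * S x * (x / c) by field; rewrite gt_eqF.
have xc : 0 < x / c by rewrite divr_gt0.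
by rewrite -{2}[x / c]mul1r -{3}[x / c]mul1r !ltr_pM2r.
Qed.
Lemma spike_subcritical x : beta < x -> (1 + phi x / x - c^-1) * t ^+ 2 < x / c.
move=> bx; have hx l : sg2 l < x by exact: lt_trans (beta_gt l) bx.
have [<- _] := fun_BE hx; have [_ <- _] := betaP; apply: fun_B_lt => //; exact: beta_gt.
Qed.
Lemma spike_supercritical x : (forall l, sg2 l < x) -> x < beta ->
 x / c < (1 + phi x / x - c^-1) * t ^+ 2.
by move=> hx bx; have [_ <-] := fun_BE hx; have [_ <- _] := betaP; apply: fun_B_lt.
Qed.
Lemma beta_gt_alpha : 0 < A beta -> alpha < beta.
move=> Ab; rewrite ltNge; apply/negP => ba; have [_ A0 _] := alphaP.
by have := fun_A_le beta_gt ba; rewrite A0 leNgt Ab.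
Qed.

Section Approximation.
Variables (D : R -> Prop)
 (D_dense : forall x y, x < y -> exists z, [/\ D z, x < z & z < y])
 (Ab : 0 < A beta).
Notation f x := (c / x).
Notation g x := (1 + phi x / x - c^-1).
Notation Fd := (c ^+ 2 / (beta ^+ 2 * A beta)).
Notation Gd := (phi beta * c / (beta ^+ 2 * A beta) - beta^-1).
(** [Fd] and [Gd] are minus the derivatives of f and g with respect to phi at [beta], since phi' =
    A/c. Secant bounds for phi give secant bounds for f. *)
Lemma difference_quotient_F x1 x2 : alpha < x1 -> x1 < x2 ->
 c ^+ 2 / (x2 ^+ 2 * A x2) <= (f x1 - f x2) / (phi x2 - phi x1) <= c ^+ 2 / (x1 ^+ 2 * A x1).
move=> a1 x12; have a2 : alpha < x2 by exact: lt_trans x12.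
have [hx1 A1] := admissible_gt a1; have [hx2 A2] := admissible_gt a2.
have x10 := na_x_gt0 hx1; have x20 := na_x_gt0 hx2.
have [lo hi] := na_phiB_bounds hx1 (ltW x12).
have D0 : 0 < phi x2 - phi x1 by rewrite subr_gt0; exact: phi_mono.
have y0 : 0 < x2 - x1 by rewrite subr_gt0.
have -> : f x1 - f x2 = c * (x2 - x1) / (x1 * x2) by field; rewrite !gt_eqF.
move: (phi x2 - phi x1) lo hi D0 => D' lo hi D0.
move: (A x1) (A x2) A1 A2 lo hi => A1 A2 A10 A20 lo hi.
rewrite ler_pdivlMr // ler_pdivrMr //; apply/andP; split.
apply: (letr (c ^+ 2 / (x2 ^+ 2 * A2) * ((x2 - x1) * (A2 / c)))).
by apply: ler_wpM2l => //; rewrite divr_ge0 // ltW // ?mulr_gt0 ?exprn_gt0.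
rewrite [leLHS](_ : _ = c * (x2 - x1) / (x2 * x2)); last by field; rewrite !gt_eqF.
apply: ler_wpM2l; first by rewrite ltW // mulr_gt0.
by rewrite lef_pV2 ?posrE ?mulr_gt0 // ler_wpM2r // ltW.
apply: (letr (c ^+ 2 / (x1 ^+ 2 * A1) * ((x2 - x1) * (A1 / c)))); last first.
by apply: ler_wpM2l => //; rewrite divr_ge0 // ltW // ?mulr_gt0 ?exprn_gt0.
rewrite [leRHS](_ : _ = c * (x2 - x1) / (x1 * x1)); last by field; rewrite !gt_eqF.
apply: ler_wpM2l; first by rewrite ltW // mulr_gt0.
by rewrite lef_pV2 ?posrE ?mulr_gt0 // ler_wpM2l // ltW.
Qed.
Lemma derivative_approx e : 0 < e -> exists x1 x2,
 [/\ D x1, D x2, alpha < x1, alpha < x2 & phi x1 < phi x2] /\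
 [/\ `|phi x1 - phi beta| <= e, `|phi x2 - phi beta| <= e & `|f x1 - f beta| <= e] /\
 [/\ `|g x1 - g beta| <= e, `|(f x1 - f x2) / (phi x2 - phi x1) - Fd| <= e &
 `|(g x1 - g x2) / (phi x2 - phi x1) - Gd| <= e].
move=> e0; have ab := beta_gt_alpha Ab; have b0 := na_x_gt0 beta_gt.
have cb := gt_eqF b0; have cc := gt_eqF c0; have cA := gt_eqF Ab.
have pb0 := phi_gt0 beta_gt.
have Fd0 : 0 < Fd by rewrite divr_gt0 ?mulr_gt0 ?exprn_gt0.
(* The total weight of the errors in the decomposition of the quotient for g below. *)
pose M := phi beta / c + c^-1 + Fd / c + 1.
have M1 : 1 <= M.
have h1 : 0 <= phi beta / c by rewrite divr_ge0 // ltW.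
have h2 : 0 <= c^-1 by rewrite invr_ge0 ltW.
have h3 : 0 <= Fd / c by rewrite divr_ge0 // ltW.
by rewrite lerDr; apply: addr_ge0 => //; apply: addr_ge0.
have M0 : 0 < M by exact: lt_le_trans M1.
pose e' := Num.min 1 (e / M).
have e'0 : 0 < e' by rewrite lt_min ltr01 divr_gt0.
have e'1 : e' <= 1 by rewrite ge_min lexx.
have e'M : e' * M <= e by rewrite -ler_pdivlMr // ge_min lexx orbT.
have e'e : e' <= e by apply: le_trans e'M; rewrite ler_peMr // ltW.
have cid : y @[y --> beta] --> beta by exact: cvg_id.
have cV : y^-1 @[y --> beta] --> beta^-1 by apply: cvgV; rewrite ?gt_eqF.
have cphi := phi_cvg beta_gt.
have cf : f y @[y --> beta] --> f beta by exact: cvgMr.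
have cg : g y @[y --> beta] --> g beta.
apply: cvgB; last exact: cvg_cst.
by apply: cvgD; [exact: cvg_cst|exact: cvgM].
have cH : c ^+ 2 / (y ^+ 2 * A y) @[y --> beta] --> Fd.
apply: cvgMr; apply: cvgV; first by rewrite mulf_neq0 ?expf_neq0 ?gt_eqF.
apply: cvgM; last exact: (fun_A_cvg beta_gt).
by rewrite expr2; under eq_fun do rewrite expr2; exact: cvgM.
have near1 h l : h y @[y --> beta] --> l -> \forall y \near beta, `|h y - l| <= e'.
move=> /cvgrPdist_le /(_ _ e'0); apply: filterS => y; by rewrite distrC.
have /nbhs_ballP[dl d0 hd] : \forall y \near beta,
 [/\ `|phi y - phi beta| <= e', `|f y - f beta| <= e', `|g y - g beta| <= e',
 `|c ^+ 2 / (y ^+ 2 * A y) - Fd| <= e' & `|y^-1 - beta^-1| <= e'].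
near=> y; split; near: y; exact: near1.
have inb y : beta < y -> y < beta + dl -> ball beta dl y.
by move=> h1 h2; rewrite /ball /= distrC ger0_norm ?subr_ge0 ?(ltW h1) //; lra.
have [x2 [D2 b2 u2]] : exists z, [/\ D z, beta < z & z < beta + dl].
by apply: D_dense; rewrite ltrDl.
have [x1 [D1 b1 u1]] := D_dense b2.
have a1 : alpha < x1 by exact: lt_trans b1.
have [p11 f1 g1 H1 V1] := hd _ (inb _ b1 (lt_trans u1 u2)).
have [p12 f2 g2 H2 V2] := hd _ (inb _ b2 u2).
have /andP[lo hi] := difference_quotient_F a1 u1.
have D0 : 0 < phi x2 - phi x1 by rewrite subr_gt0; exact: phi_mono.
have hF : `|(f x1 - f x2) / (phi x2 - phi x1) - Fd| <= e'.
move: H1 H2; rewrite !ler_norml => /andP[_ h1] /andP[h2 _]; apply/andP; split.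
by apply: le_trans h2 _; rewrite lerD2r.
by apply: le_trans h1; rewrite lerD2r.
exists x1, x2; split; first by split => //; [exact: lt_trans u1|exact: phi_mono].
split; first by split; exact: le_trans e'e.
split; [exact: le_trans e'e|exact: le_trans e'e|apply: le_trans e'M].
have x10 : x1 != 0 by rewrite gt_eqF // (lt_trans b0).
have x20 : x2 != 0 by rewrite gt_eqF // (lt_trans b0) // (lt_trans b1).
set F12 := (f x1 - f x2) / _ in hF lo hi.
(* Up to a constant g is phi f / c, so its quotient equals phi(x2) F12 / c - 1/x1 and inherits the
   limit of [F12]. *)
have -> : (g x1 - g x2) / (phi x2 - phi x1) - Gd = (phi x2 / c * (F12 - Fd) +
 (phi x2 - phi beta) * (Fd / c)) - (x1^-1 - beta^-1).
rewrite /F12; move: (phi x1) (phi x2) (phi beta) (A beta) D0 cA => z1 z2 zb Az D0 cA.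
have D1' : z2 - z1 != 0 by rewrite gt_eqF.
by field; rewrite x10 x20 cb cc cA D1'.
apply: le_trans (ler_normB _ _) _; rewrite /M [leRHS]mulrDr mulr1; apply: lerD => //.
apply: le_trans (ler_normD _ _) _; rewrite [leRHS]mulrDr; apply: lerD.
rewrite normrM mulrC; apply: ler_pM => //.
have p20 : 0 < phi x2 by apply: phi_gt0 => l; apply: lt_trans (beta_gt l) b2.
rewrite ger0_norm ?divr_ge0 ?(ltW p20) ?(ltW c0) // -[X in _ + X]mul1r -mulrDl.
apply: ler_wpM2r; first by rewrite invr_ge0 ltW.
by move: p12; rewrite ler_norml => /andP[_]; move: e'1; lra.
have h3 : 0 <= Fd / c by rewrite divr_ge0 // ltW.
by rewrite normrM [X in _ * X]ger0_norm //; apply: ler_wpM2r.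
Unshelve. all: end_near.
Qed.
End Approximation.
Lemma Stieltjes_beta : S beta = (c * t ^+ 2)^-1.
have [_ + _] := betaP; rewrite /fun_B => /eqP; rewrite subr_eq0 => /eqP h.
have n0 : c * t ^+ 2 != 0 by rewrite mulf_neq0 ?expf_neq0 // gt_eqF.
by apply: (mulfI n0); rewrite -h divff.
Qed.
Notation sb := (beta + (1 - c) * t ^+ 2).
Notation B' := (c * t ^+ 2 * \sum_l p l / (beta - sg2 l) ^+ 2).
Lemma form_beta : 1 + phi beta / beta - c^-1 = beta / (c * t ^+ 2).
by rewrite phi_mul_Stieltjes ?Stieltjes_beta //; exact: beta_gt. Qed.
(** At a root of B_i the sum in [phi_mul_Stieltjes] is known, so phi becomes rational in [beta].
    This is the origin of the factor beta + (1 - c) theta^2 in the limits. *)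
Lemma phi_beta : phi beta = beta * sb / (c * t ^+ 2).
have b0 := na_x_gt0 beta_gt; have := form_beta; move: (phi beta) => z h.
have -> : z = (1 + z / beta - c^-1 + c^-1 - 1) * beta by field; rewrite !gt_eqF.
by rewrite h; field; rewrite !gt_eqF.
Qed.
Lemma sb_gt0 : 0 < sb.
have b0 := na_x_gt0 beta_gt; have := phi_gt0 beta_gt; rewrite phi_beta.
have v0 : 0 < (c * t ^+ 2)^-1 by rewrite invr_gt0 mulr_gt0 // exprn_gt0.
by rewrite pmulr_lgt0 // pmulr_rgt0.
Qed.
Lemma is_derive_fun_B : is_derive beta 1 B B'.
pose h l : R -> R := fun x => p l / (x - sg2 l).
have hl l : is_derive beta 1 (h l) (- (p l / (beta - sg2 l) ^+ 2)).
have n0 : beta - sg2 l != 0 by rewrite gt_eqF // subr_gt0 beta_gt.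
have d1 : is_derive beta (1 : R) (fun x : R => x - sg2 l) 1.
by rewrite -[X in is_derive _ _ _ X]subr0; exact: is_deriveB.
have d2 := @is_deriveV _ (fun x : R => x - sg2 l) beta 1 1 n0 d1.
rewrite (_ : - (p l / _) = p l *: (- (beta - sg2 l) ^- 2 *: 1)); first exact: is_deriveZ.
by rewrite /GRing.scale /= mulr1 mulrN.
have hs : is_derive beta 1 (\sum_l h l) (\sum_l - (p l / (beta - sg2 l) ^+ 2)) by exact: is_derive_sum.
have -> : B = (cst 1 - (c * t ^+ 2) *: \sum_l h l).
by apply/funext => x; rewrite /fun_B !fctE fct_sumE.
rewrite (_ : B' = 0 - (c * t ^+ 2) *: \sum_l - (p l / (beta - sg2 l) ^+ 2)); first exact: is_deriveB.
by rewrite sub0r sumrN scalerN opprK.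
Qed.
(** Expanding sigma^4 as the square of beta - (beta - sigma^2) expresses A(beta) through the sum in
    B', the sum in B and the total weight. *)
Lemma derivative_identity : beta ^+ 2 * B' = beta + sb - t ^+ 2 * A beta.
have b0 := na_x_gt0 beta_gt.
have -> : A beta = 1 - c * (beta ^+ 2 * (\sum_l p l / (beta - sg2 l) ^+ 2) -
 2 * beta * S beta + 1).
rewrite /fun_A; congr (_ - _ * _); rewrite -[X in _ = _ + X]p1 !mulr_sumr -sumrB -big_split.
apply: eq_bigr => l _ /=; have h1 : beta - sg2 l != 0 by rewrite gt_eqF // subr_gt0 beta_gt.
by move: (na_sigma a l) h1 => s h1; field.
by rewrite Stieltjes_beta; move: (\sum_l _) => u; field; rewrite !gt_eqF.
Qed.
Lemma derivative_gt0 : 0 < B'.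
rewrite mulr_gt0 ?mulr_gt0 ?exprn_gt0 // (bigD1 (Ordinal noise_levels)) //=.
rewrite ltr_pwDl ?divr_gt0 ?exprn_gt0 ?subr_gt0 ?beta_gt // sumr_ge0 // => l _.
by rewrite divr_ge0 ?(ltW (p0 l)) // sqr_ge0.
Qed.
Lemma overlap_normalization : 0 < A beta -> A beta / (beta * B') *
 (c ^+ 2 / (beta ^+ 2 * A beta) * (1 + phi beta / beta - c^-1) ^+ 2 * t ^+ 4 +
 (phi beta * c / (beta ^+ 2 * A beta) - beta^-1) * t ^+ 2) = 1.
move=> Ab; have b0 := na_x_gt0 beta_gt; have B0 := derivative_gt0.
rewrite form_beta phi_beta; have := derivative_identity.
move: (B') (A beta) Ab B0 => b' Az A0 B0 E.
transitivity ((beta + sb - t ^+ 2 * Az) / (beta ^+ 2 * b')); last first.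
by rewrite E divff // -E gt_eqF // mulr_gt0 // exprn_gt0.
by field; rewrite !gt_eqF.
Qed.
Lemma overlap_r : (((1 + phi beta / beta - c^-1) * t) ^+ 2 / phi beta) * (A beta / (beta * B')) =
 A beta / (c * sb * B').
have b0 := na_x_gt0 beta_gt; have B0 := derivative_gt0; have s0 := sb_gt0.
rewrite form_beta phi_beta; move: (B') (A beta) (sb) s0 B0 => b' Az s s0 B0.
by field; rewrite !gt_eqF.
Qed.
Lemma overlap_pr : (1 + phi beta / beta - c^-1) * t / Num.sqrt (phi beta) *
 (A beta / (beta * B')) = A beta / (Num.sqrt (c * beta * sb) * B').
have b0 := na_x_gt0 beta_gt; have B0 := derivative_gt0; have s0 := sb_gt0.
have h : Num.sqrt (phi beta) = Num.sqrt (c * beta * sb) / (c * t).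
have ct : 0 < c * t by rewrite mulr_gt0.
rewrite -[X in _ / X](ger0_norm (ltW ct)) -sqrtr_sqr -sqrtrV ?sqr_ge0 // -sqrtrM.
by rewrite phi_beta; congr Num.sqrt; field; rewrite !gt_eqF.
by rewrite ltW // !mulr_gt0.
have q0 : 0 < Num.sqrt (c * beta * sb) by rewrite sqrtr_gt0 !mulr_gt0.
rewrite h form_beta; move: (Num.sqrt _) (B') (A beta) q0 B0 => q b' Az q0 B0.
by field; rewrite !gt_eqF.
Qed.
End OneSpike.
End LimitMap.

(** * Matrix convergence from quadratic forms *)

Section Polarization.
Context (R : realType) (k : nat).
Notation C := R[i].
Notation e j := (delta_mx j 0 : 'cV[C]_k).
Lemma mulmx_delta m (M : 'M[C]_(m, k)) j : M *m e j = col j M.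
by rewrite colE. Qed.
Lemma vdot_delta i (v : 'cV[C]_k) : vdot (e i) v = v i 0.
rewrite vdotE (bigD1 i) //= big1 => [|j ji]; first by rewrite !mxE !eqxx /= rmorph1 mul1r addr0.
by rewrite !mxE (negbTE ji) /= rmorph0 mul0r.
Qed.
Lemma rq_delta (H : 'M[C]_k) i j t : herm H ->
 rq H (e i + t *: e j) = cRe (H i i) + nsq t * cRe (H j j) + 2 * cRe (t * H i j).
move=> hH; rewrite rq_def mulmxDr -scalemxAr !mulmx_delta vdotDl !vdotDr !vdotZl !vdotZr.
rewrite !vdot_delta !mxE.
have -> : H j i = Num.conj (H i j) by rewrite -{1}hH !mxE.
case: (H i i) (H j j) (H i j) t => a1 a2 [b1 b2] [c1 c2] [t1 t2]; rewrite /nsq /=; ring.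
Qed.
(** Finitely many vectors e_i, e_i + e_j and e_i + i e_j whose forms determine a Hermitian matrix;
    almost sure limits are needed for these only. *)
Definition probe (s : 'I_k * 'I_k * 'I_3) : 'cV[C]_k :=
 e s.1.1 + (nth 0 [:: 0; 1; 'i%C] s.2) *: e s.1.2.
Let polarization (H : nat -> 'M[C]_k) (g : R) : (forall n, herm (H n)) ->
 (forall s, rq (H n) (probe s) @[n \oo] --> g * vsq (probe s)) ->
 frob2 (H n - g%:C%C%:M) @[n \oo] --> (0 : R).
move=> hH hs; pose M n := H n - g%:C%C%:M.
have hM n : herm (M n) by apply: hermB => //; exact: herm_scalar.
have hc s : rq (M n) (probe s) @[n \oo] --> (0 : R).
have -> : (fun n => rq (M n) (probe s)) = (fun n => rq (H n) (probe s) - g * vsq (probe s)).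
by apply/funext => n; rewrite rqB rq_scalar.
by rewrite -(subrr (g * vsq (probe s))); apply: cvgB => //; exact: cvg_cst.
have hd i : cRe (M n i i) @[n \oo] --> (0 : R).
have := hc (i, i, ord0); under eq_fun do rewrite rq_delta //= mul0r /= mulr0 addr0 nsq0 mul0r addr0.
by [].
have hr i j : cRe (M n i j) @[n \oo] --> (0 : R).
have := cvgMr (a := 2^-1) (cvgB (hc (i, j, @Ordinal 3 1 isT)) (cvgD (hd i) (hd j))).
rewrite addr0 subr0 mulr0 => h.
 suff -> : (fun n => cRe (M n i j)) = (fun n => 2^-1 * (rq (M n) (probe (i, j, @Ordinal 3 1 isT)) -
 (cRe (M n i i) + cRe (M n j j)))) by exact: h.
by apply/funext => n; rewrite rq_delta //= nsqR mul1r /=; field.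
have hi i j : cIm (M n i j) @[n \oo] --> (0 : R).
have := cvgMr (a := 2^-1) (cvgB (cvgD (hd i) (hd j)) (hc (i, j, @Ordinal 3 2 isT))).
rewrite addr0 subr0 mulr0 => h.
 suff -> : (fun n => cIm (M n i j)) = (fun n => 2^-1 * (cRe (M n i i) +
 cRe (M n j j) - rq (M n) (probe (i, j, @Ordinal 3 2 isT)))) by exact: h.
apply/funext => n; rewrite rq_delta //=; case: (M n i j) => a b; rewrite /nsq /=; by field.
have -> : (fun n => frob2 (H n - g%:C%C%:M)) = (fun n => \sum_i \sum_j nsq (M n i j)).
by apply/funext => n; rewrite frob2E.
apply: sum_cvg0 => i _; apply: sum_cvg0 => j _.
rewrite -(addr0 0) -(mulr0 0) /nsq; under eq_fun do rewrite !expr2.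
by apply: cvgD; exact: cvgM.
Qed.
Lemma polarization_cvg (H : nat -> 'M[C]_k) (g : R) : (\forall n \near \oo, herm (H n)) ->
 (forall s, rq (H n) (probe s) @[n \oo] --> g * vsq (probe s)) ->
 frob2 (H n - g%:C%C%:M) @[n \oo] --> (0 : R).
move=> hH hs; pose H' n := if `[< herm (H n) >] then H n else 0.
have HE : \forall n \near \oo, H' n = H n by apply: filterS hH => n h; rewrite /H' asboolT.
have hH' n : herm (H' n) by rewrite /H'; case: asboolP => // _; rewrite /herm adjmx0.
have hs' s : rq (H' n) (probe s) @[n \oo] --> g * vsq (probe s).
by apply: cvg_trans (hs s); apply: near_eq_cvg; apply: filterS HE => n ->.
by apply: cvg_trans (polarization hH' hs'); apply: near_eq_cvg; apply: filterS HE => n ->.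
Qed.
End Polarization.

(** * Almost sure limits of the spike forms *)

Section SpikeForms.
Context d (T : measurableType d) (R : realType) (P : probability T R).
Variable a : noise_array P.
Notation C := R[i].
Notation q := (na_q a).
Notation c := (na_c a).
Notation accn n w := (acc (na_X a n) (na_blk a n) (na_eta a n) n w).
Notation phi x := (na_phi a x 1).
Context (k : nat) (zblk : forall n, 'I_n -> 'I_k -> na_I a n).
Variables (inj_zblk : forall n i j b b', @zblk n i b = @zblk n j b' -> i = j /\ b = b')
 (zblk_blk : forall n i b j b', @zblk n i b <> na_blk a n j b')
 (U : forall n, 'M[C]_(q n, k))
 (Uiso : forall n, (U n) ^t* *m U n = 1%:M).
Notation X := (na_x a).
Definition coef_sc n w : 'M[C]_(n, k) := ((Num.sqrt n%:R)^-1)%:C%C *: na_z zblk n w.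
Notation Z := coef_sc.
Let vsqZ_mul n w b : vsq (Z n w *m b) = n%:R^-1 * vsq (na_z zblk n w *m b).
by rewrite -scalemxAl vsqZ nsqR exprVn sqr_sqrtr. Qed.
Let rqZ_mul n w M b : rq M (Z n w *m b) = n%:R^-1 * rq M (na_z zblk n w *m b).
by rewrite -scalemxAl rqZv exprVn sqr_sqrtr. Qed.
Let ae_finite (I : finType) (Q : I -> T -> Prop) :
 (forall s, {ae P, forall w, Q s w}) -> {ae P, forall w, forall s, Q s w}.
by move=> h; apply: filter_forall. Qed.
Lemma coef_iso_cvg :
 {ae P, forall w, frob2 ((Z n w) ^t* *m Z n w - 1%:M) @[n \oo] --> (0 : R)}.
have := ae_finite (fun s => coef_norm_cvg inj_zblk zblk_blk (probe R s)).
apply: filterS => w hw; rewrite -[1%:M]/((1%:C%C)%:M); apply: polarization_cvg => [|s].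
by near=> n; rewrite /herm adjmxM adjmxK.
rewrite mul1r; under eq_fun do rewrite -vsq_gram vsqZ_mul; exact: hw.
Unshelve. all: end_near.
Qed.
Let gram_accn n w : accn n w = X n w *m (X n w) ^t*.
by rewrite na_x_gram. Qed.
Let vsq_probe n b : vsq (U n *m b) = vsq b.
exact: vsq_isom. Qed.
Lemma forms_U_cvg x : regular a x -> {ae P, forall w,
 (\forall n \near \oo, below (X n w *m (X n w) ^t*) (phi x)) /\
 frob2 (forms_U (X n w) (U n) (phi x) - (c / x)%:C%C%:M) @[n \oo] --> (0 : R)}.
move=> rx.
have hb s := @resolvent_form_cvg _ _ _ _ a x (fun=> 1%N) (fun n => U n *m probe R s)
 (vsq (probe R s) ^+ 2) (vsq (probe R s)) rx.
have hb0 := @resolvent_form_cvg _ _ _ _ a x (fun=> 1%N) (fun n => 0) 0 0 rx.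
have f1 m (v : 'cV[C]_m) : frob2 v = vsq v by rewrite frob2_col big_ord1 col_id.
have f00 m n : frob2 (0 : 'M[C]_(m, n)) = 0 by rewrite -(scale0r 0) frob2Z nsq0 mul0r.
have {}hb s : {ae P, forall w, rq (forms_U (X n w) (U n) (phi x)) (probe R s) @[n \oo] -->
 c / x * vsq (probe R s)}.
have h1 : \forall n \near \oo, frob2 (U n *m probe R s *m (U n *m probe R s) ^t*) <= vsq (probe R s) ^+ 2.
by near=> n; rewrite frob2_rank1 vsq_probe.
have h2 : frob2 (U n *m probe R s) @[n \oo] --> vsq (probe R s).
by under eq_fun do rewrite f1 vsq_probe; exact: cvg_cst.
have := hb s h1 h2; apply: filterS => w [_ h].
 suff -> : (fun n => rq (forms_U (X n w) (U n) (phi x)) (probe R s)) =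
 (fun n => mform (res (phi x) (accn n w)) (U n *m probe R s)) by exact: h.
apply/funext => n; rewrite /mform big_ord1 col_id /forms_U gram_accn.
by rewrite !rq_def -!mulmxA vdotMr adjmxK.
have {}hb0 : {ae P, forall w, \forall n \near \oo, below (accn n w) (phi x)}.
have h1 : \forall n \near \oo, frob2 ((0 : 'cV[C]_(q n)) *m (0 : 'cV[C]_(q n)) ^t*) <= 0 :> R.
by near=> n; rewrite mul0mx f00.
have h2 : frob2 (0 : 'cV[C]_(q n)) @[n \oo] --> (0 : R).
by under eq_fun do rewrite f00; exact: cvg_cst.
by have := hb0 h1 h2; apply: filterS => w [].
have hf := ae_finite hb; apply: filterS2 hb0 hf => w h0 hw.
have h0' : \forall n \near \oo, below (X n w *m (X n w) ^t*) (phi x).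
by apply: filterS h0 => n; rewrite gram_accn.
split => //; apply: polarization_cvg => //.
by apply: filterS h0' => n b; exact: forms_U_herm.
Unshelve. all: end_near.
Qed.
Lemma forms_Z_cvg x : regular a x -> {ae P, forall w,
 frob2 (forms_Z (X n w) (Z n w) (phi x) - (1 + phi x / x - c^-1)%:C%C%:M) @[n \oo] --> (0 : R)}.
move=> rx; have hg := ae_finite (fun s => coef_gram_cvg inj_zblk zblk_blk (probe R s) rx).
have hn := ae_finite (fun s => coef_norm_cvg inj_zblk zblk_blk (probe R s)).
apply: filterS3 (forms_U_cvg rx) hg hn => w [hb _] h1 h2; apply: polarization_cvg.
apply: filterS hb => n b; have hg := gram_form_herm b.
apply: hermD; first by rewrite /herm adjmxM adjmxK.
by move: (gram_form _ _) hg => M hg; rewrite /herm !adjmxM adjmxK hg mulmxA.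
move=> s; rewrite -addrA mulrDl mul1r [_ * vsq _]mulrC.
have -> : (fun n => rq (forms_Z (X n w) (Z n w) (phi x)) (probe R s)) = (fun n =>
 n%:R^-1 * vsq (na_z zblk n w *m probe R s) +
 n%:R^-1 * rq (gram_form (X n w) (phi x)) (na_z zblk n w *m probe R s)).
apply/funext => n; rewrite -vsqZ_mul -rqZ_mul /forms_Z rqD -vsq_gram; congr (_ + _).
by rewrite !rq_def -!mulmxA vdotMr adjmxK.
by apply: cvgD.
Qed.
Lemma forms_X_cvg x : regular a x -> {ae P, forall w,
 frob2 (forms_X (X n w) (U n) (Z n w) (phi x)) @[n \oo] --> (0 : R)}.
move=> rx.
have u1 j n : vsq (col j (U n)) <= 1.
rewrite -mulmx_delta vsq_probe -[vsq _]/(cRe (vsq _)%:C%C) -vdotvv vdot_delta.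
by rewrite mxE !eqxx.
have := ae_finite (fun ij => coef_cross_cvg inj_zblk zblk_blk (delta_mx ij.2 0) rx (u1 ij.1)).
apply: filterS => w hw.
have -> : (fun n => frob2 (forms_X (X n w) (U n) (Z n w) (phi x))) = (fun n => \sum_i \sum_j
 n%:R^-1 * nsq (vdot (col i (U n)) (res (phi x) (accn n w) *m X n w *m
 (na_z zblk n w *m (delta_mx j 0 : 'cV[C]_k))))).
apply/funext => n; rewrite frob2E; apply: eq_bigr => i _; apply: eq_bigr => j _.
have -> : n%:R^-1 = nsq ((Num.sqrt n%:R)^-1)%:C%C :> R by rewrite nsqR exprVn sqr_sqrtr.
rewrite -nsqM -vdotZr scalemxAr scalemxAl gram_accn; congr nsq.
rewrite [LHS](_ : _ = vdot (delta_mx i 0) (forms_X (X n w) (U n) (Z n w) (phi x) *m delta_mx j 0)).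
by rewrite -(mulmx_delta (U n)) vdotMl /forms_X !mulmxA.
by move: (forms_X _ _ _ _) => M; rewrite mulmx_delta vdot_delta [RHS]mxE.
apply: sum_cvg0 => i _; apply: sum_cvg0 => j _; exact: (hw (i, j)).
Qed.
Definition forms_limit (x : R) w :=
 [/\ \forall n \near \oo, below (X n w *m (X n w) ^t*) (phi x),
 n%:R^-1 * rtr (phi x) (X n w *m (X n w) ^t*) 1 @[n \oo] --> x^-1,
 frob2 (forms_U (X n w) (U n) (phi x) - (c / x)%:C%C%:M) @[n \oo] --> (0 : R),
 frob2 (forms_Z (X n w) (Z n w) (phi x) - (1 + phi x / x - c^-1)%:C%C%:M) @[n \oo] --> (0 : R) &
 frob2 (forms_X (X n w) (U n) (Z n w) (phi x)) @[n \oo] --> (0 : R)].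
Definition rational (x : R) := exists r : rat, x = ratr r.
(** A countable intersection over an enumeration of the rationals: one null set serves for all
    levels, so the rest is deterministic. *)
Lemma all_forms_cvg alpha : (forall x, alpha < x -> regular a x) -> {ae P, forall w,
 frob2 ((Z n w) ^t* *m Z n w - 1%:M) @[n \oo] --> (0 : R) /\
 forall x, rational x -> alpha < x -> forms_limit x w}.
move=> hreg.
have key m : {ae P, forall w, forall r : rat, unpickle m = Some r -> alpha < ratr r ->
 forms_limit (ratr r) w}.
case E : (unpickle m) => [r|]; last by near=> w.
have [ar|ar] := boolP (alpha < ratr r); last first.
by near=> w => r' [<-] h; rewrite h in ar.
have rr := hreg _ ar; have h1 := forms_U_cvg rr; have h2 := forms_Z_cvg rr.
near=> w; move=> r' [<-] _; split; near: w.
 - by apply: filterS h1 => w [].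
 - by have := res_trace_cvg rr; apply: filterS => w; under eq_fun do rewrite gram_accn.
 - by apply: filterS h1 => w [].
 - exact: h2.
 - exact: forms_X_cvg.
move: key => /ae_foralln; apply: filterS2 coef_iso_cvg => w hI hw.
split => // x [r ->]; apply: (hw (pickle r)); exact: pickleK.
Unshelve. all: end_near.
Qed.
End SpikeForms.

(** * From laws to the entries of the array *)

Section LawTransfer.
Context d (T : measurableType d) (R : realType) (P : probability T R).
Notation rho x := (x.1 ^+ 2 + x.2 ^+ 2).
Lemma mutually_independent_comp (I J : finType) (X : J -> {RV P >-> (R * R)%type}) (h : I -> J) :
 injective h -> mutually_independent X -> mutually_independent (fun i => X (h i)).
move=> injh ind A B mB.
pose B' j := if [pick i | h i == j] is Some i then B i else setT.
have B'E i : B' (h i) = B i.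
by rewrite /B'; case: pickP => [i' /eqP /injh -> //|/(_ i)]; rewrite eqxx.
have mB' j : measurable (B' j) by rewrite /B'; case: pickP.
have := ind (h @: A)%SET B' mB'.
rewrite big_imset /=; last by move=> x y _ _; exact: injh.
rewrite (eq_bigr (fun i => P (X (h i) @^-1` B i))) => [<-|i _]; last by rewrite B'E.
congr (P _); apply/seteqP; split => w hw j /= jA.
by move/imsetP: jA => [i iA ->]; rewrite B'E; exact: hw.
by have := hw (h j); rewrite /= B'E; apply; apply/imsetP; exists j.
Qed.
Variable mu : probability (R * R)%type R.
Lemma law_integral (X : {RV P >-> (R * R)%type}) (f : R * R -> R) : has_law X mu ->
 mfunT f -> (\int[P]_w (f (X w))%:E = \int[mu]_x (f x)%:E)%E.
move=> law mf; have mfE : mfunT (fun x => (f x)%:E) by apply/measurable_EFinP.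
rewrite integralE [RHS]integralE; congr (_ - _)%E.
have := @has_law_int _ _ _ P 1 (fun=> X) mu (fun=> law) ord0 _ (measurable_funepos mfE).
by move=> <- => [|x]; [by apply: eq_integral => w _; rewrite !funeposE|exact: funepos_ge0].
have := @has_law_int _ _ _ P 1 (fun=> X) mu (fun=> law) ord0 _ (measurable_funeneg mfE).
by move=> <- => [|x]; [by apply: eq_integral => w _; rewrite !funenegE|exact: funeneg_ge0].
Qed.
Lemma mrho n : mfunT (fun x : R * R => rho x ^+ n).
apply: measurable_funX; apply: measurable_funD; apply: measurable_funX;
 [exact: measurable_fst | exact: measurable_snd].
Qed.
Lemma std_var : standardized mu -> (\int[mu]_x (rho x)%:E = 1)%E.
case=> _ _ <-; apply: eq_integral => x _.
by rewrite /Normc.normc /cplx sqr_sqrtr // addr_ge0 // sqr_ge0.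
Qed.
Lemma moment_le a b : (a <= b)%N -> (\int[mu]_x (rho x ^+ b)%:E < +oo)%E ->
 exists B, (\int[mu]_x (rho x ^+ a)%:E <= B%:E)%E.
move=> ab fin; have r0 (x : R * R) : 0 <= rho x by rewrite addr_ge0 // sqr_ge0.
have h : (\int[mu]_x (rho x ^+ a)%:E <= 1 + \int[mu]_x (rho x ^+ b)%:E)%E.
have -> : (1 : \bar R)%E = (\int[mu]_x (cst 1 x)%:E)%E.
by rewrite (_ : (fun x => _) = cst 1%:E) // integral_cst // mul1e; exact/esym/probability_setT.
rewrite -ge0_integralD //; first 1 last.
 - exact/measurable_EFinP.
 - by move=> x _; rewrite lee_fin exprn_ge0.
 - by apply/measurable_EFinP; exact: mrho.
apply: ge0_le_integral => //.
 - by move=> x _; rewrite lee_fin exprn_ge0.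
 - by apply/measurable_EFinP; exact: mrho.
 - apply/measurable_EFinP; apply: measurable_funD => //; exact: mrho.
move=> x _; rewrite lee_fin /=; have [x1|x1] := lerP (rho x) 1.
by apply: (letr 1); [exact: exprn_ile1|rewrite lerDl exprn_ge0].
by apply: (letr (rho x ^+ b)); [rewrite ler_weXn2l // ltW|rewrite lerDr].
exists (1 + fine (\int[mu]_x (rho x ^+ b)%:E)%E); apply: le_trans h _.
rewrite EFinD fineK // ge0_fin_numE //; apply: integral_ge0 => x _.
by rewrite lee_fin exprn_ge0.
Qed.
End LawTransfer.

(** * The statistical model as a noise array *)

Section Model.
Context d (T : measurableType d) (R : realType) (P : probability T R).
Notation rho x := (x.1 ^+ 2 + x.2 ^+ 2).
Context (k L : nat) (sigma p : 'I_L -> R) (c : R) (q : nat -> nat) (eta : forall n, 'I_n -> R)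
 (muz mueps : probability (R * R)%type R)
 (z : forall n, 'I_n -> 'I_k -> {RV P >-> (R * R)%type})
 (eps : forall n, 'I_n -> 'I_(q n) -> {RV P >-> (R * R)%type}).
Notation nl n l := (#|[pred i : 'I_n | eta i == sigma l]|).
Hypotheses (L0 : (0 < L)%N) (sigma0 : forall l, 0 < sigma l)
 (etaP : forall n (i : 'I_n), exists l, eta i = sigma l)
 (nlP : forall n, (\sum_(l < L) nl n l)%N = n).
Definition entry n (s : 'I_n * 'I_k + 'I_n * 'I_(q n)) : {RV P >-> (R * R)%type} :=
 match s with inl ij => z ij.1 ij.2 | inr ia => eps ia.1 ia.2 end.
Hypotheses (ind : forall n, mutually_independent (@entry n))
 (zlaw : forall n i j, has_law (@z n i j) muz)
 (epslaw : forall n i a, has_law (@eps n i a) mueps)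
 (zstd : standardized muz) (zls : log_sobolev muz)
 (epsstd : standardized mueps) (epsm4 : finite_fourth_moment mueps)
 (inv : (forall n i (Q : 'M[R[i]]_(q n)), Q \is unitarymx -> law_invariant (@eps n i) Q) \/
 [/\ real_law muz, real_law mueps, True &
 forall n i (Q : 'M[R[i]]_(q n)), Q \is unitarymx -> Q \is a realmx -> law_invariant (@eps n i) Q])
 (c0 : 0 < c) (asp : (n%:R / (q n)%:R : R) @[n \oo] --> c)
 (p0 : forall l, 0 < p l) (nlp : forall l, ((nl n l)%:R / n%:R : R) @[n \oo] --> p l).
(** The rotation argument mixes two coordinates of one noise vector, so a dimension of at least 2 is
    required; the entry law is the same for all n. *)
Lemma large_dimension : exists n, (0 < n)%N /\ (1 < q n)%N.
have c2 : c < 2 * c by rewrite ltr_pMl // ltr1n.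
have h1 := cvgr_lt _ asp _ c2; have h2 := cvgr_gt _ asp _ c0.
(* From n > 4 c and n / q < 2 c follows q > 2. *)
pose M := (Num.truncn (4 * c)).+1.
have [N _ hN] : \forall n \near \oo, [/\ n%:R / (q n)%:R < 2 * c, 0 < n%:R / (q n)%:R :> R & (M <= n)%N].
near=> n; split; [near: n; exact: (h1 _)|near: n; exact: (h2 _)|near: n; exact: nbhs_infty_ge].
have [hu hl Mn] := hN N (leqnn N); exists N.
have M4 : 4 * c < M%:R by rewrite /M; have := truncnS_gt (4 * c).
have n4 : 4 * c < N%:R by apply: lt_le_trans M4 _; rewrite ler_nat.
have n0 : (0 : R) < N%:R by apply: lt_trans n4; rewrite mulr_gt0.
have q0 : (0 : R) < (q N)%:R.
by rewrite lt0r ler0n andbT; apply/eqP => q0; move: hl; rewrite q0 invr0 mulr0 ltxx.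
split; first by rewrite -(ltr_nat R).
rewrite -(ltr_nat R); move: hu; rewrite ltr_pdivrMr // => hu.
by move: c0 hu n4; nra.
Unshelve. all: end_near.
Qed.
(** The fourth moment gives two moments of rho; four doublings reach 32, beyond 18. The reflection
    is real, so orthogonal invariance suffices in the real case. *)
Lemma noise_moment : exists B, (\int[mueps]_x (rho x ^+ 18)%:E <= B%:E)%E.
have [n [n0 q1]] := large_dimension; pose i := Ordinal n0.
pose i0 : 'I_(q n) := Ordinal (ltnW q1); pose i1 := Ordinal q1.
have i01 : i0 != i1 by [].
have indi : mutually_independent (@eps n i).
have injh : injective (fun b => inr (i, b) : 'I_n * 'I_k + 'I_n * 'I_(q n)) by move=> b b' [].
exact: (mutually_independent_comp injh (ind (n := n))).
have invi : law_invariant (@eps n i) (reflm R i0 i1).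
case: inv => [h|[_ _ _ h]]; apply: h; [exact: reflm_unitary|exact: reflm_unitary|exact: reflm_real].
have md := moment_doubling i01 indi (epslaw (n := n) i) invi (std_var epsstd).
have r0 (x : R * R) : 0 <= rho x by rewrite addr_ge0 // sqr_ge0.
have m2 : (\int[mueps]_x (rho x ^+ 2)%:E < +oo)%E.
move: epsm4; rewrite /finite_fourth_moment; congr (_ < _)%E; apply: eq_integral => x _.
by rewrite (exprM _ 2 2) /Normc.normc /cplx sqr_sqrtr.
by apply: (@moment_le _ mueps 18 32); rewrite //; apply: (md 16); apply: (md 8); apply: (md 4); apply: (md 2).
Qed.
Lemma entry_moment : exists2 B, 1 <= B & forall n (s : 'I_n * 'I_k + 'I_n * 'I_(q n)),
 (\int[P]_w (rho (entry s w) ^+ 18)%:E <= B%:E)%E.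
have [B1 h1] := noise_moment; have [B2 h2] := log_sobolev_moment 8 zls (std_var zstd).
exists (Num.max 1 (Num.max B1 B2)); first by rewrite le_max lexx.
move=> n [ij|ia] /=.
rewrite (law_integral (zlaw _ _) (mrho 18)); apply: le_trans h2 _.
by rewrite lee_fin !le_max lexx !orbT.
rewrite (law_integral (epslaw _ _) (mrho 18)); apply: le_trans h1 _.
by rewrite lee_fin !le_max lexx !orbT.
Qed.
Lemma entry_mean n (s : 'I_n * 'I_k + 'I_n * 'I_(q n)) :
 [/\ (\int[P]_w ((entry s w).1)%:E = 0)%E, (\int[P]_w ((entry s w).2)%:E = 0)%E &
 (\int[P]_w (rho (entry s w))%:E = 1)%E].
have m1 : mfunT (fun x : R * R => x.1) by exact: measurable_fst.
have m2 : mfunT (fun x : R * R => x.2) by exact: measurable_snd.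
have m3 : mfunT (fun x : R * R => rho x) := mrho 1.
have v1 := std_var zstd; have v2 := std_var epsstd.
case: zstd epsstd => [a1 a2 _] [b1 b2 _]; case: s => [ij|ia] /=.
by rewrite (law_integral (zlaw _ _) m1) (law_integral (zlaw _ _) m2) (law_integral (zlaw _ _) m3).
by rewrite (law_integral (epslaw _ _) m1) (law_integral (epslaw _ _) m2) (law_integral (epslaw _ _) m3).
Qed.
Lemma entry_std n B : 1 <= B -> (forall n (s : 'I_n * 'I_k + 'I_n * 'I_(q n)),
 (\int[P]_w (rho (entry s w) ^+ 18)%:E <= B%:E)%E) -> std_array (@entry n) 8 B.
by move=> B1 hB; split => // s; case: (entry_mean s). Qed.
(** The noise array numbers columns by all naturals. Beyond the n-th the value is still one of the
    levels, so bounds on the levels hold for every [j]. *)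
Definition level n (j : nat) : R :=
 if insub j is Some i then @eta n i else sigma (Ordinal L0).
Lemma levelP n j : exists l, level n j = sigma l.
by rewrite /level; case: insubP => [i _ _|_]; [exact: etaP|exists (Ordinal L0)]. Qed.
(** Double counting: the counts n_l add up to n although each of the n samples has at least one
    level. *)
Let level_unique n (i : 'I_n) : #|[pred l | eta i == sigma l]| = 1%N.
pose cnt (i : 'I_n) := #|[pred l | eta i == sigma l]|.
have cnt1 j : (1 <= cnt j)%N.
by have [l hl] := etaP j; apply/card_gt0P; exists l; rewrite inE hl.
have tot : (\sum_j cnt j)%N = n.
rewrite -[RHS](nlP n) /cnt.
under eq_bigr do rewrite -sum1_card big_mkcond.
under [RHS]eq_bigr do rewrite -sum1_card big_mkcond.
by rewrite exchange_big; apply: eq_bigr.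
have : (\sum_j (cnt j - 1))%N = 0%N.
by rewrite sumnB // tot sum1_card card_ord subnn.
move=> /eqP; rewrite sum_nat_eq0 => /forallP /(_ i) /=; rewrite subn_eq0 => h.
by apply/eqP; rewrite eqn_leq h cnt1.
Qed.
Lemma level_average (g : R -> R) : (\sum_(j < n) n%:R^-1 * g (level n j ^+ 2)) @[n \oo] -->
 \sum_l p l * g (sigma l ^+ 2).
have -> : (fun n => \sum_(j < n) n%:R^-1 * g (level n j ^+ 2)) =
 (fun n => \sum_l ((nl n l)%:R / n%:R) * g (sigma l ^+ 2)).
apply/funext => n.
have -> : \sum_(j < n) n%:R^-1 * g (level n j ^+ 2) =
 \sum_(j < n) \sum_(l | eta j == sigma l) n%:R^-1 * g (sigma l ^+ 2).
apply: eq_bigr => j _; rewrite /level insubT //= => hj.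
have -> : Sub (val j) hj = j by exact: val_inj.
transitivity (\sum_(l | eta j == sigma l) n%:R^-1 * g (eta j ^+ 2)).
by rewrite sumr_const level_unique mulr1n.
by apply: eq_bigr => l /eqP ->.
rewrite (exchange_big_dep xpredT) //=; apply: eq_bigr => l _.
by rewrite sumr_const -[LHS]mulr_natl mulrA.
apply: cvg_big => [|l _]; first exact: add_continuous.
by apply: cvgMl; exact: nlp.
Qed.
Lemma inj_noise n (i j : 'I_n) (b b' : 'I_(q n)) :
 inr (i, b) = inr (j, b') :> 'I_n * 'I_k + 'I_n * 'I_(q n) -> i = j /\ b = b'.
by case. Qed.
Definition entry_array : noise_array P :=
 let B := cid2 entry_moment in
 @NoiseArray d T R P (fun n => ('I_n * 'I_k + 'I_n * 'I_(q n))%type) entry q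
 (fun n i b => inr (i, b)) level L p sigma c (s2val B) (fun n => entry_std n (s2valP B) (s2valP' B)) inj_noise c0 asp sigma0 p0 levelP level_average.
End Model.

(** * Conclusions for a fixed outcome *)

Section Outcome.
Context d (T : measurableType d) (R : realType) (P : probability T R).
Variable a : noise_array P.
Notation C := R[i].
Notation q := (na_q a).
Notation c := (na_c a).
Notation p := (na_p a).
Notation sg2 l := (na_sigma a l ^+ 2).
Notation phi x := (na_phi a x 1).
Notation A := (fun_A c p (na_sigma a)).
Variables (p1 : \sum_l p l = 1)
 (alpha : R)
 (alphaP : largest_root (na_sigma a) A alpha).
Context (k : nat) (zblk : forall n, 'I_n -> 'I_k -> na_I a n).
Variables (U : forall n, 'M[C]_(q n, k))
 (Uiso : forall n, (U n) ^t* *m U n = 1%:M)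
 (th beta : 'I_k -> R)
 (th0 : forall j, 0 < th j) (th_sorted : forall i j : 'I_k, (i <= j)%N -> th j <= th i)
 (betaP : forall i, largest_root (na_sigma a) (fun_B c p (na_sigma a) (th i)) (beta i))
 (w : T).
Notation X n := (na_x a n w).
Notation Z n := (coef_sc zblk n w).
Notation Y n := (spiked (X n) (U n) (Z n) th).
Variables (hI : frob2 ((Z n) ^t* *m Z n - 1%:M) @[n \oo] --> (0 : R))
 (hF : forall x, rational x -> alpha < x -> forms_limit zblk U x w)
 (Uh : forall n, 'M[C]_(q n, k)) (that : nat -> 'I_k -> R)
 (V : forall n, 'M[C]_(q n)) (lam : forall n, 'I_(q n) -> R)
 (kq : forall n, (k <= q n)%N)
 (VV : forall n, (V n) ^t* *m V n = 1%:M)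
 (SE : forall n, Y n *m (Y n) ^t* = V n *m diag_mx (\row_b (@lam n b)%:C%C) *m (V n) ^t*)
 (lam_sorted : forall n (b b' : 'I_(q n)), (b <= b')%N -> @lam n b' <= @lam n b)
 (that0 : forall n i, 0 <= that n i)
 (pca : forall n (i : 'I_k) (b : 'I_(q n)), i = b :> nat ->
 col i (Uh n) = col b (V n) /\ that n i ^+ 2 = lam b).
Let c0 := na_c0 a.
Let hb x : rational x -> alpha < x -> \forall n \near \oo, below (X n *m (X n) ^t*) (phi x).
by move=> r /(hF r)[]. Qed.
Let hU x : rational x -> alpha < x ->
 frob2 (forms_U (X n) (U n) (phi x) - (c / x)%:C%C%:M) @[n \oo] --> (0 : R).
by move=> r /(hF r)[]. Qed.
Let hZ x : rational x -> alpha < x ->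
 frob2 (forms_Z (X n) (Z n) (phi x) - (1 + phi x / x - c^-1)%:C%C%:M) @[n \oo] --> (0 : R).
by move=> r /(hF r)[]. Qed.
Let hX x : rational x -> alpha < x ->
 frob2 (forms_X (X n) (U n) (Z n) (phi x)) @[n \oo] --> (0 : R).
by move=> r /(hF r)[]. Qed.
Let gt_sg2 x : alpha < x -> forall l, sg2 l < x.
by move=> ax l; exact: lt_trans (alpha_gt p1 alphaP l) ax. Qed.
Lemma rat_dense (x y : R) : x < y -> exists z, [/\ rational z, x < z & z < y].
by move=> /rat_in_itvoo[r]; rewrite in_itv /= => /andP[h1 h2]; exists (ratr r); split => //; exists r.
Qed.
Let idx n (i : 'I_k) : 'I_(q n) := Ordinal (leq_trans (ltn_ord i) (kq n)).
Let pca_col n i : col i (Uh n) = col (idx n i) (V n) /\ that n i ^+ 2 = lam (idx n i).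
exact: pca. Qed.
Let flat e : 0 < e -> exists x y, [/\ rational x, rational y, alpha < x, x < y & y < alpha + 1] /\
 phi y - phi x <= e * (y - x).
move=> e0; have [dl d0 h] := phi_flat p1 alphaP e0.
have m0 : alpha < alpha + Num.min 1 dl by rewrite ltrDl lt_min ltr01.
have [y [ry ay ym]] := rat_dense m0; have [x [rx ax xy]] := rat_dense ay.
exists x, y; split; first split => //.
by apply: lt_le_trans ym _; rewrite lerD2l ge_min lexx.
rewrite mulrC; apply: h => //; apply: lt_le_trans ym _.
by rewrite lerD2l ge_min lexx orbT.
Qed.
(** Rational levels slightly above the maximum bound the eigenvalue from above. From below, the bulk
    does so if beta_i <= alpha, and the spike at levels slightly under beta_i otherwise; continuity
    of phi concludes. *)
Lemma amplitude_cvg i : that n i ^+ 2 @[n \oo] --> phi (Num.max alpha (beta i)).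
set mx := Num.max alpha (beta i).
have amx : alpha <= mx by rewrite le_max lexx.
have hmx l : sg2 l < mx by exact: lt_le_trans (alpha_gt p1 alphaP l) amx.
apply/cvgrPdist_le => e e0.
have /cvgrPdist_le /(_ _ e0) /nbhs_ballP[dl d0 hd] := phi_cvg hmx.
have upper : \forall n \near \oo, that n i ^+ 2 <= phi mx + e.
have : mx < mx + dl by rewrite ltrDl.
move=> /rat_dense[x [rx mxx xd]].
have ax : alpha < x by exact: le_lt_trans mxx.
have bx : beta i < x by apply: le_lt_trans mxx; rewrite le_max lexx orbT.
have := spike_above th0 th_sorted c0 (alpha_gt0 p1 alphaP)
 (fun x ax => ltW (form_gt0 p1 (gt_sg2 ax))) hb hU hZ hX VV SE lam_sorted rx ax
 (spike_subcritical p1 (th0 i) (betaP i) bx).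
apply: filterS => n hn; have [_ ->] := pca_col n i.
apply: ltW; apply: lt_le_trans (hn (idx n i) erefl) _; rewrite -lerBlDl.
have := hd x; rewrite /ball /= distrC ger0_norm ?subr_ge0 ?(ltW mxx) // => h.
rewrite (le_trans (ler_norm _)) // distrC; apply: h; move: xd; lra.
have lower : \forall n \near \oo, phi mx - e <= that n i ^+ 2.
have [ba|ab] := leP (beta i) alpha.
have mxE : mx = alpha by rewrite /mx max_l.
have te : phi mx - e < phi alpha by rewrite mxE ltrBlDr ltrDl.
have := bulk_below c0 (alpha_gt0 p1 alphaP) hb VV SE lam_sorted (phi_mono p1 alphaP)
 (phi_gt_edge p1 alphaP) rat_dense (@na_aspectV _ _ _ _ a)
 (fun x r ax => let: And5 _ h _ _ _ := hF r ax in h) flat i te.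
by apply: filterS => n hn; have [_ ->] := pca_col n i; exact: hn.
have mxE : mx = beta i by rewrite /mx max_r // ltW.
have : Num.max alpha (mx - dl) < beta i by rewrite gt_max ab mxE ltrBlDr ltrDl.
move=> /rat_dense[x [rx]]; rewrite gt_max => /andP[ax xd] xb.
have := spike_below th0 th_sorted c0 (alpha_gt0 p1 alphaP)
 (fun x ax => ltW (form_gt0 p1 (gt_sg2 ax))) hb hU hZ hX VV SE lam_sorted rx ax
 (spike_supercritical p1 (th0 i) (betaP i) (gt_sg2 ax) xb).
apply: filterS => n hn; have [_ ->] := pca_col n i.
apply: le_trans (hn (idx n i) erefl); rewrite lerBlDr -lerBlDl.
have := hd x; rewrite /ball /= mxE ger0_norm ?subr_ge0 ?(ltW xb) // => h.
rewrite (le_trans (ler_norm _)) //; apply: h; move: xd; rewrite mxE; lra.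
apply: filterS2 upper lower => n h1 h2; rewrite ler_norml; apply/andP; split; lra.
Qed.

Section Eigenvector.
Variables (i : 'I_k)
 (Ab : 0 < A (beta i)).
Notation bt := (beta i).
Notation s := (Num.sqrt (phi bt)).
Notation gb := (1 + phi bt / bt - c^-1).
Notation Fd := (c ^+ 2 / (bt ^+ 2 * A bt)).
Notation Gd := (phi bt * c / (bt ^+ 2 * A bt) - bt^-1).
Notation B' := (c * th i ^+ 2 * \sum_l p l / (bt - sg2 l) ^+ 2).
Notation sb := (bt + (1 - c) * th i ^+ 2).
Notation lp := (A bt / (bt * B')).
Let t n := that n i.
Let uh n := col i (Uh n).
(** The right singular vector. As the data are already divided by sqrt n here, it is the normalised
    score vector. *)
Let wh n := ((t n)^-1)%:C%C *: ((Y n) ^t* *m uh n).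
Let pp n := (U n) ^t* *m uh n.
Let rr n := (Z n) ^t* *m wh n.
Let ab : alpha < bt. exact: (beta_gt_alpha p1 alphaP (th0 i) (betaP i) Ab). Qed.
Let hbt := beta_gt p1 (th0 i) (betaP i).
Let phi0 : 0 < phi bt. exact: phi_gt0. Qed.
Let s0 : 0 < s. by rewrite sqrtr_gt0. Qed.
Let s2 : s ^+ 2 = phi bt. by rewrite sqr_sqrtr // ltW. Qed.
Let ht : t n @[n \oo] --> s.
have := @amplitude_cvg i; rewrite max_r ?(ltW ab) // => h.
have -> : t = (fun n => Num.sqrt (that n i ^+ 2)).
by apply/funext => n; rewrite sqrtr_sqr ger0_norm.
exact: (continuous_cvg _ (@sqrt_continuous _ _) h).
Qed.
Let uh_col n : uh n = col (idx n i) (V n). by have [h _] := pca_col n i. Qed.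
Let uh1 n : vsq (uh n) = 1.
have : vdot (uh n) (uh n) = 1.
by rewrite uh_col -(mulmx_delta (V n)) vdotMl mulmxA VV mul1mx vdot_delta mxE !eqxx.
by rewrite vdotvv => /(congr1 (fun x : C => cRe x)).
Qed.
Let twh n : t n != 0 -> (t n)%:C%C *: wh n = (Y n) ^t* *m uh n.
by move=> t0; rewrite scalerA realCM divff // scale1r. Qed.
Let eigE n : Y n *m ((Y n) ^t* *m uh n) = (t n ^+ 2)%:C%C *: uh n.
rewrite mulmxA SE uh_col -(mulmx_delta (V n)) -!mulmxA (mulmxA (_ ^t*)) VV mul1mx.
have [_ ->] := pca_col n i.
rewrite (_ : diag_mx _ *m _ = (lam (idx n i))%:C%C *: delta_mx (idx n i) 0) ?scalemxAr //.
apply/colP => b; rewrite mul_diag_mx !mxE eqxx andbT.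
by case: eqP => [->|_]; rewrite ?mulr1 ?mulr0.
Qed.
Let tuh n : t n != 0 -> (t n)%:C%C *: uh n = Y n *m wh n.
move=> t0; rewrite -scalemxAr eigE scalerA realCM; congr (_%:C%C *: _).
by rewrite expr2 mulrA mulVf // mul1r.
Qed.
Let y0_exists : exists y0, [/\ rational y0, alpha < y0 & phi y0 < s ^+ 2].
have [y0 [ry ay yb]] := rat_dense ab; exists y0; split => //.
by rewrite s2; apply: (phi_mono p1 alphaP).
Qed.
Let approx e : 0 < e -> exists x1 x2,
 [/\ rational x1, rational x2, alpha < x1, alpha < x2 & phi x1 < phi x2] /\
 [/\ `|phi x1 - s ^+ 2| <= e, `|phi x2 - s ^+ 2| <= e & `|c / x1 - c / bt| <= e] /\
 [/\ `|1 + phi x1 / x1 - c^-1 - gb| <= e, `|(c / x1 - c / x2) / (phi x2 - phi x1) - Fd| <= e &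
 `|(1 + phi x1 / x1 - c^-1 - (1 + phi x2 / x2 - c^-1)) / (phi x2 - phi x1) - Gd| <= e].
by rewrite s2; exact: (derivative_approx p1 alphaP (th0 i) (betaP i) rat_dense Ab). Qed.
Let hp : vsq (pp n - (s * (c / bt))%:C%C *: (spike_diag th *m rr n)) @[n \oo] --> (0 : R).
have [y0 [ry ay yb]] := y0_exists.
exact: (eigvec_p_cvg Uiso hb hU hZ hX hI s0 ry ay yb approx ht twh tuh uh1).
Qed.
Let hr : vsq (s%:C%C *: rr n - gb%:C%C *: (spike_diag th *m pp n)) @[n \oo] --> (0 : R).
have [y0 [ry ay yb]] := y0_exists.
exact: (eigvec_r_cvg Uiso hb hU hZ hX (fun x ax => phi_gt0 (gt_sg2 ax)) hI s0 ry ay yb approx ht twh tuh uh1).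
Qed.
Let hN : s ^+ 2 * Fd * vsq (spike_diag th *m rr n) + Gd * vsq (spike_diag th *m pp n)
 @[n \oo] --> (1 : R).
have [y0 [ry ay yb]] := y0_exists.
exact: (eigvec_norm_cvg Uiso hb hU hZ hX hI s0 ry ay yb approx ht twh tuh uh1).
Qed.
Let pp1 n : vsq (pp n) <= 1.
by rewrite -(uh1 n); exact: vsq_isom_adj. Qed.
Let fg1 : c / bt * gb * th i ^+ 2 = 1.
have b0 := na_x_gt0 hbt; rewrite (form_beta p1 (th0 i) (betaP i)).
by field; rewrite !gt_eqF.
Qed.
Let lpE : lp * (Fd * gb ^+ 2 * th i ^+ 4 + Gd * th i ^+ 2) = 1.
exact: (overlap_normalization p1 (th0 i) (betaP i) Ab). Qed.
Let Upad : frob2 ((U n) ^t* *m U n - 1%:M) @[n \oo] --> (0 : R).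
under eq_fun do rewrite Uiso subrr -[0](scale0r 0) frob2Z nsq0 mul0r.
exact: cvg_cst.
Qed.
Lemma component_same_cvg :
 sqproj (uh n) (U n) (fun j => th j == th i) @[n \oo] --> lp.
by apply: sqproj_cvg Upad _; exact: (p_same_cvg th0 fg1 pp1 hp hr hN lpE). Qed.
Lemma component_other_cvg :
 sqproj (uh n) (U n) (fun j => th j != th i) @[n \oo] --> (0 : R).
by apply: sqproj_cvg Upad _; exact: (p_other_cvg th0 fg1 hp hr). Qed.
Let sqprojZs n J : (0 < n)%N -> sqproj (wh n) (Z n) J = sqproj (wh n) (na_z zblk n w) J.
move=> n0; apply: sqprojZ; rewrite (inj_eq (@complexI R) _ 0) invr_eq0 gt_eqF //.
by rewrite sqrtr_gt0 ltr0n.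
Qed.
Lemma score_same_cvg : sqproj (wh n) (na_z zblk n w) (fun j => th j == th i)
 @[n \oo] --> A bt / (c * sb * B').
rewrite -(overlap_r p1 (th0 i) (betaP i)) -{2}s2.
have := sqproj_cvg hI (r_same_cvg th0 s0 fg1 pp1 hp hr hN lpE).
apply: cvg_trans; apply: near_eq_cvg; near=> n; rewrite sqprojZs //; near: n; exact: nbhs_infty_gt.
Unshelve. all: end_near.
Qed.
Lemma score_other_cvg : sqproj (wh n) (na_z zblk n w) (fun j => th j != th i)
 @[n \oo] --> (0 : R).
have := sqproj_cvg hI (r_other_cvg th0 s0 fg1 pp1 hp hr).
apply: cvg_trans; apply: near_eq_cvg; near=> n; rewrite sqprojZs //; near: n; exact: nbhs_infty_gt.
Unshelve. all: end_near.
Qed.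
(** The ratio between normalising a coefficient vector by its own norm and by sqrt n. *)
Let kap n j : R := Num.sqrt n%:R / vnorm (col j (na_z zblk n w)).
Let kap_cvg j : kap n j @[n \oo] --> (1 : R).
have hv : vsq (col j (Z n)) @[n \oo] --> (1 : R).
have h : cRe (((Z n) ^t* *m Z n - 1%:M) j j) @[n \oo] --> (0 : R).
apply: (proj1 (nsq_cvg0_Re _)); apply: squeeze_cvgr (cvg_cst 0) hI; near=> n.
rewrite nsq_ge0 frob2E (bigD1 j) //= (bigD1 j) //= -addrA lerDl addr_ge0 // ?sumr_ge0 // => l _.
exact: nsq_ge0.
by apply: sumr_ge0 => l' _; exact: nsq_ge0.
have : cRe (((Z n) ^t* *m Z n - 1%:M) j j) + 1 @[n \oo] --> (0 + 1 : R).
by apply: cvgD => //; exact: cvg_cst.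
rewrite add0r; apply: cvg_trans; apply: near_eq_cvg; near=> n.
rewrite /= -[vsq _]/(cRe (vsq (col j (Z n)))%:C%C) -vdotvv vdotE !mxE Re_sub eqxx /= subrK.
by congr cRe; apply: eq_bigr => l _; rewrite !mxE.
have hs : (Num.sqrt (vsq (col j (Z n))))^-1 @[n \oo] --> (1 : R).
have h1 : Num.sqrt (vsq (col j (Z n))) @[n \oo] --> (1 : R).
by rewrite -sqrtr1; exact: (continuous_cvg _ (@sqrt_continuous _ _) hv).
have : (Num.sqrt (vsq (col j (Z n))))^-1 @[n \oo] --> (1^-1 : R).
by apply: cvgV => //; exact: oner_neq0.
by rewrite invr1.
apply: cvg_trans hs; apply: near_eq_cvg; near=> n.
have -> : col j (Z n) = ((Num.sqrt n%:R)^-1)%:C%C *: col j (na_z zblk n w).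
by apply/colP => l; rewrite !mxE.
rewrite vsqZ nsqR sqrtrM ?sqr_ge0 // sqrtr_sqr ger0_norm ?invr_ge0 ?sqrtr_ge0 //.
by rewrite invfM invrK /kap /vnorm vdotvv.
Unshelve. all: end_near.
Qed.
Lemma cross_overlap_cvg : nsq (\sum_(j | th j == th i) vdot (uh n) (col j (U n)) *
 Num.conj (vdot (wh n) (((vnorm (col j (na_z zblk n w)))^-1)%:C%C *: col j (na_z zblk n w))) -
 (A bt / (Num.sqrt (c * bt * sb) * B'))%:C%C) @[n \oo] --> (0 : R).
rewrite -(overlap_pr p1 (th0 i) (betaP i)).
have := overlap_cvg th0 s0 fg1 pp1 hp hr hN lpE kap_cvg.
apply: cvg_trans; apply: near_eq_cvg; near=> n.
have n0 : 0 < Num.sqrt n%:R :> R by rewrite sqrtr_gt0 ltr0n; near: n; exact: nbhs_infty_gt.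
congr (nsq (_ - _)); apply: eq_bigr => j _; congr (_ * _).
by rewrite /pp -[((_ *m _) j 0)]vdot_delta vdotMr adjmxK mulmx_delta -vdotC.
rewrite -vdotC vdotZl conjR /kap -realCM [_%:C%C * _%:C%C]mulrC -mulrA; congr (_ * _).
rewrite /rr -[((_ *m _) j 0)]vdot_delta vdotMr adjmxK mulmx_delta.
have -> : col j (Z n) = ((Num.sqrt n%:R)^-1)%:C%C *: col j (na_z zblk n w).
by apply/colP => l; rewrite !mxE.
by rewrite vdotZl conjR mulrA realCM divff ?gt_eqF // mul1r.
Unshelve. all: end_near.
Qed.
End Eigenvector.
End Outcome.
Lemma complex_cvg (R : realType) (u : nat -> R[i]) (l : R[i]) :
 nsq (u n - l) @[n \oo] --> (0 : R) ->
 (u n : Num.NumField.sort R[i]) @[n \oo] --> (l : Num.NumField.sort R[i]).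
move=> h; apply/cvgrPdist_lt => -[e e'] /=; rewrite ltcE /= => /andP[/eqP -> e0].
have e2 : 0 < e ^+ 2 by exact: exprn_gt0.
have h2 := cvgr_lt _ h _ e2; apply: filterS (h2 _) => n hn.
rewrite distrC normc_def ltcR -(ger0_norm (ltW e0)) -sqrtr_sqr ltr_sqrt //.
Qed.

(** * Identification with the data matrix of the statement *)

Section DataMatrix.
Context d (T : measurableType d) (R : realType) (P : probability T R).
Variable a : noise_array P.
Notation C := R[i].
Notation q := (na_q a).
Context (k : nat) (zblk : forall n, 'I_n -> 'I_k -> na_I a n) (n : nat).
Variables (U : 'M[C]_(q n, k)) (th : 'I_k -> R) (eta : 'I_n -> R).
Context (z : 'I_n -> 'I_k -> {RV P >-> (R * R)%type})
 (eps : 'I_n -> 'I_(q n) -> {RV P >-> (R * R)%type}).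
Hypotheses (etaE : forall i : 'I_n, na_eta a n i = eta i)
 (zE : forall i j, na_X a n (@zblk n i j) = z i j)
 (epsE : forall i b, na_X a n (na_blk a n i b) = eps i b).
Lemma coef_mxE w : coef_mx (fun i => cvec (z i) w) = na_z zblk n w.
by apply/matrixP => i j; rewrite !mxE zE. Qed.
Lemma data_mx_spiked w :
 ((Num.sqrt n%:R)^-1)%:C%C *: data_mx U th eta (fun i => cvec (z i) w) (fun i => cvec (eps i) w) =
 spiked (na_x a n w) U (coef_sc zblk n w) th.
apply/matrixP => b i; rewrite [LHS]mxE /data_mx [X in _ * X]mxE [X in _ * X]mxE mulrDr [RHS]mxE; congr (_ + _).
have -> : (U *m spike_diag th *m (coef_sc zblk n w) ^t*) b i =
 (U *m spike_diag th *m col i ((coef_sc zblk n w) ^t*)) b 0.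
by rewrite [LHS]mxE [RHS]mxE; apply: eq_bigr => j _; rewrite [col _ _ _ _]mxE.
have -> : col i ((coef_sc zblk n w) ^t*) = ((Num.sqrt n%:R)^-1)%:C%C *: cvec (z i) w.
by apply/colP => j; rewrite !mxE rmorphM /= conjR conjCK zE.
by rewrite -scalemxAr [RHS]mxE.
rewrite [in RHS]mxE [in LHS]mxE /xcol [RHS]mxE /ncol insubT //= => hi.
have -> : Sub (val i) hi = i by exact: val_inj.
rewrite etaE mulrA realCM sqrtrV ?ler0n // [_ * eta i]mulrC; congr (_ * _).
by rewrite !mxE epsE.
Qed.
Lemma sample_cov_gram q' (Y : 'M[C]_(q', n)) : sample_cov Y =
 (((Num.sqrt n%:R)^-1)%:C%C *: Y) *m (((Num.sqrt n%:R)^-1)%:C%C *: Y) ^t*.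
rewrite adjmxZ conjR -scalemxAl -scalemxAr scalerA realCM -invfM -expr2 sqr_sqrtr //.
rewrite /sample_cov; congr (_ *: _).
by rewrite -(rmorph_nat (real_complex R)) -fmorphV.
apply/matrixP => b b'; rewrite summxE mxE; apply: eq_bigr => i _.
by rewrite !mxE big_ord1 !mxE.
Qed.
End DataMatrix.

Theorem theorem1 (R : realType) (dT : measure_display) (T : measurableType dT)
    (P : probability T R)
    (k L : nat) (theta : 'I_k -> R) (sigma p : 'I_L -> R) (c : R)
    (d : nat -> nat) (U : forall n : nat, 'M[R[i]]_(d n, k))
    (eta : forall n : nat, 'I_n -> R)
    (muz mueps : probability (R * R)%type R)
    (z : forall n : nat, 'I_n -> 'I_k -> {RV P >-> (R * R)%type})
    (eps : forall n : nat, 'I_n -> 'I_(d n) -> {RV P >-> (R * R)%type})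
    (Uhat : forall n : nat, T -> 'M[R[i]]_(d n, k))
    (thetahat : nat -> T -> 'I_k -> R)
    (alpha : R) (beta : 'I_k -> R) :
  let zv (n : nat) (w : T) (i : 'I_n) : 'cV[R[i]]_k := cvec (z n i) w in
  let ev (n : nat) (w : T) (i : 'I_n) : 'cV[R[i]]_(d n) := cvec (eps n i) w in
  let Y (n : nat) (w : T) : 'M[R[i]]_(d n, n) :=
    data_mx (U n) theta (eta n) (zv n w) (ev n w) in
  let Z (n : nat) (w : T) : 'M[R[i]]_(n, k) := coef_mx (zv n w) in
  let nl (n : nat) (l : 'I_L) : nat := #|[pred i : 'I_n | eta n i == sigma l]| in
  let A : R -> R := fun_A c p sigma in
  let B (i : 'I_k) : R -> R := fun_B c p sigma (theta i) in
  (* amplitudes, noise standard deviations, deterministic quantities *)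
  (0 < k)%N -> (0 < L)%N ->
  (forall i j : 'I_k, (i <= j)%N -> theta j <= theta i) ->
  (forall i, 0 < theta i) ->
  (forall l, 0 < sigma l) ->
  (forall n, (U n) ^t* *m U n = 1%:M) ->
  (forall n i, exists l, eta n i = sigma l) ->
  (forall n, (\sum_(l < L) nl n l)%N = n) ->
  (* random quantities *)
  (forall n, mutually_independent
     (fun s : ('I_n * 'I_k) + ('I_n * 'I_(d n)) =>
        match s with
        | inl ij => z n ij.1 ij.2
        | inr ia => eps n ia.1 ia.2
        end)) ->
  (forall n i j, has_law (z n i j) muz) ->
  standardized muz -> log_sobolev muz ->
  (forall n i a, has_law (eps n i a) mueps) ->
  standardized mueps -> finite_fourth_moment mueps ->
  (forall n i (Q : 'M[R[i]]_(d n)), Q \is unitarymx ->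
     law_invariant (eps n i) Q)
  \/
  [/\ real_law muz, real_law mueps, (forall n, U n \is a realmx) &
      forall n i (Q : 'M[R[i]]_(d n)), Q \is unitarymx -> Q \is a realmx ->
        law_invariant (eps n i) Q] ->
  (* asymptotic regime *)
  0 < c -> (n%:R / (d n)%:R : R) @[n --> \oo] --> c ->
  (forall l, 0 < p l) -> \sum_(l < L) p l = 1 ->
  (forall l, ((nl n l)%:R / n%:R : R) @[n --> \oo] --> p l) ->
  (* PCA estimates and the roots alpha, beta_i *)
  (forall n w, is_pca (sample_cov (Y n w)) (Uhat n w) (thetahat n w)) ->
  largest_root sigma A alpha ->
  (forall i, largest_root sigma (B i) (beta i)) ->
  forall i : 'I_k,
  let uhat (n : nat) (w : T) : 'cV[R[i]]_(d n) := col i (Uhat n w) in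
  (* the normalized score vector *)
  let zhat (n : nat) (w : T) : 'cV[R[i]]_n :=
    ((Num.sqrt n%:R)^-1)%:C%C *: score (Y n w) (uhat n w) (thetahat n w i) in
  let same (j : 'I_k) := theta j == theta i in
  let other (j : 'I_k) := theta j != theta i in
  let mx := Num.max alpha (beta i) in
  let b := beta i in
  let B' := derive1 (B i) b in
  let s := b + (1 - c) * theta i ^+ 2 in
  {ae P, forall w, thetahat n w i ^+ 2 @[n --> \oo] -->
     c^-1 * mx *
       (1 + c * \sum_(l < L) p l * sigma l ^+ 2 / (mx - sigma l ^+ 2))}
  /\
  (0 < A b ->
   [/\ {ae P, forall w, sqproj (uhat n w) (U n) same @[n --> \oo] -->
          A b / (b * B')},
       {ae P, forall w, sqproj (uhat n w) (U n) other @[n --> \oo] --> (0 : R)},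
       {ae P, forall w, sqproj (zhat n w) (Z n w) same @[n --> \oo] -->
          A b / (c * s * B')},
       {ae P, forall w, sqproj (zhat n w) (Z n w) other @[n --> \oo] -->
          (0 : R)} &
       {ae P, forall w,
          (\sum_(j < k | same j)
             vdot (uhat n w) (col j (U n)) *
             Num.conj (vdot (zhat n w)
               (((vnorm (col j (Z n w)))^-1)%:C%C *: col j (Z n w))) : Num.NumField.sort R[i])
            @[n --> \oo] -->
          ((A b / (Num.sqrt (c * b * s) * B'))%:C%C : Num.NumField.sort R[i])}]).
Proof.
move=> zv ev Y Z nl A B k0 L0 th_sorted th0 sigma0 Uiso etaP nlP ind zlaw zstd zls epslaw epsstd
  epsm4 inv c0 asp p0 p1 nlp pca alphaP betaP i uhat zhat same other mx b B' s.
(* The two cases of the model in the form expected by [entry_array]. *)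
have inv' : (forall n i (Q : 'M[R[i]]_(d n)), Q \is unitarymx -> law_invariant (eps n i) Q) \/
    [/\ real_law muz, real_law mueps, True & forall n i (Q : 'M[R[i]]_(d n)),
      Q \is unitarymx -> Q \is a realmx -> law_invariant (eps n i) Q].
  by case: inv => [h|[h1 h2 _ h]]; [left|right].
have ind' n : mutually_independent (@entry _ _ _ P k d z eps n) by exact: ind.
pose a : noise_array P := entry_array L0 sigma0 etaP nlP ind' zlaw epslaw zstd zls epsstd epsm4 inv' c0 asp p0 nlp.
pose zblk n (i : 'I_n) (j : 'I_k) : na_I a n := inl (i, j).
have inj_zblk n (i1 j1 : 'I_n) (b1 b2 : 'I_k) : zblk n i1 b1 = zblk n j1 b2 -> i1 = j1 /\ b1 = b2.
  by case.
have zblk_blk n (i1 : 'I_n) (b1 : 'I_k) (j : 'I_n) b2 : zblk n i1 b1 <> na_blk a n j b2 by [].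
have hreg x : alpha < x -> regular a x by exact: (@regular_gt _ _ _ _ a p1 alpha alphaP).
have forms := @all_forms_cvg _ _ _ _ a k zblk inj_zblk zblk_blk U Uiso alpha hreg.
have YE n w : ((Num.sqrt n%:R)^-1)%:C%C *: Y n w = spiked (na_x a n w) (U n) (coef_sc zblk n w) theta.
  have hlev (i1 : 'I_n) : na_eta a n i1 = eta n i1.
    by rewrite /= /level insubT //= => hi; congr (eta n _); exact: val_inj.
  exact: (@data_mx_spiked _ _ _ _ a k zblk n (U n) theta (eta n) (z n) (eps n) hlev).
have ZE n w : Z n w = na_z zblk n w by exact: coef_mxE.
have pca' w n : is_pca (spiked (na_x a n w) (U n) (coef_sc zblk n w) theta *m
    (spiked (na_x a n w) (U n) (coef_sc zblk n w) theta) ^t*) (Uhat n w) (thetahat n w).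
  by rewrite -YE -sample_cov_gram; exact: pca.
have sys w : exists (V : forall n, 'M[R[i]]_(d n)) (lam : forall n, 'I_(d n) -> R),
    [/\ forall n, (V n) ^t* *m V n = 1%:M,
      forall n, spiked (na_x a n w) (U n) (coef_sc zblk n w) theta *m
        (spiked (na_x a n w) (U n) (coef_sc zblk n w) theta) ^t* =
        V n *m diag_mx (\row_b (lam n b)%:C%C) *m (V n) ^t*,
      forall n (b b' : 'I_(d n)), (b <= b')%N -> lam n b' <= lam n b,
      forall n (i : 'I_k) (b : 'I_(d n)), i = b :> nat ->
        col i (Uhat n w) = col b (V n) /\ thetahat n w i ^+ 2 = lam n b &
      forall n i, 0 <= thetahat n w i].
  (* An eigendecomposition exists for each n separately; choice assembles them into the sequences on
     which the limit lemmas operate. *)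
  exists (fun n => projT1 (cid (proj2 (pca' w n)))).
  exists (fun n => projT1 (cid (projT2 (cid (proj2 (pca' w n)))))).
  by split => n; case: (projT2 (cid (projT2 (cid (proj2 (pca' w n)))))).
have kd n : (k <= d n)%N by case: (pca n point).
have wE w n : zhat n w = ((thetahat n w i)^-1)%:C%C *:
    ((spiked (na_x a n w) (U n) (coef_sc zblk n w) theta) ^t* *m uhat n w).
  rewrite /zhat /score -YE adjmxM adjmxK adjmxZ conjR -scalemxAl !scalerA.
  by rewrite mulrC.
(* The claimed limit is phi at max(alpha, beta_i); the maximum lies beyond all noise levels because
   alpha does. *)
have mxE : c^-1 * mx * (1 + c * \sum_(l < L) p l * sigma l ^+ 2 / (mx - sigma l ^+ 2)) = na_phi a mx 1.
  have hmx l : sigma l ^+ 2 < mx.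
    by apply: lt_le_trans (@alpha_gt _ _ _ _ a p1 alpha alphaP l) _; rewrite le_max lexx.
  have mx0 : mx != 0 by rewrite gt_eqF // (@na_x_gt0 _ _ _ _ a _ hmx).
  rewrite /na_phi /na_sum mul1r mulrDr mulr1 [c^-1 * mx]mulrC; congr (_ + _).
  rewrite mulrA -[mx / c * c]mulrA mulVf ?gt_eqF // mulr1 mulr_sumr; apply: eq_bigr => l _ /=.
  have h1 : mx - sigma l ^+ 2 != 0 by rewrite gt_eqF // subr_gt0.
  by field; rewrite mx0 h1.
split.
  apply: filterS forms => w [hI hF]; have [V [lam [VV SE ls pc t0]]] := sys w.
  rewrite mxE.
  exact: (@amplitude_cvg _ _ _ _ a p1 alpha alphaP k zblk U theta beta th0 th_sorted betaP w hF
    (fun n => Uhat n w) (fun n => thetahat n w) V lam kd VV SE ls pc i).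
move=> Ab.
have B'E : B' = c * theta i ^+ 2 * \sum_l p l / (b - sigma l ^+ 2) ^+ 2.
  rewrite /B' derive1E.
  have h := @is_derive_fun_B _ _ _ _ a p1 (theta i) (beta i) (th0 i) (betaP i).
  exact: derive_val.
rewrite B'E; split; apply: filterS forms => w [hI hF]; have [V [lam [VV SE ls pc t0]]] := sys w.
- exact: (@component_same_cvg _ _ _ _ a p1 alpha alphaP k zblk U Uiso theta beta th0 th_sorted betaP w hI hF
    (fun n => Uhat n w) (fun n => thetahat n w) V lam kd VV SE ls t0 pc i Ab).
- exact: (@component_other_cvg _ _ _ _ a p1 alpha alphaP k zblk U Uiso theta beta th0 th_sorted betaP w hI hF
    (fun n => Uhat n w) (fun n => thetahat n w) V lam kd VV SE ls t0 pc i Ab).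
- under eq_fun do rewrite wE ZE.
  exact: (@score_same_cvg _ _ _ _ a p1 alpha alphaP k zblk U Uiso theta beta th0 th_sorted betaP w hI hF
    (fun n => Uhat n w) (fun n => thetahat n w) V lam kd VV SE ls t0 pc i Ab).
- under eq_fun do rewrite wE ZE.
  exact: (@score_other_cvg _ _ _ _ a p1 alpha alphaP k zblk U Uiso theta beta th0 th_sorted betaP w hI hF
    (fun n => Uhat n w) (fun n => thetahat n w) V lam kd VV SE ls t0 pc i Ab).
- apply: complex_cvg; under eq_fun do rewrite wE ZE.
  exact: (@cross_overlap_cvg _ _ _ _ a p1 alpha alphaP k zblk U Uiso theta beta th0 th_sorted betaP w hI hF
    (fun n => Uhat n w) (fun n => thetahat n w) V lam kd VV SE ls t0 pc i Ab).
Qed.
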